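(* Assume the Generalized Riemann Hypothesis for the $L(s,\chi_d)$. Let $\delta>0$ be small, $C_-$ the vertical line from $-\delta-i\infty$ up to $-\delta+i\infty$ and $C_+$ the vertical line from $\delta-i\infty$ up to $\delta+i\infty$. Let $f$ be a holomorphic function of $n$ variables with $f(x_1,\dots,x_n)=f(\pm x_1,\dots,\pm x_n)$. Then $$2^n(2\pi i)^nS^{DL}_n(f)=\sum_{K\cup L\cup M=\{1,\dots,n\}}\int_{C_+^K}\int_{C_-^{L\cup M}}(-1)^{|M|}J_{DL}(z_K\cup -z_L,z_M)f(iz_1,\dots,iz_n)\,dz_1\cdots dz_n,$$ where the sum is over ordered triples of pairwise disjoint sets with union $\{1,\dots,n\}$, variables with index in $K$ are integrated along $C_+$ and all others along $C_-$, $z_K=\{z_k:k\in K\}$, $-z_L=\{-z_l:l\in L\}$, $z_M=\{z_m:m\in M\}$, $$S^{DL}_n(f)=\sum_{0<d\le X}\ \sum_{t_1,\dots,t_n\ge1}f(\gamma_{t_1,d},\dots,\gamma_{t_n,d}),$$ and $$J_{DL}(A,B)=\sum_{0<d\le X}\prod_{\alpha\in A}\frac{L'}{L}(\tfrac12+\alpha,\chi_d)\prod_{\beta\in B}\frac{\psi_{DL}'}{\psi_{DL}}(\tfrac12+\beta,\chi_d).$$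
   Context: Sums over $0<d\le X$ run over positive fundamental discriminants; $\chi_d=(d/\cdot)$ (Kronecker symbol), a real primitive character; $L(s,\chi_d)=\sum_n\chi_d(n)n^{-s}$, satisfying $L(1-s,\chi_d)=\psi_{DL}(s,\chi_d)L(s,\chi_d)$ with $\psi_{DL}(s,\chi_d)=(\pi/d)^{s-1/2}\frac{\Gamma(s/2)}{\Gamma((1-s)/2)}$. $\gamma_{t,d}>0$ is the ordinate of the $t$-th zero $\frac12+i\gamma_{t,d}$ of $L(s,\chi_d)$ above the real axis.
   Formalization: ψ_DL is corrected to (π/d)^{s-1/2}Γ((1-s)/2)/Γ(s/2), with L(s)=ψ_DL(s)L(1-s) (the printed one is false); added: L(1/2,χ_d)≠0 for all d≤X, and |f(x)|≤B∏(1+|Re x_j|)^{-a}, a>1, on a strip |Im x_j|<η with δ<η, so that the formula holds and sums and integrals converge. *)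

(* Defs.v *)
(* MathComp-Analysis; [R] is an arbitrary [realType], complex numbers are
   [R[i]], taken as a normed module over itself ([R[i]^o]) for analysis. *)
From HB Require Import structures.
From mathcomp Require Import all_boot all_order all_algebra.
From mathcomp Require Import complex.
From mathcomp Require Import all_classical all_reals all_analysis.
Export Order.TTheory GRing.Theory Num.Theory numFieldNormedType.Exports.

Set Implicit Arguments.
Unset Strict Implicit.
Unset Printing Implicit Defensive.

Local Open Scope classical_set_scope.
Local Open Scope card_scope.
Local Open Scope ring_scope.
Local Open Scope complex_scope.

Definition squarefree (m : nat) : bool :=
  (0 < m)%N && all (fun p => logn p m == 1%N) (primes m).

(* d = 1 is included, as the discriminant of Q; then chi_1 = 1 and
   L(s, chi_1) is the Riemann zeta function. *)
Definition fundamental_discriminant (d : nat) : bool :=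
  ((d %% 4 == 1)%N && squarefree d) ||
  [&& (4 %| d)%N, ((d %/ 4) %% 4)%N \in [:: 2; 3]%N & squarefree (d %/ 4)].

Definition kronecker_prime (d p : nat) : int :=
  if (p %| d)%N then 0
  else if p == 2%N then (if (d %% 8)%N \in [:: 1; 7]%N then 1 else -1)
  else if [exists x : 'I_p, (x ^ 2 == d %[mod p])%N] then 1 else -1.

Definition kronecker (d m : nat) : int :=
  if m == 0%N then (d == 1%N)%:R
  else \prod_(pe <- prime_decomp m) kronecker_prime d pe.1 ^+ pe.2.

Section complex_analysis.
Variable R : realType.
Local Notation C := (R[i]^o).

(* x ^ s for a real base x > 0 *)
Definition rpowC (x : R) (s : C) : C :=
  (expR (complex.Re s * ln x))%:C *
  (cos (complex.Im s * ln x) +i* sin (complex.Im s * ln x)).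

(* Gauss' limit m! m^s / (s (s+1) ... (s+m)), meaningful for every s outside
   {0, -1, -2, ...}. *)
Definition GammaC (s : C) : C :=
  limn (fun m : nat =>
    ((m`!)%:R * rpowC m%:R s / \prod_(0 <= k < m.+1) (s + k%:R) : C)).

Definition holomorphic_at (g : C -> C) (s : C) : Prop :=
  \forall w \near s, derivable g w 1.

Definition logderiv (g : C -> C) (s : C) : C := derive1 g s / g s.

Definition zero_order (g : C -> C) (s : C) (m : nat) : Prop :=
  exists h : C -> C, [/\ holomorphic_at h s, h s != 0 &
    \forall w \near s, g w = (w - s) ^+ m * h w].

Definition is_Lfunction (d : nat) (L : C -> C) : Prop :=
  (forall s : C, 1 < complex.Re s ->
     series (fun k : nat => ((kronecker d k.+1)%:~R * rpowC k.+1%:R (- s) : C))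
       @ \oo --> L s) /\
  (forall s : C, (d = 1%N -> s <> 1) -> holomorphic_at L s).

(* Normalized so that L(s) = psi(s) L(1 - s); this is the factor whose
   logarithmic derivative is -(log(d/pi) + (Gamma'/Gamma)(s/2) / 2
   + (Gamma'/Gamma)((1-s)/2) / 2). *)
Definition psiDL (d : nat) (s : C) : C :=
  rpowC (pi / d%:R) (s - 2^-1) * (GammaC ((1 - s) / 2) / GammaC (s / 2)).

(* On the open critical strip; the identity theorem extends it. *)
Definition functional_equation (d : nat) (L : C -> C) : Prop :=
  forall s : C, 0 < complex.Re s < 1 -> L s = psiDL d s * L (1 - s).

Definition GRH (L : C -> C) : Prop :=
  forall s : C, 0 < complex.Re s < 1 -> L s = 0 -> complex.Re s = 2^-1.

(* [g t] is the ordinate of the (t+1)-st zero of [L] on the critical line above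
   the real axis, zeros being listed with multiplicity. *)
Definition zero_ordinates (L : C -> C) (g : nat -> R) : Prop :=
  [/\ forall t, 0 < g t,
      {homo g : t u / (t <= u)%N >-> t <= u} &
      forall y : R, 0 < y -> exists2 m : nat,
        zero_order L (2^-1 +i* y) m & [set t | g t = y] #= `I_m].

Definition integralC (F : R -> C) : C :=
  Rintegral lebesgue_measure setT (fun y => complex.Re (F y)) +i*
  Rintegral lebesgue_measure setT (fun y => complex.Im (F y)).

(* Iterated integral of F(z_1, ..., z_n) dz_1 ... dz_n, with z_j running upwards
   along the vertical line of abscissa [c j]. *)
Fixpoint vline_integral (n : nat) : ('I_n -> R) -> ('rV[C]_n -> C) -> C :=
  match n with
  | 0%N => fun _ F => F 0
  | m.+1 => fun c F =>
      integralC (fun y : R =>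
        'i * vline_integral (fun j => c (lift ord0 j))
          (fun w => F (row_mx (const_mx (c ord0 +i* y) : 'rV[C]_1) w
                       : 'rV[C]_(1 + m))))
  end.

Definition polystrip (n : nat) (eta : R) : set ('rV[C]_n) :=
  [set x | forall j, `|complex.Im (x 0 j)| < eta].

Definition even_in_each (n : nat) (D : set ('rV[C]_n)) (f : 'rV[C]_n -> C) :
    Prop :=
  forall (e : 'I_n -> bool) x, D x -> f (\row_j ((-1) ^+ e j * x 0 j)) = f x.

(* Integrable decay in every variable. *)
Definition decays_in (n : nat) (D : set ('rV[C]_n)) (f : 'rV[C]_n -> C) :
    Prop :=
  exists a B : R, 1 < a /\ forall x, D x ->
    `|f x| <= (B * \prod_j (1 + `|complex.Re (x 0 j)|) `^ (- a))%:C.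

Section DL.
Variables (X : R) (L : nat -> C -> C).

Definition discr_sum (F : nat -> C) : C :=
  \sum_(1 <= d < (Num.truncn X).+1 | fundamental_discriminant d) F d.

(* The sum over t_1, ..., t_n >= 1 is the limit of the sums over cubes. *)
Definition S_DL (gamma : nat -> nat -> R) (n : nat) (f : 'rV[C]_n -> C) : C :=
  discr_sum (fun d => limn (fun T : nat =>
    (\sum_(t : {ffun 'I_n -> 'I_T}) f (\row_j (gamma d (t j))%:C) : C))).

Definition J_DL (A B : seq C) : C :=
  discr_sum (fun d =>
    (\prod_(alpha <- A) logderiv (L d) (2^-1 + alpha)) *
    (\prod_(beta <- B) logderiv (psiDL d) (2^-1 + beta))).

End DL.

Definition partition3 (n : nat) (P : {set 'I_n} * {set 'I_n} * {set 'I_n}) :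
    bool :=
  let: (K, L, M) := P in
  [&& [disjoint K & L], [disjoint K & M], [disjoint L & M]
    & (K :|: L :|: M)%SET == [set: 'I_n]%SET].

End complex_analysis.

(* Main.v *)
(* Writing 1/2 + z for the argument of L, the functional equation gives
   psi'/psi(1/2 + z) = L'/L(1/2 + z) + L'/L(1/2 - z), so for one variable the
   three terms add up to the integral of L'/L(1/2 + z) f(iz) over C_+ minus the
   one over C_-, which by residues is 2 pi i times the sum over the zeros above
   and below the real axis, i.e. 4 pi i times the sum over the gamma_t.
   The bound L'/L(1/2 + z) << (1 + |Im z|)^ep on the two lines and on a sequence
   of horizontal segments, and the counting of zeros, come from Landau's lemma
   applied on discs centred at 2 + iT; it needs |L| <= K T there, which follows
   from partial summation because m |-> (d/m) is periodic by quadratic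
   reciprocity. For n variables one integrates out the first variable: summing
   the formula for the remaining n - 1 gives a function of that variable which
   is again holomorphic, even and decaying. *)

Require Import Defs.
From HB Require Import structures.
From mathcomp Require Import all_boot all_order all_algebra.
From mathcomp Require Import complex.
From mathcomp Require Import all_classical all_reals all_analysis.
From mathcomp Require finfield.
From mathcomp Require Import measurable_realfun ring lra zify.

Set Implicit Arguments.
Unset Strict Implicit.
Unset Printing Implicit Defensive.

Local Open Scope classical_set_scope.
Local Open Scope ring_scope.
Local Open Scope complex_scope.
Import Normc Num.Theory.

#[local] Arguments normc : simpl never.

(** * Complex derivatives *)

Section complex_norm.
Variable R : realType.
Local Notation C := (R[i]^o).
Implicit Types (z w s : C) (x y : R).

(** Two exponents carry the estimates. In each variable the test function decays like (1 + |y|)^(-a)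
    with a > 1, while the logarithmic derivatives grow at most like (1 + |y|)^ep; with ep = (a - 1)
    / 2 their product keeps the integrable weight of exponent (a + 1) / 2. In several variables the
    obstacle is that the sum over ordinates is a limit over cubes, whereas integrating out one
    variable at a time produces iterated limits. The induction therefore carries a bound B M^n for
    all cube sums, uniform in the size of the cube. That bound makes the limit holomorphic in the
    remaining variable, and it dominates the sums so that cube limit and iterated limit agree. A
    triple (K, L, M) is treated as a map from the variables to three choices, each with its own line
    and factor; the sum over triples then splits off one variable at a time. Nothing about the Gamma
    function is needed: the logarithmic derivative of psi is read off from L(s) / L(1 - s). *)

Lemma absC_normc z : `|z| = (normc z)%:C.
Proof. by []. Qed.

Lemma normc_ge0 z : 0 <= normc z.
Proof. by case: z => a b; exact: sqrtr_ge0. Qed.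

Lemma normc_eq0 z : (normc z == 0) = (z == 0).
Proof.
apply/eqP/eqP => [/eq0_normc//|->]; exact: normc0.
Qed.

Lemma normc_gt0 z : (0 < normc z) = (z != 0).
Proof. by rewrite lt_neqAle normc_ge0 andbT eq_sym normc_eq0. Qed.

Lemma normcB z w : normc (z - w) = normc (w - z).
Proof. by rewrite -normcN opprB. Qed.

Lemma le_normcB z w : normc (z - w) <= normc z + normc w.
Proof. by rewrite (le_trans (le_normcD _ _))// normcN. Qed.

Lemma le_normc_dist z w : normc z - normc w <= normc (z - w).
Proof. by rewrite lerBlDr (le_trans _ (le_normcD _ _))// subrK. Qed.

Lemma normc_real x : normc (x%:C : C) = `|x|.
Proof. by rewrite /normc /= expr0n addr0 sqrtr_sqr. Qed.

Lemma normc_sqr z : normc z ^+ 2 = complex.Re z ^+ 2 + complex.Im z ^+ 2.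
Proof. by case: z => a b /=; rewrite sqr_sqrtr// addr_ge0// sqr_ge0. Qed.

Lemma le_Re_normc z : `|complex.Re z| <= normc z.
Proof.
rewrite -(@ler_pXn2r _ 2)// ?nnegrE ?normc_ge0// normc_sqr real_normK ?num_real//.
by rewrite lerDl sqr_ge0.
Qed.

Lemma le_Im_normc z : `|complex.Im z| <= normc z.
Proof.
rewrite -(@ler_pXn2r _ 2)// ?nnegrE ?normc_ge0// normc_sqr real_normK ?num_real//.
by rewrite lerDr sqr_ge0.
Qed.

Lemma normc_i : normc ('i : C) = 1.
Proof. by rewrite /normc /= expr0n expr1n add0r sqrtr1. Qed.

Lemma normc_le z : normc z <= `|complex.Re z| + `|complex.Im z|.
Proof.
rewrite {1}(complexE z) (le_trans (le_normcD _ _))// normcM normc_i mul1r.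
by rewrite !normc_real.
Qed.

Lemma normc_conj z : normc z^* = normc z.
Proof. by case: z => a b; rewrite /normc/= sqrrN. Qed.

Lemma normcX z n : normc (z ^+ n) = normc z ^+ n.
Proof. by elim: n => [|n IH]; rewrite ?expr0 ?normc1// !exprS normcM IH. Qed.

Lemma normc_sum (I : Type) (r : seq I) (P : pred I) (F : I -> C) :
  normc (\sum_(i <- r | P i) F i) <= \sum_(i <- r | P i) normc (F i).
Proof.
elim/big_ind2 : _ => // [|a b c d ab cd]; first by rewrite normc0.
by rewrite (le_trans (le_normcD _ _))// lerD.
Qed.

Lemma normc_prod (I : Type) (r : seq I) (P : pred I) (F : I -> C) :
  normc (\prod_(i <- r | P i) F i) = \prod_(i <- r | P i) normc (F i).
Proof.
by elim/big_ind2 : _ => // [|a b c d <- <-]; rewrite ?normc1// normcM.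
Qed.

Lemma cReD z w : complex.Re (z + w) = complex.Re z + complex.Re w.
Proof. by case: z; case: w. Qed.
Lemma cImD z w : complex.Im (z + w) = complex.Im z + complex.Im w.
Proof. by case: z; case: w. Qed.
Lemma cReN z : complex.Re (- z) = - complex.Re z.
Proof. by case: z. Qed.
Lemma cImN z : complex.Im (- z) = - complex.Im z.
Proof. by case: z. Qed.
Lemma cReM z w : complex.Re (z * w) =
  complex.Re z * complex.Re w - complex.Im z * complex.Im w.
Proof. by case: z; case: w. Qed.
Lemma cImM z w : complex.Im (z * w) =
  complex.Re z * complex.Im w + complex.Im z * complex.Re w.
Proof. by case: z => a b; case: w => c d /=. Qed.

Lemma eq_ReIm z w : complex.Re z = complex.Re w ->
  complex.Im z = complex.Im w -> z = w.
Proof. by case: z => a b; case: w => c d /= -> ->. Qed.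

(** Radii of the normed structure are elements of [R[i]]; positivity forces them to be real, so
    balls for the real modulus [normc] generate the filter. *)
Lemma nbhsC (s : C) (P : C -> Prop) : (\forall w \near s, P w) <->
  exists2 d : R, 0 < d & forall w, normc (w - s) < d -> P w.
Proof.
split=> [/nbhs_ballP[e /= e0 eP]|[d d0 dP]].
  have [er e0'] : complex.Im e = 0 /\ 0 < complex.Re e.
    by move: e0; rewrite ltcE => /andP[/eqP-> ->].
  exists (complex.Re e) => // w ws; apply: eP.
  rewrite -ball_normE /= distrC absC_normc ltcE /= er eqxx/=.
  by case: e er e0' ws {e0}.
apply/nbhs_ballP; exists (d%:C); rewrite /= ?ltcR// => w.
rewrite -ball_normE /= distrC absC_normc ltcR; exact: dP.
Qed.

Definition cder (g : C -> C) s (l : C) := forall e : R, 0 < e ->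
  exists2 d : R, 0 < d & forall h, normc h < d ->
    normc (g (s + h) - g s - l * h) <= e * normc h.

Lemma cderP g s l : is_derive s 1 g l <-> cder g s l.
Proof.
split=> [gl e e0|gl].
  have /cvgrPdist_le : (fun h : C => h^-1 *: ((g \o shift s) (h *: (1:C)) - g s)) @ 0^' --> l.
    have [D <-] := gl; have /cvg_ex[l' D'] := D.
    by rewrite /derive (cvg_lim (@norm_hausdorff _ _) D').
  move=> /(_ e%:C); rewrite ltcR => /(_ e0).
  rewrite near_withinE => /nbhsC[d d0 H].
  exists d => // h hd; have [->|h0] := eqVneq h 0.
    by rewrite addr0 subrr mulr0 subr0 normc0 mulr0.
  have := H h; rewrite subr0 => /(_ hd h0).
  rewrite absC_normc lecR /= => H1.
  rewrite -ler_pdivrMr ?normc_gt0// -normcV -normcM.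
  rewrite normcB in H1.
  apply: le_trans H1; rewrite le_eqVlt; apply/orP; left; apply/eqP; congr normc.
  rewrite /shift /= /GRing.scale/= mulr1 addrC [in RHS](addrC h).
  by field.
have gl' : (fun h : C => h^-1 *: ((g \o shift s) (h *: (1:C)) - g s)) @ 0^' --> l.
  apply/cvgrPdist_le => -[e ei]; rewrite ltcE /= => /andP[/eqP-> e0].
  rewrite near_withinE; apply/nbhsC; have [d d0 H] := gl _ e0.
  exists d => // h; rewrite subr0 => hd h0; rewrite absC_normc lecR /=.
  rewrite normcB.
  have := H _ hd; rewrite -ler_pdivrMr ?normc_gt0// -normcV -normcM.
  move=> H1; apply: le_trans H1; rewrite le_eqVlt; apply/orP; left; apply/eqP; congr normc.
  rewrite /shift /= /GRing.scale/= mulr1 addrC [in LHS](addrC h).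
  by field.
apply: DeriveDef; first by apply/cvg_ex; exists l.
by rewrite /derive; apply/cvg_lim => //; exact: norm_hausdorff.
Qed.

Lemma cder_of g s l : is_derive s 1 g l -> cder g s l.
Proof. by move=> h; exact: (cderP g s l).1 h. Qed.

Lemma cder_to g s l : cder g s l -> is_derive s 1 g l.
Proof. by move=> h; exact: (cderP g s l).2 h. Qed.

Definition holo (g : C -> C) s := exists l, cder g s l.

Lemma holoP g s : derivable g s 1 <-> holo g s.
Proof.
split=> [gs|[l /cderP[]]//].
by exists ('D_1 g s); apply/cderP; exact: derivableP.
Qed.

Lemma cder_derive1 g s l : cder g s l -> derive1 g s = l.
Proof. by move=> /cderP[_ <-]; rewrite derive1E. Qed.

Lemma holo_cder g s : holo g s -> cder g s (derive1 g s).
Proof. by move=> [l gl]; rewrite (cder_derive1 gl). Qed.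

Lemma cder_cst (c : C) s : cder (fun=> c) s 0.
Proof. by apply: cder_of; exact: is_derive_cst. Qed.

Lemma cder_id s : cder id s 1.
Proof. by apply: cder_of; exact: is_derive_id. Qed.

Lemma cderD f g s df dg : cder f s df -> cder g s dg ->
  cder (fun z => f z + g z) s (df + dg).
Proof. by move=> /cder_to f1 /cder_to g1; apply: cder_of; exact: is_deriveD. Qed.

Lemma cderN f s df : cder f s df -> cder (fun z => - f z) s (- df).
Proof. by move=> /cder_to f1; apply: cder_of; exact: is_deriveN. Qed.

Lemma cderB f g s df dg : cder f s df -> cder g s dg ->
  cder (fun z => f z - g z) s (df - dg).
Proof. by move=> ? ?; apply: cderD => //; exact: cderN. Qed.

Lemma cderM f g s df dg : cder f s df -> cder g s dg ->
  cder (fun z => f z * g z) s (df * g s + f s * dg).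
Proof.
move=> /cder_to f1 /cder_to g1; have := cder_of (is_deriveM f1 g1).
by rewrite /GRing.scale/= addrC [g s * df]mulrC.
Qed.

Lemma cderV f s df : cder f s df -> f s != 0 ->
  cder (fun z => (f z)^-1) s (- df / f s ^+ 2).
Proof.
move=> /cder_to f1 fs; apply: cder_of.
have df1 : derivable f s 1 by case: f1.
apply: DeriveDef; first exact: derivableV.
rewrite deriveV// /GRing.scale/=.
case: f1 => _ ->; rewrite mulNr -mulrN; by rewrite mulrN mulNr [df * _]mulrC.
Qed.

Lemma cder_near f g s l : (\forall w \near s, f w = g w) -> cder f s l -> cder g s l.
Proof.
move=> /nbhsC[d d0 fg] fl e e0; have [d' d'0 H] := fl _ e0.
exists (Num.min d d'); first by rewrite lt_min d0.
move=> h; rewrite lt_min => /andP[h1 h2].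
rewrite -!fg ?subrr ?normc0//; first exact: H.
by rewrite addrC addKr.
Qed.

Lemma cder_cont g s l : cder g s l -> forall e : R, 0 < e ->
  exists2 d : R, 0 < d & forall w, normc (w - s) < d -> normc (g w - g s) < e.
Proof.
move=> gl e e0; have [d d0 H] := gl 1 ltr01.
have n1 : 0 < 2 * (1 + normc l) by rewrite mulr_gt0// ltr_wpDr// normc_ge0.
exists (Num.min d (e / (2 * (1 + normc l)))); first by rewrite lt_min d0 divr_gt0.
move=> w; rewrite lt_min => /andP[w1 w2].
have := H _ w1; rewrite addrCA subrr addr0 mul1r => H1.
have -> : g w - g s = (g w - g s - l * (w - s)) + l * (w - s) by rewrite subrK.
apply: le_lt_trans (le_normcD _ _) _; rewrite normcM.
apply: (@le_lt_trans _ _ ((1 + normc l) * normc (w - s))).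
  by rewrite mulrDl mul1r lerD2r.
rewrite ltr_pdivlMr// in w2.
have := normc_ge0 (w - s); have := normc_ge0 l; nra.
Qed.

Lemma cder_comp f g s df dg : cder f s df -> cder g (f s) dg ->
  cder (g \o f) s (dg * df).
Proof.
move=> fl gl e e0.
(* [A] bounds the increment of [f] relative to h, and [B] the outer derivative; the added 1 keeps
   both invertible. Each of the two error terms receives half of [e]. *)
pose A := 1 + normc df; pose B := 1 + normc dg.
have A0 : 0 < A by rewrite ltr_wpDr// normc_ge0.
have B0 : 0 < B by rewrite ltr_wpDr// normc_ge0.
have [d1 d10 H1] := gl (e / (2 * A)) (divr_gt0 e0 (mulr_gt0 (ltr0Sn _ 1) A0)).
have m0 : 0 < Num.min 1 (e / (2 * B)) by rewrite lt_min ltr01 divr_gt0// mulr_gt0.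
have [d2 d20 H2] := fl _ m0.
exists (Num.min d2 (d1 / A)); first by rewrite lt_min d20 divr_gt0.
move=> h; rewrite lt_min => /andP[h1]; rewrite ltr_pdivlMr// => h2.
have := H2 _ h1; rewrite minr_pMl ?normc_ge0// le_min mul1r => /andP[h3 h4].
set k := f (s + h) - f s.
have kA : normc k <= normc h * A.
  have -> : k = (k - df * h) + df * h by rewrite subrK.
  by rewrite (le_trans (le_normcD _ _))// normcM /A mulrDr mulr1 lerD// mulrC.
have := H1 k (le_lt_trans kA h2); rewrite /k addrCA subrr addr0 => h5.
rewrite /=.
have -> : g (f (s + h)) - g (f s) - dg * df * h =
  (g (f (s + h)) - g (f s) - dg * k) + dg * (k - df * h).
  by ring.
apply: le_trans (le_normcD _ _) _; rewrite normcM.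
have -> : e * normc h = e / (2 * A) * (normc h * A) + B * (e / (2 * B) * normc h).
  by field; rewrite !gt_eqF.
apply: lerD.
  apply: le_trans h5 _; rewrite ler_pM2l//.
  by rewrite divr_gt0// mulr_gt0.
apply: ler_pM; rewrite ?normc_ge0//; by rewrite /B lerDr.
Qed.

End complex_norm.

(** * Integrals of complex functions of a real variable *)

Section complex_integral.
Variable R : realType.
Local Notation C := (R[i]^o).
Local Notation mu := (@lebesgue_measure R).
Local Notation RT := (measurableTypeR R).
Implicit Types (F G : R -> C) (D : set RT) (a b t x : R).

Definition ccvg (u : nat -> C) (l : C) := forall e : R, 0 < e ->
  exists N : nat, forall n, (N <= n)%N -> normc (u n - l) < e.

Lemma ccvgP u l : u @ \oo --> l <-> ccvg u l.
Proof.
split=> [/cvgrPdist_lt H e e0|H].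
  have /H [N _ HN] : 0 < e%:C by rewrite ltcR.
  exists N => n Nn; have := HN n Nn.
  by rewrite /= distrC absC_normc ltcR.
apply/cvgrPdist_lt => -[e ei]; rewrite ltcE /= => /andP[/eqP-> e0].
have [N HN] := H _ e0; exists N => // n /= Nn.
by rewrite distrC absC_normc ltcR; exact: HN.
Qed.

Lemma ccvg_uniq u l l' : ccvg u l -> ccvg u l' -> l = l'.
Proof.
move=> /ccvgP h /ccvgP h'.
by rewrite -(cvg_lim (@norm_hausdorff _ _) h) (cvg_lim (@norm_hausdorff _ _) h').
Qed.

Lemma ccvg_lim u l : ccvg u l -> limn u = l.
Proof. by move=> /ccvgP h; rewrite (cvg_lim (@norm_hausdorff _ _) h). Qed.

Lemma rcvgP (u : nat -> R) l : u @ \oo --> l <-> forall e : R, 0 < e ->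
  exists N : nat, forall n, (N <= n)%N -> `|u n - l| < e.
Proof.
split=> [/cvgrPdist_lt H e e0|H].
  by have [N _ HN] := H e e0; exists N => n Nn; have := HN n Nn; rewrite /= distrC.
apply/cvgrPdist_lt => e e0; have [N HN] := H _ e0; exists N => // n /= Nn.
by rewrite distrC; exact: HN.
Qed.

Lemma ccvg_ReIm u l : ccvg u l <->
  (@complex.Re R \o u) @ \oo --> complex.Re l /\ (@complex.Im R \o u) @ \oo --> complex.Im l.
Proof.
split=> [H|[/rcvgP H1 /rcvgP H2] e e0].
  split; apply/rcvgP => e e0; have [N HN] := H _ e0; exists N => n /HN.
    by apply: le_lt_trans; rewrite /= -cReN -cReD le_Re_normc.
  by apply: le_lt_trans; rewrite /= -cImN -cImD le_Im_normc.
have e2 : 0 < e / 2 by rewrite divr_gt0.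
have [N1 HN1] := H1 _ e2; have [N2 HN2] := H2 _ e2.
exists (maxn N1 N2) => n; rewrite geq_max => /andP[/HN1 h1 /HN2 h2].
apply: le_lt_trans (normc_le _) _; rewrite cReD cImD cReN cImN.
by rewrite [e]splitr ltrD.
Qed.

Lemma ccvg_cst (c : C) : ccvg (fun=> c) c.
Proof. by move=> e e0; exists 0%N => n _; rewrite subrr normc0. Qed.

Lemma ccvgD u v l l' : ccvg u l -> ccvg v l' -> ccvg (fun n => u n + v n) (l + l').
Proof. by move=> /ccvgP h1 /ccvgP h2; exact: (ccvgP _ _).1 (cvgD h1 h2). Qed.

Lemma ccvgN u l : ccvg u l -> ccvg (fun n => - u n) (- l).
Proof. by move=> /ccvgP h1; exact: (ccvgP _ _).1 (cvgN h1). Qed.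

Lemma ccvgM u v l l' : ccvg u l -> ccvg v l' -> ccvg (fun n => u n * v n) (l * l').
Proof. by move=> /ccvgP h1 /ccvgP h2; exact: (ccvgP _ _).1 (cvgM h1 h2). Qed.

Lemma ccvg_sum (I : Type) (r : seq I) (P : pred I) (u : I -> nat -> C) (l : I -> C) :
  (forall i, P i -> ccvg (u i) (l i)) ->
  ccvg (fun n => \sum_(i <- r | P i) u i n) (\sum_(i <- r | P i) l i).
Proof.
move=> H; elim: r => [|i r IH].
  by rewrite big_nil; under eq_fun do rewrite big_nil; exact: ccvg_cst.
rewrite big_cons; under eq_fun do rewrite big_cons.
by case: ifPn => // Pi; apply: ccvgD => //; exact: H.
Qed.

Lemma ccvg_le u l (M : R) : ccvg u l -> (forall n, normc (u n) <= M) -> normc l <= M.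
Proof.
move=> H uM; apply/ler_addgt0Pr => e e0; have [N /(_ N (leqnn _)) HN] := H _ e0.
have -> : l = u N - (u N - l) by rewrite opprB addrC subrK.
by rewrite (le_trans (le_normcB _ _))// lerD// ltW.
Qed.

Definition cmeas D F := measurable_fun D (@complex.Re R \o F : RT -> R) /\
  measurable_fun D (@complex.Im R \o F : RT -> R).

Definition cintegrable D F := mu.-integrable D (EFin \o (@complex.Re R \o F)) /\
  mu.-integrable D (EFin \o (@complex.Im R \o F)).

Definition cint D F : C := Rintegral mu D (fun y => complex.Re (F y)) +i*
  Rintegral mu D (fun y => complex.Im (F y)).

Lemma cintegrable_meas D F : cintegrable D F -> cmeas D F.
Proof.
by move=> [h1 h2]; split; apply/measurable_EFinP; apply: (measurable_int mu).
Qed.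

Lemma cintegrable_dom D F (G : R -> R) : measurable D -> cmeas D F ->
  mu.-integrable D (EFin \o G) -> (forall x, D x -> normc (F x) <= G x) ->
  cintegrable D F.
Proof.
move=> mD [m1 m2] iG FG; split; apply: (le_integrable mD _ _ iG) => /=.
- exact/measurable_EFinP.
- move=> x Dx; rewrite lee_fin (le_trans (le_Re_normc _))// (le_trans (FG _ Dx))//.
  exact: ler_norm.
- exact/measurable_EFinP.
- move=> x Dx; rewrite lee_fin (le_trans (le_Im_normc _))// (le_trans (FG _ Dx))//.
  exact: ler_norm.
Qed.

Lemma eq_cint D F G : (forall x, D x -> F x = G x) -> cint D F = cint D G.
Proof.
move=> FG; congr (_ +i* _); apply: eq_Rintegral => x; rewrite inE => Dx; by rewrite FG.
Qed.

Lemma eq_cintegrable D F G : measurable D -> (forall x, D x -> F x = G x) ->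
  cintegrable D F -> cintegrable D G.
Proof.
move=> mD FG [h1 h2]; split; [apply: eq_integrable h1|apply: eq_integrable h2] => //;
  by move=> x; rewrite inE => Dx /=; rewrite FG.
Qed.

Lemma cintegrableD D F G : measurable D -> cintegrable D F -> cintegrable D G ->
  cintegrable D (fun x => F x + G x).
Proof.
move=> mD [f1 f2] [g1 g2]; split.
  have := integrableD mD f1 g1; apply: eq_integrable => // x _ /=; by rewrite -EFinD cReD.
have := integrableD mD f2 g2; apply: eq_integrable => // x _ /=; by rewrite -EFinD cImD.
Qed.

Lemma cintegrableZ D F (c : C) : measurable D -> cintegrable D F ->
  cintegrable D (fun x => c * F x).
Proof.
move=> mD [f1 f2]; split.
  have := integrableB mD (integrableZl mD (complex.Re c) f1) (integrableZl mD (complex.Im c) f2).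
  by apply: eq_integrable => // x _ /=; rewrite cReM -!EFinM -EFinB.
have := integrableD mD (integrableZl mD (complex.Re c) f2) (integrableZl mD (complex.Im c) f1).
by apply: eq_integrable => // x _ /=; rewrite cImM -!EFinM -EFinD.
Qed.

Lemma cintegrableN D F : measurable D -> cintegrable D F ->
  cintegrable D (fun x => - F x).
Proof.
move=> mD /(cintegrableZ (-1) mD); apply: eq_cintegrable => // x _.
by rewrite mulN1r.
Qed.

Lemma cintD D F G : measurable D -> cintegrable D F -> cintegrable D G ->
  cint D (fun x => F x + G x) = cint D F + cint D G.
Proof.
move=> mD [f1 f2] [g1 g2]; rewrite /cint; apply: eq_ReIm => /=.
  by rewrite -RintegralD//; apply: eq_Rintegral => x _; rewrite cReD.
by rewrite -RintegralD//; apply: eq_Rintegral => x _; rewrite cImD.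
Qed.

Lemma cintZ D F (c : C) : measurable D -> cintegrable D F ->
  cint D (fun x => c * F x) = c * cint D F.
Proof.
move=> mD [f1 f2]; have z (r : R) f : mu.-integrable D (EFin \o f) ->
   mu.-integrable D (EFin \o (fun x => r * f x)).
  by move=> h; have := integrableZl mD r h; apply: eq_integrable.
rewrite /cint; apply: eq_ReIm; rewrite ?cReM ?cImM /=.
  rewrite -!RintegralZl// -RintegralB//; [|exact: z|exact: z].
  by apply: eq_Rintegral => x _; rewrite cReM.
rewrite -!RintegralZl// -RintegralD//; [|exact: z|exact: z].
by apply: eq_Rintegral => x _; rewrite cImM.
Qed.

Lemma cintN D F : measurable D -> cintegrable D F ->
  cint D (fun x => - F x) = - cint D F.
Proof.
move=> mD iF; rewrite -mulN1r -cintZ//; apply: eq_cint => x _; by rewrite mulN1r.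
Qed.

Lemma cintB D F G : measurable D -> cintegrable D F -> cintegrable D G ->
  cint D (fun x => F x - G x) = cint D F - cint D G.
Proof.
by move=> mD iF iG; rewrite cintD ?cintN//; exact: cintegrableN.
Qed.

Lemma cintegrable0 D : measurable D -> cintegrable D (fun=> 0).
Proof. by move=> mD; split; apply: (eq_integrable mD (cst 0%E)) (integrable0 _ _). Qed.

Lemma cint0 D : cint D (fun=> 0) = 0.
Proof.
rewrite /cint; have -> : Rintegral mu D (fun=> 0) = 0.
  by rewrite /Rintegral integral0.
by [].
Qed.

Lemma cintegrable_sum D (I : Type) (r : seq I) (P : pred I) (F : I -> R -> C) :
  measurable D -> (forall i, P i -> cintegrable D (F i)) ->
  cintegrable D (fun x => \sum_(i <- r | P i) F i x).
Proof.
move=> mD H; elim: r => [|i r IH].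
  by apply: eq_cintegrable (cintegrable0 mD) => // x _; rewrite big_nil.
case Pi : (P i).
  by apply: eq_cintegrable (cintegrableD mD (H i Pi) IH) => // x _; rewrite big_cons Pi.
by apply: eq_cintegrable IH => // x _; rewrite big_cons Pi.
Qed.

Lemma cint_sum D (I : Type) (r : seq I) (P : pred I) (F : I -> R -> C) :
  measurable D -> (forall i, P i -> cintegrable D (F i)) ->
  cint D (fun x => \sum_(i <- r | P i) F i x) = \sum_(i <- r | P i) cint D (F i).
Proof.
move=> mD H; elim: r => [|i r IH].
  by rewrite big_nil -[RHS](cint0 D); apply: eq_cint => x _; rewrite big_nil.
rewrite big_cons -IH; case: ifPn => Pi.
  rewrite -cintD//; [|exact: H|exact: cintegrable_sum].
  by apply: eq_cint => x _; rewrite big_cons Pi.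
by apply: eq_cint => x _; rewrite big_cons (negbTE Pi).
Qed.

(** Multiplying by the unit conj I / |I| makes the integral I real and nonnegative, so that it is
    the integral of a real part bounded by the modulus. *)
Lemma le_normc_cint D F (G : R -> R) : measurable D -> cintegrable D F ->
  mu.-integrable D (EFin \o G) -> (forall x, D x -> normc (F x) <= G x) ->
  normc (cint D F) <= Rintegral mu D G.
Proof.
move=> mD iF iG FG; set I := cint D F; have [I0|I0] := eqVneq I 0.
  rewrite I0 normc0; apply: Rintegral_ge0 => x Dx.
  by rewrite (le_trans (normc_ge0 _) (FG _ Dx)).
have nI : normc I != 0 by rewrite normc_eq0.
pose c : C := (I^* / (normc I)%:C).
have Hc : normc c = 1.
  by rewrite normcM normcV normc_conj normc_real ger0_norm ?normc_ge0// divff.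
have -> : normc I = complex.Re (c * I).
  have -> : c * I = (normc I)%:C.
    rewrite /c mulrAC mulrC; apply: (@mulfI _ (normc I)%:C).
      by rewrite eq_complex /= negb_and nI.
    rewrite mulVKf; last by rewrite eq_complex /= negb_and nI.
    rewrite [in LHS]mulrC -sqr_normc absC_normc; by rewrite expr2.
  by [].
rewrite -cintZ//; have [ic _] := cintegrableZ c mD iF.
apply: le_Rintegral => // x Dx.
rewrite (le_trans (ler_norm _))// (le_trans (le_Re_normc _))// normcM Hc mul1r.
exact: FG.
Qed.

(** Dominated convergence for real and imaginary parts separately; the modulus dominates both, so
    [key] treats them at once. *)
Lemma cdct D (Fn : nat -> R -> C) F (G : R -> R) : measurable D ->
  (forall n, cmeas D (Fn n)) -> mu.-integrable D (EFin \o G) ->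
  (forall n x, D x -> normc (Fn n x) <= G x) ->
  (forall x, D x -> ccvg (Fn ^~ x) (F x)) ->
  cintegrable D F /\ ccvg (fun n => cint D (Fn n)) (cint D F).
Proof.
move=> mD mF iG FG cF.
have key (p : C -> R) : (forall z, `|p z| <= normc z) ->
    (forall n, measurable_fun D (p \o Fn n : RT -> R)) ->
    (forall x, D x -> (p \o Fn ^~ x) @ \oo --> p (F x)) ->
    mu.-integrable D (EFin \o (p \o F)) /\
    (fun n => Rintegral mu D (p \o Fn n)) @ \oo --> Rintegral mu D (p \o F).
  move=> pn mp cp.
  have mpF : measurable_fun D (p \o F : RT -> R).
    by apply: (measurable_fun_cvg (h := fun n => p \o Fn n)) => // x Dx; exact: cp.
  have H : (forall n, measurable_fun D (EFin \o (p \o Fn n) : RT -> _)).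
    by move=> n; apply/measurable_EFinP; exact: mp.
  have mpF' : measurable_fun D (EFin \o (p \o F) : RT -> _) by exact/measurable_EFinP.
  have [] := @dominated_convergence _ _ _ mu D mD
    (fun n => EFin \o (p \o Fn n)) (EFin \o (p \o F)) (EFin \o G) H mpF'.
  - apply: aeW => x /= Dx; apply: cvg_EFin; first exact: nearW.
    exact: cp.
  - exact: iG.
  - apply: aeW => x /= n Dx.
    by rewrite lee_fin (le_trans (pn _))// FG.
  move=> i1 _ i2; split=> //.
  have fi : (\int[mu]_(x in D) (EFin \o (p \o F)) x)%E \is a fin_num.
    by apply: integrable_fin_num.
  by apply: fine_cvg; rewrite /Rintegral fineK.
have cR x : D x -> _ := fun Dx => (ccvg_ReIm _ _).1 (cF x Dx).
have [i1 l1] := key (@complex.Re R) (@le_Re_normc R) (fun n => (mF n).1) (fun x Dx => (cR x Dx).1).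
have [i2 l2] := key (@complex.Im R) (@le_Im_normc R) (fun n => (mF n).2) (fun x Dx => (cR x Dx).2).
by split=> //; apply/ccvg_ReIm.
Qed.

Definition ccont F t := {for t, continuous (@complex.Re R \o F : R -> R)} /\
  {for t, continuous (@complex.Im R \o F : R -> R)}.

Lemma ccontP F t : ccont F t <-> forall e : R, 0 < e ->
  exists2 d : R, 0 < d & forall x, `|x - t| < d -> normc (F x - F t) < e.
Proof.
split=> [[h1 h2] e e0|H].
  have e2 : 0 < e / 2 by rewrite divr_gt0.
  move: h1 h2 => /cvgrPdist_lt/(_ _ e2) h1 /cvgrPdist_lt/(_ _ e2) h2.
  have : \forall x \near t, `|complex.Re (F t) - complex.Re (F x)| < e / 2 /\
    `|complex.Im (F t) - complex.Im (F x)| < e / 2 by near=> x; split; near: x.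
  move=> /nbhs_ballP[d /= d0 Hd]; exists d => // x xd.
  have [|a1 a2] := Hd x; first by rewrite -ball_normE /= distrC.
  rewrite normcB (le_lt_trans (normc_le _))// cReD cImD cReN cImN.
  by rewrite [e]splitr ltrD.
split; apply/cvgrPdist_lt => e e0; have [d d0 Hd] := H _ e0;
  apply/nbhs_ballP; exists d => // x; rewrite -?ball_normE /= distrC => /Hd;
  rewrite -normcN opprB; apply: le_lt_trans.
  by rewrite -cReN -cReD le_Re_normc.
by rewrite -cImN -cImD le_Im_normc.
Unshelve. all: by end_near. Qed.

Lemma ccont_cintegrable F a b : (forall x, a <= x <= b -> ccont F x) ->
  cintegrable `[a, b] F.
Proof.
move=> cF; split; apply: continuous_compact_integrable; try exact: segment_compact;
  apply: continuous_in_subspaceT => x; rewrite inE /= in_itv /= => /cF[] //.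
Qed.

Lemma cint_split F a c b : a <= c -> c <= b -> cintegrable `[a, b] F ->
  cint `[a, b] F = cint `[a, c] F + cint `[c, b] F.
Proof.
move=> ac cb [h1 h2].
have key (f : R -> R) : mu.-integrable `[a, b] (EFin \o f) ->
    Rintegral mu `[a, b] f = Rintegral mu `[a, c] f + Rintegral mu `[c, b] f.
  move=> h; have := @Rintegral_itvB _ f (BLeft a) (BRight b) c h.
  rewrite !bnd_simp => /(_ ac cb) /eqP; rewrite subr_eq => /eqP ->.
  rewrite addrC; congr (_ + _); apply: Rintegral_itv_obnd_cbnd.
  apply: integrableS h => //; apply: subset_itv; rewrite ?bnd_simp//.
by apply: eq_ReIm => /=; exact: key.
Qed.

Definition rder F t (l : C) := is_derive t (1:R) (@complex.Re R \o F) (complex.Re l) /\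
  is_derive t (1:R) (@complex.Im R \o F) (complex.Im l).

Lemma is_deriveRP (f : R -> R) t (l : R) : is_derive t (1:R) f l <->
  forall e : R, 0 < e -> exists2 d : R, 0 < d & forall h, `|h| < d ->
    `|f (t + h) - f t - l * h| <= e * `|h|.
Proof.
have E (h : R) : h != 0 -> `|l - h^-1 *: ((f \o shift t) (h *: 1) - f t)| =
   `|f (t + h) - f t - l * h| / `|h|.
  move=> h0; rewrite -normfV -normrM distrC; congr `|_|.
  by rewrite /shift /= /GRing.scale/= mulr1 [h + t]addrC; field.
split=> [gl e e0|gl].
  have /cvgrPdist_le : (fun h => h^-1 *: ((f \o shift t) (h *: (1:R)) - f t)) @ 0^' --> l.
    have [D <-] := gl; have /cvg_ex[l' D'] := D.
    by rewrite /derive (cvg_lim (@norm_hausdorff _ _) D').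
  move=> /(_ e e0); rewrite near_withinE => /nbhs_ballP[d /= d0 H].
  exists d => // h hd; have [->|h0] := eqVneq h 0.
    by rewrite addr0 subrr mulr0 subr0 normr0 mulr0.
  have := H h; rewrite -ball_normE /= sub0r normrN => /(_ hd h0).
  by rewrite E// ler_pdivrMr ?normr_gt0.
have gl' : (fun h => h^-1 *: ((f \o shift t) (h *: (1:R)) - f t)) @ 0^' --> l.
  apply/cvgrPdist_le => e e0.
  rewrite near_withinE; apply/nbhs_ballP; have [d d0 H] := gl _ e0.
  exists d => // h; rewrite -ball_normE /= sub0r normrN => hd h0.
  by rewrite E// ler_pdivrMr ?normr_gt0//; exact: H.
apply: DeriveDef; first by apply/cvg_ex; exists l.
by rewrite /derive; apply/cvg_lim => //; exact: norm_hausdorff.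
Qed.

(** Merges the two componentwise derivatives into one estimate, the form in which an outer
    holomorphic function can be composed. *)
Lemma rderP F t l : rder F t l <->
  forall e : R, 0 < e -> exists2 d : R, 0 < d & forall h : R, `|h| < d ->
    normc (F (t + h) - F t - l * h%:C) <= e * `|h|.
Proof.
have ER h : complex.Re (F (t + h) - F t - l * h%:C) =
  complex.Re (F (t + h)) - complex.Re (F t) - complex.Re l * h.
  by rewrite !cReD !cReN cReM /= mulr0 subr0.
have EI h : complex.Im (F (t + h) - F t - l * h%:C) =
  complex.Im (F (t + h)) - complex.Im (F t) - complex.Im l * h.
  by rewrite !cImD !cImN cImM /= mulr0 add0r.
split=> [[/is_deriveRP h1 /is_deriveRP h2] e e0|H].
  have e2 : 0 < e / 2 by rewrite divr_gt0.
  have [d1 d10 H1] := h1 _ e2; have [d2 d20 H2] := h2 _ e2.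
  exists (Num.min d1 d2); first by rewrite lt_min d10.
  move=> h; rewrite lt_min => /andP[/H1 a1 /H2 a2].
  apply: le_trans (normc_le _) _; rewrite ER EI.
  by rewrite [e]splitr mulrDl lerD.
split; apply/is_deriveRP => e e0; have [d d0 Hd] := H _ e0; exists d => // h /Hd.
  by apply: le_trans; rewrite /= -ER le_Re_normc.
by apply: le_trans; rewrite /= -EI le_Im_normc.
Qed.

Lemma rder_comp (g : C -> C) F t l l' : cder g (F t) l -> rder F t l' ->
  rder (g \o F) t (l * l').
Proof.
move=> gl /rderP Fl; apply/rderP => e e0.
pose A := 1 + normc l'; pose B := 1 + normc l.
have A0 : 0 < A by rewrite ltr_wpDr// normc_ge0.
have B0 : 0 < B by rewrite ltr_wpDr// normc_ge0.
have [d1 d10 H1] := gl (e / (2 * A)) (divr_gt0 e0 (mulr_gt0 (ltr0Sn _ 1) A0)).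
have m0 : 0 < Num.min 1 (e / (2 * B)) by rewrite lt_min ltr01 divr_gt0// mulr_gt0.
have [d2 d20 H2] := Fl _ m0.
exists (Num.min d2 (d1 / A)); first by rewrite lt_min d20 divr_gt0.
move=> h; rewrite lt_min => /andP[h1]; rewrite ltr_pdivlMr// => h2.
have := H2 _ h1; rewrite minr_pMl// le_min mul1r => /andP[h3 h4].
set k := F (t + h) - F t.
have kA : normc k <= `|h| * A.
  have -> : k = (k - l' * h%:C) + l' * h%:C by rewrite subrK.
  by rewrite (le_trans (le_normcD _ _))// normcM normc_real /A mulrDr mulr1 lerD// mulrC.
have := H1 k (le_lt_trans kA h2); rewrite /k addrCA subrr addr0 => h5.
rewrite /=.
have -> : g (F (t + h)) - g (F t) - l * l' * h%:C =
  (g (F (t + h)) - g (F t) - l * k) + l * (k - l' * h%:C).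
  by ring.
apply: le_trans (le_normcD _ _) _; rewrite normcM.
have -> : e * `|h| = e / (2 * A) * (`|h| * A) + B * (e / (2 * B) * `|h|).
  by field; rewrite !gt_eqF.
apply: lerD.
  apply: le_trans h5 _; rewrite ler_pM2l//.
  by rewrite divr_gt0// mulr_gt0.
apply: ler_pM; rewrite ?normc_ge0//; by rewrite /B lerDr.
Qed.

Lemma rder_cont F t l : rder F t l -> ccont F t.
Proof.
move=> [h1 h2]; split; apply: differentiable_continuous; apply/derivable1_diffP.
  by case: h1.
by case: h2.
Qed.

Lemma cder_ccont (g : C -> C) F t : holo g (F t) -> ccont F t -> ccont (g \o F) t.
Proof.
move=> [l gl] /ccontP cF; apply/ccontP => e e0; have [d d0 Hd] := cder_cont gl e0.
by have [d' d'0 Hd'] := cF _ d0; exists d' => // x /Hd' /Hd.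
Qed.

Lemma rder_affine (c v : C) t : rder (fun x => c + v * x%:C) t v.
Proof.
apply/rderP => e e0; exists 1 => // h _.
have -> : c + v * (t + h)%:C - (c + v * t%:C) - v * h%:C = 0.
  by rewrite rmorphD /=; ring.
by rewrite normc0 mulr_ge0// ltW.
Qed.

Lemma ccont_affine (c v : C) t : ccont (fun x => c + v * x%:C) t.
Proof. exact: rder_cont (rder_affine c v t). Qed.

Lemma ccont_cst (c : C) t : ccont (fun=> c) t.
Proof. by apply/ccontP => e e0; exists 1 => // x _; rewrite subrr normc0. Qed.

Lemma ccontD F G t : ccont F t -> ccont G t -> ccont (fun x => F x + G x) t.
Proof.
move=> [f1 f2] [g1 g2]; split.
  rewrite (_ : _ \o _ = (@complex.Re R \o F) \+ (@complex.Re R \o G)); first exact: continuousD.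
  by apply/funext => x /=; rewrite cReD.
rewrite (_ : _ \o _ = (@complex.Im R \o F) \+ (@complex.Im R \o G)); first exact: continuousD.
by apply/funext => x /=; rewrite cImD.
Qed.

Lemma ccontM F G t : ccont F t -> ccont G t -> ccont (fun x => F x * G x) t.
Proof.
move=> [f1 f2] [g1 g2]; split.
  rewrite (_ : _ \o _ = ((@complex.Re R \o F) \* (@complex.Re R \o G)) \-
    ((@complex.Im R \o F) \* (@complex.Im R \o G))).
    by apply: continuousB; exact: continuousM.
  by apply/funext => x /=; rewrite cReM.
rewrite (_ : _ \o _ = ((@complex.Re R \o F) \* (@complex.Im R \o G)) \+
    ((@complex.Im R \o F) \* (@complex.Re R \o G))).
  by apply: continuousD; exact: continuousM.
by apply/funext => x /=; rewrite cImM.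
Qed.

Lemma ccontN F t : ccont F t -> ccont (fun x => - F x) t.
Proof.
move=> /ccontP h; apply/ccontP => e /h[d d0 Hd]; exists d => // x /Hd.
by rewrite -opprD normcN.
Qed.

Lemma cint_FTC F (f : R -> C) a b : a <= b ->
  (forall x, a <= x <= b -> rder F x (f x)) -> (forall x, a <= x <= b -> ccont f x) ->
  cint `[a, b] f = F b - F a.
Proof.
rewrite le_eqVlt => /predU1P[<-|ab] dF cf.
  by rewrite subrr set_itv1 /cint !Rintegral_set1.
have key (p f' : R -> R) : (forall x, a <= x <= b -> is_derive x (1:R) p (f' x)) ->
   (forall x, a <= x <= b -> {for x, continuous f'}) ->
   Rintegral mu `[a, b] f' = p b - p a.
  move=> dp cf'.
  have cp x : a <= x <= b -> {for x, continuous p}.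
    move=> xab; apply: differentiable_continuous; apply/derivable1_diffP.
    by case: (dp x xab).
  rewrite /Rintegral (@continuous_FTC2 _ f' p a b ab)//.
  - by apply: continuous_in_subspaceT => x; rewrite inE /= in_itv /= => /cf'.
  - split.
    + move=> x; rewrite in_itv /= => /andP[ax xb].
      by case: (dp x _) => //; rewrite !ltW.
    + apply: cvg_at_right_filter; apply: cp; by rewrite lexx ltW.
    + apply: cvg_at_left_filter; apply: cp; by rewrite lexx ltW.
  - move=> x; rewrite in_itv /= => /andP[ax xb]; rewrite derive1E.
    by case: (dp x _) => //; rewrite !ltW.
have -> : cint `[a, b] f =
    (complex.Re (F b) - complex.Re (F a)) +i* (complex.Im (F b) - complex.Im (F a)).
  by congr (_ +i* _);
    [apply: (key (@complex.Re R \o F) (@complex.Re R \o f))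
    |apply: (key (@complex.Im R \o F) (@complex.Im R \o f))]; move=> x xab;
    case: (dF x xab); case: (cf x xab).
by apply: eq_ReIm; rewrite ?cReD ?cReN ?cImD ?cImN.
Qed.

Lemma Rintegral_cst_itv a b (M : R) : a <= b ->
  Rintegral mu `[a, b] (fun=> M) = M * (b - a).
Proof.
move=> ab; rewrite Rintegral_cst//= lebesgue_measure_itv /= lte_fin.
move: ab; rewrite le_eqVlt => /predU1P[->|ab]; first by rewrite ltxx subrr.
by rewrite ab.
Qed.

Lemma integrable_cst_itv a b (M : R) : mu.-integrable `[a, b] (EFin \o (fun=> M)).
Proof.
apply: continuous_compact_integrable; first exact: segment_compact.
by move=> x; exact: cvg_cst.
Qed.

Lemma cint_bound F a b (M : R) : a <= b -> cintegrable `[a, b] F ->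
  (forall x, a <= x <= b -> normc (F x) <= M) -> normc (cint `[a, b] F) <= M * (b - a).
Proof.
move=> ab iF FM; rewrite -Rintegral_cst_itv//; apply: le_normc_cint => //.
  exact: integrable_cst_itv.
Qed.

Lemma cint_cst a b (c : C) : a <= b -> cint `[a, b] (fun=> c) = c * (b - a)%:C.
Proof.
move=> ab; case: c => c c'; rewrite /cint !Rintegral_cst_itv//.
by apply: eq_ReIm => /=; rewrite ?mulr0 ?subr0 ?addr0 ?add0r.
Qed.

End complex_integral.
Arguments cint : simpl never.

(** * Goursat *)

Section goursat.
Variable R : realType.
Local Notation C := (R[i]^o).
Implicit Types (F : C -> C) (s z w : C) (x y : R).

Lemma vline_affine x y : x +i* y = x%:C + 'i * y%:C :> C.
Proof. by apply: eq_ReIm => /=; ring. Qed.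

Lemma hline_affine x y : x +i* y = (0 +i* y) + 1 * x%:C :> C.
Proof. by apply: eq_ReIm => /=; ring. Qed.

Lemma ccont_hline F x y : holo F (x +i* y) -> ccont (fun x => F (x +i* y)) x.
Proof.
move=> h; apply: (@cder_ccont _ F (fun x => x +i* y)) => //.
rewrite (_ : (fun x => _) = (fun x => (0 +i* y) + 1 * x%:C)); first exact: ccont_affine.
by apply/funext => z; exact: hline_affine.
Qed.

Lemma ccont_vline F x y : holo F (x +i* y) -> ccont (fun y => F (x +i* y)) y.
Proof.
move=> h; apply: (@cder_ccont _ F (fun y => x +i* y)) => //.
rewrite (_ : (fun y => _) = (fun y => x%:C + 'i * y%:C)); first exact: ccont_affine.
by apply/funext => z; exact: vline_affine.
Qed.

Lemma rder_hline F x y l : cder F (x +i* y) l -> rder (fun x => F (x +i* y)) x l.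
Proof.
move=> h; rewrite -[l]mulr1; apply: (@rder_comp _ F (fun x => x +i* y)) => //.
rewrite (_ : (fun x => _) = (fun x => (0 +i* y) + 1 * x%:C)); first exact: rder_affine.
by apply/funext => z; exact: hline_affine.
Qed.

Lemma rder_vline F x y l : cder F (x +i* y) l -> rder (fun y => F (x +i* y)) y (l * 'i).
Proof.
move=> h; apply: (@rder_comp _ F (fun y => x +i* y)) => //.
rewrite (_ : (fun y => _) = (fun y => x%:C + 'i * y%:C)); first exact: rder_affine.
by apply/funext => z; exact: vline_affine.
Qed.

(** The boundary is run counterclockwise. Sides are parametrized by increasing coordinates, hence
    the differences; dz = 'i dy on the vertical ones. *)
Definition rectint F (x1 x2 y1 y2 : R) : C :=
  cint `[x1, x2] (fun x => F (x +i* y1)) - cint `[x1, x2] (fun x => F (x +i* y2))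
  + 'i * (cint `[y1, y2] (fun y => F (x2 +i* y)) - cint `[y1, y2] (fun y => F (x1 +i* y))).

Definition holo_rect F (x1 x2 y1 y2 : R) :=
  forall x y, x1 <= x <= x2 -> y1 <= y <= y2 -> holo F (x +i* y).

Lemma holo_rect_sub F (x1 x2 y1 y2 a1 a2 b1 b2 : R) : holo_rect F x1 x2 y1 y2 ->
  x1 <= a1 -> a2 <= x2 -> y1 <= b1 -> b2 <= y2 -> holo_rect F a1 a2 b1 b2.
Proof.
move=> h ? ? ? ? x y /andP[? ?] /andP[? ?].
by apply: h; apply/andP; split; lra.
Qed.

Lemma holo_rect_hint F (x1 x2 y1 y2 y : R) : holo_rect F x1 x2 y1 y2 ->
  y1 <= y <= y2 -> cintegrable `[x1, x2] (fun x => F (x +i* y)).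
Proof. by move=> h yy; apply: ccont_cintegrable => x xx; apply: ccont_hline; exact: h. Qed.

Lemma holo_rect_vint F (x1 x2 y1 y2 x : R) : holo_rect F x1 x2 y1 y2 ->
  x1 <= x <= x2 -> cintegrable `[y1, y2] (fun y => F (x +i* y)).
Proof. by move=> h xx; apply: ccont_cintegrable => y yy; apply: ccont_vline; exact: h. Qed.

Lemma rectint_splitx F (x1 m x2 y1 y2 : R) : x1 <= m <= x2 -> y1 <= y2 ->
  holo_rect F x1 x2 y1 y2 ->
  rectint F x1 x2 y1 y2 = rectint F x1 m y1 y2 + rectint F m x2 y1 y2.
Proof.
move=> /andP[h1 h2] h3 hF; rewrite /rectint.
rewrite (@cint_split _ _ x1 m x2)//; last by apply: (holo_rect_hint hF); rewrite lexx h3.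
rewrite (@cint_split _ (fun x => F (x +i* y2)) x1 m x2)//; last first.
  by apply: (holo_rect_hint hF); rewrite lexx h3.
ring.
Qed.

Lemma rectint_splity F (x1 x2 y1 m y2 : R) : y1 <= m <= y2 -> x1 <= x2 ->
  holo_rect F x1 x2 y1 y2 ->
  rectint F x1 x2 y1 y2 = rectint F x1 x2 y1 m + rectint F x1 x2 m y2.
Proof.
move=> /andP[h1 h2] h3 hF; rewrite /rectint.
rewrite (@cint_split _ (fun y => F (x2 +i* y)) y1 m y2)//; last first.
  by apply: (holo_rect_vint hF); rewrite lexx h3.
rewrite (@cint_split _ (fun y => F (x1 +i* y)) y1 m y2)//; last first.
  by apply: (holo_rect_vint hF); rewrite lexx h3.
ring.
Qed.

Lemma rectintB F G (x1 x2 y1 y2 : R) : x1 <= x2 -> y1 <= y2 ->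
  holo_rect F x1 x2 y1 y2 -> holo_rect G x1 x2 y1 y2 ->
  rectint (fun s => F s - G s) x1 x2 y1 y2 = rectint F x1 x2 y1 y2 - rectint G x1 x2 y1 y2.
Proof.
move=> x12 y12 hF hG; rewrite /rectint.
have e1 : x1 <= x1 <= x2 by rewrite lexx.
have e2 : x1 <= x2 <= x2 by rewrite lexx x12.
have f1 : y1 <= y1 <= y2 by rewrite lexx.
have f2 : y1 <= y2 <= y2 by rewrite lexx y12.
do 2 (rewrite (cintB _ (holo_rect_hint hF _) (holo_rect_hint hG _))//).
do 2 (rewrite (cintB _ (holo_rect_vint hF _) (holo_rect_vint hG _))//).
ring.
Qed.

Lemma rectint_primitive F G (x1 x2 y1 y2 : R) : x1 <= x2 -> y1 <= y2 ->
  holo_rect F x1 x2 y1 y2 ->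
  (forall x y, x1 <= x <= x2 -> y1 <= y <= y2 -> cder G (x +i* y) (F (x +i* y))) ->
  rectint F x1 x2 y1 y2 = 0.
Proof.
move=> x12 y12 hF hG; rewrite /rectint.
have e1 : x1 <= x1 <= x2 by rewrite lexx.
have e2 : x1 <= x2 <= x2 by rewrite lexx x12.
have f1 : y1 <= y1 <= y2 by rewrite lexx.
have f2 : y1 <= y2 <= y2 by rewrite lexx y12.
have H y : y1 <= y <= y2 -> cint `[x1, x2] (fun x => F (x +i* y)) = G (x2 +i* y) - G (x1 +i* y).
  move=> yy; apply: (@cint_FTC _ (fun x => G (x +i* y))) => // x xx.
    by apply: rder_hline; exact: hG.
  by apply: ccont_hline; exact: hF.
have V x : x1 <= x <= x2 -> 'i * cint `[y1, y2] (fun y => F (x +i* y)) = G (x +i* y2) - G (x +i* y1).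
  move=> xx; rewrite -cintZ//; last by apply: (holo_rect_vint hF).
  apply: (@cint_FTC _ (fun y => G (x +i* y))) => // y yy.
    by rewrite mulrC; apply: rder_vline; exact: hG.
  apply: ccontM; first exact: ccont_cst.
  by apply: ccont_vline; exact: hF.
rewrite mulrBr !H// !V//; ring.
Qed.

Lemma cder_affine_sq (a b s : C) :
  cder (fun z => a * z + b / 2 * (z * z)) s (a + b * s).
Proof.
have -> : a + b * s = (0 * s + a * 1) + (0 * (s * s) + b / 2 * (1 * s + s * 1)) by field.
apply: cderD; apply: cderM; try exact: cder_cst; first exact: cder_id.
by apply: cderM; exact: cder_id.
Qed.

Lemma cder_affine (a b s : C) : cder (fun z => a + b * z) s b.
Proof.
have {2}-> : b = 0 + (0 * s + b * 1) by ring.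
apply: cderD; first exact: cder_cst.
by apply: cderM; [exact: cder_cst|exact: cder_id].
Qed.

Lemma rectint_affine (a b : C) (x1 x2 y1 y2 : R) : x1 <= x2 -> y1 <= y2 ->
  rectint (fun z => a + b * z) x1 x2 y1 y2 = 0.
Proof.
move=> x12 y12; apply: (@rectint_primitive _ (fun z => a * z + b / 2 * (z * z))) => //.
  by move=> x y _ _; exists b; exact: cder_affine.
by move=> x y _ _; exact: cder_affine_sq.
Qed.

Lemma rectint_bound F (x1 x2 y1 y2 M : R) : x1 <= x2 -> y1 <= y2 ->
  holo_rect F x1 x2 y1 y2 ->
  (forall x y, x1 <= x <= x2 -> y1 <= y <= y2 -> normc (F (x +i* y)) <= M) ->
  normc (rectint F x1 x2 y1 y2) <= M * (2 * (x2 - x1) + 2 * (y2 - y1)).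
Proof.
move=> x12 y12 hF FM; rewrite /rectint.
have e1 : x1 <= x1 <= x2 by rewrite lexx.
have e2 : x1 <= x2 <= x2 by rewrite lexx x12.
have f1 : y1 <= y1 <= y2 by rewrite lexx.
have f2 : y1 <= y2 <= y2 by rewrite lexx y12.
have H y : y1 <= y <= y2 -> normc (cint `[x1, x2] (fun x => F (x +i* y))) <= M * (x2 - x1).
  move=> yy; apply: cint_bound => //; first exact: (holo_rect_hint hF).
  by move=> x xx; exact: FM.
have V x : x1 <= x <= x2 -> normc (cint `[y1, y2] (fun y => F (x +i* y))) <= M * (y2 - y1).
  move=> yy; apply: cint_bound => //; first exact: (holo_rect_vint hF).
  by move=> y xx; exact: FM.
apply: le_trans (le_normcD _ _) _; rewrite normcM normc_i mul1r.
apply: le_trans (lerD (le_normcB _ _) (le_normcB _ _)) _.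
have := H _ f1; have := H _ f2; have := V _ e1; have := V _ e2; lra.
Qed.

(** The affine approximation at p has a primitive and integrates to 0. The remainder is at most [e]
    times the half perimeter, on a contour of twice that length. *)
Lemma goursat_local F p l (e d x1 x2 y1 y2 : R) : x1 <= x2 -> y1 <= y2 ->
  holo_rect F x1 x2 y1 y2 -> 0 < e ->
  x1 <= complex.Re p <= x2 -> y1 <= complex.Im p <= y2 ->
  (forall h, normc h < d -> normc (F (p + h) - F p - l * h) <= e * normc h) ->
  (x2 - x1) + (y2 - y1) < d ->
  normc (rectint F x1 x2 y1 y2) <= 2 * e * ((x2 - x1) + (y2 - y1)) ^+ 2.
Proof.
move=> x12 y12 hF e0 px py Hl dd.
pose A := fun z => (F p - l * p) + l * z.
have hA : holo_rect A x1 x2 y1 y2 by move=> x y _ _; exists l; exact: cder_affine.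
have -> : rectint F x1 x2 y1 y2 = rectint (fun z => F z - A z) x1 x2 y1 y2.
  by rewrite rectintB// rectint_affine// subr0.
apply: le_trans (@rectint_bound _ _ _ _ _ (e * ((x2 - x1) + (y2 - y1))) x12 y12 _ _) _.
- move=> x y xx yy; have [a ha] := hF x y xx yy; exists (a - l).
  by apply: cderB => //; exact: cder_affine.
- move=> x y xx yy; set z := x +i* y.
  have nz : normc (z - p) <= (x2 - x1) + (y2 - y1).
    apply: le_trans (normc_le _) _; rewrite cReD cImD cReN cImN /=.
    move: xx yy px py => /andP[? ?] /andP[? ?] /andP[? ?] /andP[? ?].
    by apply: lerD; rewrite ler_norml; apply/andP; split; lra.
  have := Hl (z - p) (le_lt_trans nz dd).
  have -> : p + (z - p) = z by ring.
  have -> : F z - F p - l * (z - p) = F z - A z by rewrite /A; ring.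
  move=> h; apply: le_trans h _; by rewrite ler_pM2l.
- rewrite le_eqVlt; apply/orP; left; apply/eqP; ring.
Qed.

Theorem goursat F (x1 x2 y1 y2 : R) : x1 <= x2 -> y1 <= y2 ->
  holo_rect F x1 x2 y1 y2 -> rectint F x1 x2 y1 y2 = 0.
Proof.
move=> x12 y12 hF; apply/eqP; rewrite -normc_eq0; apply: contrapT => /negP n0.
have N0 : 0 < normc (rectint F x1 x2 y1 y2) by rewrite lt_neqAle eq_sym n0 normc_ge0.
pose w := x2 - x1; pose h := y2 - y1.
have w0 : 0 <= w by rewrite subr_ge0.
have h0 : 0 <= h by rewrite subr_ge0.
(* Small enough for the whole rectangle to be [bad] below; the + 1 covers a degenerate rectangle. *)
pose e := normc (rectint F x1 x2 y1 y2) / (2 * ((w + h) ^+ 2 + 1)).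
have D0 : 0 < 2 * ((w + h) ^+ 2 + 1).
  by rewrite mulr_gt0// ltr_wpDl// sqr_ge0.
have e0 : 0 < e by rewrite divr_gt0.
pose W n : R := w / 2 ^+ n; pose H n : R := h / 2 ^+ n.
have p2 n : 0 < 2 ^+ n :> R by rewrite exprn_gt0.
have WS n : W n = W n.+1 + W n.+1 by rewrite /W exprS; field; rewrite lt0r_neq0.
have HS n : H n = H n.+1 + H n.+1 by rewrite /H exprS; field; rewrite lt0r_neq0.
have W0 n : 0 <= W n by rewrite divr_ge0// ltW.
have H0 n : 0 <= H n by rewrite divr_ge0// ltW.
pose inside n (p : R * R) := [/\ x1 <= p.1, p.1 + W n <= x2, y1 <= p.2 & p.2 + H n <= y2].
(* The threshold drops by a factor 4 at each bisection, so one of the four quarters of a bad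
   rectangle is again bad. *)
pose bad n (p : R * R) := inside n p /\
  e * (W n + H n) ^+ 2 < normc (rectint F p.1 (p.1 + W n) p.2 (p.2 + H n)).
have step n p : exists p', bad n p -> [/\ bad n.+1 p', p.1 <= p'.1,
    p'.1 + W n.+1 <= p.1 + W n, p.2 <= p'.2 & p'.2 + H n.+1 <= p.2 + H n].
  have [[[i1 i2 i3 i4] bp]|nb] := pselect (bad n p); last by exists p.
  case: p i1 i2 i3 i4 bp => x y /= i1 i2 i3 i4 bp.
  have hr : holo_rect F x (x + W n) y (y + H n) by exact: holo_rect_sub hF _ _ _ _.
  have wn := WS n; have hn := HS n; have wp := W0 n.+1; have hp := H0 n.+1.
  set x' := x + W n.+1; set y' := y + H n.+1.
  have ex : x' + W n.+1 = x + W n by rewrite /x' wn addrA.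
  have ey : y' + H n.+1 = y + H n by rewrite /y' hn addrA.
  have xx' : x <= x' by rewrite lerDl.
  have x'x : x' <= x + W n by rewrite -ex lerDl.
  have yy' : y <= y' by rewrite lerDl.
  have y'y : y' <= y + H n by rewrite -ey lerDl.
  have : rectint F x (x + W n) y (y + H n) =
      rectint F x x' y y' + rectint F x x' y' (y + H n)
    + (rectint F x' (x + W n) y y' + rectint F x' (x + W n) y' (y + H n)).
    rewrite (@rectint_splitx F x x')//; [|by rewrite xx'|by rewrite lerDl].
    by congr (_ + _); apply: rectint_splity; rewrite ?yy'//;
      apply: holo_rect_sub hr _ _ _ _ => //; rewrite lerDl.
  move=> E.
  have [/asboolP Q|/asboolPn Q] := boolP `[< exists p', p' \in [:: (x, y); (x, y'); (x', y); (x', y')] /\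
      e * (W n.+1 + H n.+1) ^+ 2 < normc (rectint F p'.1 (p'.1 + W n.+1) p'.2 (p'.2 + H n.+1)) >].
    case: Q => p' [pin pb]; exists p' => _.
    have [a1 a2 a3 a4] : [/\ x <= p'.1, p'.1 + W n.+1 <= x + W n, y <= p'.2
        & p'.2 + H n.+1 <= y + H n].
      by move: pin; rewrite !inE => /or4P[] /eqP -> /=; rewrite ?ex ?ey ?lexx;
        split=> //; rewrite -/x' -/y'.
    split=> //; split=> //; split.
    - exact: le_trans i1 a1.
    - exact: le_trans a2 i2.
    - exact: le_trans i3 a3.
    - exact: le_trans a4 i4.
  exfalso; have Q' p' : p' \in [:: (x, y); (x, y'); (x', y); (x', y')] ->
      normc (rectint F p'.1 (p'.1 + W n.+1) p'.2 (p'.2 + H n.+1)) <= e * (W n.+1 + H n.+1) ^+ 2.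
    by move=> pin; rewrite leNgt; apply/negP => pb; apply: Q; exists p'.
  have q1 := Q' (x, y); have q2 := Q' (x, y'); have q3 := Q' (x', y); have q4 := Q' (x', y').
  move: q1 q2 q3 q4; rewrite !inE !eqxx ?orbT /= -/x' -/y' ex ey => /(_ isT) q1 /(_ isT) q2 /(_ isT) q3 /(_ isT) q4.
  move: bp; rewrite E; apply/negP; rewrite -leNgt.
  apply: le_trans (le_normcD _ _) _.
  apply: le_trans (lerD (le_normcD _ _) (le_normcD _ _)) _.
  have -> : e * (W n + H n) ^+ 2 = e * (W n.+1 + H n.+1) ^+ 2 + e * (W n.+1 + H n.+1) ^+ 2 +
    (e * (W n.+1 + H n.+1) ^+ 2 + e * (W n.+1 + H n.+1) ^+ 2) by rewrite wn hn; ring.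
  by rewrite !lerD.
have /choice[f Hf] : forall np : nat * (R * R), exists p', bad np.1 np.2 ->
    [/\ bad np.1.+1 p', np.2.1 <= p'.1, p'.1 + W np.1.+1 <= np.2.1 + W np.1,
     np.2.2 <= p'.2 & p'.2 + H np.1.+1 <= np.2.2 + H np.1].
  by move=> [n p]; exact: step.
pose u := fix u n := if n is n'.+1 then f (n', u n') else (x1, y1).
have bu n : bad n (u n).
  elim: n => [|n /(Hf (n, _))[]//].
  have E0 : W 0%N = w /\ H 0%N = h by rewrite /W /H expr0 !divr1.
  rewrite /bad /inside /= !E0.1 !E0.2 /w /h !lexx; split.
    by split=> //; rewrite addrCA subrr addr0.
  have -> : x1 + (x2 - x1) = x2 by ring.
  have -> : y1 + (y2 - y1) = y2 by ring.
  rewrite /e -/w -/h mulrAC ltr_pdivrMr//; have := sqr_ge0 (w + h); nra.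
have mono n m : (n <= m)%N -> [/\ (u n).1 <= (u m).1, (u m).1 + W m <= (u n).1 + W n,
    (u n).2 <= (u m).2 & (u m).2 + H m <= (u n).2 + H n].
  elim: m => [|m IH]; first by rewrite leqn0 => /eqP ->.
  rewrite leq_eqVlt => /predU1P[->//|/IH[a1 a2 a3 a4]].
  have [_ b1 b2 b3 b4] := Hf (m, u m) (bu m); split; rewrite [u m.+1]/= ; move: b1 b2 b3 b4 => /=; lra.
(* The lower left corners increase and stay below the upper and right edges of every rectangle of
   the nest, so the suprema give a point common to all. *)
pose px := sup (range (fun n => (u n).1)); pose py := sup (range (fun n => (u n).2)).
have hx n m : (u m).1 <= (u n).1 + W n.
  have [a1 _ _ _] := mono _ _ (leq_maxl n m); have [b1 _ _ _] := mono _ _ (leq_maxr n m).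
  have [_ a2 _ _] := mono _ _ (leq_maxl n m); have := W0 (maxn n m); lra.
have hy n m : (u m).2 <= (u n).2 + H n.
  have [_ _ b1 _] := mono _ _ (leq_maxr n m).
  have [_ _ _ a2] := mono _ _ (leq_maxl n m); have := H0 (maxn n m); lra.
have ipx n : (u n).1 <= px <= (u n).1 + W n.
  apply/andP; split.
    apply: ub_le_sup; last by exists n.
    by exists ((u 0%N).1 + W 0%N) => _ [m _ <-].
  by apply: ge_sup; [exists (u 0%N).1; exists 0%N|move=> _ [m _ <-]].
have ipy n : (u n).2 <= py <= (u n).2 + H n.
  apply/andP; split.
    apply: ub_le_sup; last by exists n.
    by exists ((u 0%N).2 + H 0%N) => _ [m _ <-].
  by apply: ge_sup; [exists (u 0%N).2; exists 0%N|move=> _ [m _ <-]].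
have [l Hl] : holo F (px +i* py).
  have [[b1 b2 b3 b4] _] := bu 0%N; have := ipx 0%N; have := ipy 0%N.
  by move=> /andP[? ?] /andP[? ?]; apply: hF; apply/andP; split; lra.
(* Half of [e], because the local estimate carries a factor 2. *)
have [d d0 Hd] := Hl (e / 2) (divr_gt0 e0 (ltr0Sn _ 1)).
have [n Hn] : exists n, W n + H n < d.
  have wh : 0 <= w + h by rewrite addr_ge0.
  exists (Num.bound ((w + h) / d)).
  rewrite /W /H -mulrDl ltr_pdivrMr//.
  have := archi_boundP (divr_ge0 wh (ltW d0)); rewrite ltr_pdivrMr// => /lt_le_trans; apply.
  rewrite mulrC ler_pM2l// -natrX ler_nat; exact/ltnW/ltn_expl.
have [[b1 b2 b3 b4] bn] := bu n.
have := @goursat_local F (px +i* py) l (e / 2) d (u n).1 ((u n).1 + W n) (u n).2 ((u n).2 + H n).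
have -> : (u n).1 + W n - (u n).1 = W n by ring.
have -> : (u n).2 + H n - (u n).2 = H n by ring.
have -> : 2 * (e / 2) = e by field.
move=> /(_ _ _ _ _ (ipx n) (ipy n) Hd Hn) HH.
have : normc (rectint F (u n).1 ((u n).1 + W n) (u n).2 ((u n).2 + H n)) <= e * (W n + H n) ^+ 2.
  apply: HH; rewrite ?lerDl ?W0 ?H0//; last by rewrite divr_gt0.
  exact: holo_rect_sub hF _ _ _ _.
by rewrite leNgt bn.
Qed.

End goursat.
Arguments rectint : simpl never.

(** * The complex exponential and circle integrals *)

Section complex_exp.
Variable R : realType.
Local Notation C := (R[i]^o).
Implicit Types (s z w : C) (x y t : R).

Definition cis t : C := cos t +i* sin t.
Definition expc z : C := (expR (complex.Re z))%:C * cis (complex.Im z).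

Lemma cis0 : cis 0 = 1.
Proof. by rewrite /cis cos0 sin0. Qed.

Lemma cisD x y : cis (x + y) = cis x * cis y.
Proof. by apply: eq_ReIm => /=; rewrite ?cosD ?sinD; ring. Qed.

Lemma normc_cis t : normc (cis t) = 1.
Proof.
apply/eqP; rewrite -(@eqrXn2 _ 2)// ?normc_ge0// normc_sqr /= expr1n.
by rewrite cos2Dsin2.
Qed.

Lemma cis_neq0 t : cis t != 0.
Proof. by rewrite -normc_gt0 normc_cis. Qed.

Lemma cis_conj t : (cis t)^* = cis (- t).
Proof. by rewrite /cis cosN sinN. Qed.

Lemma cisN t : cis (- t) = (cis t)^-1.
Proof.
apply: (mulfI (cis_neq0 t)); rewrite -cisD subrr cis0 divff//; exact: cis_neq0.
Qed.

Lemma cis_2pi : cis (2 * pi) = 1.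
Proof. by rewrite /cis mulrC mulr_natr cos2pi sin2pi. Qed.

Lemma expc0 : expc 0 = 1.
Proof. by rewrite /expc /= expR0 cis0 mulr1. Qed.

Lemma expcD z w : expc (z + w) = expc z * expc w.
Proof. by rewrite /expc cReD cImD expRD cisD rmorphM /=; ring. Qed.

Lemma normc_expc z : normc (expc z) = expR (complex.Re z).
Proof. by rewrite normcM normc_real normc_cis mulr1 ger0_norm// expR_ge0. Qed.

Lemma expc_ln x t : 0 < x -> expc (ln x +i* t) = x%:C * cis t.
Proof. by move=> x0; rewrite /expc /= lnK. Qed.

Lemma rpowCE x s : rpowC x s = expc (s * (ln x)%:C).
Proof. by case: s => a b; rewrite /rpowC /expc /cis /= !mulr0 subr0 add0r. Qed.

Lemma rder_cis t : rder cis t ('i * cis t).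
Proof.
split; rewrite /= ?mul0r ?mul1r ?add0r ?sub0r.
  by rewrite (_ : _ \o _ = cos)//; exact: is_derive_cos.
by rewrite (_ : _ \o _ = sin)//; exact: is_derive_sin.
Qed.

Lemma cder_expc0 : cder expc 0 1.
Proof.
(* The three error terms add up to at most 6 q |h|, so e / 8 suffices; q <= 1 serves to bound the
   real exponential by 3. *)
move=> e e0; pose q := Num.min 1 (e / 8).
have q0 : 0 < q by rewrite lt_min ltr01 divr_gt0.
have [d1 d10 H1] := (is_deriveRP _ _ _).1 (is_derive_expR (0 : R)) _ q0.
have [d2 d20 H2] := (rderP _ _ _).1 (rder_cis 0) _ q0.
have dd : 0 < Num.min d1 (Num.min d2 q) by rewrite !lt_min d10 d20 ltr01 divr_gt0.
exists (Num.min d1 (Num.min d2 q)) => // h; rewrite !lt_min => /and3P[n1 n2 n3].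
set a := complex.Re h; set b := complex.Im h.
have an : `|a| <= normc h by exact: le_Re_normc.
have bn : `|b| <= normc h by exact: le_Im_normc.
have := H1 a (le_lt_trans an n1); rewrite add0r expR0 mul1r => h1.
have := H2 b (le_lt_trans bn n2); rewrite add0r cis0 mulr1 => h2.
have q1 : q <= 1 by rewrite ge_min lexx.
have q8 : q <= e / 8 by rewrite ge_min lexx orbT.
have hE : h = a%:C + 'i * b%:C by exact: complexE.
rewrite add0r expc0 mul1r.
have -> : expc h - 1 - h = (expR a)%:C * (cis b - 1 - 'i * b%:C) +
   (expR a - 1)%:C * ('i * b%:C) + (expR a - 1 - a)%:C.
  rewrite /expc -/a -/b [X in _ - X]hE !rmorphB /=; ring.
have ea : `|expR a - 1| <= 2 * normc h.
  have -> : expR a - 1 = (expR a - 1 - a) + a by ring.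
  apply: le_trans (ler_normD _ _) _.
  have := normr_ge0 a; nra.
have ea2 : `|expR a| <= 3.
  have -> : expR a = (expR a - 1) + 1 by ring.
  apply: le_trans (ler_normD _ _) _; rewrite normr1; lra.
apply: le_trans (le_normcD _ _) _; rewrite normc_real.
apply: le_trans (lerD (le_normcD _ _) (lexx _)) _.
rewrite !normcM !normc_real normc_i mul1r.
have nh := normc_ge0 h; have nb := normr_ge0 b; have na := normr_ge0 a.
have A1 : `|expR a| * normc (cis b - 1 - 'i * b%:C) <= 3 * (q * normc h).
  apply: ler_pM => //; first exact: normc_ge0.
  by apply: le_trans h2 _; rewrite ler_pM2l.
have A2 : `|expR a - 1| * `|b| <= 2 * normc h * normc h by apply: ler_pM.
have A3 : `|expR a - 1 - a| <= q * normc h.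
  by apply: le_trans h1 _; rewrite ler_pM2l.
have A4 : normc h * normc h <= q * normc h.
  rewrite ler_wpM2r// /q le_min; by move: n3 => /andP[/ltW-> /ltW->].
have A5 : q * normc h <= e / 8 * normc h by rewrite ler_wpM2r.
have A6 : 0 <= e * normc h by rewrite mulr_ge0// ltW.
lra.
Qed.

Lemma cder_expc z : cder expc z (expc z).
Proof.
(* The addition formula exp w = exp z exp (w - z) moves the derivative to the point 0. *)
have E : (fun w => expc z * (expc \o (fun w => - z + 1 * w)) w) = expc.
  apply/funext => w /=; rewrite -expcD; congr expc; ring.
rewrite -{1}E.
have {2}-> : expc z = 0 * (expc \o (fun w => - z + 1 * w)) z + expc z * (1 * 1).
  by rewrite mul0r add0r !mulr1.
apply: cderM; first exact: cder_cst.
apply: cder_comp; first exact: cder_affine.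
by rewrite mul1r addNr; exact: cder_expc0.
Qed.

Lemma holo_expc z : holo expc z.
Proof. by exists (expc z); exact: cder_expc. Qed.

End complex_exp.

(** * Closure rules for holomorphy at a point *)

Section holo_rules.
Variable R : realType.
Local Notation C := (R[i]^o).
Implicit Types (f g : C -> C) (s z w : C).

Lemma holo_cst (c : C) s : holo (fun=> c) s.
Proof. by exists 0; exact: cder_cst. Qed.
Lemma holo_id s : holo id s.
Proof. by exists 1; exact: cder_id. Qed.
Lemma holo_affine (a b : C) s : holo (fun z => a + b * z) s.
Proof. by exists b; exact: cder_affine. Qed.
Lemma holo_shift (a : C) s : holo (fun z => z - a) s.
Proof. by exists (1 - 0); apply: cderB; [exact: cder_id|exact: cder_cst]. Qed.
Lemma holoD f g s : holo f s -> holo g s -> holo (fun z => f z + g z) s.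
Proof. by move=> [a ?] [b ?]; exists (a + b); exact: cderD. Qed.
Lemma holoN f s : holo f s -> holo (fun z => - f z) s.
Proof. by move=> [a ?]; exists (- a); exact: cderN. Qed.
Lemma holoB f g s : holo f s -> holo g s -> holo (fun z => f z - g z) s.
Proof. by move=> [a ?] [b ?]; exists (a - b); exact: cderB. Qed.
Lemma holoM f g s : holo f s -> holo g s -> holo (fun z => f z * g z) s.
Proof. by move=> [a ha] [b hb]; eexists; exact: (cderM ha hb). Qed.
Lemma holoV f s : holo f s -> f s != 0 -> holo (fun z => (f z)^-1) s.
Proof. by move=> [a ha] fs; eexists; exact: (cderV ha fs). Qed.
Lemma holo_div f g s : holo f s -> holo g s -> g s != 0 -> holo (fun z => f z / g z) s.
Proof. by move=> ? ? ?; apply: holoM => //; exact: holoV. Qed.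
Lemma holo_comp f g s : holo f s -> holo g (f s) -> holo (g \o f) s.
Proof. by move=> [a ha] [b hb]; eexists; exact: (cder_comp ha hb). Qed.
Lemma holo_near f g s : (\forall w \near s, f w = g w) -> holo f s -> holo g s.
Proof. by move=> fg [a ?]; exists a; exact: cder_near fg _. Qed.
Lemma holoX f n s : holo f s -> holo (fun z => f z ^+ n) s.
Proof.
move=> h; elim: n => [|n IH].
  by rewrite (_ : (fun z => _) = (fun=> 1)); [exact: holo_cst|apply/funext => z; rewrite expr0].
rewrite (_ : (fun z => _) = (fun z => f z * f z ^+ n)); first exact: holoM.
by apply/funext => z; rewrite exprS.
Qed.
Lemma holo_prod (I : Type) (r : seq I) (F : I -> C -> C) s :
  (forall i, holo (F i) s) -> holo (fun z => \prod_(i <- r) F i z) s.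
Proof.
move=> h; elim: r => [|i r IH].
  by rewrite (_ : (fun z => _) = (fun=> 1)); [exact: holo_cst|apply/funext => z; rewrite big_nil].
rewrite (_ : (fun z => _) = (fun z => F i z * \prod_(j <- r) F j z)); first exact: holoM.
by apply/funext => z; rewrite big_cons.
Qed.
Lemma holo_sum (I : Type) (r : seq I) (F : I -> C -> C) s :
  (forall i, holo (F i) s) -> holo (fun z => \sum_(i <- r) F i z) s.
Proof.
move=> h; elim: r => [|i r IH].
  by rewrite (_ : (fun z => _) = (fun=> 0)); [exact: holo_cst|apply/funext => z; rewrite big_nil].
rewrite (_ : (fun z => _) = (fun z => F i z + \sum_(j <- r) F j z)); first exact: holoD.
by apply/funext => z; rewrite big_cons.
Qed.

Lemma holo_cont f s : holo f s -> forall e : R, 0 < e ->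
  exists2 d : R, 0 < d & forall w, normc (w - s) < d -> normc (f w - f s) < e.
Proof. by move=> [l h]; exact: cder_cont h. Qed.

Lemma holo_near_neq0 f s : holo f s -> f s != 0 -> \forall w \near s, f w != 0.
Proof.
move=> h f0; apply/nbhsC; have [|d d0 H] := holo_cont h (e := normc (f s)).
  by rewrite normc_gt0.
exists d => // w /H; apply: contraTneq => ->.
by rewrite sub0r normcN ltxx.
Qed.

End holo_rules.

(** * Mean values and Cauchy's formula on circles *)

Section circle.
Variable R : realType.
Local Notation C := (R[i]^o).
Implicit Types (f g k : C -> C) (s z w : C) (r : R).

Lemma pi2_ge0 : 0 <= 2 * pi :> R.
Proof. by rewrite mulr_ge0// pi_ge0. Qed.

Lemma normc_circle r t : 0 <= r -> normc (r%:C * cis t : C) = r.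
Proof. by move=> r0; rewrite normcM normc_real normc_cis mulr1 ger0_norm. Qed.

Lemma ccont_circle s r t : ccont (fun t => s + r%:C * cis t) t.
Proof.
apply: ccontD; first exact: ccont_cst.
by apply: ccontM; [exact: ccont_cst|exact: rder_cont (rder_cis t)].
Qed.

Lemma circle_int k s r : 0 <= r -> (forall w, normc (w - s) = r -> holo k w) ->
  cintegrable `[0, 2 * pi] (fun t => k (s + r%:C * cis t)).
Proof.
move=> r0 h; apply: ccont_cintegrable => t _.
apply: (@cder_ccont _ k (fun t => s + r%:C * cis t)); last exact: ccont_circle.
by apply: h; rewrite addrC addKr normc_circle.
Qed.

(** Goursat's theorem for k(s + exp) on [ln r1, ln r2] x [0, 2 pi]: the horizontal sides cancel by
    periodicity of exp, and the vertical sides are the two circles. *)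
Lemma circle_invariant k s (r1 r2 : R) : 0 < r1 -> r1 <= r2 ->
  (forall w, r1 <= normc (w - s) <= r2 -> holo k w) ->
  cint `[0, 2 * pi] (fun t => k (s + r1%:C * cis t)) =
  cint `[0, 2 * pi] (fun t => k (s + r2%:C * cis t)).
Proof.
move=> r10 r12 hk; pose K := k \o (fun w => s + expc w).
have r20 : 0 < r2 by exact: lt_le_trans r12.
have l12 : ln r1 <= ln r2 by rewrite ler_ln.
have := @goursat _ K (ln r1) (ln r2) 0 (2 * pi) l12 pi2_ge0.
have hK : holo_rect K (ln r1) (ln r2) 0 (2 * pi).
  move=> x y /andP[x1 x2] _; apply: holo_comp.
    by apply: holoD; [exact: holo_cst|exact: holo_expc].
  apply: hk; rewrite addrC addKr normc_expc /=.
  by rewrite -[X in X <= _]lnK// -[X in _ <= _ <= X]lnK// !ler_expR x1 x2.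
move=> /(_ hK); rewrite /rectint.
have -> : cint `[ln r1, ln r2] (fun x => K (x +i* 0)) =
  cint `[ln r1, ln r2] (fun x => K (x +i* (2 * pi))).
  by apply: eq_cint => x _; rewrite /K /= /expc /= cis_2pi cis0.
rewrite subrr add0r => /eqP; rewrite mulf_eq0 subr_eq0 => /orP[|/eqP].
  by rewrite eq_complex /= oner_eq0 andbF.
have E r : 0 < r -> cint `[0, 2 * pi] (fun y => K (ln r +i* y)) =
    cint `[0, 2 * pi] (fun t => k (s + r%:C * cis t)).
  by move=> r0; apply: eq_cint => t _; rewrite /K /= expc_ln.
by rewrite !E.
Qed.

(** Shrinking the circle leaves the integral unchanged, so at the centre continuity is enough. This
    is what allows an application to difference quotients, whose singularity is not yet known to be
    removable. *)
Lemma circle_mean k s r : 0 < r ->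
  (forall w, 0 < normc (w - s) <= r -> holo k w) ->
  (forall e : R, 0 < e -> exists2 d : R, 0 < d &
     forall w, normc (w - s) < d -> normc (k w - k s) < e) ->
  cint `[0, 2 * pi] (fun t => k (s + r%:C * cis t)) = (2 * pi)%:C * k s.
Proof.
move=> r0 hk ck; apply/eqP; rewrite -subr_eq0 -normc_eq0 eq_le normc_ge0 andbT.
apply/ler_addgt0Pr => e e0; rewrite add0r.
have p0 : 0 < 2 * pi :> R by rewrite mulr_gt0// pi_gt0.
have [d d0 Hd] := ck (e / (2 * pi)) (divr_gt0 e0 p0).
pose r1 := Num.min r (d / 2).
have r10 : 0 < r1 by rewrite lt_min r0 divr_gt0.
have r1r : r1 <= r by rewrite ge_min lexx.
have r1d : r1 < d by rewrite /r1 gt_min orbC ltr_pdivrMr// ltr_pMr// ltr1n.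
rewrite -(@circle_invariant k s r1 r)//; last first.
  by move=> w /andP[w1 w2]; apply: hk; rewrite w2 (lt_le_trans r10).
have -> : (2 * pi)%:C * k s = cint `[0, 2 * pi] (fun=> k s).
  by rewrite cint_cst ?pi2_ge0// subr0 mulrC.
have ic : cintegrable `[0, 2 * pi] (fun=> k s).
  by apply: ccont_cintegrable => *; exact: ccont_cst.
have ik : cintegrable `[0, 2 * pi] (fun t => k (s + r1%:C * cis t)).
  by apply: circle_int; [exact: ltW|move=> w E; apply: hk; rewrite E r10].
rewrite -cintB//; apply: le_trans (@cint_bound _ _ _ _ (e / (2 * pi)) pi2_ge0 _ _) _.
- have := cintegrableD (measurable_itv _) ik (cintegrableN (measurable_itv _) ic).
  exact.
- by move=> t _; apply/ltW/Hd; rewrite addrC addKr normc_circle// ltW.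
- by rewrite subr0 divfK// gt_eqF.
Qed.

Lemma holo_circle_mean k s r : 0 < r -> (forall w, normc (w - s) <= r -> holo k w) ->
  cint `[0, 2 * pi] (fun t => k (s + r%:C * cis t)) = (2 * pi)%:C * k s.
Proof.
move=> r0 hk; apply: circle_mean => // [w /andP[_]|]; first exact: hk.
by apply: holo_cont; apply: hk; rewrite subrr normc0 ltW.
Qed.

Lemma cint_cisN : cint `[0, 2 * pi] (fun t => cis (- t)) = 0 :> C.
Proof.
pose G := fun t : R => 'i * cis (- t) : C.
have rc t : rder (fun t => cis (- t)) t (- ('i * cis (- t)) : C).
  have [h1 h2] := rder_cis (- t); split.
    rewrite (_ : _ \o _ = fun t => cos (- t)); last by [].
    have E : (fun t : R => cos (- t)) = cos by apply/funext => x; rewrite cosN.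
    rewrite E; apply: is_derive_eq (is_derive_cos t) _.
    by rewrite /= sinN; ring.
  rewrite (_ : _ \o _ = fun t => sin (- t)); last by [].
  have E : (fun t : R => sin (- t)) = - sin by apply/funext => x; rewrite sinN.
  rewrite E; apply: is_derive_eq (is_deriveN (is_derive_sin t)) _.
  by rewrite /= cosN; ring.
rewrite (@cint_FTC _ G)//; first by rewrite /G cisN cis_2pi oppr0 cis0 invr1 subrr.
- exact: pi2_ge0.
- move=> t _; have := @rder_comp _ (fun z => 0 + 'i * z) _ _ _ _ (cder_affine 0 'i _) (rc t).
  rewrite (_ : (fun z => _) \o _ = G); last by apply/funext => x; rewrite /= add0r.
  by rewrite mulrN mulrA -expr2 sqr_i mulN1r opprK.
- by move=> t _; exact: rder_cont (rc t).
Qed.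

(** When g vanishes at s this is the cofactor left after dividing one factor w - s out of g. *)
Definition dquot g s w := if w == s then derive1 g s else (g w - g s) / (w - s).

Lemma dquot_cont g s : holo g s -> forall e : R, 0 < e -> exists2 d : R, 0 < d &
     forall w, normc (w - s) < d -> normc (dquot g s w - dquot g s s) < e.
Proof.
move=> /holo_cder hg e e0; have [d d0 H] := hg (e / 2) (divr_gt0 e0 (ltr0Sn _ 1)).
exists d => // w wd; rewrite /dquot eqxx; have [_|ws] := eqVneq w s.
  by rewrite subrr normc0.
have ws0 : w - s != 0 by rewrite subr_eq0.
have := H _ wd; rewrite addrCA subrr addr0 => h.
have -> : (g w - g s) / (w - s) - derive1 g s = (g w - g s - derive1 g s * (w - s)) / (w - s).
  by field.
rewrite normcM normcV ltr_pdivrMr ?normc_gt0//; apply: le_lt_trans h _.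
by rewrite ltr_pM2r ?normc_gt0//; lra.
Qed.

Lemma dquot_holo g s w : holo g w -> w != s -> holo (dquot g s) w.
Proof.
move=> gw ws.
have : holo (fun w => (g w - g s) / (w - s)) w.
  apply: holo_div; [|exact: holo_shift|by rewrite subr_eq0].
  by apply: holoB => //; exact: holo_cst.
apply: holo_near; apply/nbhsC; exists (normc (w - s)); first by rewrite normc_gt0 subr_eq0.
move=> z zw; rewrite /dquot; case: eqVneq => // zs.
by move: zw; rewrite zs normcB ltxx.
Qed.

(** Cauchy's formula for the derivative, as the mean value of [dquot g s]; the constant g s
    disappears because [cis (- t)] has mean 0. *)
Lemma circle_derive g s r : 0 < r -> (forall w, normc (w - s) <= r -> holo g w) ->
  cint `[0, 2 * pi] (fun t => g (s + r%:C * cis t) * cis (- t)) =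
  (2 * pi * r)%:C * derive1 g s.
Proof.
move=> r0 hg.
have hs : holo g s by apply: hg; rewrite subrr normc0 ltW.
have : cint `[0, 2 * pi] (fun t => dquot g s (s + r%:C * cis t)) = (2 * pi)%:C * derive1 g s.
  rewrite circle_mean//; first by rewrite /dquot eqxx.
    move=> w /andP[w0 wr]; apply: dquot_holo; first exact: hg.
    by rewrite -subr_eq0 -normc_gt0.
  exact: dquot_cont.
have ig : cintegrable `[0, 2 * pi] (fun t => g (s + r%:C * cis t) * cis (- t)).
  apply: ccont_cintegrable => t _; apply: ccontM.
    apply: (@cder_ccont _ g (fun t => s + r%:C * cis t)); last exact: ccont_circle.
    by apply: hg; rewrite addrC addKr normc_circle// ltW.
  rewrite (_ : (fun t => _) = (fun t => (cis t)^-1)); last by apply/funext => x; rewrite cisN.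
  apply: (@cder_ccont _ (fun z => z^-1) (@cis R)); last exact: rder_cont (rder_cis t).
  by apply: holoV; [exact: holo_id|exact: cis_neq0].
have ic : cintegrable `[0, 2 * pi] (fun t => cis (- t) : C).
  apply: ccont_cintegrable => t _.
  rewrite (_ : (fun t => _) = (fun t => (cis t)^-1)); last by apply/funext => x; rewrite cisN.
  apply: (@cder_ccont _ (fun z => z^-1) (@cis R)); last exact: rder_cont (rder_cis t).
  by apply: holoV; [exact: holo_id|exact: cis_neq0].
have rC : r%:C != 0 :> C by rewrite eq_complex /= gt_eqF.
have -> : cint `[0, 2 * pi] (fun t => dquot g s (s + r%:C * cis t)) =
   r%:C^-1 * (cint `[0, 2 * pi] (fun t => g (s + r%:C * cis t) * cis (- t)) - g s * 0).
  rewrite -cint_cisN -[in RHS]cintZ// -cintB//; last exact: cintegrableZ.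
  rewrite -cintZ//; last first.
    exact: (cintegrableD (measurable_itv _) ig (cintegrableN (measurable_itv _) (cintegrableZ _ (measurable_itv _) ic))).
  apply: eq_cint => t _; rewrite /dquot.
  have -> : s + r%:C * cis t - s = r%:C * cis t by ring.
  rewrite ifF; last first.
    apply/negbTE; rewrite -subr_eq0 addrC addKr mulf_neq0//; exact: cis_neq0.
  by rewrite cisN; field; rewrite rC cis_neq0.
move=> E; rewrite rmorphM /= mulrAC -E; by field.
Qed.

(** The mean value property of g(w) (w - s), which vanishes at s. *)
Lemma circle_cis g s r : 0 < r -> (forall w, normc (w - s) <= r -> holo g w) ->
  cint `[0, 2 * pi] (fun t => g (s + r%:C * cis t) * cis t) = 0.
Proof.
move=> r0 hg; have := @holo_circle_mean (fun w => g w * (w - s)) s r r0.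
rewrite subrr mulr0 mulr0 => H.
have rC : r%:C != 0 :> C by rewrite eq_complex /= gt_eqF.
apply: (mulfI rC); rewrite mulr0 -cintZ//; last first.
  apply: ccont_cintegrable => t _; apply: ccontM; last exact: rder_cont (rder_cis t).
  apply: (@cder_ccont _ g (fun t => s + r%:C * cis t)); last exact: ccont_circle.
  by apply: hg; rewrite addrC addKr normc_circle// ltW.
rewrite -[RHS]H; last by move=> w /hg h; apply: holoM => //; exact: holo_shift.
by apply: eq_cint => t _; ring.
Qed.

Lemma cauchy_estimate g s r M : 0 < r -> (forall w, normc (w - s) <= r -> holo g w) ->
  (forall w, normc (w - s) <= r -> normc (g w) <= M) -> normc (derive1 g s) <= M / r.
Proof.
move=> r0 hg gM; have := circle_derive r0 hg.
have p0 : 0 < 2 * pi :> R by rewrite mulr_gt0// pi_gt0.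
move=> /(congr1 (@normc R)); rewrite normcM normc_real ger0_norm; last first.
  by rewrite mulr_ge0// ltW.
move=> E; rewrite ler_pdivlMr// -(ler_pM2l p0) mulrCA mulrC [_ * r]mulrC [r * _]mulrC -E.
have -> : 2 * pi * M = M * (2 * pi - 0) by rewrite subr0 mulrC.
apply: cint_bound; first exact: pi2_ge0.
  apply: ccont_cintegrable => t _; apply: ccontM.
    apply: (@cder_ccont _ g (fun t => s + r%:C * cis t)); last exact: ccont_circle.
    by apply: hg; rewrite addrC addKr normc_circle// ltW.
  rewrite (_ : (fun t => _) = (fun t => (cis t)^-1)); last by apply/funext => x; rewrite cisN.
  apply: (@cder_ccont _ (fun z => z^-1) (@cis R)); last exact: rder_cont (rder_cis t).
  by apply: holoV; [exact: holo_id|exact: cis_neq0].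
move=> t _; rewrite normcM normc_cis mulr1; apply: gM.
by rewrite addrC addKr normc_circle// ltW.
Qed.

End circle.

(** * Cauchy estimates, maximum modulus, identity theorem *)

Section holo_theory.
Variable R : realType.
Local Notation C := (R[i]^o).
Local Notation mu := (@lebesgue_measure R).
Implicit Types (f g k F : C -> C) (s z w c a : C) (r : R).

Lemma unit_rot (D : C) : exists2 u : C, normc u = 1 & u * D = (normc D)%:C.
Proof.
have [->|D0] := eqVneq D 0; first by exists 1; rewrite ?normc1// normc0 mulr0.
have nD : normc D != 0 by rewrite normc_eq0.
have nDC : (normc D)%:C != 0 :> C by rewrite eq_complex /= negb_and nD.
exists (D^* / (normc D)%:C).
  by rewrite normcM normcV normc_conj normc_real ger0_norm ?normc_ge0// divff.
rewrite mulrAC mulrC [_ * D]mulrC -sqr_normc absC_normc; by field.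
Qed.

(** Rotating the increment onto the positive real axis reduces the claim to the real mean value
    theorem. *)
Lemma rder_mvt (F f : R -> C) (x y M : R) : x <= y ->
  (forall t, x <= t <= y -> rder F t (f t)) ->
  (forall t, x <= t <= y -> normc (f t) <= M) -> normc (F y - F x) <= M * (y - x).
Proof.
rewrite le_eqVlt => /predU1P[<-|xy] dF fM; first by rewrite !subrr normc0 mulr0.
have [u u1 uD] := unit_rot (F y - F x).
have dF' t : x <= t <= y -> rder (fun t => 0 + u * F t) t (u * f t).
  by move=> /dF h; exact: (@rder_comp _ (fun z => 0 + u * z) _ _ _ _ (cder_affine 0 u _) h).
pose v := @complex.Re R \o (fun t => 0 + u * F t).
have [||t txy E] := @MVT _ v (fun t => complex.Re (u * f t)) x y xy.
- move=> t; rewrite in_itv /= => /andP[h1 h2]; apply: (dF' t _).1; by rewrite !ltW.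
- apply: continuous_in_subspaceT => t; rewrite inE /= in_itv /= => h.
  by have [] := rder_cont (dF' t h).
move: txy; rewrite in_itv /= => /andP[h1 h2].
have -> : normc (F y - F x) = v y - v x.
  rewrite /v /= -cReN -cReD.
  have -> : 0 + u * F y - (0 + u * F x) = u * (F y - F x) by ring.
  by rewrite uD.
rewrite E ler_pM2r ?subr_gt0//; apply: le_trans (ler_norm _) _.
apply: le_trans (le_Re_normc _) _; rewrite normcM u1 mul1r.
by apply: fM; rewrite !ltW.
Qed.

Lemma rder_segment g s (h : C) (t : R) l : cder g (s + h * t%:C) l ->
  rder (fun t => g (s + h * t%:C)) t (l * h).
Proof. by move=> hg; exact: (@rder_comp _ g (fun t => s + h * t%:C) _ _ _ hg (rder_affine _ _ _)). Qed.

Lemma holo_mvt g s (h : C) (M : R) :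
  (forall t : R, 0 <= t <= 1 -> holo g (s + h * t%:C)) ->
  (forall t : R, 0 <= t <= 1 -> normc (derive1 g (s + h * t%:C)) <= M) ->
  normc (g (s + h) - g s) <= M * normc h.
Proof.
move=> hg gM; have := @rder_mvt (fun t => g (s + h * t%:C)) (fun t => derive1 g (s + h * t%:C) * h) 0 1 (M * normc h) ler01.
rewrite subr0 !mulr1 mulr0 addr0; apply.
  by move=> t /hg ht; apply: rder_segment; exact: holo_cder.
by move=> t /gM ht; rewrite normcM ler_wpM2r// normc_ge0.
Qed.

Lemma segment_in_disc s (h : C) (t r : R) : 0 <= t <= 1 -> normc h < r ->
  normc (s + h * t%:C - s) < r.
Proof.
move=> /andP[t0 t1] hr; rewrite addrC addKr normcM normc_real ger0_norm//.
apply: le_lt_trans hr; by rewrite ler_piMr// normc_ge0.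
Qed.

(** Differentiation under the integral sign. Cauchy's estimate on a smaller disc bounds the
    derivatives in z uniformly in t, and hence dominates the difference quotients. *)
Lemma cint_param_holo (phi : C -> R -> C) s r (x y M : R) : 0 < r -> x <= y ->
  (forall z t, x <= t <= y -> normc (z - s) < r -> holo (phi ^~ t) z) ->
  (forall z t, x <= t <= y -> normc (z - s) < r -> normc (phi z t) <= M) ->
  (forall z, normc (z - s) < r -> cintegrable `[x, y] (phi z)) ->
  holo (fun z => cint `[x, y] (phi z)) s.
Proof.
move=> r0 xy hphi bphi iphi.
have r4 : 0 < r / 4 by rewrite divr_gt0.
pose B := M / (r / 4).
have dB z t : x <= t <= y -> normc (z - s) < r / 2 -> normc (derive1 (phi ^~ t) z) <= B.
  move=> txy zs.
  have zr w : normc (w - z) <= r / 4 -> normc (w - s) < r.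
    move=> wz; have -> : w - s = (w - z) + (z - s) by ring.
    apply: le_lt_trans (le_normcD _ _) _; lra.
  by apply: cauchy_estimate => // w /zr wr; [exact: hphi|exact: bphi].
pose l := cint `[x, y] (fun t => derive1 (phi ^~ t) s).
exists l => e e0; apply: contrapT => H.
(* If the candidate derivative fails, it fails at every scale 1 / (n + 1); the resulting sequence of
   increments tends to 0 and can be fed to dominated convergence. *)
have P n : exists h : C, [/\ normc h < r / 2, normc h < n.+1%:R^-1 &
   e * normc h < normc (cint `[x, y] (phi (s + h)) - cint `[x, y] (phi s) - l * h)].
  apply: contrapT => H1; apply: H.
  exists (Num.min (r / 2) n.+1%:R^-1).
    by rewrite lt_min invr_gt0 ltr0Sn divr_gt0.
  move=> h; rewrite lt_min => /andP[h1 h2]; rewrite leNgt; apply/negP => h3.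
  by apply: H1; exists h.
have /choice[h Hh] := P.
have h0 n : h n != 0.
  apply/eqP => E; have [_ _] := Hh n.
  by rewrite E addr0 subrr mulr0 subr0 normc0 mulr0 ltxx.
have sh n : normc (s + h n - s) < r.
  have [h1 _ _] := Hh n; rewrite addrC addKr; apply: lt_le_trans h1 _; lra.
have ss : normc (s - s) < r by rewrite subrr normc0.
pose q n t := (h n)^-1 * (phi (s + h n) t - phi s t).
have iq n : cintegrable `[x, y] (q n).
  apply: cintegrableZ => //; apply: cintegrableD => //; first exact: iphi.
  by apply: cintegrableN => //; exact: iphi.
have [| |_ cq] := @cdct _ `[x, y] q (fun t => derive1 (phi ^~ t) s) (fun=> B)
  (measurable_itv _) (fun n => cintegrable_meas (iq n)) (integrable_cst_itv _ _ _)
  _ _.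
- move=> n t; rewrite /= in_itv /= => txy; rewrite /q normcM normcV.
  rewrite mulrC ler_pdivrMr ?normc_gt0//.
  apply: (@holo_mvt (phi ^~ t)) => u u01.
    have [h1 _ _] := Hh n; apply: hphi => //; apply: segment_in_disc => //; lra.
  have [h1 _ _] := Hh n; apply: dB => //; exact: segment_in_disc.
- move=> t; rewrite /= in_itv /= => txy e1 e10.
  have [d d0 Hd] := holo_cder (hphi s t txy ss) (divr_gt0 e10 (ltr0Sn _ 1)).
  exists (Num.bound d^-1) => n Nn; have [_ h2 _] := Hh n.
  have hd : normc (h n) < d.
    apply: lt_trans h2 _; rewrite -[d]invrK ltf_pV2 ?posrE ?invr_gt0//.
    apply: lt_le_trans (archi_boundP _) _; first by rewrite invr_ge0 ltW.
    by rewrite ler_nat ltnW.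
  have := Hd _ hd; set L := derive1 _ _ => H3.
  have -> : q n t - L = (h n)^-1 * (phi (s + h n) t - phi s t - L * h n).
    by rewrite /q; field.
  rewrite normcM normcV mulrC ltr_pdivrMr ?normc_gt0//.
  apply: le_lt_trans H3 _; rewrite ltr_pM2r ?normc_gt0//; lra.
have [N /(_ N (leqnn _))] := cq e e0.
have [_ _ HN] := Hh N.
rewrite /q cintZ//; last first.
  apply: cintegrableD => //; first exact: iphi.
  by apply: cintegrableN => //; exact: iphi.
rewrite cintB//; [|exact: iphi|exact: iphi].
set D := cint _ _ - _; move: HN; rewrite -/D => HN.
have -> : (h N)^-1 * D - cint `[x, y] (fun t => derive1 (phi ^~ t) s) = (h N)^-1 * (D - l * h N).
  by rewrite /l; field.
rewrite normcM normcV mulrC ltr_pdivrMr ?normc_gt0// => /lt_trans/(_ HN).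
by rewrite ltxx.
Qed.

Definition holo_disc g c r := forall w, normc (w - c) < r -> holo g w.

Lemma holo_disc_near g c r w : holo_disc g c r -> normc (w - c) < r ->
  exists2 d : R, 0 < d & holo_disc g w d.
Proof.
move=> hg wr; exists (r - normc (w - c)); first by rewrite subr_gt0.
move=> z zw; apply: hg; have -> : z - c = (z - w) + (w - c) by ring.
by apply: le_lt_trans (le_normcD _ _) _; rewrite -ltrBrDr.
Qed.

(** Cauchy's formula on circles of fixed radius about a moving centre exhibits the derivative as an
    integral with a holomorphic parameter. *)
Lemma holo_derive g s r : 0 < r -> holo_disc g s r -> holo (derive1 g) s.
Proof.
move=> r0 hg; have hs : holo g s by apply: hg; rewrite subrr normc0.
have [d d0 Hd] := holo_cont hs ltr01.
pose p := Num.min r d / 2.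
have m0 : 0 < Num.min r d by rewrite lt_min r0.
have p0 : 0 < p by rewrite divr_gt0.
have pr : p + p <= r by rewrite /p -splitr ge_min lexx.
have pd : p + p <= d by rewrite /p -splitr ge_min lexx orbT.
have E z : normc (z - s) < p -> forall t, normc (z + p%:C * cis t - s) < p + p.
  move=> zp t; have -> : z + p%:C * cis t - s = (z - s) + p%:C * cis t by ring.
  by apply: le_lt_trans (le_normcD _ _) _; rewrite normc_circle ?ltW// ltrD2r.
pose K z := cint `[0, 2 * pi] (fun t => g (z + p%:C * cis t) * cis (- t)).
have hK : holo K s.
  apply: (@cint_param_holo _ s p 0 (2 * pi) (normc (g s) + 1) p0 (pi2_ge0 _)).
  - move=> z t _ zp; apply: holoM; last exact: holo_cst.
    apply: (@holo_comp _ (fun z => z + p%:C * cis t)).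
      by apply: holoD; [exact: holo_id|exact: holo_cst].
    apply: hg; exact: lt_le_trans (E z zp t) pr.
  - move=> z t _ zp; rewrite normcM normc_cis mulr1.
    have := Hd _ (lt_le_trans (E z zp t) pd).
    have -> : g (z + p%:C * cis t) = g (z + p%:C * cis t) - g s + g s by rewrite subrK.
    move=> h; apply: le_trans (le_normcD _ _) _; rewrite addrC lerD2l ltW//.
    by move: h; rewrite addrK.
  - move=> z zp; apply: ccont_cintegrable => t _; apply: ccontM.
      apply: (@cder_ccont _ g (fun t => z + p%:C * cis t)); last exact: ccont_circle.
      apply: hg; exact: lt_le_trans (E z zp t) pr.
    rewrite (_ : (fun t => _) = (fun t => (cis t)^-1)); last by apply/funext => x; rewrite cisN.
    apply: (@cder_ccont _ (fun z => z^-1) (@cis R)); last exact: rder_cont (rder_cis t).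
    by apply: holoV; [exact: holo_id|exact: cis_neq0].
have hK' : holo (fun z => (2 * pi * p)%:C^-1 * K z) s.
  by apply: holoM => //; exact: holo_cst.
apply: holo_near hK'; apply/nbhsC; exists p => // z zp.
rewrite /K circle_derive//.
  have q0 : (2 * pi * p)%:C != 0 :> C.
    by rewrite eq_complex /= negb_and gt_eqF// !mulr_gt0// pi_gt0.
  by rewrite mulKf.
move=> w wz; apply: hg; apply: lt_le_trans pr; have -> : w - s = (w - z) + (z - s) by ring.
by apply: le_lt_trans (le_normcD _ _) _; rewrite ler_ltD.
Qed.

Lemma holo_disc_derive g c r : holo_disc g c r -> holo_disc (derive1 g) c r.
Proof.
move=> hg w wr; have [d d0 hd] := holo_disc_near hg wr; exact: holo_derive hd.
Qed.

(** The singularity is removable: the quotient equals the integral over [0, 1] of g'(s + t (z - s)),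
    which is holomorphic in the parameter z. *)
Lemma dquot_holo_center g s r : 0 < r -> holo_disc g s r -> holo (dquot g s) s.
Proof.
move=> r0 hg; have hs := holo_derive r0 hg.
have [d d0 Hd] := holo_cont hs ltr01.
pose p := Num.min r d; have p0 : 0 < p by rewrite lt_min r0.
have pr : p <= r by rewrite ge_min lexx.
have pd : p <= d by rewrite ge_min lexx orbT.
pose K z := cint `[0, 1] (fun t => derive1 g (s + (z - s) * t%:C)).
have ic z : normc (z - s) < p -> forall t, 0 <= t <= 1 -> ccont (fun t => derive1 g (s + (z - s) * t%:C)) t.
  move=> zp t t01; apply: (@cder_ccont _ (derive1 g) (fun t => s + (z - s) * t%:C)).
    apply: (holo_disc_derive hg); apply: segment_in_disc => //; exact: lt_le_trans pr.
  exact: ccont_affine.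
have hK : holo K s.
  apply: (@cint_param_holo _ s p 0 1 (normc (derive1 g s) + 1) p0 ler01).
  - move=> z t t01 zp; apply: (@holo_comp _ (fun z => s + (z - s) * t%:C)).
      apply: holoD; first exact: holo_cst.
      by apply: holoM; [exact: holo_shift|exact: holo_cst].
    apply: (holo_disc_derive hg); apply: segment_in_disc => //; exact: lt_le_trans pr.
  - move=> z t t01 zp.
    have := Hd _ (lt_le_trans (segment_in_disc s t01 zp) pd).
    set q := derive1 g (_ + _); move=> h.
    have -> : q = q - derive1 g s + derive1 g s by rewrite subrK.
    by apply: le_trans (le_normcD _ _) _; rewrite addrC lerD2l ltW.
  - by move=> z zp; apply: ccont_cintegrable => t t01; exact: ic.
apply: holo_near hK; apply/nbhsC; exists p => // z zp; rewrite /dquot.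
case: eqVneq => [->|zs].
  by rewrite /K subrr; under eq_cint do rewrite mul0r addr0; rewrite cint_cst// subr0 mulr1.
have zs0 : z - s != 0 by rewrite subr_eq0.
apply: (mulfI zs0); rewrite mulrCA mulfV// mulr1 /K -cintZ//; last first.
  by apply: ccont_cintegrable => t t01; exact: ic.
rewrite (@cint_FTC _ (fun t => g (s + (z - s) * t%:C))) ?ler01//.
- by rewrite mulr1 mulr0 addr0; congr (g _ - _); ring.
- move=> t t01; rewrite mulrC; apply: rder_segment; apply: holo_cder; apply: hg.
  apply: segment_in_disc => //; exact: lt_le_trans pr.
- by move=> t t01; apply: ccontM; [exact: ccont_cst|exact: ic].
Qed.

Lemma dquot_holo_disc g a c r : holo_disc g c r -> normc (a - c) < r ->
  holo_disc (dquot g a) c r.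
Proof.
move=> hg ar w wr; have [->|wa] := eqVneq w a.
  have [d d0 hd] := holo_disc_near hg ar; exact: dquot_holo_center hd.
by apply: dquot_holo => //; exact: hg.
Qed.

Lemma circle_bounded g c r : 0 <= r -> (forall w, normc (w - c) = r -> holo g w) ->
  exists M : R, forall w, normc (w - c) = r -> normc (g w) <= M.
Proof.
move=> r0 hg.
have cg t : ccont (fun t => g (c + r%:C * cis t)) t.
  apply: (@cder_ccont _ g (fun t => c + r%:C * cis t)); last exact: ccont_circle.
  by apply: hg; rewrite addrC addKr normc_circle.
have cn : {within `[0, 2 * pi], continuous (fun t => normc (g (c + r%:C * cis t)))}.
  apply: continuous_in_subspaceT => t _; apply/cvgrPdist_lt => e e0.
  have [d d0 Hd] := (ccontP _ _).1 (cg t) _ e0.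
  apply/nbhs_ballP; exists d => // x; rewrite -?ball_normE /= distrC => /Hd h.
  rewrite ltr_norml; apply/andP; split.
    rewrite ltrNl opprB; exact: le_lt_trans (le_normc_dist _ _) h.
  rewrite normcB in h; exact: le_lt_trans (le_normc_dist _ _) h.
have [m _ Hm] := EVT_max (pi2_ge0 R) cn.
exists (normc (g (c + r%:C * cis m))) => w wr.
have [r00|r00] := eqVneq r 0.
  have -> : w = c by apply/eqP; rewrite -subr_eq0 -normc_eq0 wr r00.
  by rewrite r00 mul0r addr0.
have [t t02 wt] : exists2 t, t \in `[0, 2 * pi] & w = c + r%:C * cis t.
  pose u := (w - c) / r%:C.
  have rC : r%:C != 0 :> C by rewrite eq_complex /= negb_and r00.
  have nu : normc u = 1 by rewrite normcM normcV normc_real ger0_norm// wr divff.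
  have nu2 : complex.Re u ^+ 2 + complex.Im u ^+ 2 = 1 by rewrite -normc_sqr nu expr1n.
  have Reu : -1 <= complex.Re u <= 1.
    by rewrite -ler_norml; apply: le_trans (le_Re_normc _) _; rewrite nu.
  have [/andP[a0 a1] ca] := acos_def Reu.
  have sa : sin (acos (complex.Re u)) ^+ 2 = complex.Im u ^+ 2.
    by rewrite sin2cos2 ca -nu2; ring.
  have wE : w = c + r%:C * u by rewrite /u; field.
  have p0 : 0 <= pi :> R by exact: pi_ge0.
  move/eqP: sa; rewrite eqf_sqr => /orP[] /eqP sa.
    exists (acos (complex.Re u)); first by rewrite in_itv /= a0/=; lra.
    by rewrite wE /cis ca sa; congr (_ + _ * _); case: (u).
  exists (2 * pi - acos (complex.Re u)); first by rewrite in_itv /=; apply/andP; split; lra.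
  by rewrite wE cisD cis_2pi mul1r -cis_conj /cis ca sa /= opprK; congr (_ + _ * _); case: (u).
by rewrite wt; exact: Hm.
Qed.

(* The disc automorphism z |-> (z + al) / (1 + conj al z) moves the centre to
   any given point, so the mean value property at the centre suffices. *)
Lemma max_modulus g c r M : 0 < r -> (forall w, normc (w - c) <= r -> holo g w) ->
  (forall w, normc (w - c) = r -> normc (g w) <= M) ->
  forall w, normc (w - c) <= r -> normc (g w) <= M.
Proof.
move=> r0 hg gM a; rewrite le_eqVlt => /predU1P[/gM//|ar].
have rC : r%:C != 0 :> C by rewrite eq_complex /= gt_eqF.
pose al := (a - c) / r%:C.
have nal : normc al < 1 by rewrite normcM normcV normc_real ger0_norm ?ltW// ltr_pdivrMr// mul1r.
(* This identity shows at once that the map preserves the closed unit disc and the unit circle. *)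
have id2 z : normc (1 + al^* * z) ^+ 2 - normc (z + al) ^+ 2 =
   (1 - normc z ^+ 2) * (1 - normc al ^+ 2).
  by rewrite !normc_sqr; case: (z) => z1 z2; case: (al) => a1 a2 /=; ring.
have al2 : 0 < 1 - normc al ^+ 2 by rewrite subr_gt0 expr_lt1// normc_ge0.
have den z : normc z <= 1 -> 1 + al^* * z != 0.
  move=> z1; apply/eqP => E; have : normc (al^* * z) = 1.
    have E' : al^* * z = - 1 by rewrite -[LHS](addKr 1) E addr0.
    by rewrite E' normcN normc1.
  rewrite normcM normc_conj => H.
  have : normc al * normc z <= normc al * 1 by rewrite ler_wpM2l// normc_ge0.
  by rewrite H mulr1 leNgt nal.
pose T z := c + r%:C * ((z + al) / (1 + al^* * z)).
have le1 z : normc z <= 1 -> normc ((z + al) / (1 + al^* * z)) <= 1.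
  move=> z1; rewrite normcM normcV ler_pdivrMr ?normc_gt0 ?den// mul1r.
  rewrite -(@ler_pXn2r _ 2)// ?nnegrE ?normc_ge0// -subr_ge0 id2.
  by rewrite mulr_ge0 ?(ltW al2)// subr_ge0 expr_le1// normc_ge0.
have eq1 z : normc z = 1 -> normc ((z + al) / (1 + al^* * z)) = 1.
  move=> z1; have z1' : normc z <= 1 by rewrite z1.
  suff E : normc (z + al) = normc (1 + al^* * z).
    by rewrite normcM normcV E divff// normc_eq0 den.
  apply/eqP; rewrite -(@eqrXn2 _ 2)// ?normc_ge0//.
  by rewrite -subr_eq0 -opprB id2 z1 expr1n subrr mul0r oppr0.
have hT z : normc (z - 0) <= 1 -> holo (g \o T) z.
  rewrite subr0 => z1; apply: holo_comp.
    apply: holoD; first exact: holo_cst.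
    apply: holoM; first exact: holo_cst.
    apply: holo_div; [|exact: holo_affine|exact: den].
    by apply: holoD; [exact: holo_id|exact: holo_cst].
  apply: hg; rewrite /T addrC addKr normcM normc_real ger0_norm ?(ltW r0)//.
  by rewrite ler_piMr ?le1// (ltW r0).
have := holo_circle_mean ltr01 hT.
have T0 : (g \o T) 0 = g a.
  rewrite /T /=; congr g; rewrite mulr0 addr0 add0r divr1 /al; by field.
rewrite T0 => /(congr1 (@normc R)); rewrite normcM normc_real ger0_norm ?pi2_ge0//.
have p0 : 0 < 2 * pi :> R by rewrite mulr_gt0// pi_gt0.
move=> E; rewrite -(ler_pM2l p0) -E.
have -> : 2 * pi * M = M * (2 * pi - 0) by rewrite subr0 mulrC.
apply: cint_bound; first exact: pi2_ge0.
  by apply: circle_int => // w; rewrite subr0 => w1; apply: hT; rewrite subr0 w1.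
move=> t _; rewrite /= add0r mul1r; apply: gM.
by rewrite /T addrC addKr normcM normc_real eq1 ?normc_cis// mulr1 ger0_norm// ltW.
Qed.

Lemma disc_bounded g c r : 0 < r -> (forall w, normc (w - c) <= r -> holo g w) ->
  exists M : R, forall w, normc (w - c) <= r -> normc (g w) <= M.
Proof.
move=> r0 hg; have [|M HM] := @circle_bounded g c r (ltW r0).
  by move=> w E; apply: hg; rewrite E.
by exists M; exact: max_modulus.
Qed.

(** Since g vanishes near c, every g(w) / (w - c)^n is holomorphic, and the maximum principle gives
    |g a| <= M q^n for all n, with q = |a - c| / p < 1. *)
Lemma identity_disc g c r r0 : 0 < r0 -> holo_disc g c r ->
  (forall w, normc (w - c) < r0 -> g w = 0) ->
  forall w, normc (w - c) < r -> g w = 0.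
Proof.
move=> r00 hg g0 a ar; have [|ra] := ltrP (normc (a - c)) r0; first exact: g0.
pose p := (normc (a - c) + r) / 2.
have na : 0 < normc (a - c) by exact: lt_le_trans ra.
have ap : normc (a - c) < p by rewrite /p; lra.
have pr : p < r by rewrite /p; lra.
have p0 : 0 < p by exact: lt_trans ap.
have [|M HM] := @circle_bounded g c p (ltW p0).
  by move=> w E; apply: hg; rewrite E.
have HM0 : 0 <= M.
  apply: le_trans (normc_ge0 _) (HM (c + p%:C * cis 0) _).
  by rewrite addrC addKr normc_circle// ltW.
pose q := normc (a - c) / p.
have q1 : q < 1 by rewrite ltr_pdivrMr// mul1r.
have q0 : 0 <= q by rewrite divr_ge0// ltW.
have H (n : nat) : normc (g a) <= M * q ^+ n.
  pose G w := g w / (w - c) ^+ n.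
  have hG w : normc (w - c) <= p -> holo G w.
    move=> wp; have [wr0|rw] := ltrP (normc (w - c)) r0.
      apply: holo_near (holo_cst 0 w); apply/nbhsC.
      exists (r0 - normc (w - c)); first by rewrite subr_gt0.
      move=> z zw; rewrite /G g0 ?mul0r//.
      have -> : z - c = (z - w) + (w - c) by ring.
      by apply: le_lt_trans (le_normcD _ _) _; rewrite -ltrBrDr.
    apply: holo_div.
    - by apply: hg; exact: le_lt_trans pr.
    - by apply: holoX; exact: holo_shift.
    - by rewrite expf_neq0// -normc_gt0; exact: lt_le_trans rw.
  have := @max_modulus G c p (M / p ^+ n) p0 hG _ a (ltW ap).
  move=> H; have : normc (G a) <= M / p ^+ n.
    apply: H => w E; rewrite /G normcM normcV normcX E ler_wpM2r// ?HM//.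
    by rewrite invr_ge0 exprn_ge0// ltW.
  rewrite /G normcM normcV normcX ler_pdivrMr ?exprn_gt0//.
  have -> : M * q ^+ n = M / p ^+ n * normc (a - c) ^+ n; last by [].
  by rewrite /q expr_div_n; field; rewrite expf_neq0// gt_eqF.
apply/eqP; rewrite -normc_eq0 eq_le normc_ge0 andbT.
have : (fun n => M * q ^+ n) @ \oo --> M * 0.
  by apply: cvgMr; apply: cvg_expr; rewrite ger0_norm.
rewrite mulr0 => /rcvgP cv; apply/ler_addgt0Pr => e e0; rewrite add0r.
have [N /(_ N (leqnn _))] := cv _ e0.
rewrite subr0 ger0_norm ?mulr_ge0 ?exprn_ge0// => /ltW; exact: le_trans.
Qed.

End holo_theory.

(** * Landau's local formula for the logarithmic derivative *)

Section log_derivative.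
Variable R : realType.
Local Notation C := (R[i]^o).
Local Notation mu := (@lebesgue_measure R).
Implicit Types (f g k F L : C -> C) (s z w c a : C) (r : R).

Lemma cintegrable_conj (D : set (measurableTypeR R)) (F : R -> C) : measurable D ->
  cintegrable D F -> cintegrable D (fun t => (F t)^*).
Proof.
move=> mD [h1 h2]; split.
  by apply: eq_integrable h1 => // x _ /=; case: (F x).
have := integrableZl mD (-1) h2; apply: eq_integrable => // x _ /=.
by rewrite -EFinM mulN1r; case: (F x).
Qed.

Lemma cint_conj (D : set (measurableTypeR R)) (F : R -> C) : measurable D ->
  cintegrable D F -> cint D (fun t => (F t)^*) = (cint D F)^*.
Proof.
move=> mD [h1 h2]; rewrite /cint /=; apply: eq_ReIm => /=.
  by apply: eq_Rintegral => x _; case: (F x).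
rewrite -mulN1r -RintegralZl//; apply: eq_Rintegral => x _; rewrite mulN1r.
by case: (F x).
Qed.

Lemma is_derive_ln_normc (G : R -> C) (t : R) (l : C) : rder G t l -> G t != 0 ->
  is_derive t (1 : R) (fun t => ln (normc (G t))) (complex.Re (l / G t)).
Proof.
move=> [du dv] G0; set u := @complex.Re R \o G; set v := @complex.Im R \o G.
(* Valid at zeros of [G] as well, both sides being 0 there by the convention ln 0 = 0. *)
have E : (fun t => ln (normc (G t))) = (2^-1 : R) *: ((@ln R) \o (u * u + v * v)).
  apply/funext => x; rewrite /GRing.scale /=.
  have -> : (u * u + v * v) x = normc (G x) ^+ 2.
    by rewrite normc_sqr !expr2.
  have [->|n0] := eqVneq (normc (G x)) 0.
    by rewrite expr0n ln0// scaler0.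
  rewrite lnXn; last by rewrite lt_neqAle eq_sym n0 normc_ge0.
  change (ln (normc (G x)) = 2^-1 * (ln (normc (G x)) *+ 2)).
  by rewrite -[ln _ *+ 2]mulr_natl mulKf.
rewrite E.
have p0 : 0 < (u * u + v * v) t.
  have -> : (u * u + v * v) t = normc (G t) ^+ 2 by rewrite normc_sqr !expr2.
  by rewrite exprn_gt0// normc_gt0.
have H := is_deriveZ 2^-1 (is_derive1_comp (is_derive1_ln p0)
  (is_deriveD (is_deriveM du du) (is_deriveM dv dv))).
apply: is_derive_eq H _; rewrite /GRing.scale /=.
have -> : (u * u + v * v) t = u t ^+ 2 + v t ^+ 2 by rewrite !expr2.
have p0' : u t ^+ 2 + v t ^+ 2 != 0.
  by move: p0; rewrite lt0r => /andP[]; rewrite !expr2.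
rewrite /u /v /= in p0' *; case: (G t) p0' => x y /= p0'; case: (l) => x' y' /=.
by field.
Qed.

(** A Borel-Caratheodory argument. On the disc F has a logarithm P vanishing at s, with Re P = ln
    |F| - ln |F s| <= V = ln E - ln |F s|. The function V - Re P is nonnegative with mean V on the
    circle, and its first Fourier coefficient is a multiple of P'(s). *)
Lemma logder_disc_bound F s (r E p : R) : 0 < p -> p < r -> holo_disc F s r ->
  (forall w, normc (w - s) < r -> F w != 0) ->
  (forall w, normc (w - s) < r -> normc (F w) <= E) ->
  normc (logderiv F s) <= 2 / p * (ln E - ln (normc (F s))).
Proof.
move=> p0 pr hF F0 FE; have r0 : 0 < r by exact: lt_trans pr.
have ss : normc (s - s) < r by rewrite subrr normc0.
pose k w := derive1 F w / F w.
have hk : holo_disc k s r.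
  by move=> w wr; apply: holo_div; [exact: (holo_disc_derive hF)|exact: hF|exact: F0].
have ck z : normc (z - s) < r -> forall t : R, 0 <= t <= 1 -> ccont (fun t => k (s + (z - s) * t%:C)) t.
  move=> zr t t01; apply: (@cder_ccont _ k (fun t => s + (z - s) * t%:C)).
    by apply: hk; exact: segment_in_disc.
  exact: ccont_affine.
(* (z - s) K z is the integral of F'/F along the segment from s to z. Its derivative is needed at s
   alone, where it is K s. *)
pose K z := cint `[0, 1] (fun t => k (s + (z - s) * t%:C)).
have hK : holo_disc K s r.
  move=> a ar; pose d := (r - normc (a - s)) / 2.
  have d0 : 0 < d by rewrite divr_gt0// subr_gt0.
  pose q := normc (a - s) + d.
  have q0 : 0 < q by rewrite ltr_wpDl// normc_ge0.
  have qr : q < r by rewrite /q /d; lra.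
  have [|M HM] := @disc_bounded _ k s q q0.
    by move=> w wq; apply: hk; exact: le_lt_trans qr.
  have aq z : normc (z - a) < d -> normc (z - s) < q.
    move=> za; have -> : z - s = (z - a) + (a - s) by ring.
    by apply: le_lt_trans (le_normcD _ _) _; rewrite addrC ltrD2l.
  apply: (@cint_param_holo _ _ a d 0 1 M d0 ler01).
  - move=> z t t01 za; apply: (@holo_comp _ (fun z => s + (z - s) * t%:C)).
      apply: holoD; first exact: holo_cst.
      by apply: holoM; [exact: holo_shift|exact: holo_cst].
    apply: hk; apply: lt_trans qr; apply: segment_in_disc => //; exact: aq.
  - by move=> z t t01 za; apply: HM; apply/ltW/segment_in_disc => //; exact: aq.
  - move=> z za; apply: ccont_cintegrable => t t01; apply: ck => //.
    by apply: lt_trans qr; exact: aq.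
have Ks : K s = k s.
  by rewrite /K subrr; under eq_cint do rewrite mul0r addr0; rewrite cint_cst// subr0 mulr1.
pose P z := (z - s) * K z.
have hP : holo_disc P s r by move=> w wr; apply: holoM; [exact: holo_shift|exact: hK].
have Ps : P s = 0 by rewrite /P subrr mul0r.
have dP : derive1 P s = k s.
  have [l hl] := hK s ss.
  have := cderM (cderB (cder_id s) (cder_cst s s)) hl.
  by move=> /cder_derive1; rewrite subr0 mul1r subrr mul0r addr0 Ks.
have ReP z : normc (z - s) < r -> complex.Re (P z) = ln (normc (F z)) - ln (normc (F s)).
  move=> zr; pose U t := (ln (normc (F (s + (z - s) * t%:C))))%:C : C.
  pose f t := (z - s) * k (s + (z - s) * t%:C).
  have cf t : 0 <= t <= 1 -> ccont f t.
    by move=> t01; apply: ccontM; [exact: ccont_cst|exact: ck].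
  have -> : P z = cint `[0, 1] f.
    by rewrite /P /K -cintZ//; apply: ccont_cintegrable => t t01; exact: ck.
  have -> : complex.Re (cint `[0, 1] f) = complex.Re (cint `[0, 1] (fun t => (complex.Re (f t))%:C)).
    by [].
  rewrite (@cint_FTC _ U) ?ler01//.
  - rewrite /U mulr1 mulr0 addr0 /=; congr (ln (normc (F _)) - _); ring.
  - move=> t t01; split => /=; last first.
      by rewrite (_ : _ \o _ = cst 0)//; exact: is_derive_cst.
    have Fst := segment_in_disc s t01 zr.
    have := rder_segment (holo_cder (hF _ Fst)) => /is_derive_ln_normc/(_ (F0 _ Fst)).
    rewrite (_ : _ \o _ = (fun t => ln (normc (F (s + (z - s) * t%:C)))))//.
    move=> H; apply: is_derive_eq H _; congr complex.Re; rewrite /f /k; ring.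
  - move=> t t01; have [h1 h2] := cf t t01; split => //=.
    rewrite (_ : _ \o _ = cst 0)//; exact: cst_continuous.
pose V := ln E - ln (normc (F s)).
have circ t : normc (s + p%:C * cis t - s) = p by rewrite addrC addKr normc_circle// ltW.
have cp t : normc (s + p%:C * cis t - s) < r by rewrite circ.
have hP' w : normc (w - s) <= p -> holo P w by move=> wp; apply: hP; exact: le_lt_trans pr.
have I0 := holo_circle_mean p0 hP'; rewrite Ps mulr0 in I0.
have I1 := circle_derive p0 hP'; rewrite dP in I1.
have I2 := circle_cis p0 hP'.
have cP t : ccont (fun t => P (s + p%:C * cis t)) t.
  apply: (@cder_ccont _ P (fun t => s + p%:C * cis t)); last exact: ccont_circle.
  exact: hP.
have cc t : ccont (@cis R) t by exact: rder_cont (rder_cis t).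
have ccN t : ccont (fun t => cis (- t) : C) t.
  rewrite (_ : (fun t => _) = (fun t => (cis t)^-1)); last by apply/funext => x; rewrite cisN.
  apply: (@cder_ccont _ (fun z => z^-1) (@cis R)) => //.
  by apply: holoV; [exact: holo_id|exact: cis_neq0].
(* Of the three parts of this integral the constant V and the conjugate of P contribute 0; the term
   in P yields - pi p P'(s). *)
pose W t := (V - complex.Re (P (s + p%:C * cis t)))%:C * cis (- t) : C.
have WE t : W t = V%:C * cis (- t) +
   (- 2^-1 * (P (s + p%:C * cis t) * cis (- t)) + - 2^-1 * (P (s + p%:C * cis t) * cis t)^*).
  have K' (a c c' : C) (x : R) : c' = c^* -> (x - complex.Re a)%:C * c' =
      x%:C * c' + (- 2^-1 * (a * c') + - 2^-1 * (a * c)^*).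
    have -> : 2^-1 = (2^-1 : R)%:C :> C by rewrite rmorphV ?rmorph_nat ?unitfE.
    by move=> ->; case: a => a1 a2; case: c => c1 c2; apply: eq_ReIm => /=; field.
  by apply: K'; rewrite cis_conj.
have iN : cintegrable `[0, 2 * pi] (fun t => cis (- t) : C) by apply: ccont_cintegrable.
have i1 : cintegrable `[0, 2 * pi] (fun t => P (s + p%:C * cis t) * cis (- t)).
  by apply: ccont_cintegrable => t _; exact: ccontM.
have i2 : cintegrable `[0, 2 * pi] (fun t => P (s + p%:C * cis t) * cis t).
  by apply: ccont_cintegrable => t _; exact: ccontM.
have i3 := cintegrable_conj (measurable_itv _) i2.
have iW : cintegrable `[0, 2 * pi] W.
  apply: eq_cintegrable (cintegrableD (measurable_itv _) (cintegrableZ V%:C (measurable_itv _) iN)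
   (cintegrableD (measurable_itv _) (cintegrableZ (- 2^-1) (measurable_itv _) i1)
   (cintegrableZ (- 2^-1) (measurable_itv _) i3))) => //.
have IW : cint `[0, 2 * pi] W = - (pi * p)%:C * k s.
  rewrite (eq_cint (fun t _ => WE t)) cintD//; last 2 first.
    exact: cintegrableZ.
    by apply: cintegrableD => //; exact: cintegrableZ.
  rewrite cintD//; [|exact: cintegrableZ|exact: cintegrableZ].
  rewrite !cintZ// cint_conj// I1 I2 cint_cisN conjc0 !mulr0 add0r addr0.
  rewrite !rmorphM /=; have -> : 2%:C = 2 :> C by rewrite rmorph_nat.
  by field.
have ReV t : complex.Re (P (s + p%:C * cis t)) <= V.
  rewrite ReP ?cp// lerD2r ler_ln ?posrE ?FE ?cp//; first by rewrite normc_gt0 F0 ?cp.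
  by apply: lt_le_trans (FE s ss); rewrite normc_gt0 F0.
have iVP : cintegrable `[0, 2 * pi] (fun t => V%:C - P (s + p%:C * cis t)).
  apply: ccont_cintegrable => t _; apply: ccontD; first exact: ccont_cst.
  exact: ccontN.
have := @le_normc_cint _ `[0, 2 * pi] W (fun t => V - complex.Re (P (s + p%:C * cis t)))
  (measurable_itv _) iW _ _.
have -> : Rintegral mu `[0, 2 * pi] (fun t => V - complex.Re (P (s + p%:C * cis t))) =
    2 * pi * V.
  transitivity (complex.Re (cint `[0, 2 * pi] (fun t => V%:C - P (s + p%:C * cis t)))).
    by apply: eq_Rintegral => t _; rewrite cReD cReN.
  rewrite cintB//; last 2 first.
    by apply: ccont_cintegrable => t _; exact: ccont_cst.
    by apply: ccont_cintegrable => t _; exact: cP.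
  by rewrite I0 subr0 cint_cst ?pi2_ge0// subr0 -rmorphM /= mulrC.
rewrite IW normcM normcN normc_real ger0_norm; last by rewrite mulr_ge0 ?pi_ge0// ltW.
have -> : logderiv F s = k s by [].
move=> H; have {}H : pi * p * normc (k s) <= 2 * pi * V.
  apply: H.
    by have [h _] := iVP; apply: eq_integrable h => // t _ /=; rewrite cReD cReN.
  move=> t _; rewrite normcM normc_cis mulr1 normc_real ger0_norm// subr_ge0.
  exact: ReV.
have pp : 0 < pi :> R by exact: pi_gt0.
rewrite -(ler_pM2l (mulr_gt0 pp p0)); apply: le_trans H _.
rewrite le_eqVlt; apply/orP; left; apply/eqP; rewrite /V; field; by rewrite gt_eqF.
Qed.

(* Harnack's inequality for ln E - ln |F|, obtained by Gronwall along a radius. *)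
Lemma logder_harnack F c (r r1 E p : R) : 0 <= r -> r < r1 -> p = (r1 - r) / 2 ->
  holo_disc F c r1 -> (forall w, normc (w - c) < r1 -> F w != 0) ->
  (forall w, normc (w - c) < r1 -> normc (F w) <= E) ->
  forall s, normc (s - c) <= r ->
  normc (logderiv F s) <= 2 / p * expR (2 * r / p) * (ln E - ln (normc (F c))).
Proof.
move=> r0 rr1 pE hF F0 FE s sr.
have p0 : 0 < p by rewrite pE divr_gt0// subr_gt0.
pose v z := ln E - ln (normc (F z)).
have loc z : normc (z - c) <= r -> normc (logderiv F z) <= 2 / p * v z.
  move=> zr; have sub w : normc (w - z) < p + p -> normc (w - c) < r1.
    move=> wz; have -> : w - c = (w - z) + (z - c) by ring.
    apply: le_lt_trans (le_normcD _ _) _; lra.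
  apply: (@logder_disc_bound F z (p + p) E p p0); first by rewrite ltrDl.
  - by move=> w /sub; exact: hF.
  - by move=> w /sub; exact: F0.
  - by move=> w /sub; exact: FE.
pose A := 2 * r / p.
pose y t := v (c + (s - c) * t%:C); pose Y t := y t * expR (- A * t).
have seg t : 0 <= t <= 1 -> normc (c + (s - c) * t%:C - c) <= r.
  move=> /andP[t0 t1]; rewrite addrC addKr normcM normc_real ger0_norm//.
  by apply: le_trans sr; rewrite ler_piMr// normc_ge0.
have segr t : 0 <= t <= 1 -> normc (c + (s - c) * t%:C - c) < r1.
  by move=> /seg h; exact: le_lt_trans rr1.
have dy (t : R) : 0 <= t <= 1 -> is_derive t (1 : R) y
   (0 - complex.Re (logderiv F (c + (s - c) * t%:C) * (s - c))).
  move=> t01; have h := segr t t01.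
  have := rder_segment (holo_cder (hF _ h)) => /is_derive_ln_normc/(_ (F0 _ h)) H.
  apply: is_derive_eq (is_deriveB (is_derive_cst (ln E) t 1) H) _.
  by congr (_ - complex.Re _); rewrite /logderiv; ring.
have dY (t : R) : 0 <= t <= 1 -> is_derive t (1 : R) Y
   ((- complex.Re (logderiv F (c + (s - c) * t%:C) * (s - c)) - A * y t) * expR (- A * t)).
  move=> t01.
  have de : is_derive t (1 : R) (fun t => expR (- A * t)) (expR (- A * t) * (- A)).
    apply: (@is_derive1_comp _ expR (fun t => - A * t)).
    have H := is_deriveZ (- A) (is_derive_id t (1 : R)).
    by apply: is_derive_eq H _; rewrite /GRing.scale /= mulr1.
  have := is_deriveM (dy t t01) de => H; apply: is_derive_eq H _.
  by rewrite /GRing.scale /=; ring.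
have Ymono : Y 1 <= Y 0.
  apply: (@ler0_derive1_nincr _ Y 0 1) => //.
  - move=> t; rewrite in_itv /= => /andP[t0 t1].
    by have [] := dY t; rewrite ?ltW.
  - move=> t; rewrite in_itv /= => /andP[t0 t1]; rewrite derive1E.
    have t01 : 0 <= t <= 1 by rewrite !ltW.
    have [_ ->] := dY t t01.
    rewrite mulr_le0_ge0 ?expR_ge0// subr_le0.
    apply: le_trans (ler_norm _) _; rewrite normrN.
    apply: le_trans (le_Re_normc _) _; rewrite normcM.
    have h := loc _ (seg t t01).
    have -> : A * y t = 2 / p * v (c + (s - c) * t%:C) * r by rewrite /A /y; field; rewrite gt_eqF.
    by apply: ler_pM => //; exact: normc_ge0.
  - apply: continuous_in_subspaceT => t; rewrite inE /= in_itv /= => t01.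
    apply: differentiable_continuous; apply/derivable1_diffP.
    by have [] := dY t t01.
have := loc s sr => H; apply: le_trans H _.
rewrite -[X in _ <= X]mulrA ler_pM2l ?divr_gt0//.
move: Ymono; rewrite /Y /y mulr1 mulr0 addr0 !mulr0 expR0 mulr1.
have -> : c + (s - c) = s by ring.
rewrite -/(v c) mulr1 expRN ler_pdivrMr ?expR_gt0// => H; apply: le_trans H _.
by rewrite mulrC.
Qed.

(** The order of vanishing expressed on a punctured disc: this form passes to quotients by w - a
    without reference to the value at a. *)
Definition pzero L s (m : nat) := exists h : C -> C, [/\ holo h s, h s != 0 &
  exists2 d : R, 0 < d & forall w, 0 < normc (w - s) < d -> L w = (w - s) ^+ m * h w].

Lemma punctured_eq f g s (d : R) : holo f s -> holo g s -> 0 < d ->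
  (forall w, 0 < normc (w - s) < d -> f w = g w) -> f s = g s.
Proof.
move=> hf hg d0 fg; apply/eqP; rewrite -subr_eq0 -normc_eq0 eq_le normc_ge0 andbT.
apply/ler_addgt0Pr => e e0; rewrite add0r.
have e2 : 0 < e / 2 by rewrite divr_gt0.
have [d1 d10 H1] := holo_cont hf e2; have [d2 d20 H2] := holo_cont hg e2.
pose q := Num.min d (Num.min d1 d2) / 2.
have m0 : 0 < Num.min d (Num.min d1 d2) by rewrite !lt_min d0 d10.
have q0 : 0 < q by rewrite divr_gt0.
have : q < Num.min d (Num.min d1 d2) by rewrite /q; lra.
rewrite !lt_min => /and3P[q1 q2 q3].
pose w : C := s + q%:C.
have ws : normc (w - s) = q by rewrite addrC addKr normc_real gtr0_norm.
have E : f w = g w by apply: fg; rewrite ws q0.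
have -> : f s - g s = (g w - g s) - (f w - f s) by rewrite E; ring.
apply: le_trans (le_normcB _ _) _; rewrite [e]splitr.
by rewrite lerD// ltW// ?H1 ?H2// ws.
Qed.

Lemma pzero_val L s m : holo L s -> pzero L s m -> (L s == 0) = (0 < m)%N.
Proof.
move=> hL [h [hh h0 [d d0 Hd]]].
have -> : L s = (s - s) ^+ m * h s.
  apply: (@punctured_eq L (fun w => (w - s) ^+ m * h w) s d) => //.
  by apply: holoM => //; apply: holoX; exact: holo_shift.
by rewrite subrr expr0n; case: m {Hd} => [|m]; rewrite ?mul1r ?(negbTE h0)// mul0r eqxx.
Qed.

Lemma dquot_mul L a w : L a = 0 -> L w = (w - a) * dquot L a w.
Proof.
move=> La; rewrite /dquot; have [->|wa] := eqVneq w a; first by rewrite subrr mul0r.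
by rewrite La subr0 mulrCA divff ?mulr1// subr_eq0.
Qed.

Lemma pzero_dquot_same L a m : L a = 0 -> pzero L a m.+1 -> pzero (dquot L a) a m.
Proof.
move=> La [h [hh h0 [d d0 Hd]]]; exists h; split => //; exists d => // w wd.
have wa : w - a != 0 by rewrite -normc_gt0; case/andP: wd.
by apply: (mulfI wa); rewrite -dquot_mul// Hd// exprS mulrA.
Qed.

Lemma pzero_dquot_other L a s m : L a = 0 -> s != a -> pzero L s m ->
  pzero (dquot L a) s m.
Proof.
move=> La sa [h [hh h0 [d d0 Hd]]]; exists (fun w => h w / (w - a)).
have sa0 : s - a != 0 by rewrite subr_eq0.
split; first by apply: holo_div => //; exact: holo_shift.
  by rewrite mulf_neq0// invr_neq0.
exists (Num.min d (normc (s - a))); first by rewrite lt_min d0 normc_gt0.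
move=> w; rewrite lt_min => /and3P[w0 wd ws].
have wa : w - a != 0.
  by rewrite subr_eq0; apply: contraTneq ws => ->; rewrite normcB ltxx.
by apply: (mulfI wa); rewrite -dquot_mul// Hd ?w0//; field.
Qed.

Definition open_dom (U : C -> Prop) := forall w, U w ->
  exists2 d : R, 0 < d & forall z, normc (z - w) < d -> U z.

Definition holo_on (U : C -> Prop) g := forall w, U w -> holo g w.

Lemma dquot_holo_on (U : C -> Prop) g a : open_dom U -> holo_on U g -> U a ->
  holo_on U (dquot g a).
Proof.
move=> oU hg Ua w Uw; have [->|wa] := eqVneq w a; last by apply: dquot_holo => //; exact: hg.
have [d d0 hd] := oU a Ua; apply: (@dquot_holo_center _ g a d d0) => z /hd; exact: hg.
Qed.

Lemma holo_on_derive (U : C -> Prop) g : open_dom U -> holo_on U g -> holo_on U (derive1 g).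
Proof.
move=> oU hg w Uw; have [d d0 hd] := oU w Uw.
by apply: (@holo_derive _ g w d d0) => z /hd; exact: hg.
Qed.

(** The zeros are divided out one by one with [dquot]; each division keeps the cofactor holomorphic
    on [U] and lowers the order at that zero only. [m] records the orders at the points of [P], and
    an element of [zs] may be repeated up to its order. *)
Lemma factor_zeros (zs : seq C) (U P : C -> Prop) (m : C -> nat) L : open_dom U ->
  holo_on U L -> (forall s, P s -> U s) -> (forall s, s \in zs -> P s) ->
  (forall s, P s -> pzero L s (m s)) -> (forall s, P s -> (count_mem s zs <= m s)%N) ->
  exists Q, [/\ holo_on U Q, (forall w, L w = (\prod_(a <- zs) (w - a)) * Q w) &
   forall s, P s -> pzero Q s (m s - count_mem s zs)].
Proof.
move=> oU hL PU; elim: zs L m hL => [|a zs IH] L m hL zsP Lm cm.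
  exists L; split => // [w|s Ps]; first by rewrite big_nil mul1r.
  by rewrite subn0; exact: Lm.
have Pa := zsP a (mem_head _ _).
have ma : (0 < m a)%N by apply: leq_trans (cm a Pa); rewrite /= eqxx.
have La : L a = 0 by apply/eqP; rewrite (pzero_val (hL a (PU a Pa)) (Lm a Pa)).
pose m' s := (m s - (s == a))%N.
have [||||Q [hQ LQ mQ]] := IH (dquot L a) m'.
- by apply: dquot_holo_on => //; exact: PU.
- by move=> s szs; apply: zsP; rewrite inE szs orbT.
- move=> s Ps; rewrite /m'; have [->|sa] := eqVneq s a.
    rewrite subn1; apply: pzero_dquot_same => //; rewrite prednK//; exact: Lm.
  by rewrite subn0; apply: pzero_dquot_other => //; exact: Lm.
- move=> s Ps; have := cm s Ps; rewrite /m' /= eq_sym; case: (s == a) => /=; lia.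
exists Q; split => // [w|s Ps]; first by rewrite big_cons -mulrA -LQ -dquot_mul.
by have := mQ s Ps; rewrite /m' /= eq_sym subnDA.
Qed.

Lemma pzero_prod L Q s (zs : seq C) : (forall w, L w = (\prod_(a <- zs) (w - a)) * Q w) ->
  holo Q s -> Q s != 0 -> pzero L s (count_mem s zs).
Proof.
move=> LQ hQ Q0; exists (fun w => (\prod_(a <- zs | a != s) (w - a)) * Q w); split.
- apply: holoM => //; rewrite (_ : (fun z => _) =
     (fun z => \prod_(a <- [seq a <- zs | a != s]) (z - a))).
    by apply: holo_prod => a; exact: holo_shift.
  by apply/funext => z; rewrite big_filter.
- rewrite mulf_neq0// prodf_seq_neq0; apply/allP => a _ /=; apply/implyP => as0.
  by rewrite subr_eq0 eq_sym.
exists 1 => // w _; rewrite LQ mulrA; congr (_ * _).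
rewrite (bigID (fun a => a == s)) /=; congr (_ * _).
elim: zs {LQ} => [|a zs IH]; first by rewrite big_nil.
by rewrite big_cons /= IH; case: eqVneq => [->|_] /=; rewrite ?add1n ?exprS.
Qed.

Lemma pzero_uniq L s (m k : nat) : pzero L s m -> pzero L s k -> m = k.
Proof.
wlog mk : m k / (m <= k)%N.
  by move=> H hm hk; case: (leqP m k) => [/H|/ltnW/H]; [apply|move=> /(_ hk hm)].
move=> [h [hh h0 [d d0 Hd]]] [g [hg g0 [e e0 He]]].
apply/eqP; rewrite eqn_leq mk /= leqNgt; apply/negP => mk'.
have de : 0 < Num.min d e by rewrite lt_min d0.
have : h s = (s - s) ^+ (k - m) * g s.
  apply: (@punctured_eq h (fun w => (w - s) ^+ (k - m) * g w) s _ hh _ de).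
    by apply: holoM => //; apply: holoX; exact: holo_shift.
  move=> w; rewrite lt_min => /and3P[w0 wd we].
  have ws : w - s != 0 by rewrite -normc_gt0.
  apply: (mulfI (expf_neq0 m ws)); rewrite -Hd ?w0// He ?w0// mulrA -exprD.
  by rewrite subnKC.
by rewrite subrr expr0n subn_eq0 leqNgt mk' mul0r => /eqP; rewrite (negbTE h0).
Qed.

Lemma logderivM f g s : holo f s -> holo g s -> f s != 0 -> g s != 0 ->
  logderiv (fun z => f z * g z) s = logderiv f s + logderiv g s.
Proof.
move=> /holo_cder hf /holo_cder hg f0 g0.
rewrite /logderiv (cder_derive1 (cderM hf hg)).
have K (a b x y : C) : x != 0 -> y != 0 -> (a * y + x * b) / (x * y) = a / x + b / y.
  by move=> *; field; apply/andP.
exact: K.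
Qed.

Lemma logderiv_prod (I : eqType) (zs : seq I) (G : I -> C -> C) s :
  (forall i, i \in zs -> holo (G i) s /\ G i s != 0) ->
  logderiv (fun z => \prod_(i <- zs) G i z) s = \sum_(i <- zs) logderiv (G i) s.
Proof.
elim: zs => [|i zs IH] h.
  rewrite big_nil /logderiv (_ : (fun z => _) = (fun=> 1)).
    by rewrite (cder_derive1 (cder_cst 1 s)) mul0r.
  by apply/funext => z; rewrite big_nil.
have [hi gi] := h i (mem_head _ _).
have h' j : j \in zs -> holo (G j) s /\ G j s != 0 by move=> jz; apply: h; rewrite inE jz orbT.
rewrite big_cons -IH// (_ : (fun z => _) = (fun z => G i z * \prod_(j <- zs) G j z)); last first.
  by apply/funext => z; rewrite big_cons.
rewrite logderivM//.
- elim: zs h' {IH h} => [|j zs IH] h'.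
    by rewrite (_ : (fun z => _) = (fun=> 1)); [exact: holo_cst|apply/funext => z; rewrite big_nil].
  rewrite (_ : (fun z => _) = (fun z => G j z * \prod_(i <- zs) G i z)); last first.
    by apply/funext => z; rewrite big_cons.
  apply: holoM; first by case: (h' j (mem_head _ _)).
  by apply: IH => l lz; apply: h'; rewrite inE lz orbT.
- rewrite prodf_seq_neq0; apply/allP => j jz /=; by case: (h' j jz).
Qed.

Lemma logderiv_affine (a b : C) s :
  logderiv (fun z => a + b * z) s = b / (a + b * s).
Proof. by rewrite /logderiv (cder_derive1 (cder_affine a b s)). Qed.

Lemma logderiv_shift (a : C) s : logderiv (fun z => z - a) s = (s - a)^-1.
Proof.
have -> : (fun z => z - a) = (fun z => - a + 1 * z) by apply/funext => z; ring.
by rewrite logderiv_affine div1r; congr (_^-1); ring.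
Qed.

(** * Zeros in a disc: Blaschke factors, Jensen's bound, Landau's lemma *)

Section landau.
Variables (L : C -> C) (c : C) (r r1 r2 r3 E : R).
Hypotheses (r0 : 0 <= r) (rr1 : r < r1) (r12 : r1 < r2) (r23 : r2 < r3).
Hypotheses (hL : holo_disc L c r3) (Lc : L c != 0).
Hypothesis (LE : forall w, normc (w - c) <= r2 -> normc (L w) <= E).

Let r10 : 0 < r1. Proof. exact: le_lt_trans rr1. Qed.
Let r20 : 0 < r2. Proof. exact: lt_trans r12. Qed.
Let r2C : r2%:C != 0 :> C. Proof. by rewrite eq_complex /= gt_eqF. Qed.
Let r21 : 0 < r2 ^+ 2 - r1 ^+ 2.
Proof. by rewrite subr_gt0 ltr_pXn2r// nnegrE ltW. Qed.
Let lnr : 0 < ln (r2 / r1). Proof. by rewrite ln_gt0// ltr_pdivlMr// mul1r. Qed.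
Let Lc0 : 0 < normc (L c). Proof. by rewrite normc_gt0. Qed.
Let cc : normc (c - c) < r1. Proof. by rewrite subrr normc0. Qed.
Let E0 : 0 < E.
Proof. by apply: (lt_le_trans Lc0); apply: LE; rewrite subrr normc0 ltW. Qed.

(* [blaschke a w / (w - a)] has modulus 1 on the circle of radius r2. *)
Let blaschke a w := (r2%:C + (a - c)^* / r2%:C * c) + (- (a - c)^* / r2%:C) * w.

Let blaschke_holo a w : holo (blaschke a) w.
Proof. exact: holo_affine. Qed.

Let blaschkeE a w : blaschke a w = r2%:C - (a - c)^* / r2%:C * (w - c).
Proof. by rewrite /blaschke; ring. Qed.

Let blaschke_low a w : normc (a - c) < r1 -> normc (w - c) < r1 ->
  (r2 ^+ 2 - r1 ^+ 2) / r2 <= normc (blaschke a w).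
Proof.
move=> ar wr; rewrite blaschkeE.
apply: le_trans (le_normc_dist _ _); rewrite !normcM normcV normc_conj normc_real gtr0_norm//.
have -> : (r2 ^+ 2 - r1 ^+ 2) / r2 = r2 - r1 * r1 / r2 by field; rewrite gt_eqF.
rewrite lerD2l lerN2 mulrAC ler_pM2r ?invr_gt0//.
by apply: ler_pM; rewrite ?normc_ge0// ltW.
Qed.

Let blaschke_neq0 a w : normc (a - c) < r1 -> normc (w - c) < r1 -> blaschke a w != 0.
Proof.
move=> ar wr; rewrite -normc_gt0; apply: lt_le_trans (blaschke_low ar wr).
by rewrite divr_gt0.
Qed.

Let blaschke_circle a w : normc (w - c) = r2 -> normc (blaschke a w) = normc (w - a).
Proof.
move=> wr; have v2 : (w - c) * (w - c)^* = r2%:C * r2%:C.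
  by rewrite -sqr_normc absC_normc wr expr2.
have v0 : w - c != 0 by rewrite -normc_gt0 wr.
have -> : blaschke a w = (w - c) / r2%:C * (w - a)^*.
  rewrite blaschkeE; apply: (mulfI r2C); rewrite mulrBr -v2.
  have -> : w - a = (w - c) - (a - c) by ring.
  by rewrite rmorphB /=; field.
by rewrite !normcM normcV normc_conj wr normc_real gtr0_norm// divff ?mul1r// gt_eqF.
Qed.

Let zlist (zs : seq C) Q := [/\ (forall a, a \in zs -> normc (a - c) < r1),
  holo_disc Q c r3 & forall w, L w = (\prod_(a <- zs) (w - a)) * Q w].

Let Bp (zs : seq C) w := \prod_(a <- zs) blaschke a w.

Let Bp_neq0 zs Q w : zlist zs Q -> normc (w - c) < r1 -> Bp zs w != 0.
Proof.
move=> [zsr _ _] wr; rewrite prodf_seq_neq0; apply/allP => a az /=.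
by apply: blaschke_neq0 => //; exact: zsr.
Qed.

Let Bp_holo zs w : holo (Bp zs) w.
Proof. by apply: holo_prod => a; exact: blaschke_holo. Qed.

(** On the outer circle each Blaschke factor has the modulus of the factor w - a that it replaces,
    so the product has modulus |L|; the maximum principle extends the bound inside. *)
Let F_bound zs Q w : zlist zs Q -> normc (w - c) <= r2 -> normc (Q w * Bp zs w) <= E.
Proof.
move=> [_ hQ LQ]; apply: (@max_modulus _ (fun w => Q w * Bp zs w)) => // z zr.
  by apply: holoM => //; apply: hQ; exact: le_lt_trans r23.
rewrite normcM normc_prod; under eq_bigr do rewrite blaschke_circle//.
by rewrite -normc_prod -normcM mulrC -LQ LE// zr.
Qed.

(** At the centre a factor of modulus below r1 is replaced by one of modulus r2, a gain of r2 / r1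
    for every zero. Together with the upper bound [E] this is Jensen's inequality for the number of
    zeros. *)
Let F_center zs Q : zlist zs Q ->
  normc (L c) * (r2 / r1) ^+ size zs <= normc (Q c * Bp zs c).
Proof.
move=> [zsr hQ LQ].
rewrite LQ !normcM mulrC mulrA [X in _ <= X]mulrC ler_wpM2r ?normc_ge0// !normc_prod.
elim: (zs) zsr => [|a l IH] lr; first by rewrite !big_nil expr0 mulr1.
rewrite !big_cons /= exprS mulrACA; apply: ler_pM.
- by rewrite mulr_ge0// ?normc_ge0// divr_ge0// ltW.
- by rewrite mulr_ge0 ?prodr_ge0// ?exprn_ge0// ?divr_ge0 ?ltW// => i _; exact: normc_ge0.
- have -> : blaschke a c = r2%:C by rewrite blaschkeE subrr mulr0 subr0.
  rewrite normc_real gtr0_norm// mulrAC ler_pdivrMr//.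
  have := lr a (mem_head _ _); rewrite normcB => /ltW h.
  by rewrite ler_pM2l.
- by apply: IH => s sl; apply: lr; rewrite inE sl orbT.
Qed.

Let F_ln zs Q : zlist zs Q ->
  ln (normc (L c)) + (size zs)%:R * ln (r2 / r1) <= ln (normc (Q c * Bp zs c)) <= ln E.
Proof.
move=> zQ; have h := F_center zQ.
have qq : 0 < (r2 / r1) ^+ size zs by rewrite exprn_gt0// divr_gt0.
have F0 : 0 < normc (Q c * Bp zs c) by apply: lt_le_trans h; rewrite mulr_gt0.
apply/andP; split.
  have -> : (size zs)%:R * ln (r2 / r1) = ln ((r2 / r1) ^+ size zs).
    by rewrite lnXn ?divr_gt0// mulr_natl.
  by rewrite -lnM ?posrE// ler_ln ?posrE ?mulr_gt0.
rewrite ler_ln ?posrE//; apply: (F_bound zQ); by rewrite subrr normc0 ltW.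
Qed.

Let size_bound zs Q : zlist zs Q -> (size zs)%:R * ln (r2 / r1) <= ln E - ln (normc (L c)).
Proof. by move=> /F_ln/andP[h1 h2]; lra. Qed.

(* Jensen's bound makes a zero list of maximal length exist; its cofactor has no zeros. *)
Let maximal_zlist : exists zs Q, zlist zs Q /\ forall w, normc (w - c) < r1 -> Q w != 0.
Proof.
pose p n := `[< exists zs Q, zlist zs Q /\ size zs = n >].
have p0 : exists n, p n.
  exists 0%N; apply/asboolP; exists [::], L; split => //; split => // w.
  by rewrite big_nil mul1r.
have pb n : p n -> (n <= Num.bound ((ln E - ln (normc (L c))) / ln (r2 / r1)))%N.
  move=> /asboolP[zs [Q [zQ <-]]]; rewrite -(ler_nat R).
  have h := size_bound zQ.
  apply: (@le_trans _ _ ((ln E - ln (normc (L c))) / ln (r2 / r1))).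
    by rewrite ler_pdivlMr.
  apply/ltW/archi_boundP; rewrite divr_ge0 ?(ltW lnr)//.
  by apply: le_trans h; rewrite mulr_ge0// ltW.
case: (ex_maxnP p0 pb) => n /asboolP[zs [Q [zQ zn]]] nmax.
exists zs, Q; split => // w wr; apply/eqP => Qw.
have [zsr hQ LQ] := zQ.
have : p n.+1.
  apply/asboolP; exists (rcons zs w), (dquot Q w); split; last by rewrite size_rcons zn.
  split.
  - by move=> a; rewrite mem_rcons inE => /orP[/eqP->//|/zsr].
  - by apply: dquot_holo_disc => //; apply: lt_trans r23; exact: lt_trans r12.
  - by move=> z; rewrite LQ -cats1 big_cat /= big_seq1 -mulrA -dquot_mul.
by move=> /nmax; rewrite ltnn.
Qed.

Lemma landau : exists zs : seq C, [/\
  (forall a, a \in zs -> normc (a - c) < r1 /\ L a = 0),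
  (forall s, normc (s - c) < r1 -> pzero L s (count_mem s zs)),
  (size zs)%:R * ln (r2 / r1) <= ln E - ln (normc (L c)) &
  forall s, normc (s - c) <= r -> L s != 0 ->
    normc (logderiv L s - \sum_(a <- zs) (s - a)^-1) <=
    (4 / (r1 - r) * expR (4 * r / (r1 - r)) + r1 / (r2 ^+ 2 - r1 ^+ 2) / ln (r2 / r1)) *
    (ln E - ln (normc (L c)))].
Proof.
have [zs [Q [zQ Q0]]] := maximal_zlist; have [zsr hQ LQ] := zQ.
have NM := size_bound zQ; have /andP[lF1 lF2] := F_ln zQ.
have r13 w : normc (w - c) < r1 -> normc (w - c) < r3.
  by move=> h; apply: lt_trans r23; exact: lt_trans r12.
exists zs; split => //.
- move=> a az; split; first exact: zsr.
  rewrite LQ (big_rem a az) /= subrr !mul0r//.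
- by move=> s sr; apply: (@pzero_prod _ Q) => //; [apply: hQ; exact: r13|exact: Q0].
move=> s sr Ls.
have sr1 : normc (s - c) < r1 by exact: le_lt_trans rr1.
have szs a : a \in zs -> s - a != 0.
  move=> az; apply: contraNneq Ls => sa; rewrite LQ (big_rem a az) /= sa !mul0r//.
have LE1 : logderiv L s = \sum_(a <- zs) (s - a)^-1 + logderiv Q s.
  have -> : L = (fun w => (\prod_(a <- zs) (w - a)) * Q w) by apply/funext => w; exact: LQ.
  rewrite logderivM; last 4 first.
  - by apply: holo_prod => a; exact: holo_shift.
  - by apply: hQ; exact: r13.
  - by rewrite prodf_seq_neq0; apply/allP => a az /=; exact: szs.
  - exact: Q0.
  congr (_ + _); rewrite logderiv_prod; first by apply: eq_bigr => a _; exact: logderiv_shift.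
  by move=> a az; split; [exact: holo_shift|exact: szs].
pose F w := Q w * Bp zs w.
have FQ : logderiv F s = logderiv Q s + \sum_(a <- zs) (- (a - c)^* / r2%:C) / blaschke a s.
  rewrite logderivM; last 4 first.
  - by apply: hQ; exact: r13.
  - exact: Bp_holo.
  - exact: Q0.
  - exact: Bp_neq0 zQ _.
  congr (_ + _); rewrite logderiv_prod; first by apply: eq_bigr => a _; exact: logderiv_affine.
  by move=> a az; split; [exact: blaschke_holo|apply: blaschke_neq0 => //; exact: zsr].
rewrite LE1 addrC addKr.
have -> : logderiv Q s = logderiv F s - \sum_(a <- zs) (- (a - c)^* / r2%:C) / blaschke a s.
  by rewrite FQ addrK.
apply: le_trans (le_normcB _ _) _; rewrite mulrDl; apply: lerD.
  have := @logder_harnack F c r r1 E ((r1 - r) / 2) r0 rr1 erefl.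
  have -> : 2 / ((r1 - r) / 2) = 4 / (r1 - r) by field; rewrite subr_eq0 gt_eqF.
  have -> : 2 * r / ((r1 - r) / 2) = 4 * r / (r1 - r) by field; rewrite subr_eq0 gt_eqF.
  move=> H; apply: le_trans (H _ _ _ s sr) _.
  - by move=> w /r13 wr; apply: holoM; [exact: hQ|exact: Bp_holo].
  - by move=> w wr; rewrite mulf_neq0 ?Q0//; exact: Bp_neq0 zQ _.
  - by move=> w wr; apply: (F_bound zQ); rewrite ltW// (lt_trans wr).
  - rewrite ler_wpM2l//; first by rewrite mulr_ge0 ?expR_ge0// divr_ge0// subr_ge0 ltW.
    have : 0 <= (size zs)%:R * ln (r2 / r1) by rewrite mulr_ge0// ltW.
    rewrite /F; lra.
apply: le_trans (normc_sum _ _ _) _.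
have K0 : 0 <= r1 / (r2 ^+ 2 - r1 ^+ 2) by rewrite divr_ge0// ltW.
apply: (@le_trans _ _ ((size zs)%:R * (r1 / (r2 ^+ 2 - r1 ^+ 2)))).
  elim: (zs) zsr => [|a l IH] lr; first by rewrite big_nil mul0r.
  rewrite big_cons /= -natr1 mulrDl mul1r addrC; apply: lerD.
    by apply: IH => t tl; apply: lr; rewrite inE tl orbT.
  have ar := lr a (mem_head _ _); have Bl := blaschke_low ar sr1.
  rewrite !normcM !normcV normcN normc_conj normc_real gtr0_norm//.
  have -> : r1 / (r2 ^+ 2 - r1 ^+ 2) = r1 / r2 / ((r2 ^+ 2 - r1 ^+ 2) / r2).
    by field; rewrite !gt_eqF.
  apply: ler_pM.
  - by rewrite divr_ge0 ?normc_ge0// ltW.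
  - by rewrite invr_ge0 normc_ge0.
  - by rewrite ler_pM2r ?invr_gt0// ltW.
  - by rewrite lef_pV2 ?posrE ?divr_gt0// normc_gt0 blaschke_neq0.
rewrite mulrC -[X in _ <= X]mulrA ler_wpM2l// [_^-1 * _]mulrC ler_pdivlMr//.
Qed.

End landau.

End log_derivative.

(** * Growth of Dirichlet series with periodic coefficients *)

Section dirichlet_growth.
Variable R : realType.
Local Notation C := (R[i]^o).
Local Notation mu := (@lebesgue_measure R).
Implicit Types (s z w c : C).

Lemma real_series_cvg (u b : nat -> R) (M : R) : (forall k, `|u k| <= b k) ->
  (forall N, \sum_(0 <= k < N) b k <= M) ->
  exists l : R, (fun N => \sum_(0 <= k < N) u k) @ \oo --> l.
Proof.
move=> ub bM; apply/cvg_ex.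
have cn : cvgn [normed series u].
  apply: nondecreasing_is_cvgn.
    apply/nondecreasing_seqP => n.
    by rewrite [X in _ <= X](_ : _ = \sum_(0 <= k < n.+1) `|u k|)// big_nat_recr//= lerDl.
  exists M => _ [N _ <-]; apply: le_trans (bM N); rewrite /series /=.
  by apply: ler_sum => k _.
exact: (normed_cvg cn).
Qed.

Lemma ccvg_series (e : nat -> C) (b : nat -> R) (M : R) : (forall k, normc (e k) <= b k) ->
  (forall N, \sum_(0 <= k < N) b k <= M) ->
  exists l, ccvg (fun N => \sum_(0 <= k < N) e k) l.
Proof.
move=> eb bM.
have [l1 h1] := @real_series_cvg (fun k => complex.Re (e k)) b M
  (fun k => le_trans (le_Re_normc _) (eb k)) bM.
have [l2 h2] := @real_series_cvg (fun k => complex.Im (e k)) b M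
  (fun k => le_trans (le_Im_normc _) (eb k)) bM.
have SRe N : complex.Re (\sum_(0 <= k < N) e k) = \sum_(0 <= k < N) complex.Re (e k).
  by elim: N => [|N IH]; rewrite ?big_nil// !big_nat_recr//= cReD IH.
have SIm N : complex.Im (\sum_(0 <= k < N) e k) = \sum_(0 <= k < N) complex.Im (e k).
  by elim: N => [|N IH]; rewrite ?big_nil// !big_nat_recr//= cImD IH.
exists (l1 +i* l2); apply/ccvg_ReIm; split => /=.
  by rewrite (_ : _ \o _ = (fun N => \sum_(0 <= k < N) complex.Re (e k)))//; apply/funext.
by rewrite (_ : _ \o _ = (fun N => \sum_(0 <= k < N) complex.Im (e k)))//; apply/funext.
Qed.

(** Two Cauchy estimates bound g'' and two mean value inequalities integrate the bound. The constant
    depends on g through [M] alone, so the estimate is uniform in a bounded family. *)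
Lemma holo_quadratic (g : C -> C) s (r M : R) : 0 < r -> holo_disc g s (4 * r) ->
  (forall w, normc (w - s) < 4 * r -> normc (g w) <= M) ->
  forall h, normc h < r ->
  normc (g (s + h) - g s - derive1 g s * h) <= M / r / r * normc h * normc h.
Proof.
move=> r0 hg gM.
have d1 w : normc (w - s) < 3 * r -> normc (derive1 g w) <= M / r.
  move=> ws; have E z : normc (z - w) <= r -> normc (z - s) < 4 * r.
    move=> zw; have -> : z - s = (z - w) + (w - s) by ring.
    by apply: le_lt_trans (le_normcD _ _) _; lra.
  by apply: cauchy_estimate => // z /E h; [exact: hg|exact: gM].
have hg' : holo_disc (derive1 g) s (4 * r) by exact: holo_disc_derive.
have d2 w : normc (w - s) < 2 * r -> normc (derive1 (derive1 g) w) <= M / r / r.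
  move=> ws; have E z : normc (z - w) <= r -> normc (z - s) < 3 * r.
    move=> zw; have -> : z - s = (z - w) + (w - s) by ring.
    by apply: le_lt_trans (le_normcD _ _) _; lra.
  apply: cauchy_estimate => // z /E h; first by apply: hg'; lra.
  exact: d1.
move=> h hr.
have seg u : normc u < r -> forall t : R, 0 <= t <= 1 -> normc (s + u * t%:C - s) < r.
  by move=> ur t t01; exact: segment_in_disc.
have lip u : normc u < r -> normc (derive1 g (s + u) - derive1 g s) <= M / r / r * normc u.
  move=> ur; apply: holo_mvt => t t01; have := seg u ur t t01 => H.
    by apply: hg'; lra.
  by apply: d2; lra.
pose G z := g z - derive1 g s * z.
have -> : g (s + h) - g s - derive1 g s * h = G (s + h) - G s.
  by rewrite /G; move: (derive1 g s) => D; ring.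
have dG z : normc (z - s) < r -> cder G z (derive1 g z - derive1 g s).
  move=> zr; have zr4 : normc (z - s) < 4 * r by lra.
  have := cderB (holo_cder (hg z zr4)) (cderM (cder_cst (derive1 g s) z) (cder_id z)).
  by rewrite mul0r add0r mulr1.
apply: holo_mvt => t t01; have st := seg h hr t t01; first by eexists; exact: dG.
rewrite (cder_derive1 (dG _ st)); have nt : normc (h * t%:C) <= normc h.
  case/andP: t01 => t0 t1; rewrite normcM normc_real ger0_norm//.
  by rewrite ler_piMr// normc_ge0.
apply: le_trans (lip _ (le_lt_trans nt hr)) _; rewrite ler_wpM2l//.
have := d2 s; rewrite subrr normc0 => H; apply: le_trans (normc_ge0 _) (H _); lra.
Qed.

(** Uniform boundedness replaces uniform convergence: dominated convergence in Cauchy's formula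
    makes the derivatives converge, and the quadratic remainder estimate, whose constant is
    independent of n, passes to the limit. *)
Lemma holo_limit (G : nat -> C -> C) (E : C -> C) c (r M : R) :
  (forall n, holo_disc (G n) c r) ->
  (forall n w, normc (w - c) < r -> normc (G n w) <= M) ->
  (forall w, normc (w - c) < r -> ccvg (G ^~ w) (E w)) -> holo_disc E c r.
Proof.
move=> hG GM cG s sr; pose p := (r - normc (s - c)) / 4.
have p0 : 0 < p by rewrite divr_gt0// subr_gt0.
have sub w : normc (w - s) < 4 * p -> normc (w - c) < r.
  move=> ws; have -> : w - c = (w - s) + (s - c) by ring.
  apply: le_lt_trans (le_normcD _ _) _; move: ws; rewrite /p; lra.
have M0 : 0 <= M by apply: le_trans (normc_ge0 _) (GM 0%N s sr).
have circ t : normc (s + p%:C * cis t - s) = p by rewrite addrC addKr normc_circle// ltW.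
have circr t : normc (s + p%:C * cis t - c) < r by apply: sub; rewrite circ; lra.
pose I n := cint `[0, 2 * pi] (fun t => G n (s + p%:C * cis t) * cis (- t)).
pose J := cint `[0, 2 * pi] (fun t => E (s + p%:C * cis t) * cis (- t)).
have cN t : ccont (fun t => cis (- t) : C) t.
  rewrite (_ : (fun t => _) = (fun t => (cis t)^-1)); last by apply/funext => x; rewrite cisN.
  apply: (@cder_ccont _ (fun z => z^-1) (@cis R)); last exact: rder_cont (rder_cis t).
  by apply: holoV; [exact: holo_id|exact: cis_neq0].
have iG n : cintegrable `[0, 2 * pi] (fun t => G n (s + p%:C * cis t) * cis (- t)).
  apply: ccont_cintegrable => t _; apply: ccontM => //.
  apply: (@cder_ccont _ (G n) (fun t => s + p%:C * cis t)); last exact: ccont_circle.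
  by apply: hG.
have [| |_ IJ] := @cdct _ `[0, 2 * pi] (fun n t => G n (s + p%:C * cis t) * cis (- t))
   (fun t => E (s + p%:C * cis t) * cis (- t)) (fun=> M) (measurable_itv _)
   (fun n => cintegrable_meas (iG n)) (integrable_cst_itv _ _ _).
- by move=> n t _; rewrite normcM normc_cis mulr1 GM.
- by move=> t _; apply: ccvgM; [exact: cG|exact: ccvg_cst].
have K0 : (2 * pi * p)%:C != 0 :> C.
  have h : 0 < 2 * pi * p by rewrite (mulr_gt0 (mulr_gt0 _ (pi_gt0 _)) p0).
  by rewrite eq_complex /= negb_and gt_eqF.
pose l := (2 * pi * p)%:C^-1 * J.
have dl : ccvg (fun n => derive1 (G n) s) l.
  rewrite (_ : (fun n => _) = (fun n => (2 * pi * p)%:C^-1 * I n)).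
    by apply: ccvgM => //; exact: ccvg_cst.
  apply/funext => n; rewrite /I circle_derive ?mulKf// => w wp.
  by apply: hG; apply: sub; lra.
pose B := M / p / p.
have B0 : 0 <= B by exact: (divr_ge0 (divr_ge0 M0 (ltW p0)) (ltW p0)).
have key h : normc h < p -> normc (E (s + h) - E s - l * h) <= B * normc h * normc h.
  move=> hp.
  have cv : ccvg (fun n => G n (s + h) - G n s - derive1 (G n) s * h) (E (s + h) - E s - l * h).
    apply: ccvgD; last by apply: ccvgN; apply: ccvgM => //; exact: ccvg_cst.
    apply: ccvgD; first by apply: cG; apply: sub; rewrite addrC addKr; lra.
    by apply: ccvgN; exact: cG.
  apply: ccvg_le cv _ => n; apply: holo_quadratic => // [w|w] /sub wr; first exact: hG.
  exact: GM.
exists l => e e0; exists (Num.min p (e / (B + 1))).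
  by rewrite lt_min p0 divr_gt0// ltr_wpDl.
move=> h; rewrite lt_min => /andP[hp he]; apply: le_trans (key h hp) _.
rewrite ler_wpM2r ?normc_ge0//; move: he; rewrite ltr_pdivlMr ?ltr_wpDl// => he.
have := normc_ge0 h; nra.
Qed.

Lemma rder_of_real (f : R -> R) (t l : R) : is_derive t (1 : R) f l ->
  rder (fun t => (f t)%:C) t l%:C.
Proof.
move=> h; split; first by [].
rewrite (_ : _ \o _ = cst 0)//; exact: is_derive_cst.
Qed.

Lemma rder_lin (v : C) (F : R -> C) t l : rder F t l -> rder (fun t => v * F t) t (v * l).
Proof.
move=> h; have := @rder_comp _ (fun z => 0 + v * z) F t _ _ (cder_affine 0 v (F t)) h.
by rewrite (_ : _ \o _ = (fun t => v * F t))//; apply/funext => x /=; rewrite add0r.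
Qed.

Lemma rderB (F G : R -> C) t l l' : rder F t l -> rder G t l' ->
  rder (fun t => F t - G t) t (l - l').
Proof.
move=> [f1 f2] [g1 g2]; split.
  rewrite (_ : _ \o _ = (@complex.Re R \o F) - (@complex.Re R \o G)).
    by rewrite cReD cReN; exact: is_deriveB.
  by apply/funext => x /=; rewrite cReD cReN.
rewrite (_ : _ \o _ = (@complex.Im R \o F) - (@complex.Im R \o G)).
  by rewrite cImD cImN; exact: is_deriveB.
by apply/funext => x /=; rewrite cImD cImN.
Qed.

Definition rpw (x : R) (w : C) : C := expc (w * (ln x)%:C).

Lemma normc_rpw x w : normc (rpw x w) = expR (complex.Re w * ln x).
Proof. by rewrite /rpw normc_expc cReM /= mulr0 subr0. Qed.

Lemma rder_rpw w (x : R) : 0 < x -> rder (fun x => rpw x w) x (w * rpw x (w - 1)).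
Proof.
move=> x0.
have := @rder_comp _ (@expc R) (fun x => w * (ln x)%:C) x _ _ (cder_expc _)
  (rder_lin w (rder_of_real (is_derive1_ln x0))).
have -> : expc (w * (ln x)%:C) * (w * (x^-1)%:C) = w * rpw x (w - 1).
  rewrite /rpw mulrBl mul1r expcD mulrCA; congr (_ * (_ * _)).
  have -> : - (ln x)%:C = (- ln x) +i* 0 :> C by rewrite -rmorphN.
  by rewrite /expc /= cis0 mulr1 expRN lnK.
by [].
Qed.

Lemma holo_rpw x w : holo (rpw x) w.
Proof.
apply: (@holo_comp _ (fun w => w * (ln x)%:C)); last exact: holo_expc.
by apply: holoM; [exact: holo_id|exact: holo_cst].
Qed.

Lemma rpw_diff (a b : R) s : 0 < a -> a <= b -> b <= a + 1 -> -1 <= complex.Re s ->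
  normc (rpw b (- s) - rpw a (- s)) <= normc s * expR (- (complex.Re s + 1) * ln a).
Proof.
move=> a0 ab ba s1.
have := @rder_mvt _ (fun x => rpw x (- s)) (fun x => - s * rpw x (- s - 1)) a b
  (normc s * expR (- (complex.Re s + 1) * ln a)) ab.
move=> H; apply: le_trans (H _ _) _.
- by move=> t /andP[at_ _]; apply: rder_rpw; exact: lt_le_trans at_.
- move=> t /andP[at_ _]; have t0 : 0 < t by exact: lt_le_trans at_.
  rewrite normcM normcN normc_rpw ler_wpM2l ?normc_ge0// ler_expR.
  have -> : complex.Re (- s - 1) = - (complex.Re s + 1) by rewrite cReD !cReN /=; ring.
  have : ln a <= ln t by rewrite ler_ln.
  nra.
- rewrite -[X in _ <= X]mulr1 ler_wpM2l//; last lra.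
  by rewrite mulr_ge0 ?normc_ge0 ?expR_ge0.
Qed.

(** Compares a^(-s) with the integral of x^(-s) over [a, a + 1]: [P] is a primitive of x^(-s) -
    a^(-s), which is small on this interval. *)
Lemma rpw_trapezoid (a : R) s : 0 < a -> -1 <= complex.Re s -> s != 1 ->
  normc (rpw (a + 1) (1 - s) / (1 - s) - rpw a (1 - s) / (1 - s) - rpw a (- s)) <=
  normc s * expR (- (complex.Re s + 1) * ln a).
Proof.
move=> a0 s1 sn1; have s10 : 1 - s != 0 by rewrite subr_eq0 eq_sym.
have aa1 : a <= a + 1 by rewrite lerDl.
pose P x := (1 - s)^-1 * rpw x (1 - s) - rpw a (- s) * x%:C.
have := @rder_mvt _ P (fun x => rpw x (- s) - rpw a (- s)) a (a + 1)
  (normc s * expR (- (complex.Re s + 1) * ln a)) aa1.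
have -> : a + 1 - a = 1 by ring.
rewrite mulr1; have -> : P (a + 1) - P a =
    rpw (a + 1) (1 - s) / (1 - s) - rpw a (1 - s) / (1 - s) - rpw a (- s).
  by rewrite /P rmorphD /=; ring.
apply.
- move=> t /andP[at_ _]; have t0 : 0 < t by exact: lt_le_trans at_.
  apply: rderB.
    have := rder_lin (1 - s)^-1 (rder_rpw (1 - s) t0).
    rewrite mulKf//; by have -> : 1 - s - 1 = - s by ring.
  have := @rder_affine _ 0 (rpw a (- s)) t.
  by rewrite (_ : (fun x => 0 + _) = (fun x => rpw a (- s) * x%:C))//; apply/funext => x; rewrite add0r.
- move=> t /andP[at_ ta]; exact: rpw_diff.
Qed.

Lemma expR_ln_decay (al : R) : 0 < al ->
  (fun n => expR (- al * ln n.+1%:R)) @ \oo --> (0 : R).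
Proof.
move=> al0; apply/rcvgP => e e0.
exists (Num.bound (expR (- ln e / al))) => n Nn; rewrite subr0 ger0_norm ?expR_ge0//.
rewrite -[X in _ < X]lnK ?posrE// ltr_expR.
have h : expR (- ln e / al) < n.+1%:R.
  apply: lt_le_trans (archi_boundP (expR_ge0 _)) _.
  by rewrite ler_nat (leq_trans Nn).
have : - ln e / al < ln n.+1%:R by rewrite -[X in X < _]expRK ltr_ln ?posrE ?expR_gt0.
rewrite ltr_pdivrMr// mulNr mulrC => H; lra.
Qed.

(** The right-hand side is 1 plus the integral of x^(-sg - 1) from 1 to N + 1; each new term is at
    most the new piece of that integral. *)
Lemma zeta_tail_bound (sg : R) N : 0 < sg ->
  \sum_(0 <= k < N.+1) expR (- (sg + 1) * ln k.+1%:R) <=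
  1 + sg^-1 * (1 - expR (- sg * ln N.+1%:R)).
Proof.
move=> sg0; elim: N => [|N IH].
  by rewrite big_nat1 ln1 !mulr0 expR0 subrr mulr0 addr0.
rewrite big_nat_recr//=; apply: le_trans (lerD IH (lexx _)) _.
set y : R := N.+1%:R; set z : R := N.+2%:R.
have y0 : 0 < y by rewrite ltr0Sn.
have z0 : 0 < z by rewrite ltr0Sn.
have zy : z = y + 1 by rewrite /z /y -natr1.
suff : expR (- (sg + 1) * ln z) <= sg^-1 * (expR (- sg * ln y) - expR (- sg * ln z)) by lra.
rewrite -(ler_pM2l sg0) mulVKf ?gt_eqF//.
have -> : - (sg + 1) * ln z = - sg * ln z + - ln z by ring.
have -> : - sg * ln y = - sg * ln z + sg * (ln z - ln y) by ring.
rewrite !expRD expRN lnK ?posrE//.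
have h1 : 1 + sg * (ln z - ln y) <= expR (sg * (ln z - ln y)) by exact: expR_ge1Dx.
have h2 : z^-1 <= ln z - ln y.
  have : ln (1 + (y / z - 1)) <= y / z - 1.
    by apply: le_ln1Dx; rewrite ltrBrDl subrr divr_gt0.
  have -> : 1 + (y / z - 1) = y / z by ring.
  rewrite ln_div ?posrE//.
  have -> : y / z - 1 = - z^-1.
    have -> : y = z - 1 by rewrite zy addrK.
    by field; rewrite gt_eqF.
  move=> h; move: (ln y) (ln z) (z^-1) h => u v t; lra.
have e0 : 0 < expR (- sg * ln z) by exact: expR_gt0.
have : sg * z^-1 <= expR (sg * (ln z - ln y)) - 1.
  by rewrite lerBrDl; apply: le_trans h1; rewrite lerD2l ler_pM2l.
by move=> h; have := ler_wpM2l (ltW e0) h; rewrite [X in _ <= X -> _]mulrBr mulr1 mulrCA.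
Qed.

(** * Continuation and growth for bounded periodic coefficients *)

Section periodic.
Variables (x : nat -> R) (q : nat).
Hypotheses (q0 : (0 < q)%N) (xq : forall k, x (k + q)%N = x k) (x1 : forall k, `|x k| <= 1).

(** Removing the mean keeps the partial sums bounded even when the coefficients do not sum to 0 over
    a period, as for the trivial character. The mean itself contributes a multiple of zeta, with its
    pole at 1. *)
Let mean : R := (\sum_(0 <= k < q) x k) / q%:R.
Let A n : R := \sum_(0 <= k < n) x k - mean * n%:R.

Let qR : 0 < q%:R :> R. Proof. by rewrite ltr0n. Qed.

Let sum_le n : `|\sum_(0 <= k < n) x k| <= n%:R.
Proof.
elim: n => [|n IH]; first by rewrite big_nil normr0.
rewrite big_nat_recr//= -natr1; apply: le_trans (ler_normD _ _) _; exact: lerD.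
Qed.

Let mean_le : `|mean| <= 1.
Proof. by rewrite /mean normrM normfV [`|q%:R|]ger0_norm// ler_pdivrMr// mul1r. Qed.

(** [A] has period [q], and over one period the trivial bound suffices. *)
Let A_le n : `|A n| <= 2 * q%:R.
Proof.
have [k] := ubnP n; elim: k n => // k IH n nk.
have [nq|qn] := ltnP n q.
  apply: le_trans (ler_normB _ _) _; rewrite normrM [`|n%:R|]ger0_norm//.
  have h : n%:R <= q%:R :> R by rewrite ler_nat ltnW.
  have := sum_le n; have := mean_le; have : 0 <= n%:R :> R by [].
  have := normr_ge0 mean; nra.
have nE : (n = q + (n - q))%N by rewrite subnKC.
suff -> : A n = A (n - q)%N by apply: IH; lia.
rewrite /A {1 2}nE (@big_cat_nat _ _ _ q) ?leq_addr//= natrD mulrDr.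
have -> : \sum_(q <= i < q + (n - q)) x i = \sum_(0 <= i < n - q) x i.
  by rewrite -{1}[q]add0n big_addn addKn; apply: eq_bigr => i _; rewrite xq.
have -> : mean * q%:R = \sum_(0 <= k < q) x k by rewrite /mean divfK// gt_eqF.
ring.
Qed.

(** Summation by parts for the mean-free coefficients, plus the error in replacing (k + 1)^(-s) by
    its integral over [k + 1, k + 2] for the mean. Both parts are O(|s| (k + 1)^(- Re s - 1)), hence
    summable for Re s > 0. *)
Let term k s : C := (A k.+1)%:C * (rpw k.+1%:R (- s) - rpw k.+2%:R (- s)) +
  mean%:C * (rpw k.+1%:R (- s) - (rpw k.+2%:R (1 - s) / (1 - s) - rpw k.+1%:R (1 - s) / (1 - s))).

Let term_le k s (sg : R) : 0 < sg -> sg <= complex.Re s -> s != 1 ->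
  normc (term k s) <= (2 * q%:R + 1) * normc s * expR (- (sg + 1) * ln k.+1%:R).
Proof.
move=> sg0 sgs s1.
have k0 : 0 < k.+1%:R :> R by rewrite ltr0Sn.
have kS : k.+2%:R = k.+1%:R + 1 :> R by rewrite -natr1.
have sN : -1 <= complex.Re s by lra.
set B := expR (- (complex.Re s + 1) * ln k.+1%:R).
have h1 : normc (rpw k.+1%:R (- s) - rpw k.+2%:R (- s)) <= normc s * B.
  by rewrite normcB; apply: rpw_diff; rewrite ?kS ?lerDl.
have h2 : normc (rpw k.+1%:R (- s) - (rpw k.+2%:R (1 - s) / (1 - s) - rpw k.+1%:R (1 - s) / (1 - s))) <= normc s * B.
  by rewrite normcB kS; apply: rpw_trapezoid.
have BB : B <= expR (- (sg + 1) * ln k.+1%:R).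
  rewrite ler_expR; have : 0 <= ln k.+1%:R :> R by rewrite ln_ge0// ler1n.
  nra.
apply: (@le_trans _ _ ((2 * q%:R + 1) * normc s * B)); last first.
  by rewrite ler_wpM2l// mulr_ge0 ?normc_ge0// addr_ge0// mulr_ge0.
apply: le_trans (le_normcD _ _) _; rewrite !normcM !normc_real.
have sB : 0 <= normc s * B by rewrite mulr_ge0 ?normc_ge0 ?expR_ge0.
rewrite -mulrA mulrDl; apply: lerD; apply: ler_pM => //; try exact: normc_ge0.
Qed.

Let term_holo k s : s != 1 -> holo (term k) s.
Proof.
move=> s1; have hN y : holo (fun s => rpw y (- s)) s.
  by apply: (@holo_comp _ (fun s => - s)); [apply: holoN; exact: holo_id|exact: holo_rpw].
have hP y : holo (fun s => rpw y (1 - s) / (1 - s)) s.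
  have h : holo (fun s => 1 - s) s by apply: holoB; [exact: holo_cst|exact: holo_id].
  apply: holo_div => //; last by rewrite subr_eq0 eq_sym.
  by apply: (@holo_comp _ (fun s => 1 - s)) => //; exact: holo_rpw.
apply: holoD; apply: holoM; try exact: holo_cst; apply: holoB => //.
by apply: holoB.
Qed.

Let partial_sum N s : s != 1 -> \sum_(0 <= k < N) (x k)%:C * rpw k.+1%:R (- s) =
  \sum_(0 <= k < N) term k s + ((A N)%:C * rpw N.+1%:R (- s) +
  mean%:C * (rpw N.+1%:R (1 - s) / (1 - s) - 1 / (1 - s))) :> C.
Proof.
move=> s1; have s10 : 1 - s != 0 by rewrite subr_eq0 eq_sym.
elim: N => [|N IH].
  rewrite !big_nil /A big_nil mulr0 subr0 mul0r /rpw ln1 !mulr0 expc0; ring.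
rewrite [LHS]big_nat_recr//= IH [in RHS]big_nat_recr//=.
move: (\sum_(0 <= k < N) term k s) => S; rewrite /term.
have -> : A N.+1 = A N + x N - mean by rewrite /A big_nat_recr//= -natr1; ring.
rewrite !rmorphB !rmorphD /=.
move: (A N) (x N) mean (rpw N.+2%:R _) (rpw N.+2%:R _) (rpw N.+1%:R _) (rpw N.+1%:R _) => a b m p1 p2 p3 p4.
by field.
Qed.

(** For Re s > 0 the sum of [term] minus mean / (1 - s) continues the Dirichlet series, and it
    equals L on the disc by the identity theorem. It is O(|s|) there, with |s| <= 2 T. *)
Lemma periodic_dirichlet_growth (L : C -> C) (rho : R) : 0 < rho < 2 ->
  (forall s, s != 1 -> holo L s) ->
  (forall s, 1 < complex.Re s ->
     ccvg (fun N => \sum_(0 <= k < N) (x k)%:C * rpw k.+1%:R (- s)) (L s)) ->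
  exists K : R, forall T w, 4 <= T -> normc (w - (2 +i* T)) <= rho -> normc (L w) <= K * T.
Proof.
move=> /andP[rho0 rho2] hL Lser.
(* A radius strictly between [rho] and 2: on the disc of radius [r] about 2 + i T the real part
   stays above sg = 2 - r > 0. *)
pose r := (rho + 2) / 2; pose sg := 2 - r.
have rr : rho < r by rewrite /r; lra.
have r2 : r < 2 by rewrite /r; lra.
have sg0 : 0 < sg by rewrite /sg; lra.
pose S := 1 + sg^-1.
have S0 : 0 < S by rewrite /S ltr_wpDr// invr_ge0 ltW.
have sumS N : \sum_(0 <= k < N) expR (- (sg + 1) * ln k.+1%:R) <= S.
  case: N => [|N]; first by rewrite big_nil ltW.
  apply: le_trans (zeta_tail_bound N sg0) _; rewrite /S lerD2l ger_pMr ?invr_gt0//.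
pose K1 := (2 * q%:R + 1) * S.
have K10 : 0 <= K1 by rewrite /K1 mulr_ge0 ?ltW// addr_gt0// mulr_gt0.
exists (2 * K1 + 1) => T w T4 wr.
set c := 2 +i* T in wr.
(* T >= 4 keeps the imaginary parts at least 2, hence away from the possible pole at 1. *)
have geo z : normc (z - c) < r -> [/\ sg <= complex.Re z, T - 2 <= complex.Im z,
    normc z <= 2 * T & z != 1].
  move=> zr; have h1 := le_lt_trans (le_Re_normc _) zr; have h2 := le_lt_trans (le_Im_normc _) zr.
  move: h1 h2; rewrite cReD cImD cReN cImN /= !ltr_norml => /andP[a1 a2] /andP[b1 b2].
  have i2 : T - 2 <= complex.Im z by lra.
  split => //; first by rewrite /sg; lra.
    have : normc z <= normc (z - c) + normc c.
      by apply: le_trans (le_normcD _ _); rewrite subrK.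
    have : normc c <= 2 + T.
      apply: le_trans (normc_le _) _; rewrite /= ger0_norm// ger0_norm//; lra.
    lra.
  apply/eqP => z1; move: i2; rewrite z1 /=; lra.
pose G N z := \sum_(0 <= k < N) term k z.
have GM N z : normc (z - c) < r -> normc (G N z) <= K1 * (2 * T).
  move=> /geo[z1 z2 z3 z4]; apply: le_trans (normc_sum _ _ _) _.
  apply: (@le_trans _ _ (\sum_(0 <= k < N) (2 * q%:R + 1) * (2 * T) * expR (- (sg + 1) * ln k.+1%:R))).
    apply: ler_sum => k _; apply: le_trans (term_le k sg0 z1 z4) _.
    rewrite ler_wpM2r ?expR_ge0// ler_wpM2l// addr_ge0// mulr_ge0.
  rewrite -mulr_sumr /K1 [_ * S * _]mulrAC ler_wpM2l//.
  by rewrite mulr_ge0 ?addr_ge0 ?mulr_ge0//; lra.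
have exE z : exists l, normc (z - c) < r -> ccvg (G ^~ z) l.
  have [zr|_] := ltrP (normc (z - c)) r; last by exists 0.
  have [z1 z2 z3 z4] := geo z zr.
  have [|l hl] := @ccvg_series (term ^~ z)
    (fun k => (2 * q%:R + 1) * normc z * expR (- (sg + 1) * ln k.+1%:R))
    ((2 * q%:R + 1) * normc z * S) (fun k => term_le k sg0 z1 z4).
    move=> N; rewrite -mulr_sumr ler_wpM2l// mulr_ge0 ?normc_ge0// addr_ge0// mulr_ge0.
  by exists l.
have [E hE] := choice exE.
have holoE : holo_disc E c r.
  apply: (@holo_limit G E c r (K1 * (2 * T))) => // n z zr.
  by have [_ _ _ z4] := geo z zr; apply: holo_sum => k; exact: term_holo.
pose D z := L z - (E z + - (mean%:C / (1 - z))).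
have holoD' : holo_disc D c r.
  move=> z zr; have [_ _ _ z4] := geo z zr; apply: holoB; first exact: hL.
  apply: holoD; first exact: holoE.
  apply: holoN; apply: holo_div; first exact: holo_cst.
    by apply: holoB; [exact: holo_cst|exact: holo_id].
  by rewrite subr_eq0 eq_sym.
(* Within distance 1 of the centre Re z > 1, so the Dirichlet series itself converges, and the
   boundary terms of the summation by parts tend to their limits. *)
have D0 z : normc (z - c) < 1 -> D z = 0.
  move=> zc1; have zr : normc (z - c) < r by apply: lt_trans zc1 _; rewrite /r; lra.
  have [_ _ _ z4] := geo z zr.
  have z1 : 1 < complex.Re z.
    have := le_lt_trans (le_Re_normc _) zc1; rewrite cReD cReN /= ltr_norml; lra.
  have z10 : 1 - z != 0 by rewrite subr_eq0 eq_sym.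
  apply/eqP; rewrite subr_eq0; apply/eqP; apply: (ccvg_uniq (Lser z z1)).
  rewrite (_ : (fun N => _) = (fun N => G N z + ((A N)%:C * rpw N.+1%:R (- z) +
     mean%:C * (rpw N.+1%:R (1 - z) / (1 - z) - 1 / (1 - z))))); last first.
    by apply/funext => N; exact: partial_sum.
  apply: ccvgD; first exact: hE.
  have -> : - (mean%:C / (1 - z)) = 0 + mean%:C * (0 / (1 - z) - 1 / (1 - z)) by ring.
  have dec al v : 0 < al -> complex.Re v = - al -> ccvg (fun N => rpw N.+1%:R v) 0.
    move=> al0 Rv e e0; have [N HN] := (rcvgP _ _).1 (expR_ln_decay al0) e e0.
    exists N => n /HN; rewrite !subr0 normc_rpw Rv ger0_norm ?expR_ge0//.
  apply: ccvgD.
    move=> e e0; have q2 : 0 < 2 * q%:R :> R by rewrite mulr_gt0.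
    have [|//|N HN] := dec (complex.Re z) (- z) _ _ (e / (2 * q%:R)) (divr_gt0 e0 q2).
    - by lra.
    - by rewrite cReN.
    exists N => n /HN; rewrite !subr0 ltr_pdivlMr// => h.
    apply: le_lt_trans h; rewrite normcM normc_real mulrC ler_wpM2l ?normc_ge0//; exact: A_le.
  apply: ccvgM; first exact: ccvg_cst.
  apply: ccvgD; last exact: ccvg_cst.
  apply: ccvgM; last exact: ccvg_cst.
  apply: (dec (complex.Re z - 1)); first lra.
  by rewrite cReD cReN /=; ring.
have wr' : normc (w - c) < r by exact: le_lt_trans rr.
have [_ w2 _ w4] := geo w wr'.
have := identity_disc ltr01 holoD' D0 wr'; rewrite /D => /eqP; rewrite subr_eq0 => /eqP ->.
apply: le_trans (le_normcD _ _) _; rewrite normcN normcM normc_real.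
have hEw : normc (E w) <= K1 * (2 * T) by apply: ccvg_le (hE w wr') _ => n; exact: GM.
have h1w : 1 <= normc (1 - w).
  apply: le_trans (le_Im_normc _); rewrite cImD cImN /= sub0r normrN ger0_norm; lra.
have : `|mean| * normc (1 - w)^-1 <= 1.
  rewrite normcV ler_pdivrMr ?(lt_le_trans ltr01)// mul1r; exact: le_trans mean_le h1w.
rewrite normcV -normcV; lra.
Qed.

(** The terms after the first add up to at most 3 / 4 in modulus: 1 / 4 from the second, then a
    telescoping comparison with 1 / k - 1 / (k + 1). *)
Lemma dirichlet_lower (L : C) (T : R) : x 0%N = 1 ->
  ccvg (fun N => \sum_(0 <= k < N) (x k)%:C * rpw k.+1%:R (- (2 +i* T))) L -> 4^-1 <= normc L.
Proof.
move=> x01 cL; set c := 2 +i* T in cL.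
have nr k : normc (rpw k.+1%:R (- c)) = (k.+1%:R ^+ 2)^-1 :> R.
  rewrite normc_rpw cReN /= mulNr expRN; congr (_^-1).
  have -> : 2 * ln k.+1%:R = ln k.+1%:R + ln k.+1%:R :> R by ring.
  by rewrite expRD lnK ?posrE// expr2.
have bound N : normc (\sum_(0 <= k < N.+2) (x k)%:C * rpw k.+1%:R (- c) - 1) <= 3 / 4 - N.+2%:R^-1.
  elim: N => [|N IH].
    rewrite !big_nat_recr//= big_nil x01 add0r mul1r /rpw ln1 mulr0 expc0 [1 + _]addrC addrK.
    rewrite normcM normc_real -/(rpw 2 _) nr; have := x1 1%N.
    have : 0 < (2 ^+ 2)^-1 :> R by rewrite invr_gt0.
    have : (2 ^+ 2)^-1 = 4^-1 :> R by congr (_^-1); rewrite -natrX.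
    nra.
  rewrite big_nat_recr//= addrAC; apply: le_trans (le_normcD _ _) _.
  apply: le_trans (lerD IH (lexx _)) _; rewrite normcM normc_real nr.
  have n0 : 0 < N.+2%:R :> R by rewrite ltr0Sn.
  have nS : N.+3%:R = N.+2%:R + 1 :> R by rewrite -natr1.
  have h : (N.+3%:R ^+ 2)^-1 <= N.+2%:R^-1 - N.+3%:R^-1 :> R.
    rewrite nS; set y := N.+2%:R in n0 *.
    have -> : y^-1 - (y + 1)^-1 = (y * (y + 1))^-1 by field; rewrite !gt_eqF// addr_gt0.
    by rewrite lef_pV2 ?posrE ?mulr_gt0 ?exprn_gt0 ?addr_gt0// expr2 ler_wpM2r ?lerDl// ltW ?addr_gt0.
  have p0 : 0 <= (N.+3%:R ^+ 2)^-1 :> R by rewrite invr_ge0 sqr_ge0.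
  have hx : `|x N.+2| * (N.+3%:R ^+ 2)^-1 <= (N.+3%:R ^+ 2)^-1 by rewrite ler_piMl.
  by move: (x1 N.+2) hx h => _; move: (_ * _) (_^-1) (_^-1) (_^-1) => *; lra.
have cL1 : ccvg (fun N => \sum_(0 <= k < N.+2) (x k)%:C * rpw k.+1%:R (- c) - 1) (L - 1).
  apply: ccvgD; last exact: ccvg_cst.
  by move=> e /cL[N HN]; exists N => n Nn; apply: HN; lia.
have : normc (L - 1) <= 3 / 4.
  apply: ccvg_le cL1 _ => N; apply: le_trans (bound N) _.
  by rewrite gerBl invr_ge0.
have : 1 <= normc (L - 1) + normc L.
  have -> : 1 = normc (- (L - 1) + L) by rewrite opprB subrK normc1.
  by rewrite (le_trans (le_normcD _ _))// normcN.
lra.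
Qed.

End periodic.
End dirichlet_growth.

(** * Reflection in the real axis *)

Section reflection.
Variable R : realType.
Local Notation C := (R[i]^o).
Implicit Types (s z w c : C).

Lemma conjcE (z : C) : z^* = complex.Re z +i* - complex.Im z.
Proof. by case: z. Qed.

Lemma cder_conj (g : C -> C) s l : cder g s^* l -> cder (fun z => (g z^*)^*) s l^*.
Proof.
move=> H e e0; have [d d0 Hd] := H e e0; exists d => // h hd.
have := Hd h^*; rewrite normc_conj => /(_ hd).
by rewrite -normc_conj !(rmorphB, rmorphD, rmorphM) /= !conjcK.
Qed.

Lemma holo_conj (g : C -> C) s : holo g s^* -> holo (fun z => (g z^*)^*) s.
Proof. by move=> [l /cder_conj h]; exists l^*. Qed.

Lemma ccvg_conj (u : nat -> C) l : ccvg u l -> ccvg (fun n => (u n)^*) l^*.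
Proof.
move=> H e /H[N HN]; exists N => n /HN.
by rewrite -normc_conj rmorphB.
Qed.

Lemma expc_conj z : (expc z)^* = expc z^*.
Proof.
by case: z => a b; apply: eq_ReIm; rewrite conjcE /expc /cis ?cReM ?cImM /= ?cosN ?sinN; ring.
Qed.

Lemma conjcM z w : conjc (z * w) = conjc z * conjc w.
Proof. exact: rmorphM. Qed.

Lemma rpw_conj (x : R) z : (rpw x z)^* = rpw x z^*.
Proof.
rewrite /rpw expc_conj; congr (expc _); case: z => a b.
by apply: eq_ReIm; rewrite /= ?cReM ?cImM /=; ring.
Qed.

(** L and its reflection agree where the series converges; the identity theorem extends this, but on
    a disc that must avoid the possible pole at 1 and still contain s. *)
Lemma dirichlet_conj (x : nat -> R) (L : C -> C) : (forall s, s != 1 -> holo L s) ->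
  (forall s, 1 < complex.Re s ->
     ccvg (fun N => \sum_(0 <= k < N) (x k)%:C * rpw k.+1%:R (- s)) (L s)) ->
  forall s, complex.Im s != 0 -> L s^* = (L s)^*.
Proof.
move=> hL Lser.
suff pos s : 0 < complex.Im s -> L s^* = (L s)^*.
  move=> s; rewrite neq_lt => /orP[s0|/pos//].
  have p : 0 < complex.Im s^* by rewrite conjcE /= oppr_gt0.
  by have := pos _ p; rewrite conjcK => ->; rewrite conjcK.
move=> y0; set y := complex.Im s in y0; set sg := complex.Re s.
(* With this height |s - c|^2 = tau^2 - y tau, which is less than 1 + tau^2 = |c - 1|^2: the point s
   is nearer to c than 1 is. *)
pose tau := ((sg - 2) ^+ 2 + y ^+ 2) / y; pose c := 2 +i* tau : C.
have ytau : y * tau = (sg - 2) ^+ 2 + y ^+ 2 by rewrite /tau mulrC divfK// gt_eqF.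
pose D z := L z - (L z^*)^*; pose r := normc (c - 1).
have c1 : c != 1 by rewrite eq_complex /= negb_and gt_eqF ?ltr1n.
have sr : normc (s - c) < r.
  rewrite -(ltr_pXn2r (n := 2)) ?nnegrE ?normc_ge0// !normc_sqr !(cReD, cImD, cReN, cImN) /=.
  rewrite -/sg -/y; have := sqr_ge0 (sg - 2); have := sqr_ge0 y; nra.
have ne1 w : normc (w - c) < r -> w != 1.
  by move=> wr; apply/eqP => w1; move: wr; rewrite w1 normcB ltxx.
have conj1 z : (z^* == 1) = (z == 1) by rewrite -[1 in LHS](conjc1 R) (inj_eq (can_inj (@conjcK R))).
have hD : holo_disc D c r.
  move=> w /ne1 w1; apply: holoB; first exact: hL.
  by apply: holo_conj; apply: hL; rewrite conj1.
have D0 w : normc (w - c) < 1 -> D w = 0.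
  move=> wc; have w1 : 1 < complex.Re w.
    have := le_lt_trans (le_Re_normc _) wc; rewrite cReD cReN /= ltr_norml; lra.
  apply/eqP; rewrite subr_eq0; apply/eqP; apply: ccvg_uniq (Lser w w1) _.
  have w1' : 1 < complex.Re w^* by rewrite conjcE.
  have := ccvg_conj (Lser _ w1').
  rewrite (_ : (fun n => _) = (fun N => \sum_(0 <= k < N) (x k)%:C * rpw k.+1%:R (- w)))//.
  apply/funext => N; rewrite rmorph_sum; apply: eq_bigr => k _.
  change (((x k)%:C * rpw k.+1%:R (- w^*))^* = (x k)%:C * rpw k.+1%:R (- w) :> C).
  rewrite conjcM; congr (_ * _); first by apply: eq_ReIm; rewrite /= ?oppr0.
  have := rpw_conj k.+1%:R (- w^*); move=> ->; congr rpw.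
  by case: (w) => a b; apply: eq_ReIm; rewrite /= ?opprK.
have := identity_disc ltr01 hD D0 sr; rewrite /D => /eqP; rewrite subr_eq0 => /eqP ->.
by rewrite conjcK.
Qed.

Lemma logderiv_conj (L : C -> C) : (forall s, s != 1 -> holo L s) ->
  (forall s, complex.Im s != 0 -> L s^* = (L s)^*) ->
  forall s, complex.Im s != 0 -> logderiv L s^* = (logderiv L s)^*.
Proof.
move=> hL Lc s s0; rewrite /logderiv Lc// rmorphM /= fmorphV; congr (_ * _).
have s1 : s != 1 by apply/eqP => s1; move: s0; rewrite s1 /= eqxx.
apply: cder_derive1.
have h : cder (fun z => (L z^*)^*) s^* (derive1 L s)^*.
  by apply: cder_conj; rewrite conjcK; apply: holo_cder; exact: hL.
apply: cder_near h; apply/nbhsC.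
exists `|complex.Im s|; rewrite ?normr_gt0// => w ws; rewrite -Lc ?conjcK//.
apply/eqP => w0; have := le_lt_trans (le_Im_normc _) ws.
move: w0; rewrite cImD cImN !conjcE /= => /eqP; rewrite oppr_eq0 => /eqP ->.
by rewrite opprK add0r ltxx.
Qed.

(** Pigeonhole: of (size s) + 1 cells of equal width one contains no point of s, and its midpoint is
    half a cell away from all of them. *)
Lemma gap_point (s : seq R) (x w : R) : 0 < w -> exists2 y : R, x <= y <= x + w &
  forall a, a \in s -> w / (2 * (size s).+1%:R) <= `|y - a|.
Proof.
move=> w0; set N := (size s).+1.
have N0 : 0 < N%:R :> R by rewrite ltr0n.
pose h := w / N%:R; have h0 : 0 < h by rewrite divr_gt0.
pose idx a := Num.truncn ((a - x) / h).
have [k kN ks] : exists2 k, (k < N)%N & k \notin map idx s.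
  apply: contrapT => H; have : (N <= size (map idx s))%N.
    rewrite -[N](size_iota 0); apply: uniq_leq_size; first exact: iota_uniq.
    move=> k; rewrite mem_iota add0n /= => kN; apply/negPn/negP => ks; apply: H.
    by exists k.
  by rewrite size_map ltnn.
have kh : k%:R * h + h <= w.
  rewrite -[X in _ + X]mul1r -mulrDl natr1 /h mulrA ler_pdivrMr// mulrC ler_pM2l//.
  by rewrite ler_nat.
have k0 : 0 <= k%:R * h by rewrite mulr_ge0// ltW.
exists (x + k%:R * h + h / 2); first by apply/andP; split; lra.
move=> a /(map_f idx) as_; have -> : w / (2 * N%:R) = h / 2.
  by rewrite /h; field; rewrite gt_eqF.
rewrite leNgt; apply/negP; rewrite ltr_distlC => /andP[a1 a2].
move/negP: ks; apply; rewrite (_ : k = idx a)//; apply/esym/truncn_def.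
by rewrite ler_pdivlMr// ltr_pdivrMr// -natr1 mulrDl mul1r; apply/andP; split; lra.
Qed.

Lemma vbounded (F : R -> C) (a : R) : (forall y, ccont F y) ->
  exists M, forall y, `|y| <= a -> normc (F y) <= M.
Proof.
move=> cF; have [a0|a0] := ltrP a 0.
  by exists 0 => y ya; have := normr_ge0 y; lra.
have aa : - a <= a by lra.
have cn : {within `[- a, a], continuous (fun y => normc (F y))}.
  apply: continuous_subspaceT => y; apply/cvgrPdist_lt => e e0.
  have [d d0 hd] := (ccontP _ _).1 (cF y) e e0.
  near=> z; apply: le_lt_trans (hd z _); last first.
    by rewrite distrC; near: z; exact: cvgr_dist_lt.
  rewrite ler_norml; have := le_normc_dist (F y) (F z); have := le_normc_dist (F z) (F y).
  rewrite [normc (F y - _)]normcB; move=> *; apply/andP; split; lra.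
have [c _ hc] := EVT_max aa cn; exists (normc (F c)) => y ya; apply: hc.
by rewrite in_itv /=; move: ya; rewrite ler_norml.
Unshelve. all: by end_near.
Qed.

End reflection.

(** * Zeros of L and bounds for its logarithmic derivative *)

(** Converts the cardinality of a set of indices into counts over initial segments, which can be
    compared with multiplicities in a finite list of zeros. *)
Lemma count_card_II (A : pred nat) (m : nat) : ([set t | A t] #= `I_m)%card ->
  (forall M, (count A (iota 0 M) <= m)%N) /\
  exists M0, forall M, (M0 <= M)%N -> count A (iota 0 M) = m.
Proof.
move=> /card_set_bijP[f [fI finj fsurj]].
have up M : (count A (iota 0 M) <= m)%N.
  rewrite -size_filter -(size_map f) -[X in (_ <= X)%N](size_iota 0).
  apply: uniq_leq_size.
    rewrite map_inj_in_uniq ?filter_uniq ?iota_uniq// => x y.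
    by rewrite !mem_filter => /andP[xA _] /andP[yA _]; apply: finj; rewrite inE.
  by move=> x /mapP[y]; rewrite mem_filter => /andP[/fI yA _] ->; rewrite mem_iota.
split => //.
have exh i : exists j : nat, (i < m)%N -> A j /\ f j = i.
  have [im|] := boolP (i < m)%N; last by exists 0%N.
  by have [j jA ji] := fsurj i im; exists j.
have [h hh] := choice exh.
exists (\sum_(i <- iota 0 m) h i).+1 => M hM; apply/eqP; rewrite eqn_leq up /=.
rewrite -[X in (X <= _)%N](size_iota 0) -(size_map h) -size_filter; apply: uniq_leq_size.
  rewrite map_inj_in_uniq ?iota_uniq// => x y; rewrite !mem_iota /= => /hh[_ {2}<-] /hh[_ {2}<-].
  by move=> ->.
move=> x /mapP[i im ->]; rewrite mem_filter mem_iota /= add0n.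
have := im; rewrite mem_iota /= => /hh[-> _] /=; apply: leq_trans hM; rewrite ltnS.
by rewrite (big_rem i im) /= leq_addr.
Qed.

(** * Elementary bounds for real powers *)

Section power_bounds.
Variable R : realType.
Implicit Types (x y a ep : R).

Lemma powR_ge1 x ep : 1 <= x -> 0 <= ep -> 1 <= x `^ ep.
Proof. by move=> x1 e0; rewrite -(powRr0 x) ler_powR. Qed.

Lemma le_powRl x y ep : 0 <= ep -> 0 <= x -> x <= y -> x `^ ep <= y `^ ep.
Proof.
by move=> e0 x0 xy; apply: ge0_ler_powR; rewrite // nnegrE// (le_trans x0).
Qed.

Lemma ln_le_powR x ep : 0 < ep -> 1 <= x -> ln x <= x `^ ep / ep.
Proof.
move=> e0 x1; rewrite ler_pdivlMr// mulrC -ln_powR ltW// ln_sublinear//.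
by rewrite powR_gt0// (lt_le_trans ltr01).
Qed.

Lemma powRDl x a b : 0 < x -> x `^ (a + b) = x `^ a * x `^ b.
Proof. by move=> x0; rewrite powRD// (gt_eqF x0) implybT. Qed.

End power_bounds.

(** * Logarithmic derivative and ordinates under the Riemann hypothesis *)

Section critical_strip.
Variable R : realType.
Local Notation C := (R[i]^o).
Variables (L : C -> C) (g : nat -> R) (dl : R).
Hypotheses (dl0 : 0 < dl) (dl2 : dl < 2^-1)
 (hL : forall s, s != 1 -> holo L s)
 (Lconj : forall s, complex.Im s != 0 -> L s^* = (L s)^*)
 (Lgrow : forall rho : R, 0 < rho < 2 -> exists K : R, forall (T : R) (w : C),
    4 <= T -> normc (w - (2 +i* T)) <= rho -> normc (L w) <= K * T)
 (Llow : forall T : R, 4^-1 <= normc (L (2 +i* T)))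
 (rh : GRH L) (Lcentral : L 2^-1 <> 0)
 (gpos : forall t, 0 < g t) (gmono : {homo g : t u / (t <= u)%N >-> t <= u})
 (gzero : forall y : R, 0 < y -> exists2 m : nat,
        pzero L (2^-1 +i* y) m & ([set t | g t = y] #= `I_m)%card).

(** Discs are centred at 2 + i T. Radius [rad] reaches the line Re = 1/2 - dl with vertical slack
    [win], and rad + 3 win = 2 leaves room for the three larger radii of Landau's lemma inside Re >
    0. *)
Let win : R := (2^-1 - dl) / 4.
Let rad : R := 3 / 2 + dl + win.

Let consts : [/\ 0 < win, 1 < rad, rad + 3 * win = 2, 0 < dl & dl < 2^-1].
Proof. by move: (dl0) (dl2) => h1 h2; split => //; rewrite /rad /win; lra. Qed.

(** At centre 2 + i T the quantity ln E - ln |L c| of Landau's lemma is O(ln T), by linear growth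
    and the lower bound 1/4, and so O(T^ep). Inside the critical strip GRH places the zeros on the
    critical line; the others have real part at least 1. *)
Lemma landau_height (ep : R) : 0 < ep -> exists2 A : R, 0 < A & forall T : R, 4 <= T ->
  exists zs : seq C, [/\
    (forall a, a \in zs -> complex.Re a = 2^-1 \/ 1 <= complex.Re a),
    (forall s, normc (s - (2 +i* T)) < rad + win -> L s = 0 -> s \in zs) ,
    (forall s, normc (s - (2 +i* T)) < rad + win -> pzero L s (count_mem s zs)),
    (size zs)%:R <= A * T `^ ep &
    (forall s, normc (s - (2 +i* T)) <= rad -> L s != 0 ->
      normc (logderiv L s - \sum_(a <- zs) (s - a)^-1) <= A * T `^ ep)].
Proof.
move=> ep0; have [win0 rad0 rad2 _ _] := consts; pose r1 := rad + win; pose r2 := r1 + win; pose r3 := r2 + win / 2.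
have [|K LK] := @Lgrow r2; first by rewrite /r2 /r1; lra.
have rr1 : rad < r1 by rewrite /r1; lra.
have r12 : r1 < r2 by rewrite /r2; lra.
have r23 : r2 < r3 by rewrite /r3; lra.
have r10 : 0 < r1 by lra.
have r32 : r3 < 2 by rewrite /r3 /r2 /r1; lra.
have lnr0 : 0 < ln (r2 / r1) by rewrite ln_gt0// ltr_pdivlMr// mul1r.
pose c1 := 4 / (r1 - rad) * expR (4 * rad / (r1 - rad)) + r1 / (r2 ^+ 2 - r1 ^+ 2) / ln (r2 / r1).
pose c2 := `|ln (4 * K)| + ep^-1.
have c20 : 0 < c2 by rewrite /c2 ltr_wpDl// invr_gt0.
have c10 : 0 < c1.
  have h1 : 0 < r1 - rad by lra.
  have h2 : 0 < r2 ^+ 2 - r1 ^+ 2 by rewrite subr_gt0 ltr_pXn2r// ?nnegrE; lra.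
  by rewrite /c1 addr_gt0// ?mulr_gt0 ?expR_gt0 ?invr_gt0.
exists (c1 * c2 + c2 / ln (r2 / r1)); first by rewrite addr_gt0// ?mulr_gt0 ?invr_gt0.
move=> T T4; set c : C := 2 +i* T.
have T1 : 1 <= T by lra.
have geo s : normc (s - c) < r3 -> 0 < complex.Re s /\ 0 < complex.Im s.
  move=> sr; have := le_lt_trans (le_Re_normc _) sr; have := le_lt_trans (le_Im_normc _) sr.
  rewrite cImD cReD cImN cReN /= !ltr_norml; lra.
have Lc0 : 0 < normc (L c) by apply: lt_le_trans (Llow T); rewrite invr_gt0.
have KT : normc (L c) <= K * T by apply: LK => //; rewrite subrr normc0; lra.
have K0 : 0 < K by rewrite -(pmulr_lgt0 _ (lt_le_trans ltr01 T1)); exact: lt_le_trans KT.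
have hd : holo_disc L c r3.
  by move=> s /geo[_ h]; apply: hL; apply/eqP => s1; move: h; rewrite s1 /= ltxx.
have Lcn : L c != 0 by rewrite -normc_gt0.
have [zs [z1 z2 z3 z4]] := landau (ltW (lt_trans ltr01 rad0)) rr1 r12 r23 hd Lcn (fun w => @LK T w T4).
have Tp : 1 <= T `^ ep by apply: powR_ge1 => //; exact: ltW.
have EB : ln (K * T) - ln (normc (L c)) <= c2 * T `^ ep.
  have h1 : - ln 4 <= ln (normc (L c)).
    by rewrite -lnV ?posrE// ler_ln ?posrE//; exact: Llow.
  have h2 : ln (K * T) + ln 4 = ln (4 * K) + ln T.
    by rewrite !lnM ?posrE//; lra.
  have h3 := ln_le_powR ep0 T1.
  have h4 : ln (4 * K) <= `|ln (4 * K)| * T `^ ep.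
    by apply: le_trans (ler_norm _) _; rewrite ler_peMr.
  have -> : c2 * T `^ ep = `|ln (4 * K)| * T `^ ep + T `^ ep / ep by rewrite /c2; ring.
  lra.
have Tp0 : 0 <= T `^ ep by exact: powR_ge0.
exists zs; split.
- move=> a /z1[ar La]; have [h1 h2] := geo a (lt_trans ar (lt_trans r12 r23)).
  have [h|h] := ltrP (complex.Re a) 1; last by right.
  by left; apply: rh => //; rewrite h1.
- move=> s sr Ls; have /pzero_val := z2 s sr; rewrite Ls eqxx -has_count has_pred1.
  by move=> <- //; apply: hd; apply: lt_trans (lt_trans r12 r23).
- exact: z2.
- rewrite -ler_pdivlMr// in z3; apply: le_trans z3 _; rewrite [X in _ <= X]mulrDl ler_wpDl//.
    by rewrite !mulr_ge0// ltW.
  by rewrite mulrAC ler_wpM2r// invr_ge0 ltW.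
- move=> s sr Ls; apply: le_trans (z4 s sr Ls) _.
  rewrite [X in _ <= X]mulrDl ler_wpDr//; first by rewrite !mulr_ge0 ?invr_ge0// ltW.
  by rewrite -[X in _ <= X]mulrA -/c1 ler_wpM2l// ltW.
Qed.

Lemma count_ordinate (y : R) m : ([set t | g t = y] #= `I_m)%card ->
  (forall M, (count (fun t => g t == y) (iota 0 M) <= m)%N) /\
  exists M0, forall M, (M0 <= M)%N -> count (fun t => g t == y) (iota 0 M) = m.
Proof.
move=> h; apply: count_card_II.
by rewrite (_ : mkset _ = [set u | g u = y]) //; apply/seteqP; split => u /= /eqP.
Qed.

Lemma root_ordinate t : L (2^-1 +i* g t) = 0.
Proof.
have [m hm hc] := gzero (gpos t); have := pzero_val _ hm.
have [h _] := count_ordinate hc.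
have m0 : (0 < m)%N.
  apply: leq_trans (h t.+1); rewrite -has_count; apply/hasP; exists t => //.
  by rewrite mem_iota add0n ltnSn.
rewrite m0 => H; apply/eqP; apply: H; apply: hL; apply/eqP => /(congr1 (@complex.Im R)) /=.
by have := gpos t; lra.
Qed.

(** Bounded ordinates would increase to a limit y. The order of L at 1/2 + i y is finite, so zeros
    cannot accumulate there and the ordinates are eventually equal to y; but y occurs only finitely
    often. *)
Lemma ordinate_unbounded (B : R) : exists N, forall t, (N <= t)%N -> B < g t.
Proof.
apply: contrapT => H.
have gB t : g t <= B.
  rewrite leNgt; apply/negP => Bt; apply: H; exists t => u tu.
  exact: lt_le_trans (gmono tu).
have hs : has_sup (range g) by split; [exists (g 0%N); exists 0%N|exists B => _ [t _ <-]].
pose y := sup (range g).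
have gy t : g t <= y by apply: sup_upper_bound => //; exists t.
have y0 : 0 < y by exact: lt_le_trans (gpos 0) (gy 0%N).
have [m [h [hh h0 [d d0 Hd]]] /count_ordinate[cm _]] := gzero y0.
have [e e0 he] : exists2 e : R, 0 < e & forall w, normc (w - (2^-1 +i* y)) < e -> h w != 0.
  by apply/nbhsC; exact: holo_near_neq0.
have de : 0 < Num.min d e by rewrite lt_min d0.
have [_ [t0 _ <-] ht0] := sup_adherent de hs.
have gt t : (t0 <= t)%N -> g t = y.
  move=> t0t; apply/eqP; rewrite eq_le gy /= leNgt; apply/negP => gty.
  have : normc ((2^-1 +i* g t) - (2^-1 +i* y)) < Num.min d e.
    have -> : (2^-1 +i* g t) - (2^-1 +i* y) = 'i * (g t - y)%:C :> C.
      by apply: eq_ReIm; rewrite ?cReM ?cImM ?cReD ?cImD ?cReN ?cImN /=; ring.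
    rewrite normcM normc_i mul1r normc_real ltr_norml.
    by have := gmono t0t; move: ht0; rewrite -/y; move: (Num.min d e) de => q *; lra.
  rewrite lt_min => /andP[hd /he].
  have n0 : (2^-1 +i* g t) - (2^-1 +i* y) != 0 :> C.
    rewrite subr_eq0; apply/eqP => /(congr1 (@complex.Im R)) /=; lra.
  have := Hd (2^-1 +i* g t); rewrite hd normc_gt0 n0 => /(_ isT); rewrite root_ordinate => /esym/eqP.
  by rewrite mulf_eq0 expf_eq0 (negbTE n0) andbF /= => ->.
have := cm (t0 + m.+1)%N; rewrite iotaD count_cat add0n.
have -> : count (fun t => g t == y) (iota t0 m.+1) = m.+1.
  rewrite -[RHS](size_iota t0); apply/eqP; rewrite -all_count; apply/allP => t.
  by rewrite mem_iota => /andP[/gt -> _].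
lia.
Qed.

(** The ordinates in a window give a sub-multiset of the listed zeros, because at each point both
    multiplicities are tied to the order of L. *)
Let window_count (zs : seq C) (T : R) (M : nat) :
  (forall s, normc (s - (2 +i* T)) < rad + win -> pzero L s (count_mem s zs)) ->
  (count (fun t => (T <= g t <= T + win)%R) (iota 0 M) <= size zs)%N.
Proof.
move=> hz; pose s1 := [seq (2^-1 +i* g t : C) | t <- iota 0 M & T <= g t <= T + win].
have -> : count (fun t => (T <= g t <= T + win)%R) (iota 0 M) = size s1.
  by rewrite size_map size_filter.
have [s ss ps] : exists2 s : seq C, subseq s zs & perm_eq s1 s.
  apply/count_subseqP => x; have [xs|xs] := boolP (x \in s1); last first.
    by rewrite (count_memPn xs).
  move/mapP: xs => [t]; rewrite mem_filter => /andP[tT _] ->.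
  have [m hm /count_ordinate[cm _]] := gzero (gpos t).
  have -> : count_mem (2^-1 +i* g t : C) zs = m.
    apply: pzero_uniq hm; apply: hz.
    apply: le_lt_trans (normc_le _) _; rewrite cReD cImD cReN cImN /=.
    have -> : `|2^-1 - 2| = 3 / 2 :> R by rewrite ltr0_norm; [field|lra].
    rewrite ger0_norm; last by lra.
    by have [w0 _ _ d0 _] := consts; case/andP: tT; rewrite /rad; lra.
  apply: leq_trans (cm M); rewrite count_map count_filter; apply: sub_count => u /=.
  by move=> /andP[/eqP/(congr1 (@complex.Im R)) /= -> _].
by rewrite (perm_size ps) size_subseq.
Qed.

Lemma open_dom_neq1 : open_dom (fun w : C => w != 1).
Proof.
move=> w w1; exists (normc (w - 1)); first by rewrite normc_gt0 subr_eq0.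
by move=> z; apply: contraTneq => ->; rewrite normcB ltxx.
Qed.

Lemma holo_logderiv s : s != 1 -> L s != 0 -> holo (logderiv L) s.
Proof.
by move=> s1 L0; apply: holo_div => //; [exact: (holo_on_derive open_dom_neq1 hL)|exact: hL].
Qed.

Lemma normc_logderiv_conj s : complex.Im s != 0 -> normc (logderiv L (conjc s)) = normc (logderiv L s).
Proof. by move=> s0; rewrite logderiv_conj// normc_conj. Qed.

Lemma vline_neq0 (b y : R) : `|b - 2^-1| = dl -> L (b +i* y) != 0.
Proof.
have [_ _ _ d0 d2] := consts; move=> bd.
have : `|b - 2^-1| <= dl by rewrite bd.
rewrite ler_distlC => /andP[b1 b2].
apply/eqP => /rh /= h; have {}h : b = 2^-1 by apply: h; lra.
by move: bd; rewrite h subrr normr0; lra.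
Qed.

(** Listed zeros stay at distance at least [q] from the two lines, so the O(T^ep) terms of the sum
    over zeros are bounded by 1 / q each. Heights up to 4 follow by compactness, negative heights by
    conjugation. *)
Lemma vline_logderiv_bound (ep : R) : 0 < ep -> exists2 A : R, 0 < A &
  forall b y : R, `|b - 2^-1| = dl -> normc (logderiv L (b +i* y)) <= A * (1 + `|y|) `^ ep.
Proof.
move=> ep0; have [w0 r0 r2 d0 d2] := consts.
have [A A0 HA] := landau_height ep0.
(* [dl] is the distance to the critical line, and 1/2 - dl bounds from below the distance to zeros
   of real part at least 1. *)
pose q := Num.min dl (2^-1 - dl); have q0 : 0 < q by rewrite lt_min d0 subr_gt0.
have big (b T : R) : `|b - 2^-1| = dl -> 4 <= T ->
    normc (logderiv L (b +i* T)) <= (A + A / q) * T `^ ep.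
  move=> bd T4; have [zs [z1 _ _ z3 z4]] := HA T T4.
  have bd' : `|b - 2^-1| <= dl by rewrite bd.
  have := bd'; rewrite ler_distlC => /andP[b1 b2].
  have sr : normc ((b +i* T) - (2 +i* T)) <= rad.
    apply: le_trans (normc_le _) _; rewrite cReD cImD cReN cImN /= subrr normr0 addr0.
    rewrite ler0_norm; last by lra.
    by rewrite /rad; lra.
  have := z4 _ sr (vline_neq0 T bd) => h.
  have -> : logderiv L (b +i* T) = (logderiv L (b +i* T) - \sum_(a <- zs) ((b +i* T) - a)^-1)
    + \sum_(a <- zs) ((b +i* T) - a)^-1 by rewrite subrK.
  apply: le_trans (le_normcD _ _) _; rewrite mulrDl; apply: lerD => //.
  apply: le_trans (normc_sum _ _ _) _; apply: (@le_trans _ _ (\sum_(a <- zs) q^-1)); last first.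
    rewrite big_const_seq count_predT iter_addr_0 -mulr_natl mulrAC ler_wpM2r//.
    by rewrite invr_ge0 ltW.
  rewrite big_seq [X in _ <= X]big_seq; apply: ler_sum => a /z1 az.
  have qa : q <= normc (b +i* T - a).
    apply: le_trans (le_Re_normc _); rewrite cReD cReN /= /q.
    case: az => [->|az]; first by rewrite bd ge_min lexx.
    by rewrite distrC ger0_norm ?ge_min; [apply/orP; right|]; lra.
  by rewrite normcV lef_pV2 ?posrE// (lt_le_trans q0).
have [M HM] : exists M, forall b y : R, `|b - 2^-1| = dl -> `|y| <= 4 ->
    normc (logderiv L (b +i* y)) <= M.
  have cc b : `|b - 2^-1| = dl -> forall y, ccont (fun y => logderiv L (b +i* y)) y.
    move=> bd y; apply: ccont_vline; apply: holo_logderiv; last exact: vline_neq0.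
    apply/eqP => /(congr1 (@complex.Re R)) /= b1; move: bd; rewrite b1.
    by rewrite ger0_norm; lra.
  have bp : `|2^-1 + dl - 2^-1| = dl by rewrite addrC addKr ger0_norm// ltW.
  have bm : `|2^-1 - dl - 2^-1| = dl by rewrite addrC addKr normrN ger0_norm// ltW.
  have [M1 H1] := vbounded 4 (cc _ bp); have [M2 H2] := vbounded 4 (cc _ bm).
  exists (`|M1| + `|M2|) => b y bd y4.
  have [b0|b0] := ltrP (b - 2^-1) 0.
    have -> : b = 2^-1 - dl by move: bd; rewrite ltr0_norm//; lra.
    by apply: le_trans (H2 y y4) _; rewrite ler_wpDl// ler_norm.
  have -> : b = 2^-1 + dl by move: bd; rewrite ger0_norm//; lra.
  by apply: le_trans (H1 y y4) _; rewrite ler_wpDr// ler_norm.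
have A1 : 0 < A + A / q by rewrite addr_gt0// divr_gt0.
have M0 : 0 <= `|M| by [].
exists (`|M| + (A + A / q)); first by lra.
move=> b y bd; have y1 : 1 <= 1 + `|y| by rewrite lerDl.
have p1 : 1 <= (1 + `|y|) `^ ep by apply: powR_ge1 => //; exact: ltW.
have [y4|y4] := lerP `|y| 4.
  apply: le_trans (HM b y bd y4) _; apply: le_trans (ler_norm _) _.
  rewrite mulrDl ler_wpDr ?ler_peMr//; first by rewrite mulr_ge0// ltW.
have main : normc (logderiv L (b +i* `|y|)) <= (A + A / q) * `|y| `^ ep.
  by apply: big => //; exact: ltW.
have -> : normc (logderiv L (b +i* y)) = normc (logderiv L (b +i* `|y|)).
  have [y0|y0] := ger0P y; first by [].
  by rewrite -[LHS]normc_logderiv_conj /= ?lt_eqF.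
apply: le_trans main _; apply: (@le_trans _ _ ((A + A / q) * (1 + `|y|) `^ ep)).
  by rewrite ler_wpM2l//; [exact: ltW|apply: le_powRl => //; [exact: ltW|rewrite lerDr]].
by rewrite ler_wpM2r ?powR_ge0// lerDr.
Qed.

(** With O(T^ep) zeros nearby, some height in [T, T + win] keeps a distance of order T^(-ep) from
    all their ordinates; the sum over zeros is then O(T^ep) terms of size O(T^ep), whence the
    exponent ep + ep. *)
Lemma good_height (ep : R) : 0 < ep -> exists2 A : R, 0 < A & forall T : R, 4 <= T ->
  exists2 y : R, T <= y <= T + win & forall x : R, `|x - 2^-1| <= dl ->
    [/\ L (x +i* y) != 0, L (x +i* - y) != 0, normc (logderiv L (x +i* y)) <= A * T `^ (ep + ep) &
     normc (logderiv L (x +i* - y)) <= A * T `^ (ep + ep)].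
Proof.
move=> ep0; have [w0 r0 r2 d0 d2] := consts.
have [A A0 HA] := landau_height ep0.
exists (A + A * (2 * (A + 1)) / win).
  by rewrite addr_gt0// divr_gt0// !mulr_gt0// addr_gt0.
move=> T T4; have [zs [z1 z0 _ z3 z4]] := HA T T4.
have [y /andP[y1 y2] hy] := gap_point (map (@complex.Im R) zs) T w0.
exists y; first by rewrite y1.
have T1 : 1 <= T by lra.
have p1 : 1 <= T `^ ep by apply: powR_ge1 => //; exact: ltW.
have pp : T `^ ep <= T `^ (ep + ep).
  rewrite powRDl; last by lra.
  by rewrite ler_peMl// (le_trans ler01).
rewrite size_map in hy.
have gap0 : 0 < win / (2 * (size zs).+1%:R) by rewrite divr_gt0// mulr_gt0.
have upper x : `|x - 2^-1| <= dl -> L (x +i* y) != 0 /\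
    normc (logderiv L (x +i* y)) <= (A + A * (2 * (A + 1)) / win) * T `^ (ep + ep).
  move=> xd; have := xd; rewrite ler_distlC => /andP[x1 x2].
  have sr : normc ((x +i* y) - (2 +i* T)) <= rad.
    apply: le_trans (normc_le _) _; rewrite cReD cImD cReN cImN /=.
    rewrite ler0_norm; last by lra.
    rewrite ger0_norm; last by lra.
    by rewrite /rad; lra.
  have far a : a \in zs -> win / (2 * (size zs).+1%:R) <= normc ((x +i* y) - a).
    move=> az; apply: le_trans (hy _ (map_f _ az)) _; apply: le_trans (le_Im_normc _).
    by rewrite cImD cImN.
  have L0 : L (x +i* y) != 0.
    apply/eqP => /z0 h; have {}h : (x +i* y : C) \in zs by apply: h; lra.
    by have := far _ h; rewrite subrr normc0 leNgt gap0.
  split => //.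
  have -> : logderiv L (x +i* y) = (logderiv L (x +i* y) - \sum_(a <- zs) ((x +i* y) - a)^-1)
    + \sum_(a <- zs) ((x +i* y) - a)^-1 by rewrite subrK.
  apply: le_trans (le_normcD _ _) _; rewrite mulrDl; apply: lerD => //.
    by apply: le_trans (z4 _ sr L0) _; rewrite ler_wpM2l// ltW.
  apply: le_trans (normc_sum _ _ _) _.
  apply: (@le_trans _ _ (\sum_(a <- zs) (win / (2 * (size zs).+1%:R))^-1)).
    rewrite big_seq [X in _ <= X]big_seq; apply: ler_sum => a /far qa.
    by rewrite normcV lef_pV2 ?posrE// (lt_le_trans gap0).
  have nE : (size zs).+1%:R = (size zs)%:R + 1 :> R by rewrite natr1.
  rewrite big_const_seq count_predT iter_addr_0 -[_ *+ size zs]mulr_natl invf_div nE.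
  rewrite powRDl; last by lra.
  set N : R := (size zs)%:R in z3 *; have N0 : 0 <= N by [].
  have -> : A * (2 * (A + 1)) / win * (T `^ ep * T `^ ep) =
    (A * T `^ ep) * ((2 * ((A + 1) * T `^ ep)) / win) by ring.
  apply: ler_pM => //; first by apply: divr_ge0; [rewrite mulr_ge0 ?addr_ge0|exact: ltW].
  rewrite ler_pM2r ?invr_gt0// ler_pM2l// mulrDl mul1r; exact: lerD.
move=> x xd; have [u1 u2] := upper x xd; have y0 : y != 0 by rewrite gt_eqF//; lra.
have cE : (x +i* - y : C) = conjc (x +i* y) by [].
split => //; last by rewrite cE normc_logderiv_conj.
by rewrite cE Lconj//= -normc_eq0 normc_conj normc_eq0.
Qed.

(** Windows of length [win] above height 4 contain O(T^ep) ordinates each, and O(T) windows reach T;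
    [N0] accounts for the ordinates up to 4. *)
Lemma zero_count (ep : R) : 0 < ep -> exists2 A : R, 0 < A & forall (T : R) (M : nat),
  4 <= T -> (count (fun t => (g t <= T)%R) (iota 0 M))%:R <= A * T `^ (1 + ep).
Proof.
move=> ep0; have [w0 r0 r2 d0 d2] := consts.
have [A A0 HA] := landau_height ep0; have [N0 hN0] := ordinate_unbounded 4.
have win_le (T : R) (M : nat) : 4 <= T ->
    (count (fun t => (T <= g t <= T + win)%R) (iota 0 M))%:R <= A * T `^ ep.
  move=> /HA[zs [_ _ z2 z3 _]]; apply: le_trans z3; rewrite ler_nat; exact: window_count.
have step (j M : nat) : (count (fun t => (g t <= 4 + j%:R * win)%R) (iota 0 M))%:R <=
    N0%:R + j%:R * (A * (4 + j%:R * win) `^ ep).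
  elim: j => [|j IH].
    rewrite !mul0r !addr0 ler_nat -size_filter -[X in (_ <= X)%N](size_iota 0).
    apply: uniq_leq_size; first by rewrite filter_uniq ?iota_uniq.
    move=> t; rewrite mem_filter !mem_iota /= add0n => /andP[gt _].
    by rewrite ltnNge; apply/negP => /hN0; rewrite ltNge gt.
  set T := 4 + j%:R * win in IH; have T4 : 4 <= T by rewrite lerDl mulr_ge0// ltW.
  have -> : 4 + j.+1%:R * win = T + win by rewrite /T -natr1; ring.
  apply: (@le_trans _ _ ((count (fun t => (g t <= T)%R) (iota 0 M))%:R +
      (count (fun t => (T <= g t <= T + win)%R) (iota 0 M))%:R)).
    rewrite -natrD ler_nat -count_predUI; apply: leq_trans (leq_addr _ _).
    apply: sub_count => t /= gt; rewrite gt andbT; exact: le_total.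
  apply: le_trans (lerD IH (win_le T M T4)) _.
  have pT : T `^ ep <= (T + win) `^ ep.
    by apply: le_powRl; [exact: ltW|lra|rewrite lerDl ltW].
  have j0 : 0 <= j%:R :> R by [].
  have h : A * T `^ ep <= A * (T + win) `^ ep by rewrite ler_wpM2l// ltW.
  rewrite -natr1 mulrDl mul1r addrA; apply: lerD => //.
  by rewrite lerD2l ler_wpM2l.
have iw0 : 0 < win^-1 by rewrite invr_gt0.
have p20 : 0 < 2 `^ ep :> R by exact: powR_gt0.
have B0 : 0 < (win^-1 + 1) * (A * 2 `^ ep) by rewrite mulr_gt0 ?addr_gt0 ?mulr_gt0.
exists (N0%:R + (win^-1 + 1) * (A * 2 `^ ep)); first by rewrite ltr_wpDl.
move=> T M T4; have T1 : 1 <= T by lra.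
have T0 : 0 < T by lra.
pose j := (Num.truncn ((T - 4) / win)).+1.
have q0 : 0 <= (T - 4) / win by rewrite divr_ge0; lra.
have /andP[j1 j2] := truncn_itv q0.
have jT : T <= 4 + j%:R * win by move: j2; rewrite ltr_pdivrMr// -/j; lra.
have jw : (Num.truncn ((T - 4) / win))%:R * win <= T - 4 by rewrite -ler_pdivlMr.
have jE : j%:R = (Num.truncn ((T - 4) / win))%:R + 1 :> R by rewrite natr1.
have jT2 : 4 + j%:R * win <= 2 * T.
  by rewrite jE; move: jw; move: (Num.truncn _)%:R => u *; lra.
have jB : j%:R <= (win^-1 + 1) * T.
  rewrite jE [X in _ <= X]mulrDl mul1r; apply: lerD => //; apply: le_trans j1 _.
  by rewrite mulrC ler_pM2l//; lra.
apply: (@le_trans _ _ (count (fun t => (g t <= 4 + j%:R * win)%R) (iota 0 M))%:R).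
  rewrite ler_nat; apply: sub_count => t /= gt; exact: le_trans jT.
apply: le_trans (step j M) _; rewrite powRDl// powRr1; last exact: ltW.
have p1 : 1 <= T `^ ep by apply: powR_ge1 => //; exact: ltW.
rewrite mulrDl; apply: lerD.
  by rewrite ler_peMr// -[1]mulr1 ler_pM.
have -> : (win^-1 + 1) * (A * 2 `^ ep) * (T * T `^ ep) =
  ((win^-1 + 1) * T) * (A * (2 `^ ep * T `^ ep)) by ring.
have cw : 0 <= 4 + j%:R * win by rewrite addr_ge0// mulr_ge0// ltW.
apply: ler_pM => //; first by rewrite mulr_ge0 ?powR_ge0// ltW.
rewrite ler_pM2l// -powRM//; last exact: ltW.
by apply: le_powRl => //; exact: ltW.
Qed.

(** Inverting the count, t + 1 = O((1 + g t)^(1 + ep)), so the t-th term is O((t + 1)^(-be)) with be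
    = a / (1 + ep) > 1. *)
Lemma zero_sum_bound (a : R) : 1 < a -> exists M : R, forall N : nat,
  \sum_(0 <= t < N) (1 + g t) `^ (- a) <= M.
Proof.
move=> a1; pose ep := (a - 1) / 2; have ep0 : 0 < ep by rewrite /ep; lra.
have ep1 : 0 < 1 + ep by lra.
have [A A0 HA] := zero_count ep0.
(* The factor 4 appears because the count is applied at height 4 (1 + g t), which is at least 4 as
   required there. *)
pose be := a / (1 + ep); pose A' := A * 4 `^ (1 + ep).
have A'0 : 0 < A' by rewrite mulr_gt0// powR_gt0.
have be1 : 0 < be - 1 by rewrite subr_gt0 /be ltr_pdivlMr// mul1r /ep; lra.
have term t : (1 + g t) `^ (- a) <= expR (be * ln A') * expR (- (be - 1 + 1) * ln t.+1%:R).
  have g0 := gpos t.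
  have ct : t.+1%:R <= A' * (1 + g t) `^ (1 + ep).
    have := HA (4 * (1 + g t)) t.+1; rewrite (_ : count _ _ = t.+1); last first.
      rewrite -[RHS](size_iota 0 t.+1); apply/eqP; rewrite -all_count; apply/allP => u.
      rewrite mem_iota /= add0n ltnS => ut; apply: le_trans (gmono ut) _; lra.
    rewrite powRM//; last by lra.
    by rewrite mulrA; apply; lra.
  have p0 : 0 < (1 + g t) `^ (1 + ep) by rewrite powR_gt0//; lra.
  have : ln t.+1%:R <= ln A' + (1 + ep) * ln (1 + g t).
    by rewrite -ln_powR -lnM ?posrE// ler_ln ?posrE// mulr_gt0.
  rewrite -expRD /powR gt_eqF ?ler_expR; last by lra.
  move: (ln _) (ln A') (ln (1 + g t)) => u v w H.
  have bE : a = be * (1 + ep) by rewrite /be divfK// gt_eqF.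
  have be0 : 0 < be by lra.
  have := ler_wpM2l (ltW be0) H; rewrite mulrDr mulrA -bE; lra.
exists (expR (be * ln A') * (1 + (be - 1)^-1)) => N.
apply: le_trans (ler_sum _ (fun t _ => term t)) _.
rewrite -mulr_sumr ler_wpM2l ?expR_ge0//.
case: N => [|N]; first by rewrite big_nil addr_ge0// invr_ge0 ltW.
apply: le_trans (zeta_tail_bound N be1) _; rewrite lerD2l ger_pMr ?invr_gt0//.
Qed.

End critical_strip.

(** * Residues on rectangles *)

Section boundary_integrals.
Variable R : realType.
Local Notation C := (R[i]^o).
Local Notation mu := (@lebesgue_measure R).
Implicit Types (F G : C -> C).

Lemma atan_inv (x : R) : 0 < x -> atan x + atan x^-1 = pi / 2.
Proof.
move=> x0; have a1 := atan_gtNpi2 x; have a2 := atan_ltpi2 x.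
have a0 : 0 < atan x.
  rewrite ltNge; apply/negP => h.
  have : x <= 0.
    rewrite -[x]atanK /tan; have c0 : 0 < cos (atan x) by apply: cos_gt0_pihalf; rewrite a1 a2.
    rewrite ler_pdivrMr// mul0r -oppr_ge0 -sinN; apply: sin_ge0_pi.
    by have := @pi_gt0 R; lra.
  by rewrite leNgt x0.
have -> : x^-1 = tan (pi / 2 - atan x).
  by rewrite -{1}[x]atanK /tan sinB cosB sin_pihalf cos_pihalf !mul1r !mul0r subr0 add0r invf_div.
by rewrite tanK ?in_itv /=; [ring|apply/andP; split; lra].
Qed.

Lemma invcE (x u : R) : (x +i* u : C)^-1 = (x / (x ^+ 2 + u ^+ 2)) +i* (- u / (x ^+ 2 + u ^+ 2)).
Proof. by rewrite /GRing.inv /= mulNr. Qed.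

(** A logarithm along a horizontal line off the real axis. Writing its argument through atan((x - m)
    / u) keeps it smooth on the whole line, with no branch cut. *)
Lemma rder_log (m u x : R) : u != 0 ->
  rder (fun x => (ln ((x - m) ^+ 2 + u ^+ 2) / 2) +i* (- atan ((x - m) / u))) x ((x - m) +i* u)^-1.
Proof.
move=> u0; have p0 : 0 < (x - m) ^+ 2 + u ^+ 2.
  by rewrite ltr_wpDl ?sqr_ge0// exprn_even_gt0.
have dx : is_derive x (1 : R) (fun x : R => x - m) 1.
  by apply: is_derive_eq; rewrite subr0.
have dq : is_derive x (1 : R) (fun x : R => (x - m) ^+ 2 + u ^+ 2) (2 * (x - m)).
  apply: is_derive_eq; rewrite /GRing.scale /=; ring.
rewrite invcE; split => /=.
- have := @is_derive1_comp _ (@ln R) (fun x : R => (x - m) ^+ 2 + u ^+ 2) x _ _ (is_derive1_ln p0) dq.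
  move=> h; have := is_deriveM h (is_derive_cst (2^-1 : R) x 1) => h2.
  rewrite (_ : _ \o _ = (ln (R:=R) \o (fun x : R => (x - m) ^+ 2 + u ^+ 2)) * cst 2^-1)//.
  apply: is_derive_eq h2 _; rewrite /GRing.scale /=; field.
  by rewrite gt_eqF.
- have dq2 : is_derive x (1 : R) (fun x : R => (x - m) / u) u^-1.
    have := is_deriveM dx (is_derive_cst (u^-1 : R) x 1) => h2.
    by apply: is_derive_eq h2 _; rewrite /GRing.scale /=; ring.
  have := @is_derive1_comp _ (@atan R) (fun x : R => (x - m) / u) x _ _ (is_derive1_atan _) dq2.
  move=> h; have h2 := is_deriveN h.
  rewrite (_ : _ \o _ = - (atan (R:=R) \o (fun x : R => (x - m) / u)))//.
  apply: is_derive_eq h2 _; rewrite /GRing.scale /=.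
  have q0 : 1 + ((x - m) / u) ^+ 2 = ((x - m) ^+ 2 + u ^+ 2) / u ^+ 2 by field.
  rewrite q0; field; by rewrite u0 gt_eqF.
Qed.

Lemma cint_inv (m u a b : R) : a <= b -> u != 0 ->
  cint `[a, b] (fun x => ((x - m) +i* u)^-1) =
  ((ln ((b - m) ^+ 2 + u ^+ 2) - ln ((a - m) ^+ 2 + u ^+ 2)) / 2) +i*
   (atan ((a - m) / u) - atan ((b - m) / u)) :> C.
Proof.
move=> ab u0; rewrite (cint_FTC ab (fun x _ => rder_log m x u0)).
  by apply: eq_ReIm; rewrite ?cReD ?cImD ?cReN ?cImN /=; ring.
move=> x _; apply: (@cder_ccont _ (fun z : C => z^-1) (fun x : R => (x - m) +i* u)).
  by apply: holoV; [exact: holo_id|rewrite eq_complex /= negb_and u0 orbT].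
rewrite (_ : (fun x => _) = (fun x => ((- m) +i* u) + 1 * x%:C)); first exact: ccont_affine.
by apply/funext => y; apply: eq_ReIm; rewrite ?cReD ?cImD ?cReM ?cImM /=; ring.
Qed.

(** Over the four sides the logarithms cancel, and the arctangents combine by atan x + atan (1 / x)
    = pi / 2 to a total of 2 pi. *)
Lemma winding (d y y1 y2 : R) : 0 < d -> y1 < y < y2 ->
  rectint (fun z => (z - (0 +i* y))^-1) (- d) d y1 y2 = 2 * pi%:C * 'i.
Proof.
move=> d0 /andP[y1y yy2]; have dd : - d <= d by lra.
have y12 : y1 <= y2 by lra.
have hE (x t : R) : ((x +i* t) - (0 +i* y))^-1 = ((x - 0) +i* (t - y))^-1 :> C.
  by congr (_^-1); apply: eq_ReIm; rewrite ?cReD ?cImD ?cReN ?cImN /=; ring.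
have vE (x t : R) : ((x +i* t) - (0 +i* y))^-1 = - 'i * ((t - y) +i* (- x))^-1 :> C.
  have <- : ('i : C)^-1 = - 'i by rewrite /GRing.inv /=; apply: eq_ReIm; rewrite ?cReN ?cImN /=; field.
  rewrite -invfM; congr (_^-1); apply: eq_ReIm; rewrite ?cReM ?cImM ?cReD ?cImD ?cReN ?cImN /=; ring.
have u1 : y1 - y != 0 by rewrite lt_eqF//; lra.
have u2 : y2 - y != 0 by rewrite gt_eqF//; lra.
have dn : d != 0 by rewrite gt_eqF.
have iv (a : R) : a != 0 -> cintegrable `[y1, y2] (fun t : R => ((t - y) +i* a)^-1 : C).
  move=> a0; apply: ccont_cintegrable => t _.
  apply: (@cder_ccont _ (fun z : C => z^-1) (fun x : R => (x - y) +i* a)).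
    by apply: holoV; [exact: holo_id|rewrite eq_complex /= negb_and a0 orbT].
  rewrite (_ : (fun x => _) = (fun x => ((- y) +i* a) + 1 * x%:C)); first exact: ccont_affine.
  by apply/funext => x; apply: eq_ReIm; rewrite ?cReD ?cImD ?cReM ?cImM /=; ring.
rewrite /rectint.
rewrite (eq_cint (G := fun x => ((x - 0) +i* (y1 - y))^-1)); last by move=> x _; exact: hE.
rewrite (eq_cint (F := fun x => (x +i* y2 - 0 +i* y)^-1) (G := fun x => ((x - 0) +i* (y2 - y))^-1));
  last by move=> x _; exact: hE.
rewrite (eq_cint (F := fun t => (d +i* t - 0 +i* y)^-1) (G := fun t => - 'i * ((t - y) +i* (- d))^-1));
  last by move=> x _; exact: vE.
rewrite (eq_cint (F := fun t => (- d +i* t - 0 +i* y)^-1) (G := fun t => - 'i * ((t - y) +i* (- - d))^-1));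
  last by move=> x _; exact: vE.
rewrite opprK !cintZ ?cint_inv ?oppr_eq0//; try exact: measurable_itv; try (by apply: iv; rewrite ?oppr_eq0).
rewrite !subr0 !sqrrN !mulNr !invrN !mulrN !atanN.
have A1 := @atan_inv (d / (y2 - y)); have A2 := @atan_inv (d / (y - y1)).
rewrite !invf_div in A1 A2.
have {}A1 := A1 (divr_gt0 d0 _); have {}A2 := A2 (divr_gt0 d0 _).
have e1 : (y1 - y) / d = - ((y - y1) / d) by rewrite -mulNr opprB.
have e2 : d / (y1 - y) = - (d / (y - y1)) by rewrite -mulrN -invrN opprB.
rewrite e1 e2 !atanN.
have {}A1 := A1 ltac:(rewrite subr_gt0; exact: yy2).
have {}A2 := A2 ltac:(rewrite subr_gt0; exact: y1y).
have pE : pi = (atan (d / (y2 - y)) + atan ((y2 - y) / d)) + (atan (d / (y - y1)) + atan ((y - y1) / d)).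
  by rewrite A1 A2; field.
rewrite pE; move: (atan _) (atan _) (atan _) (atan _) (ln _) (ln _) => *.
by apply: eq_ReIm; rewrite ?cReM ?cImM ?cReD ?cImD ?cReN ?cImN ?cReM ?cImM /=; field.
Qed.

(** Holomorphy on the boundary alone, for integrands with poles inside the rectangle. *)
Definition holo_bd F (x1 x2 y1 y2 : R) :=
  (forall x, x1 <= x <= x2 -> holo F (x +i* y1) /\ holo F (x +i* y2)) /\
  (forall y, y1 <= y <= y2 -> holo F (x1 +i* y) /\ holo F (x2 +i* y)).

Lemma rectintD_bd F G (x1 x2 y1 y2 : R) :
  holo_bd F x1 x2 y1 y2 -> holo_bd G x1 x2 y1 y2 ->
  rectint (fun s => F s + G s) x1 x2 y1 y2 = rectint F x1 x2 y1 y2 + rectint G x1 x2 y1 y2.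
Proof.
move=> [F1 F2] [G1 G2].
have hz (K : C -> C) y : (forall x, x1 <= x <= x2 -> holo K (x +i* y)) ->
    cintegrable `[x1, x2] (fun x => K (x +i* y)).
  by move=> h; apply: ccont_cintegrable => x xx; apply: ccont_hline; exact: h.
have vt (K : C -> C) x : (forall y, y1 <= y <= y2 -> holo K (x +i* y)) ->
    cintegrable `[y1, y2] (fun y => K (x +i* y)).
  by move=> h; apply: ccont_cintegrable => y yy; apply: ccont_vline; exact: h.
rewrite /rectint !cintD//; try (by apply: hz => x /F1[]); try (by apply: hz => x /G1[]);
  try (by apply: vt => x /F2[]); try (by apply: vt => x /G2[]).
ring.
Qed.

Lemma eq_rectint_bd F G (x1 x2 y1 y2 : R) :
  (forall x, x1 <= x <= x2 -> F (x +i* y1) = G (x +i* y1) /\ F (x +i* y2) = G (x +i* y2)) ->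
  (forall y, y1 <= y <= y2 -> F (x1 +i* y) = G (x1 +i* y) /\ F (x2 +i* y) = G (x2 +i* y)) ->
  rectint F x1 x2 y1 y2 = rectint G x1 x2 y1 y2.
Proof.
move=> h1 h2; rewrite /rectint; congr (_ - _ + 'i * (_ - _)); apply: eq_cint => t;
  rewrite /= in_itv /=; by [move=> /h1[]|move=> /h2[]].
Qed.

Lemma rectint_sum_bd (I : eqType) (r : seq I) (F : I -> C -> C) (x1 x2 y1 y2 : R) :
  (forall i, i \in r -> holo_bd (F i) x1 x2 y1 y2) ->
  rectint (fun s => \sum_(i <- r) F i s) x1 x2 y1 y2 = \sum_(i <- r) rectint (F i) x1 x2 y1 y2.
Proof.
elim: r => [|i r IH] h.
  rewrite big_nil (_ : (fun s => _) = (fun=> 0)); last by apply/funext => s; rewrite big_nil.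
  by rewrite /rectint !cint0 !subr0 mulr0 addr0.
rewrite big_cons (_ : (fun s => \sum_(j <- i :: r) F j s) =
  (fun s => F i s + \sum_(j <- r) F j s)); last by apply/funext => s; rewrite big_cons.
rewrite rectintD_bd.
- by rewrite IH// => j jr; apply: h; rewrite inE jr orbT.
- by apply: h; rewrite mem_head.
- have hs s : (forall j, j \in r -> holo (F j) s) -> holo (fun s => \sum_(i <- r) F i s) s.
    move=> H; rewrite (_ : (fun s => _) = (fun s => \sum_(j <- r) (if j \in r then F j s else 0))).
      by apply: holo_sum => j; have [jr|_] := boolP (j \in r); [exact: H|exact: holo_cst].
    by apply/funext => z; rewrite big_seq [RHS]big_seq; apply: eq_bigr => j ->.
  have hr j : j \in r -> holo_bd (F j) x1 x2 y1 y2 by move=> jr; apply: h; rewrite inE jr orbT.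
  by split => t tt; split; apply: hs => j /hr[H1 H2]; by [have [] := H1 _ tt|have [] := H2 _ tt].
Qed.

(** On the boundary G(z) / (z - p) = dquot G p z + G(p) / (z - p). The first part is holomorphic
    inside and drops out by Goursat; the second is a winding number. *)
Lemma residue (G : C -> C) (d y y1 y2 : R) : 0 < d -> y1 < y < y2 ->
  (exists2 e : R, 0 < e & holo_disc G (0 +i* y) e) ->
  holo_rect G (- d) d y1 y2 ->
  rectint (fun z => (z - (0 +i* y))^-1 * G z) (- d) d y1 y2 = 2 * pi%:C * 'i * G (0 +i* y).
Proof.
move=> d0 yy [e e0 hG] hR; case/andP: (yy) => y1y yy2.
have dd : - d <= d by lra.
have y12 : y1 <= y2 by lra.
set p : C := 0 +i* y.
have bd (x t : R) : (`|x| = d) \/ (t = y1 \/ t = y2) -> x +i* t != p.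
  move=> h; apply/eqP => /eqP; rewrite eq_complex /= => /andP[/eqP x0 /eqP ty].
  case: h => [|[h|h]]; move: ty; rewrite ?x0 ?h ?normr0; lra.
have ad : `|d| = d by rewrite ger0_norm// ltW.
have ad' : `|- d| = d by rewrite normrN.
have hq : holo_rect (dquot G p) (- d) d y1 y2.
  move=> x t xx tt; have [->|np] := eqVneq (x +i* t : C) p.
    exact: (dquot_holo_center e0 hG).
  by apply: dquot_holo => //; exact: hR.
have hinv z : z != p -> holo (fun z => G p * (z - p)^-1) z.
  move=> zp; apply: holoM; first exact: holo_cst.
  by apply: holoV; [exact: holo_shift|rewrite subr_eq0].
rewrite (@eq_rectint_bd _ (fun z => dquot G p z + G p * (z - p)^-1)).
- rewrite rectintD_bd.
  + rewrite (goursat dd y12 hq) add0r; have -> : rectint (fun z => G p * (z - p)^-1) (- d) d y1 y2 =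
        G p * rectint (fun z => (z - p)^-1) (- d) d y1 y2.
      have hv z : z != p -> holo (fun z => (z - p)^-1) z.
        by move=> zp; apply: holoV; [exact: holo_shift|rewrite subr_eq0].
      have h1 (t : R) : t = y1 \/ t = y2 -> cintegrable `[(- d), d] (fun x => (x +i* t - p)^-1).
        move=> tt; apply: ccont_cintegrable => x _.
        by apply: (@ccont_hline _ (fun z => (z - p)^-1)); apply: hv; apply: bd; right.
      have h2 (x : R) : `|x| = d -> cintegrable `[y1, y2] (fun t => (x +i* t - p)^-1).
        move=> xx; apply: ccont_cintegrable => t _.
        by apply: (@ccont_vline _ (fun z => (z - p)^-1)); apply: hv; apply: bd; left.
      by rewrite /rectint !cintZ//; [ring|exact: h2|exact: h2|by apply: h1; right|by apply: h1; left].
    by rewrite winding// mulrC.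
  + split => t tt; split; apply: hq => //; rewrite ?lexx ?dd ?y12//.
  + split => t tt; split; apply: hinv; apply: bd; by [right; left|right; right|left].
- move=> x xx; split; have np : forall t : R, t = y1 \/ t = y2 -> (x +i* t - p != 0 :> C)%R
    by move=> t tt; rewrite subr_eq0; apply: bd; right.
  + have n := np y1 (or_introl erefl); rewrite /dquot -subr_eq0 (negbTE n).
    by move: (G _) (G p) => u v; field.
  + have n := np y2 (or_intror erefl); rewrite /dquot -subr_eq0 (negbTE n).
    by move: (G _) (G p) => u v; field.
- move=> t tt; split; have np : forall x : R, `|x| = d -> (x +i* t - p != 0 :> C)%R
    by move=> x xx; rewrite subr_eq0; apply: bd; left.
  + have n := np (- d) ad'; rewrite /dquot -subr_eq0 (negbTE n).
    by move: (G _) (G p) => u v; field.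
  + have n := np d ad; rewrite /dquot -subr_eq0 (negbTE n).
    by move: (G _) (G p) => u v; field.
Qed.

Lemma cint_mkcond (D : set (measurableTypeR R)) (F : R -> C) :
  cint D F = cint setT (fun y => if y \in D then F y else 0).
Proof.
rewrite /cint; congr (_ +i* _); rewrite Rintegral_mkcond; congr (Rintegral _ _ _);
  by apply/funext => y; rewrite patchE; case: ifP.
Qed.

Lemma cmeas_ccont (F : R -> C) : (forall y, ccont F y) -> cmeas setT F.
Proof.
by move=> cF; split; apply: continuous_measurable_fun => y; have [] := cF y.
Qed.

(** The truncation heights only have to diverge, since the heights avoiding the zeros of L form no
    regular sequence. *)
Lemma cvg_cint_trunc (F : R -> C) (h : R -> R) (Y : nat -> R) : (forall y, ccont F y) ->
  mu.-integrable setT (EFin \o h) -> (forall y, normc (F y) <= h y) ->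
  (forall B, exists N, forall n, (N <= n)%N -> B <= Y n) ->
  cintegrable setT F /\ ccvg (fun n => cint `[- Y n, Y n] F) (cint setT F).
Proof.
move=> cF ih Fh Yinf.
have h0 y : 0 <= h y by apply: le_trans (normc_ge0 _) (Fh y).
have [| | | |i1 i2] := @cdct _ setT (fun n y => if y \in `[- Y n, Y n]%classic then F y else 0) F h
  measurableT.
- move=> n; have [m1 m2] := cmeas_ccont cF; split.
    rewrite (_ : _ \o _ = (@complex.Re R \o F) \_ `[- Y n, Y n]%classic).
      by apply/(measurable_restrictT _ _).1 => //; exact: measurable_funTS.
    by apply/funext => y; rewrite patchE /=; case: ifP.
  rewrite (_ : _ \o _ = (@complex.Im R \o F) \_ `[- Y n, Y n]%classic).
    by apply/(measurable_restrictT _ _).1 => //; exact: measurable_funTS.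
  by apply/funext => y; rewrite patchE /=; case: ifP.
- exact: ih.
- by move=> n y _; case: ifP => _ //; rewrite normc0.
- move=> y _ e e0; have [N HN] := Yinf `|y|; exists N => n /HN Yn.
  rewrite ifT ?subrr ?normc0//; rewrite inE /= in_itv /= -ler_norml//.
split => //; rewrite (_ : (fun n => _) = (fun n =>
  cint setT (fun y => if y \in `[- Y n, Y n]%classic then F y else 0)))//.
by apply/funext => n; rewrite cint_mkcond.
Qed.

Definition weight (b y : R) : R := (1 + `|y|) `^ (- b).

Lemma weight_continuous b : continuous (weight b).
Proof.
move=> y; rewrite /weight; have y0 : 0 < 1 + `|y| by rewrite ltr_wpDr.
have -> : (fun y : R => (1 + `|y|) `^ (- b)) = (fun y : R => expR (- b * ln (1 + `|y|))).
  by apply/funext => z; rewrite /powR gt_eqF// ltr_wpDr.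
apply: (@continuous_comp R R R (fun y => - b * ln (1 + `|y|)) (@expR R)); last exact: continuous_expR.
apply: cvgM; first exact: cvg_cst.
apply: (@continuous_comp R R R (fun y => 1 + `|y|) (@ln R)); last exact: continuous_ln.
by apply: cvgD; [exact: cvg_cst|exact: norm_continuous].
Qed.

Lemma weight_ge0 b y : 0 <= weight b y. Proof. exact: powR_ge0. Qed.

Lemma weight_le_inv b y : 1 <= b -> 0 <= y -> weight b y <= (1 + y)^-1.
Proof.
move=> b1 y0; have y1 : 0 < 1 + y by rewrite ltr_wpDr.
rewrite /weight ger0_norm// powRN lef_pV2 ?posrE ?powR_gt0//.
rewrite -{1}[1 + y]powRr1 ?(ltW y1)//; apply: ler_powR => //.
by rewrite lerDl.
Qed.

Lemma weight_tail b (K e : R) (Y : nat -> R) : 1 <= b -> 0 <= K -> 0 < e ->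
  (forall n, n%:R <= Y n) -> exists N, forall n, (N <= n)%N -> K * weight b (Y n) < e.
Proof.
move=> b1 K0 e0 nY; exists (Num.bound (K / e)) => n Kn.
have Y0 : 0 <= Y n by apply: le_trans (nY n).
have Y1 : 0 < 1 + Y n by rewrite ltr_wpDr.
apply: le_lt_trans (ler_wpM2l K0 (weight_le_inv b1 Y0)) _.
rewrite ltr_pdivrMr// -ltr_pdivrMl// mulrC.
apply: lt_le_trans (archi_boundP (divr_ge0 K0 (ltW e0))) _.
apply: (@le_trans _ _ n%:R); first by rewrite ler_nat.
by apply: le_trans (nY n) _; rewrite lerDr.
Qed.

(** By symmetry it suffices to treat the positive half line, where (1 + x)^(1 - b) / (1 - b) is a
    primitive that vanishes at infinity. *)
Lemma weight_integrable b : 1 < b -> mu.-integrable setT (EFin \o weight b).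
Proof.
move=> b1; apply/integrableP; split.
  by apply/measurable_EFinP; apply: continuous_measurable_fun; exact: weight_continuous.
rewrite (_ : (\int[mu]_x `|(EFin \o weight b) x|)%E = (\int[mu]_x (weight b x)%:E)%E); last first.
  by apply: eq_integral => y _ /=; rewrite ger0_norm ?weight_ge0.
rewrite ge0_symfun_integralT; last 3 first.
- exact: weight_ge0.
- exact: weight_continuous.
- by move=> y; rewrite /weight /= normrN.
rewrite (_ : [set x : R | 0 <= x] = `[0, +oo[%classic); last first.
  by apply/seteqP; split => x /=; rewrite in_itv /= andbT.
have b10 : 1 - b != 0 by rewrite lt_eqF//; lra.
pose F (x : R) := (1 - b)^-1 * expR ((1 - b) * ln (1 + x)).
have dF (x : R) : 0 <= x -> is_derive x (1 : R) F (weight b x).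
  move=> x0; have x10 : 0 < 1 + x by lra.
  have d1 : is_derive x (1 : R) (fun x : R => 1 + x) 1.
    exact: (is_derive_eq (is_deriveD (is_derive_cst (1 : R) x (1 : R)) (is_derive_id x (1 : R))) (add0r _)).
  have d2 := @is_derive1_comp _ (@ln R) (fun x : R => 1 + x) x _ _ (is_derive1_ln x10) d1.
  have d3 : is_derive x (1 : R) (fun x : R => (1 - b) * ln (1 + x)) ((1 - b) / (1 + x)).
    have := is_deriveM (is_derive_cst (1 - b : R) x 1) d2 => h.
    by apply: is_derive_eq h _; rewrite /GRing.scale /=; ring.
  have d4 := @is_derive1_comp _ (@expR R) (fun x : R => (1 - b) * ln (1 + x)) x _ _
    (is_derive_expR _) d3.
  have := is_deriveM (is_derive_cst ((1 - b)^-1 : R) x 1) d4 => h.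
  apply: is_derive_eq h _; rewrite /GRing.scale /= /weight /powR gt_eqF ?ger0_norm//.
  have -> : (1 - b) * ln (1 + x) = ln (1 + x) + - b * ln (1 + x) by ring.
  by rewrite expRD lnK ?posrE//; field; rewrite b10 gt_eqF.
rewrite (@ge0_continuous_FTC2y _ (weight b) F 0 0).
- by rewrite -EFinB -EFinM ltry.
- by move=> x _; exact: weight_ge0.
- by apply: continuous_subspaceT; exact: weight_continuous.
- have -> : 0 = (1 - b)^-1 * 0 :> R by rewrite mulr0.
  apply: cvgM; first exact: cvg_cst.
  apply/cvgrPdist_lt => e e0; near=> x; rewrite sub0r normrN ger0_norm ?expR_ge0//.
  rewrite -[X in _ < X]lnK ?posrE// ltr_expR.
  have x0 : expR (- ln e / (b - 1)) < 1 + x.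
    rewrite -ltrBlDl; near: x; exact: nbhs_pinfty_gt.
  have : - ln e / (b - 1) < ln (1 + x).
    by rewrite -[X in X < _]expRK ltr_ln ?posrE ?expR_gt0// (lt_trans _ x0) ?expR_gt0.
  rewrite ltr_pdivrMr; last by lra.
  move: (ln _) (ln _) => u v; nra.
- by move=> x /ltW x0; have [] := dF x x0.
- apply: cvg_at_right_filter; have [h _] := dF 0 (lexx 0).
  exact/differentiable_continuous/derivable1_diffP.
- move=> x; rewrite in_itv /= andbT => /ltW x0; rewrite derive1E; exact: (@derive_val _ _ _ _ _ _ _ (dF x x0)).
Unshelve. all: by end_near.
Qed.

End boundary_integrals.

(** * The one-variable formula *)

Lemma halfC (R : realType) : 2^-1 = 2^-1 +i* 0 :> R[i]^o.
Proof. by rewrite -[2 in LHS](rmorph_nat (real_complex R)) -fmorphV. Qed.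

Lemma half_add (R : realType) (x y : R) : 2^-1 + (x +i* y) = (2^-1 + x) +i* y :> R[i]^o.
Proof. by rewrite halfC; apply: eq_ReIm; rewrite ?cReD ?cImD /= ?add0r. Qed.

(** * Residues at the zeros in a rectangle *)

Section residue_sum.
Variable R : realType.
Local Notation C := (R[i]^o).
Local Notation mu := (@lebesgue_measure R).
Variables (L : C -> C) (g : nat -> R) (dl : R).
Hypotheses (dl0 : 0 < dl) (dl2 : dl < 2^-1)
 (hL : forall s, s != 1 -> holo L s)
 (Lconj : forall s, complex.Im s != 0 -> L s^* = (L s)^*)
 (Lgrow : forall rho : R, 0 < rho < 2 -> exists K : R, forall (T : R) (w : C),
    4 <= T -> normc (w - (2 +i* T)) <= rho -> normc (L w) <= K * T)
 (Llow : forall T : R, 4^-1 <= normc (L (2 +i* T)))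
 (rh : GRH L) (Lcentral : L 2^-1 <> 0)
 (gpos : forall t, 0 < g t) (gmono : {homo g : t u / (t <= u)%N >-> t <= u})
 (gzero : forall y : R, 0 < y -> exists2 m : nat,
        pzero L (2^-1 +i* y) m & ([set t | g t = y] #= `I_m)%card).

Lemma pzero_conj s m : complex.Im s != 0 -> pzero L s m -> pzero L (conjc s) m.
Proof.
move=> s0 [h [hh h0 [d d0 Hd]]]; exists (fun z => conjc (h (conjc z))); split.
- by apply: holo_conj; rewrite conjcK.
- by rewrite conjcK -normc_eq0 normc_conj normc_eq0.
exists (Num.min d `|complex.Im s|); first by rewrite lt_min d0 normr_gt0.
move=> w; rewrite lt_min => /andP[w0 /andP[wd ws]].
have nE : normc (conjc w - s) = normc (w - conjc s).
  by rewrite -normc_conj; congr normc; case: (w) (s) => a b [a' b']; apply: eq_ReIm; rewrite /=; ring.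
have w0' : complex.Im w != 0.
  apply/eqP => wI; have := le_lt_trans (le_Im_normc _) ws.
  by rewrite cImD cImN wI conjcE /= opprK add0r ltxx.
have wI : complex.Im (conjc w) != 0 by rewrite conjcE /= oppr_eq0.
have := Lconj wI; rewrite conjcK => ->; rewrite Hd ?nE ?w0// conjcM; congr (_ * _).
have -> : conjc ((conjc w - s) ^+ m) = (conjc (conjc w - s)) ^+ m :> C by exact: rmorphXn.
by congr (_ ^+ _); case: (w) (s) => a b [a' b']; apply: eq_ReIm; rewrite /=; ring.
Qed.

Definition heights (k : nat) := [seq g t | t <- iota 0 k] ++ [seq - g t | t <- iota 0 k].

(** The hypothesis says that the first [k] ordinates are exactly those below [Y], so occurrences in
    the list count the full order; conjugation supplies the zeros below the real axis. *)
Lemma pzero_heights k (Y y : R) : (forall t, (t < k)%N = (g t < Y)) -> y != 0 -> `|y| < Y ->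
  pzero L (2^-1 +i* y) (count_mem (2^-1 +i* y : C) [seq (2^-1 +i* h : C) | h <- heights k]).
Proof.
move=> kY.
have memE (s : seq R) (u : R) : count_mem (2^-1 +i* u : C) [seq (2^-1 +i* h : C) | h <- s] =
    count_mem u s.
  rewrite count_map; apply: eq_count => h /=; apply/eqP/eqP => [/(congr1 (@complex.Im R))//|->//].
have pos u : 0 < u -> u < Y -> exists2 m, pzero L (2^-1 +i* u) m &
    count_mem u (heights k) = m /\ count_mem (- u) (heights k) = m.
  move=> u0 uY; have [m hm hc] := gzero u0; exists m => //.
  have [_ [M0 HM]] := count_ordinate hc; set M := maxn M0 k.
  have mE : count (fun t => g t == u) (iota 0 k) = m.
    rewrite -(HM M (leq_maxl _ _)); have -> : M = (k + (M - k))%N by rewrite subnKC ?leq_maxr.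
    rewrite iotaD count_cat add0n -[LHS]addn0; congr (_ + _)%N; apply/esym/eqP.
    rewrite eqn0Ngt -has_count; apply/hasPn => t; rewrite mem_iota => /andP[kt _].
    by apply/eqP => gt; move: kt; rewrite leqNgt kY gt uY.
  have z (s : seq nat) (v : R) : 0 < v -> count_mem (- v) [seq g t | t <- s] = 0%N.
    move=> v0; apply/eqP; rewrite eqn0Ngt -has_count; apply/hasPn => _ /mapP[t _ ->] /=.
    by apply/eqP => gt; have := gpos t; rewrite gt; lra.
  have z' (s : seq nat) (v : R) : 0 < v -> count_mem v [seq - g t | t <- s] = 0%N.
    move=> v0; apply/eqP; rewrite eqn0Ngt -has_count; apply/hasPn => _ /mapP[t _ ->] /=.
    by apply/eqP => gt; have := gpos t; move: v0; rewrite -gt; lra.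
  rewrite /heights !count_cat z// z'// addn0 add0n !count_map -mE; split => //.
  by apply: eq_count => t /=; rewrite eqr_opp.
rewrite memE neq_lt => /orP[y0|y0] yY.
  have ny0 : 0 < - y by lra.
  have nyY : - y < Y by rewrite -(ltr0_norm y0).
  have [m hm [_]] := pos _ ny0 nyY; rewrite opprK => ->.
  have := @pzero_conj (2^-1 +i* - y) m; rewrite /= opprK; apply => //.
  by rewrite gt_eqF.
have yY' : y < Y by rewrite -(gtr0_norm y0).
by have [m hm [-> _]] := pos _ y0 yY'.
Qed.

(** Dividing L by its listed zeros leaves a cofactor Q without zeros on the rectangle, by GRH,
    L(1/2) <> 0 and the nonvanishing on the horizontal sides. Hence L'/L is a sum of simple poles
    plus the holomorphic Q'/Q. *)
Lemma rect_residue k (Y eta : R) (G : C -> C) : 0 < Y -> dl < eta ->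
  (forall t, (t < k)%N = (g t < Y)) ->
  (forall x : R, `|x - 2^-1| <= dl -> L (x +i* Y) != 0 /\ L (x +i* - Y) != 0) ->
  (forall z, `|complex.Re z| < eta -> holo G z) ->
  rectint (fun z => logderiv L (2^-1 + z) * G z) (- dl) dl (- Y) Y =
  2 * pi%:C * 'i * \sum_(h <- heights k) G (0 +i* h).
Proof.
move=> Y0 dle kY hY hG.
have d0 := dl0; have d2 := dl2.
pose zs := [seq (2^-1 +i* h : C) | h <- heights k].
(* The points where the order of L is known; 1/2 and 1/2 + i Y, 1/2 - i Y are left out, L being
   nonzero there. *)
pose P (s : C) := [/\ complex.Re s = 2^-1, complex.Im s != 0 & `|complex.Im s| < Y].
have hsY h : h \in heights k -> h != 0 /\ `|h| < Y.
  rewrite mem_cat => /orP[] /mapP[t]; rewrite mem_iota /= add0n kY => tY ->; have := gpos t => g0.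
    by rewrite gt_eqF// gtr0_norm.
  by rewrite oppr_eq0 gt_eqF// normrN gtr0_norm.
have half1 (y : R) : (2^-1 +i* y : C) != 1.
  by apply/eqP => /(congr1 (@complex.Re R)) /=; lra.
have [Q [hQ LQ Qz]] : exists Q, [/\ holo_on (fun w : C => w != 1) Q,
    (forall w, L w = (\prod_(a <- zs) (w - a)) * Q w) &
    forall s, P s -> pzero Q s (count_mem s zs - count_mem s zs)].
  apply: (@factor_zeros _ zs (fun w => w != 1) P (fun s => count_mem s zs)) => //.
  - exact: open_dom_neq1.
  - by case=> x y [/= -> _ _]; exact: half1.
  - by move=> s /mapP[h /hsY[h0 hY'] ->].
  - by case=> x y [/= -> y0 yY]; exact: pzero_heights kY y0 yY.
have Q0 x y : - dl <= x <= dl -> - Y <= y <= Y -> Q (2^-1 + (x +i* y)) != 0.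
  move=> xd yY; rewrite half_add; have s1 : ((2^-1 + x) +i* y : C) != 1.
    by apply/eqP => /(congr1 (@complex.Re R)) /=; lra.
  have [L0|L0] := eqVneq (L ((2^-1 + x) +i* y)) 0; last first.
    by move: L0; rewrite LQ mulf_eq0 negb_or => /andP[].
  have x0 : 2^-1 + x = 2^-1 by apply: rh L0 => /=; lra.
  rewrite x0 in L0 s1 *; have y0 : y != 0.
    apply/eqP => y0; apply: Lcentral; rewrite -L0 y0; exact: congr1 (halfC R).
  have hd : `|2^-1 - 2^-1| <= dl by rewrite subrr normr0 ltW.
  have [h1 h2] := hY _ hd.
  have yY' : `|y| < Y.
    rewrite lt_neqAle ler_norml yY andbT; apply/eqP => yE.
    have [yp|yn] := ger0P y.
      by rewrite ger0_norm// in yE; move: h1; rewrite -yE L0 eqxx.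
    by rewrite ltr0_norm// in yE; move: h2; rewrite -yE opprK L0 eqxx.
  have := @Qz (2^-1 +i* y); rewrite subnn => h.
  have /pzero_val : pzero Q (2^-1 +i* y) 0 by apply: h.
  by rewrite ltnn => -> //; apply: hQ.
have ldE z : 2^-1 + z != 1 -> L (2^-1 + z) != 0 ->
  logderiv L (2^-1 + z) = \sum_(h <- heights k) (z - (0 +i* h))^-1 + logderiv Q (2^-1 + z).
  move=> z1 L0; have LE : L = (fun w => (\prod_(a <- zs) (w - a)) * Q w) by apply/funext.
  have /andP[p0 q0] : (\prod_(a <- zs) (2^-1 + z - a) != 0) && (Q (2^-1 + z) != 0).
    by rewrite -negb_or -mulf_eq0 -LQ.
  rewrite {1}LE logderivM//; last 2 first.
  - by apply: holo_prod => a; exact: holo_shift.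
  - exact: hQ.
  congr (_ + _); rewrite (@logderiv_prod _ _ zs (fun a w => w - a)).
    rewrite big_map; apply: eq_bigr => h _; rewrite logderiv_shift; congr (_^-1).
    have -> : 2^-1 +i* h = 2^-1 + (0 +i* h) :> C by rewrite half_add addr0.
    ring.
  move=> a az; split; first exact: holo_shift.
  by apply/eqP => a0; move/eqP: p0; apply; apply/eqP; rewrite prodf_seq_eq0; apply/hasP; exists a => //; apply/eqP.
have bdE z : 2^-1 + z != 1 -> L (2^-1 + z) != 0 -> logderiv L (2^-1 + z) * G z =
    \sum_(h <- heights k) (z - (0 +i* h))^-1 * G z + logderiv Q (2^-1 + z) * G z.
  by move=> z1 L0; rewrite ldE// mulrDl mulr_suml.
have zE := @half_add R.
have z1 (x y : R) : - dl <= x <= dl -> (2^-1 + (x +i* y) : C) != 1.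
  by move=> xd; rewrite zE; apply/eqP => /(congr1 (@complex.Re R)) /=; lra.
have dd : - dl <= dl <= dl by apply/andP; split; lra.
have dd' : - dl <= - dl <= dl by apply/andP; split; lra.
have xd' (x : R) : - dl <= x <= dl -> `|2^-1 + x - 2^-1| <= dl.
  by rewrite addrC addKr ler_norml.
have vd (y : R) : L (2^-1 + (dl +i* y)) != 0.
  by rewrite zE (vline_neq0 dl0 dl2 rh)// addrC addKr ger0_norm// ltW.
have vd' (y : R) : L (2^-1 + (- dl +i* y)) != 0.
  by rewrite zE (vline_neq0 dl0 dl2 rh)// addrC addKr normrN ger0_norm// ltW.
have hGs (x y : R) : - dl <= x <= dl -> holo G (x +i* y).
  move=> xd; apply: hG => /=; apply: le_lt_trans dle; by rewrite ler_norml.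
rewrite (eq_rectint_bd (G := fun z => \sum_(h <- heights k) (z - (0 +i* h))^-1 * G z +
    logderiv Q (2^-1 + z) * G z)); last 2 first.
- move=> x xd; have [h1 h2] := hY _ (xd' x xd).
  by split; apply: bdE; rewrite ?z1// zE.
- by move=> y yY; split; apply: bdE; rewrite ?z1.
have hQG : holo_rect (fun z => logderiv Q (2^-1 + z) * G z) (- dl) dl (- Y) Y.
  move=> x y xd yY; apply: holoM; last exact: hGs.
  apply: (@holo_comp _ (fun z => 2^-1 + z)).
    by apply: holoD; [exact: holo_cst|exact: holo_id].
  apply: holo_div; last exact: Q0.
    by apply: (holo_on_derive (open_dom_neq1 (R := R)) hQ); exact: z1.
  by apply: hQ; exact: z1.
have ne h x y : h \in heights k -> (`|x| = dl \/ `|y| = Y) -> (x +i* y - (0 +i* h) : C) != 0.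
  move=> /hsY[_ hY'] b; rewrite subr_eq0; apply/eqP => /eqP.
  rewrite eq_complex /= => /andP[/eqP x0 /eqP y0]; case: b; rewrite ?x0 ?y0 ?normr0; lra.
have nY : `|- Y| = Y by rewrite normrN gtr0_norm.
have pY : `|Y| = Y by rewrite gtr0_norm.
have nd : `|- dl| = dl by rewrite normrN gtr0_norm.
have pd : `|dl| = dl by rewrite gtr0_norm.
have bd h : h \in heights k -> holo_bd (fun z => (z - (0 +i* h))^-1 * G z) (- dl) dl (- Y) Y.
  move=> hk; have H x y : - dl <= x <= dl -> (`|x| = dl \/ `|y| = Y) ->
      holo (fun z => (z - (0 +i* h))^-1 * G z) (x +i* y).
    move=> xd b; apply: holoM; last exact: hGs.
    by apply: holoV; [exact: holo_shift|exact: ne].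
  by split => t tt; split; apply: H => //; first [by left|by right].
have YY : - Y <= Y by lra.
have d00 : - dl <= dl by lra.
rewrite rectintD_bd.
- rewrite (goursat d00 YY hQG) addr0 rectint_sum_bd// mulr_sumr big_seq [RHS]big_seq.
  apply: eq_bigr => h /hsY[_]; rewrite ltr_norml => hY'.
  rewrite residue//; last by move=> x y xd _; exact: hGs.
  exists eta; first by lra.
  move=> w wr; apply: hG; apply: le_lt_trans wr; apply: le_trans (le_Re_normc _).
  by rewrite cReD cReN /= subr0.
- have H x y : - dl <= x <= dl -> (`|x| = dl \/ `|y| = Y) ->
      holo (fun z => \sum_(h <- heights k) (z - (0 +i* h))^-1 * G z) (x +i* y).
    move=> xd b; rewrite (_ : (fun z => _) = (fun z => \sum_(h <- heights k)
      (if h \in heights k then (z - (0 +i* h))^-1 * G z else 0))); last first.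
      by apply/funext => z; rewrite big_seq [RHS]big_seq; apply: eq_bigr => j ->.
    apply: holo_sum => h; have [hk|_] := boolP (h \in heights k); last exact: holo_cst.
    apply: holoM; last exact: hGs.
    by apply: holoV; [exact: holo_shift|exact: ne].
  by split => t tt; split; apply: H => //; first [by left|by right].
- have y1 : - Y <= - Y <= Y by rewrite lexx.
  have y2 : - Y <= Y <= Y by rewrite lexx YY.
  by split => t tt; split; apply: hQG.
Qed.

End residue_sum.

(** * Passage to infinite vertical lines *)

Section one_variable.
Variable R : realType.
Local Notation C := (R[i]^o).
Local Notation mu := (@lebesgue_measure R).
Variables (L : C -> C) (g : nat -> R) (dl : R).
Hypotheses (dl0 : 0 < dl) (dl2 : dl < 2^-1)
 (hL : forall s, s != 1 -> holo L s)
 (Lconj : forall s, complex.Im s != 0 -> L s^* = (L s)^*)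
 (Lgrow : forall rho : R, 0 < rho < 2 -> exists K : R, forall (T : R) (w : C),
    4 <= T -> normc (w - (2 +i* T)) <= rho -> normc (L w) <= K * T)
 (Llow : forall T : R, 4^-1 <= normc (L (2 +i* T)))
 (rh : GRH L) (Lcentral : L 2^-1 <> 0)
 (gpos : forall t, 0 < g t) (gmono : {homo g : t u / (t <= u)%N >-> t <= u})
 (gzero : forall y : R, 0 < y -> exists2 m : nat,
        pzero L (2^-1 +i* y) m & ([set t | g t = y] #= `I_m)%card).

Lemma ordinate_index (Y : R) : exists k, forall t, (t < k)%N = (g t < Y).
Proof.
have [N hN] := ordinate_unbounded dl0 dl2 hL gpos gmono gzero Y.
have ex : exists k, Y <= g k by exists N; rewrite ltW// hN.
exists (ex_minn ex) => t; case: ex_minnP => k Yk kmin.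
apply/idP/idP => [tk|tY]; first by rewrite ltNge; apply/negP => /kmin; rewrite leqNgt tk.
rewrite ltnNge; apply/negP => /gmono; rewrite leNgt; move/negP; apply.
exact: lt_le_trans tY Yk.
Qed.

Let vE (b y : R) : 2^-1 + (b +i* y) = (2^-1 + b) +i* y :> C.
Proof. exact: half_add. Qed.

Let vb (b : R) : `|b| = dl -> `|2^-1 + b - 2^-1| = dl.
Proof. by move=> h; rewrite addrC addKr. Qed.

Lemma logderiv_vline_ccont (b y : R) : `|b| = dl ->
  ccont (fun y => logderiv L (2^-1 + (b +i* y))) y.
Proof.
move=> bd; rewrite (_ : (fun y => _) = (fun y => logderiv L ((2^-1 + b) +i* y))); last first.
  by apply/funext => t; rewrite vE.
apply: ccont_vline; apply: (holo_logderiv hL); last by apply: (vline_neq0 dl0 dl2 rh); exact: vb.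
apply/eqP => /(congr1 (@complex.Re R)) /= h; have b2 : b = 2^-1 by lra.
by move: bd dl2; rewrite b2 ger0_norm => // <-; rewrite ltxx.
Qed.

Lemma one_variable (G : C -> C) (eta a B : R) : dl < eta -> 1 < a ->
  (forall z, `|complex.Re z| < eta -> holo G z) ->
  (forall z, `|complex.Re z| < eta -> G (- z) = G z) ->
  (forall z, `|complex.Re z| < eta -> normc (G z) <= B * weight a (complex.Im z)) ->
  exists2 S, ccvg (fun N => \sum_(0 <= t < N) G (0 +i* g t)) S &
  cint setT (fun y => 'i * (logderiv L (2^-1 + (dl +i* y)) * G (dl +i* y))) -
  cint setT (fun y => 'i * (logderiv L (2^-1 + (- dl +i* y)) * G (- dl +i* y))) =
  2 * (2 * pi%:C * 'i) * S.
Proof.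
move=> dle a1 hG Gev GB; have d0 := dl0; have d2 := dl2.
have eta0 : 0 < eta by lra.
have B0 : 0 <= B.
  have h0 : `|complex.Re (0 : C)| < eta by rewrite /= normr0.
  have := le_trans (normc_ge0 _) (GB 0 h0); rewrite /weight /= normr0 addr0 powR1 mulr1.
  by [].
have ad : `|dl| = dl by rewrite gtr0_norm.
have ad' : `|- dl| = dl by rewrite normrN.
have adl (b : R) : `|b| = dl -> `|b| < eta by move=> ->.
have [M HM] := zero_sum_bound dl0 dl2 hL Lgrow Llow rh gpos gmono gzero a1.
have [S hS] : exists S, ccvg (fun N => \sum_(0 <= t < N) G (0 +i* g t)) S.
  apply: (@ccvg_series _ _ (fun t => B * (1 + g t) `^ (- a)) (B * M)) => [t|N].
    have h0 : `|complex.Re (0 +i* g t : C)| < eta by rewrite /= normr0.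
    by have := GB _ h0; rewrite /weight /= gtr0_norm.
  by rewrite -mulr_sumr ler_wpM2l.
exists S => //.
(* With this [ep] the exponent b = a - ep left to the integrand still exceeds 1. Its half is passed
   to [good_height], which doubles the exponent. *)
pose ep := (a - 1) / 2; have ep0 : 0 < ep by rewrite /ep; lra.
have ep20 : 0 < ep / 2 by rewrite /ep; lra.
have epE : ep / 2 + ep / 2 = ep by field.
pose b := a - ep; have b1 : 1 < b by rewrite /b /ep; lra.
have [A A0 HA] := vline_logderiv_bound dl0 dl2 hL Lconj Lgrow Llow rh ep0.
have [A' A'0 HA'] := good_height dl0 dl2 hL Lconj Lgrow Llow rh ep20.
have wE (y : R) : (1 + `|y|) `^ ep * weight a y = weight b y.
  have y0 : 0 < 1 + `|y| by rewrite ltr_wpDr.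
  by rewrite /weight -powRDl//; congr (_ `^ _); rewrite /b; ring.
have bound (c y : R) : `|c| = dl ->
    normc (logderiv L (2^-1 + (c +i* y)) * G (c +i* y)) <= A * B * weight b y.
  move=> cd; rewrite normcM vE -wE.
  have -> : A * B * ((1 + `|y|) `^ ep * weight a y) = A * (1 + `|y|) `^ ep * (B * weight a y) by ring.
  by apply: ler_pM; rewrite ?normc_ge0//; [apply: HA; exact: vb|apply: GB; exact: adl].
have cc (c y : R) : `|c| = dl -> ccont (fun y => logderiv L (2^-1 + (c +i* y)) * G (c +i* y)) y.
  by move=> cd; apply: ccontM; [exact: logderiv_vline_ccont|apply: ccont_vline; apply: hG; exact: adl].
have iw : mu.-integrable setT (EFin \o (fun y => A * B * weight b y)).
  rewrite (_ : _ \o _ = (fun y => (A * B)%:E * (weight b y)%:E)%E)//.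
  by apply: integrableZl => //; exact: weight_integrable.
have exY n : exists y : R, n%:R + 4 <= y /\ forall x : R, `|x - 2^-1| <= dl ->
    [/\ L (x +i* y) != 0, L (x +i* - y) != 0, normc (logderiv L (x +i* y)) <= A' * y `^ ep &
     normc (logderiv L (x +i* - y)) <= A' * y `^ ep].
  have T4 : 4 <= n%:R + 4 :> R by rewrite lerDr.
  have [y /andP[y1 _] hy] := HA' _ T4; exists y; split => // x xd; have [h1 h2 h3 h4] := hy x xd.
  have pT : A' * (n%:R + 4) `^ (ep / 2 + ep / 2) <= A' * y `^ ep.
    rewrite epE ler_pM2l//; apply: le_powRl => //; exact: ltW.
  by split => //; [exact: le_trans h3 pT|exact: le_trans h4 pT].
have [Y HY] := choice exY.
have Y0 n : 0 < Y n by have [h _] := HY n; apply: lt_le_trans h; rewrite ltr_wpDl.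
have [k Hk] := choice (fun n => ordinate_index (Y n)).
have Yinf D : exists N, forall n, (N <= n)%N -> D <= Y n.
  exists (Num.bound `|D|) => n Dn; have [h _] := HY n; apply: le_trans h.
  have := archi_boundP (normr_ge0 D); have : (Num.bound `|D|)%:R <= n%:R :> R by rewrite ler_nat.
  have := ler_norm D; lra.
have kinf D : exists N, forall n, (N <= n)%N -> (D <= k n)%N.
  have [N HN] := Yinf (g D + 1); exists N => n /HN h; apply: ltnW; rewrite Hk; lra.
pose F := fun z => logderiv L (2^-1 + z) * G z.
(* Ordinates of both signs contribute equally because [G] is even; this is the origin of the extra
   factor 2. *)
have R1 n : rectint F (- dl) dl (- Y n) (Y n) =
    2 * (2 * pi%:C * 'i) * \sum_(0 <= t < k n) G (0 +i* g t).
  rewrite (@rect_residue _ L g dl dl0 dl2 hL Lconj rh Lcentral gpos gzero (k n) (Y n) eta)//; last first.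
    by move=> x xd; have [_ h] := HY n; have [] := h x xd.
  rewrite /heights big_cat !big_map /= /index_iota subn0.
  have -> : \sum_(j <- iota 0 (k n)) G (0 +i* - g j) = \sum_(j <- iota 0 (k n)) G (0 +i* g j).
    apply: eq_bigr => t _; have h0 : `|complex.Re (0 +i* g t : C)| < eta by rewrite /= normr0.
    by rewrite -(Gev _ h0); congr G; apply: eq_ReIm; rewrite ?cReN ?cImN /= ?oppr0.
  by rewrite -mulr2n -[X in _ * X = _]mulr_natl; ring.
have [ip cp] := cvg_cint_trunc (fun y => cc _ y ad) iw (fun y => bound _ y ad) Yinf.
have [im cm] := cvg_cint_trunc (fun y => cc _ y ad') iw (fun y => bound _ y ad') Yinf.
(* Top and bottom sides together, s being 1 or -1: the length is fixed and the integrand is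
   O(Y^(-b)), so the integral tends to 0. *)
have hor (s : R) : `|s| = 1 ->
    ccvg (fun n => cint `[- dl, dl] (fun x => F (x +i* (s * Y n)))) 0.
  move=> s1; move=> e e0; pose K := A' * B * (dl - - dl); have K0 : 0 <= K.
    by rewrite /K opprK; apply: mulr_ge0 (mulr_ge0 (ltW A'0) B0) (addr_ge0 (ltW d0) (ltW d0)).
  have nY n : n%:R <= Y n by have [h _] := HY n; apply: le_trans h; rewrite lerDl.
  have [N HN] := weight_tail (ltW b1) K0 e0 nY.
  exists N => n Kn; rewrite subr0.
  have [Yn hY] := HY n; have Yp := Y0 n.
  have sY : `|s * Y n| = Y n by rewrite normrM s1 mul1r gtr0_norm.
  have bx (x : R) : - dl <= x <= dl -> `|2^-1 + x - 2^-1| <= dl.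
    by move=> xd; rewrite addrC addKr ler_norml.
  have sg x : `|x - 2^-1| <= dl -> L (x +i* (s * Y n)) != 0 /\
     normc (logderiv L (x +i* (s * Y n))) <= A' * Y n `^ ep.
    move=> /hY[h1 h2 h3 h4]; have [s0|s0] := ger0P s.
      by move: s1; rewrite ger0_norm// => ->; rewrite mul1r.
    have -> : s = -1 by rewrite -[s]opprK -(ltr0_norm s0) s1.
    by rewrite mulN1r.
  apply: le_lt_trans (@cint_bound _ _ _ _ (A' * B * weight b (Y n)) _ _ _) _.
  - by apply: le_trans (ltW d0); rewrite oppr_le0 ltW.
  - apply: ccont_cintegrable => x xd; apply: (@ccont_hline _ F); apply: holoM; last first.
      by apply: hG => /=; apply: le_lt_trans dle; rewrite ler_norml.
    apply: (@holo_comp _ (fun z => 2^-1 + z)).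
      by apply: holoD; [exact: holo_cst|exact: holo_id].
    rewrite vE; apply: (holo_logderiv hL); last by have [] := sg _ (bx x xd).
    by apply/eqP => /(congr1 (@complex.Re R)) /=; lra.
  - move=> x xd; rewrite /F normcM vE -wE gtr0_norm//.
    have -> : A' * B * ((1 + Y n) `^ ep * weight a (Y n)) = A' * (1 + Y n) `^ ep * (B * weight a (Y n)) by ring.
    apply: ler_pM; rewrite ?normc_ge0//.
      have [_ h] := sg _ (bx x xd); apply: le_trans h _; rewrite ler_pM2l//.
      by apply: le_powRl; [exact: ltW|exact: ltW|rewrite lerDr].
    have -> : weight a (Y n) = weight a (s * Y n) by rewrite /weight sY gtr0_norm.
    by apply: GB => /=; apply: le_lt_trans dle; rewrite ler_norml.
  have -> : A' * B * weight b (Y n) * (dl - - dl) = K * weight b (Y n) by rewrite /K; ring.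
  exact: HN.
have l1 : ccvg (fun n => rectint F (- dl) dl (- Y n) (Y n))
    (0 - 0 + 'i * (cint setT (fun y => F (dl +i* y)) - cint setT (fun y => F (- dl +i* y)))).
  rewrite /rectint; apply: ccvgD; first apply: ccvgD.
  - have := hor (-1); rewrite normrN1 => /(_ erefl).
    by rewrite (_ : (fun n => _) = (fun n => cint `[- dl, dl] (fun x => F (x +i* - Y n))))//;
      apply/funext => n; rewrite mulN1r.
  - apply: ccvgN; have := hor 1; rewrite normr1 => /(_ erefl).
    by rewrite (_ : (fun n => _) = (fun n => cint `[- dl, dl] (fun x => F (x +i* Y n))))//;
      apply/funext => n; rewrite mul1r.
  by apply: ccvgM; [exact: ccvg_cst|apply: ccvgD => //; apply: ccvgN].
have l2 : ccvg (fun n => rectint F (- dl) dl (- Y n) (Y n)) (2 * (2 * pi%:C * 'i) * S).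
  rewrite (_ : (fun n => _) = (fun n => 2 * (2 * pi%:C * 'i) * \sum_(0 <= t < k n) G (0 +i* g t))); last first.
    by apply/funext => n; exact: R1.
  apply: ccvgM; first exact: ccvg_cst.
  move=> e /hS[N HN]; have [N' HN'] := kinf N; exists N' => n /HN'; exact: HN.
rewrite -(ccvg_uniq l1 l2) subr0 add0r mulrBr !cintZ//.
Qed.

(** Near the line L(1 - s) has no zeros, so psi agrees there with L(s) / L(1 - s). Differentiability
    of psi is a consequence of this, and the limit defining Gamma is never analysed. *)
Lemma logderiv_functional (psi : C -> C) (y : R) :
  (forall s, 0 < complex.Re s < 1 -> L s = psi s * L (1 - s)) ->
  logderiv psi (2^-1 + (- dl +i* y)) =
  logderiv L (2^-1 + (- dl +i* y)) + logderiv L (2^-1 - (- dl +i* y)).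
Proof.
move=> fe; have d0 := dl0; have d2 := dl2.
set s : C := 2^-1 + (- dl +i* y).
have sE : s = (2^-1 - dl) +i* y by exact: vE.
have s'E : 2^-1 - (- dl +i* y) = 1 - s :> C.
  by rewrite sE halfC; apply: eq_ReIm; rewrite ?cReD ?cImD ?cReN ?cImN /=; field.
have s'E2 : 1 - s = (2^-1 + dl) +i* - y :> C.
  by rewrite sE; apply: eq_ReIm; rewrite ?cReD ?cImD ?cReN ?cImN /=; field.
have L0 : L s != 0 by rewrite sE; apply: (vline_neq0 dl0 dl2 rh); rewrite vb// normrN gtr0_norm.
have L1 : L (1 - s) != 0 by rewrite s'E2; apply: (vline_neq0 dl0 dl2 rh); rewrite vb// gtr0_norm.
have s1 : s != 1 by rewrite sE; apply/eqP => /(congr1 (@complex.Re R)) /=; lra.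
have s1' : 1 - s != 1 by rewrite s'E2; apply/eqP => /(congr1 (@complex.Re R)) /=; lra.
pose m z := L (1 - z).
have dm : cder m s (- derive1 L (1 - s)).
  have := @cder_comp _ (fun z => 1 - z) L s _ _ (cderB (cder_cst 1 s) (cder_id s)) (holo_cder (hL s1')).
  by rewrite sub0r mulrN1.
have dq := cderM (holo_cder (hL s1)) (cderV dm L1).
have strip : \forall z \near s, 0 < complex.Re z < 1.
  apply/nbhsC; exists (2^-1 - dl); first by lra.
  move=> z; move/(le_lt_trans (le_Re_normc _)); rewrite cReD cReN sE /= ltr_norml.
  by move=> /andP[? ?]; apply/andP; split; lra.
have mn : \forall z \near s, m z != 0.
  by apply: holo_near_neq0 => //; eexists; exact: dm.
have dpsi : cder psi s (derive1 L s / m s + L s * (- - derive1 L (1 - s) / m s ^+ 2)).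
  apply: cder_near dq; near=> z.
  have zs : 0 < complex.Re z < 1 by near: z.
  by rewrite (fe _ zs) mulfK//; near: z.
have psE : psi s = L s / m s.
  have ss : 0 < complex.Re s < 1 by rewrite sE /=; lra.
  by rewrite (fe _ ss) mulfK.
rewrite s'E /logderiv (cder_derive1 dpsi) psE /m.
move: (derive1 L s) (derive1 L (1 - s)) (L s) (L (1 - s)) L0 L1 => D D' l l' l0 l0'.
by field; rewrite l0 l0'.
Unshelve. all: by end_near.
Qed.

End one_variable.

(** * Iterated integrals over vertical lines *)

Section sequences.
Variable R : realType.
Local Notation C := (R[i]^o).

Definition rcvg (u : nat -> R) (l : R) := forall e : R, 0 < e ->
  exists N, forall n, (N <= n)%N -> `|u n - l| < e.

Lemma rcvg_cst (x : R) : rcvg (fun=> x) x.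
Proof. by move=> e e0; exists 0%N => n _; rewrite subrr normr0. Qed.

Lemma ccont_rcvg (F : R -> C) y (u : nat -> R) : ccont F y -> rcvg u y -> ccvg (F \o u) (F y).
Proof.
move=> /ccontP cF hu e /cF[d d0 hd]; have [N HN] := hu d d0.
by exists N => n /HN; exact: hd.
Qed.

Lemma rcvg_ccont (F : R -> C) y : (forall u, rcvg u y -> ccvg (F \o u) (F y)) -> ccont F y.
Proof.
move=> H; apply/ccontP => e e0; apply: contrapT => nd.
have ex n : exists x, `|x - y| < n.+1%:R^-1 /\ e <= normc (F x - F y).
  apply: contrapT => nx; apply: nd; exists n.+1%:R^-1; first by rewrite invr_gt0.
  move=> x xy; rewrite ltNge; apply/negP => ex; apply: nx; by exists x.
have [u hu] := choice ex.
have cu : rcvg u y.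
  move=> e' e'0; exists (Num.bound e'^-1) => n Nn; have [h _] := hu n; apply: lt_le_trans h _.
  rewrite -[X in _ <= X]invrK lef_pV2 ?posrE ?invr_gt0//.
  have i0 : 0 <= e'^-1 by rewrite invr_ge0 ltW.
  by apply: le_trans (ltW (archi_boundP i0)) _; rewrite ler_nat; exact: leq_trans Nn _.
have [N HN] := H u cu e e0; have := HN N (leqnn N); have [_ h] := hu N.
by rewrite /= ltNge h.
Qed.

Lemma ccvg_prod (I : Type) (r : seq I) (u : I -> nat -> C) (l : I -> C) :
  (forall i, ccvg (u i) (l i)) ->
  ccvg (fun n => \prod_(i <- r) u i n) (\prod_(i <- r) l i).
Proof.
move=> h; elim: r => [|i r IH].
  rewrite big_nil (_ : (fun n => _) = (fun=> 1)); first exact: ccvg_cst.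
  by apply/funext => n; rewrite big_nil.
rewrite big_cons (_ : (fun n => _) = (fun n => u i n * \prod_(j <- r) u j n)).
  exact: ccvgM.
by apply/funext => n; rewrite big_cons.
Qed.

(** Tannery's theorem: the length of the sum and its terms vary together, and the dominating series
    makes the tail uniformly small. *)
Lemma tannery (u : nat -> nat -> C) (b : nat -> R) (M : R) : (forall N t, normc (u N t) <= b t) ->
  (forall N, \sum_(0 <= t < N) b t <= M) -> (forall t, ccvg (u ^~ t) 0) ->
  ccvg (fun N => \sum_(0 <= t < N) u N t) 0.
Proof.
move=> ub bM u0 e e0.
have b0 t : 0 <= b t by apply: le_trans (normc_ge0 _) (ub 0%N t).
pose sb N := \sum_(0 <= t < N) b t.
have mono : {homo sb : m n / (m <= n)%N >-> m <= n}.
  by move=> m n mn; rewrite /sb (big_cat_nat (leq0n m) mn) /= lerDl sumr_ge0.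
have hs : has_sup (range sb) by split; [exists (sb 0%N); exists 0%N|exists M => _ [N _ <-]; exact: bM].
have e2 : 0 < e / 2 by rewrite divr_gt0.
have [_ [N0 _ <-] hN0] := sup_adherent e2 hs.
have c0 : ccvg (fun N => \sum_(0 <= t < N0) u N t) (\sum_(0 <= t < N0) 0).
  by apply: ccvg_sum => t _; exact: u0.
rewrite big1_eq in c0; have [N1 HN1] := c0 _ e2.
exists (maxn N0 N1) => N; rewrite geq_max => /andP[N0N N1N].
have := HN1 N N1N; rewrite !subr0 => h1.
rewrite (big_cat_nat (leq0n N0) N0N) /=; apply: le_lt_trans (le_normcD _ _) _.
have h2 : normc (\sum_(N0 <= t < N) u N t) <= \sum_(N0 <= t < N) b t.
  apply: le_trans (normc_sum _ _ _) _; apply: ler_sum => t _; exact: ub.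
have h3 : sb N <= sup (range sb) by apply: sup_upper_bound => //; exists N.
have h4 : sb N = sb N0 + \sum_(N0 <= t < N) b t by rewrite /sb (big_cat_nat (leq0n N0) N0N).
move: hN0 h3; rewrite h4; lra.
Qed.

End sequences.

Definition fcons (T : Type) (n : nat) (x : T) (f : 'I_n -> T) : 'I_n.+1 -> T :=
  fun i => if unlift ord0 i is Some j then f j else x.

Lemma fcons0 (T : Type) n (x : T) (f : 'I_n -> T) : fcons x f ord0 = x.
Proof. by rewrite /fcons unlift_none. Qed.

Lemma fconsS (T : Type) n (x : T) (f : 'I_n -> T) j : fcons x f (lift ord0 j) = f j.
Proof. by rewrite /fcons liftK. Qed.

Lemma big_ffun_recl (V : zmodType) (T : finType) n (E : ('I_n.+1 -> T) -> V) :
  \sum_(f : {ffun 'I_n.+1 -> T}) E f = \sum_(x : T) \sum_(f : {ffun 'I_n -> T}) E (fcons x f).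
Proof.
rewrite pair_big /= (reindex (fun p : T * {ffun 'I_n -> T} => [ffun i => fcons p.1 p.2 i])) /=.
  by apply: eq_bigr => -[x f] _ /=; congr E; apply/funext => i; rewrite ffunE.
exists (fun f : {ffun 'I_n.+1 -> T} => (f ord0, [ffun j => f (lift ord0 j)])).
  move=> [x f] _ /=; rewrite ffunE fcons0; congr (_, _).
  by apply/ffunP => j; rewrite !ffunE fconsS.
move=> f _; apply/ffunP => i; rewrite ffunE /=.
by have [j ->|->] := unliftP ord0 i; rewrite ?fconsS ?fcons0 ?ffunE.
Qed.

Section iterated_integrals.
Variable R : realType.
Local Notation C := (R[i]^o).
Local Notation mu := (@lebesgue_measure R).
Variable b : R.
Hypothesis b1 : 1 < b.

Definition rvcons n (v : C) (w : 'rV[C]_n) : 'rV[C]_(1 + n) := row_mx (const_mx v) w.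

Lemma rvcons0 n (v : C) (w : 'rV[C]_n) : rvcons v w 0 ord0 = v.
Proof.
have -> : ord0 = lshift n ord0 :> 'I_(1 + n) by apply: ord_inj.
by rewrite /rvcons row_mxEl mxE.
Qed.

Lemma rvconsS n (v : C) (w : 'rV[C]_n) j : rvcons v w 0 (lift ord0 j) = w 0 j.
Proof.
have -> : lift ord0 j = rshift 1 j by apply/val_inj.
by rewrite /rvcons row_mxEr.
Qed.

Definition vpoint n (c y : 'I_n -> R) : 'rV[C]_n := \row_j (c j +i* y j).

Lemma vpoint_cons n (c : 'I_n.+1 -> R) (y0 : R) (y : 'I_n -> R) :
  vpoint c (fcons y0 y) = rvcons (c ord0 +i* y0) (vpoint (c \o lift ord0) y).
Proof.
apply/rowP => i; have [j ->|->] := unliftP ord0 i.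
  by rewrite rvconsS !mxE fconsS.
by rewrite rvcons0 mxE fcons0.
Qed.

(** Sequential continuity and domination by a product weight, both on the lines only: enough to
    integrate one variable after another by dominated convergence. *)
Definition vnice n (c : 'I_n -> R) (F : 'rV[C]_n -> C) (K : R) :=
  (forall (u : nat -> 'I_n -> R) y, (forall j, rcvg (u ^~ j) (y j)) ->
     ccvg (fun m => F (vpoint c (u m))) (F (vpoint c y))) /\
  (forall y, normc (F (vpoint c y)) <= K * \prod_j weight b (y j)).

Let W : R := Rintegral mu setT (weight b).

Lemma weight_le1 y : weight b y <= 1.
Proof.
rewrite /weight powRN -[X in _ <= X]invr1 lef_pV2 ?posrE ?powR_gt0 ?ltr_wpDr//.
by apply: powR_ge1; [rewrite lerDl|move: (b1); lra].
Qed.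

Lemma weight_gt0 y : 0 < weight b y.
Proof. by rewrite /weight powR_gt0// ltr_wpDr. Qed.

Lemma vnice_ge0 n (c : 'I_n -> R) F K : vnice c F K -> 0 <= K.
Proof.
move=> [_ h]; have := le_trans (normc_ge0 _) (h (fun=> 0)).
by rewrite pmulr_lge0// prodr_gt0// => j _; exact: weight_gt0.
Qed.

Lemma vnice_slice n (c : 'I_n.+1 -> R) F K y0 : vnice c F K ->
  vnice (c \o lift ord0) (fun w => F (rvcons (c ord0 +i* y0) w)) (K * weight b y0).
Proof.
move=> [h1 h2]; split.
  move=> u y hu; have := h1 (fun m => fcons y0 (u m)) (fcons y0 y).
  rewrite vpoint_cons (_ : (fun m => F (vpoint c _)) =
    (fun m => F (rvcons (c ord0 +i* y0) (vpoint (c \o lift ord0) (u m))))); last first.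
    by apply/funext => m; rewrite vpoint_cons.
  apply => i; have [j ->|->] := unliftP ord0 i.
    by rewrite fconsS (_ : (fun x => _) = u ^~ j)//; apply/funext => x; rewrite fconsS.
  by rewrite fcons0 (_ : (fun x => _) = (fun=> y0)); [exact: rcvg_cst|apply/funext => x; rewrite fcons0].
move=> y; have := h2 (fcons y0 y); rewrite vpoint_cons big_ord_recl fcons0 mulrA.
by rewrite (eq_bigr (fun j => weight b (y j)))// => j _; rewrite fconsS.
Qed.

Lemma vline_ext n (c : 'I_n -> R) F G : (forall y, F (vpoint c y) = G (vpoint c y)) ->
  vline_integral c F = vline_integral c G.
Proof.
elim: n c F G => [|n IH] c F G FG /=.
  by have := FG (fun=> 0); rewrite (_ : vpoint _ _ = 0)//; apply/rowP => -[].
congr integralC; apply/funext => y0; congr (_ * _); apply: IH => y.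
by have := FG (fcons y0 y); rewrite vpoint_cons.
Qed.

Let slice n (c : 'I_n.+1 -> R) (F : 'rV[C]_n.+1 -> C) (y : R) : C :=
  'i * vline_integral (c \o lift ord0) (fun w => F (rvcons (c ord0 +i* y) w)).

Let slice_bound n (c : 'I_n.+1 -> R) F K y :
  (forall G K', vnice (c \o lift ord0) G K' ->
    normc (vline_integral (c \o lift ord0) G) <= K' * W ^+ n) ->
  vnice c F K -> normc (slice c F y) <= K * W ^+ n * weight b y.
Proof.
move=> IH hF; rewrite /slice normcM normc_i mul1r.
by apply: le_trans (IH _ _ (vnice_slice y hF)) _; rewrite mulrAC.
Qed.

Let slice_cont n (c : 'I_n.+1 -> R) F K y :
  (forall (Gk : nat -> 'rV[C]_n -> C) G K', (forall k, vnice (c \o lift ord0) (Gk k) K') ->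
    (forall z, ccvg (fun k => Gk k (vpoint (c \o lift ord0) z)) (G (vpoint (c \o lift ord0) z))) ->
    ccvg (fun k => vline_integral (c \o lift ord0) (Gk k)) (vline_integral (c \o lift ord0) G)) ->
  vnice c F K -> ccont (slice c F) y.
Proof.
move=> IH hF; apply: rcvg_ccont => u hu; apply: ccvgM; first exact: ccvg_cst.
apply: (IH _ _ K) => [k|y'].
  have [h1 h2] := vnice_slice (u k) hF; split => // y'; apply: le_trans (h2 y') _.
  rewrite ler_wpM2r//; first by apply: prodr_ge0 => j _; exact: weight_ge0.
  by rewrite ler_piMr ?weight_le1//; exact: vnice_ge0 hF.
have [h1 _] := hF; have := h1 (fun m => fcons (u m) y') (fcons y y').
rewrite vpoint_cons (_ : (fun m => F (vpoint c _)) =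
  (fun m => F (rvcons (c ord0 +i* u m) (vpoint (c \o lift ord0) y')))); last first.
  by apply/funext => m; rewrite vpoint_cons.
apply => i; have [j ->|->] := unliftP ord0 i.
  by rewrite fconsS (_ : (fun x => _) = (fun=> y' j)); [exact: rcvg_cst|apply/funext => x; rewrite fconsS].
by rewrite fcons0 (_ : (fun x => _) = u)//; apply/funext => x; rewrite fcons0.
Qed.

Let weight_cst_integrable (K : R) : mu.-integrable setT (EFin \o (fun y => K * weight b y)).
Proof.
rewrite (_ : _ \o _ = (fun y => K%:E * (weight b y)%:E)%E)//.
by apply: integrableZl => //; exact: weight_integrable.
Qed.

(** The two parts feed each other in the induction: as a function of the first variable, the inner
    integral is bounded by the first part and continuous by the second, hence integrable. *)
Lemma vline_bound_dct n (c : 'I_n -> R) :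
  (forall F K, vnice c F K -> normc (vline_integral c F) <= K * W ^+ n) /\
  (forall (Fk : nat -> 'rV[C]_n -> C) F K, (forall k, vnice c (Fk k) K) ->
    (forall y, ccvg (fun k => Fk k (vpoint c y)) (F (vpoint c y))) ->
    ccvg (fun k => vline_integral c (Fk k)) (vline_integral c F)).
Proof.
have W0 : 0 <= W by apply: Rintegral_ge0 => // y _; exact: weight_ge0.
elim: n c => [|n IH] c.
  have p0 (y : 'I_0 -> R) : vpoint c y = 0 by apply/rowP => -[].
  split=> [F K [_ h]|Fk F K _ h] /=.
    by have := h (fun=> 0); rewrite big_ord0 p0 expr0.
  by have := h (fun=> 0); rewrite p0.
have [IH1 IH2] := IH (c \o lift ord0).
have sb F K y := @slice_bound n c F K y IH1.
have sc F K y := @slice_cont n c F K y IH2.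
have iw := weight_cst_integrable.
split=> [F K hF|Fk F K hF cF].
  have i1 : cintegrable setT (slice c F).
    apply: (cintegrable_dom measurableT (cmeas_ccont (fun y => sc F K y hF)) (iw (K * W ^+ n))).
    by move=> y _; exact: sb.
  have := le_normc_cint measurableT i1 (iw (K * W ^+ n)) (fun y _ => sb F K y hF).
  rewrite RintegralZl//; last exact: weight_integrable.
  by rewrite -mulrA -exprSr.
have [| | | |_ h] := @cdct _ setT (fun k => slice c (Fk k)) (slice c F)
   (fun y => K * W ^+ n * weight b y) measurableT.
- by move=> k; apply: cmeas_ccont => y; exact: sc (hF k).
- exact: iw.
- by move=> k y _; exact: sb (hF k).
- move=> y _; apply: ccvgM; first exact: ccvg_cst.
  apply: (IH2 _ _ (K * weight b y)) => [k|y']; first exact: vnice_slice.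
  by have := cF (fcons y y'); rewrite vpoint_cons.
exact: h.
Qed.

Lemma slice_integrable n (c : 'I_n.+1 -> R) F K : vnice c F K ->
  cintegrable setT (fun y : R =>
    'i * vline_integral (c \o lift ord0) (fun w => F (rvcons (c ord0 +i* y) w))).
Proof.
move=> hF; apply: (cintegrable_dom measurableT _ (weight_cst_integrable (K * W ^+ n))).
  by apply: cmeas_ccont => y; exact: slice_cont (proj2 (vline_bound_dct _)) hF.
by move=> y _; exact: slice_bound (proj1 (vline_bound_dct _)) hF.
Qed.

Lemma vlineD n (c : 'I_n -> R) F G K K' : vnice c F K -> vnice c G K' ->
  vline_integral c (fun z => F z + G z) = vline_integral c F + vline_integral c G.
Proof.
elim: n c F G K K' => [//|n IH] c F G K K' hF hG /=.
rewrite -[RHS]cintD//; [|exact: slice_integrable hF|exact: slice_integrable hG].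
congr integralC; apply/funext => y; rewrite -mulrDr; congr (_ * _).
exact: IH (vnice_slice y hF) (vnice_slice y hG).
Qed.

Lemma vlineZ n (c : 'I_n -> R) F K (a : C) : vnice c F K ->
  vline_integral c (fun z => a * F z) = a * vline_integral c F.
Proof.
elim: n c F K => [//|n IH] c F K hF /=.
rewrite -[RHS]cintZ//; last exact: slice_integrable hF.
congr integralC; apply/funext => y; rewrite mulrCA; congr (_ * _).
exact: IH (vnice_slice y hF).
Qed.

Lemma vnice0 n (c : 'I_n -> R) : vnice c (fun=> 0) 0.
Proof.
split=> [u y _|y]; first exact: ccvg_cst.
by rewrite normc0 mul0r.
Qed.

Lemma vniceD n (c : 'I_n -> R) F G K K' : vnice c F K -> vnice c G K' ->
  vnice c (fun z => F z + G z) (K + K').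
Proof.
move=> [h1 h2] [h1' h2']; split=> [u y hu|y]; first by apply: ccvgD; [exact: h1|exact: h1'].
by apply: le_trans (le_normcD _ _) _; rewrite mulrDl lerD.
Qed.

Lemma vline_sum n (c : 'I_n -> R) (I : Type) (r : seq I) (P : pred I) (F : I -> 'rV[C]_n -> C)
    (K : I -> R) : (forall i, P i -> vnice c (F i) (K i)) ->
  vline_integral c (fun z => \sum_(i <- r | P i) F i z) = \sum_(i <- r | P i) vline_integral c (F i).
Proof.
move=> hF; have nS s : vnice c (fun z => \sum_(i <- s | P i) F i z) (\sum_(i <- s | P i) K i).
  elim: s => [|i s IH].
    rewrite big_nil (_ : (fun z => _) = (fun=> 0)); first exact: vnice0.
    by apply/funext => z; rewrite big_nil.
  rewrite big_cons (_ : (fun z => _) =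
    (fun z => if P i then F i z + \sum_(i <- s | P i) F i z else \sum_(i <- s | P i) F i z)).
    by case: ifP => // Pi; apply: vniceD => //; exact: hF.
  by apply/funext => z; rewrite big_cons.
elim: r => [|i r IH].
  rewrite big_nil (_ : (fun z => _) = (fun z => 0 * 0)).
    by rewrite (vlineZ _ (vnice0 c)) mul0r.
  by apply/funext => z; rewrite big_nil mul0r.
rewrite big_cons -IH (_ : (fun z => _) =
    (fun z => if P i then F i z + \sum_(i <- r | P i) F i z else \sum_(i <- r | P i) F i z)).
  by case: ifP => // Pi; apply: vlineD; [exact: hF|exact: nS].
by apply/funext => z; rewrite big_cons.
Qed.

End iterated_integrals.

(** * Several variables *)

Section several_variables.
Variable R : realType.
Local Notation C := (R[i]^o).
Local Notation mu := (@lebesgue_measure R).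

Definition upd n (z : 'rV[C]_n) (i : 'I_n) (v : C) : 'rV[C]_n :=
  \row_j (if j == i then v else z 0 j).

Lemma upd_rvcons0 n (v v' : C) (w : 'rV[C]_n) : upd (rvcons v w) ord0 v' = rvcons v' w.
Proof.
apply/rowP => j; rewrite mxE; have [k ->|->] := unliftP ord0 j; last by rewrite eqxx rvcons0.
by rewrite eq_sym (negbTE (neq_lift ord0 k)) !rvconsS.
Qed.

Lemma upd_rvconsS n (v x : C) (w : 'rV[C]_n) i :
  upd (rvcons v w) (lift ord0 i) x = rvcons v (upd w i x).
Proof.
apply/rowP => j; rewrite mxE; have [k ->|->] := unliftP ord0 j.
  by rewrite (inj_eq (@lift_inj _ ord0)) !rvconsS mxE.
by rewrite (negbTE (neq_lift ord0 i)) !rvcons0.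
Qed.

(** Each variable has three choices k, with factor [om k] on the line of abscissa [c k]. Hypothesis
    [onevar] is the one-variable formula with the three choices summed, [c0] being its constant. *)
Variables (om : 'I_3 -> C -> C) (c : 'I_3 -> R) (g : nat -> R) (eta a ep A M : R) (c0 : C).
Hypotheses (eta0 : 0 < eta) (a1 : 1 < a) (b1 : 1 < a - ep) (A0 : 0 <= A)
 (ceta : forall k, `|c k| < eta)
 (wcont : forall k y, ccont (fun y => om k (c k +i* y)) y)
 (wbound : forall k y, normc (om k (c k +i* y)) <= A * (1 + `|y|) `^ ep)
 (onevar : forall (G : C -> C) (B : R),
  (forall z, `|complex.Re z| < eta -> holo G z) ->
  (forall z, `|complex.Re z| < eta -> G (- z) = G z) ->
  (forall z, `|complex.Re z| < eta -> normc (G z) <= B * weight a (complex.Im z)) ->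
  exists2 S, ccvg (fun N => \sum_(0 <= t < N) G (0 +i* g t)) S &
  \sum_k cint setT (fun y => 'i * (om k (c k +i* y) * G (c k +i* y))) = c0 * S)
 (gsum : forall N, \sum_(0 <= t < N) weight a (g t) <= M).

Definition in_strip n (z : 'rV[C]_n) := forall j, `|complex.Re (z 0 j)| < eta.

(** Joint continuity along sequences, and separately in each variable holomorphy and evenness, with
    decay: a class stable under fixing the first variable. *)
Definition admissible n (F : 'rV[C]_n -> C) (B : R) := [/\
  (forall (u : nat -> 'rV[C]_n) z, (forall m, in_strip (u m)) -> in_strip z ->
     (forall j, ccvg (fun m => u m 0 j) (z 0 j)) -> ccvg (F \o u) (F z)),
  (forall z j, in_strip z -> holo (fun v => F (upd z j v)) (z 0 j)),
  (forall z j, in_strip z -> F (upd z j (- z 0 j)) = F z) &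
  (forall z, in_strip z -> normc (F z) <= B * \prod_j weight a (complex.Im (z 0 j)))].

Lemma in_strip_rvcons n v (w : 'rV[C]_n) : `|complex.Re v| < eta -> in_strip w ->
  in_strip (rvcons v w).
Proof.
by move=> hv hw j; have [k ->|->] := unliftP ord0 j; rewrite ?rvconsS ?rvcons0.
Qed.

Lemma admissible_ge0 n (F : 'rV[C]_n -> C) B : admissible F B -> 0 <= B.
Proof.
move=> [_ _ _ h]; have := h 0; rewrite big1 => [H|j _]; last first.
  by rewrite mxE /weight /= normr0 addr0 powR1.
rewrite mulr1 in H; apply: le_trans (normc_ge0 _) (H _) => j.
by rewrite mxE /= normr0.
Qed.

Lemma admissible_tail n (F : 'rV[C]_n.+1 -> C) B v : `|complex.Re v| < eta ->
  admissible F B -> admissible (fun w => F (rvcons v w)) (B * weight a (complex.Im v)).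
Proof.
move=> hv [P1 P2 P3 P4]; split.
- move=> u z us zs cu; apply: (P1 (fun m => rvcons v (u m)) (rvcons v z)).
  + by move=> m; exact: in_strip_rvcons.
  + exact: in_strip_rvcons.
  + move=> j; have [k ->|->] := unliftP ord0 j.
      by rewrite rvconsS (_ : (fun m => _) = (fun m => u m 0 k))//; apply/funext => m; rewrite rvconsS.
    by rewrite rvcons0 (_ : (fun m => _) = (fun=> v)); [exact: ccvg_cst|apply/funext => m; rewrite rvcons0].
- move=> z j zs; have := P2 (rvcons v z) (lift ord0 j) (in_strip_rvcons hv zs).
  rewrite rvconsS (_ : (fun x => F (upd _ _ x)) = (fun x => F (rvcons v (upd z j x))))//.
  by apply/funext => x; rewrite upd_rvconsS.
- move=> z j zs; have := P3 (rvcons v z) (lift ord0 j) (in_strip_rvcons hv zs).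
  by rewrite rvconsS upd_rvconsS.
- move=> z zs; have := P4 _ (in_strip_rvcons hv zs).
  rewrite big_ord_recl rvcons0 mulrA (eq_bigr (fun j => weight a (complex.Im (z 0 j))))//.
  by move=> j _; rewrite rvconsS.
Qed.

Lemma admissible_head n (F : 'rV[C]_n.+1 -> C) B w : in_strip w -> admissible F B ->
  (forall v, `|complex.Re v| < eta -> holo (fun v => F (rvcons v w)) v) /\
  (forall v, `|complex.Re v| < eta -> F (rvcons (- v) w) = F (rvcons v w)).
Proof.
move=> ws [_ P2 P3 _]; split=> v hv.
  have := P2 (rvcons v w) ord0 (in_strip_rvcons hv ws); rewrite rvcons0.
  rewrite (_ : (fun x => F (upd _ _ x)) = (fun x => F (rvcons x w)))//.
  by apply/funext => x; rewrite upd_rvcons0.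
by have := P3 (rvcons v w) ord0 (in_strip_rvcons hv ws); rewrite rvcons0 upd_rvcons0.
Qed.

Definition omprod n (phi : 'I_n -> 'I_3) (z : 'rV[C]_n) : C := \prod_j om (phi j) (z 0 j).

(** In each variable the growth (1 + |y|)^ep of the factor is absorbed by the decay of [F], which
    lowers the exponent to a - ep. *)
Lemma omprod_nice n (F : 'rV[C]_n -> C) B (phi : 'I_n -> 'I_3) : admissible F B ->
  vnice (a - ep) (c \o phi) (fun z => omprod phi z * F z) (A ^+ n * B).
Proof.
move=> hF; have B0 := admissible_ge0 hF; have [P1 _ _ P4] := hF.
have st y : in_strip (vpoint (c \o phi) y) by move=> j; rewrite mxE /=; exact: ceta.
split.
  move=> u y hu; apply: ccvgM; last first.
    apply: (P1 (fun m => vpoint (c \o phi) (u m))) => // j.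
    rewrite mxE (_ : (fun m => _) = (fun x => (c (phi j) +i* x : C)) \o (u ^~ j)); last first.
      by apply/funext => m; rewrite mxE.
    apply: (@ccont_rcvg _ (fun x => c (phi j) +i* x)) (hu j).
    rewrite (_ : (fun x => _) = (fun x : R => (c (phi j))%:C + 'i * x%:C)); first exact: ccont_affine.
    by apply/funext => x; exact: vline_affine.
  rewrite /omprod; apply: ccvg_prod => j.
  rewrite mxE (_ : (fun m => _) = (fun x => om (phi j) (c (phi j) +i* x)) \o (u ^~ j)).
    by apply: (@ccont_rcvg _ (fun x => om (phi j) (c (phi j) +i* x))).
  by apply/funext => m; rewrite mxE.
move=> y; rewrite normcM /omprod normc_prod.
have h : \prod_j normc (om (phi j) (vpoint (c \o phi) y 0 j)) <= \prod_j (A * (1 + `|y j|) `^ ep).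
  by apply: ler_prod => j _; rewrite normc_ge0 mxE wbound.
have h' := P4 _ (st y).
apply: le_trans (ler_pM _ (normc_ge0 _) h h') _; first by apply: prodr_ge0 => j _; exact: normc_ge0.
rewrite big_split /= prodr_const card_ord -!mulrA ler_wpM2l ?exprn_ge0// mulrCA.
rewrite ler_wpM2l//.
rewrite -big_split /= le_eqVlt; apply/orP; left; apply/eqP; apply: eq_bigr => j _.
rewrite mxE /= /weight -powRDl ?ltr_wpDr//; congr (_ `^ _); ring.
Qed.

Definition hpoint n (N : nat) (t : 'I_n -> 'I_N) : 'rV[C]_n := \row_j (0 +i* g (t j)).

Lemma hpoint_cons n N (x : 'I_N) (t : 'I_n -> 'I_N) :
  hpoint (fcons x t) = rvcons (0 +i* g x) (hpoint t).
Proof.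
apply/rowP => i; have [j ->|->] := unliftP ord0 i.
  by rewrite rvconsS !mxE fconsS.
by rewrite rvcons0 mxE fcons0.
Qed.

Lemma in_strip_hpoint n N (t : 'I_n -> 'I_N) : in_strip (hpoint t).
Proof. by move=> j; rewrite mxE /= normr0. Qed.

Definition cube_sum n (F : 'rV[C]_n -> C) (N : nat) : C :=
  \sum_(t : {ffun 'I_n -> 'I_N}) F (hpoint t).

Lemma several_variables n (F : 'rV[C]_n -> C) B : admissible F B ->
  exists S, [/\ ccvg (cube_sum F) S,
    \sum_(phi : {ffun 'I_n -> 'I_3})
       vline_integral (c \o phi) (fun z => omprod phi z * F z) = c0 ^+ n * S &
    forall N, normc (cube_sum F N) <= B * M ^+ n].
Proof.
have M0 : 0 <= M by have := gsum 0; rewrite big_nil.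
have gst (x : R) : `|complex.Re (0 +i* x : C)| < eta by rewrite /= normr0.
elim: n F B => [|n IH] F B hF.
  have p0 N (t : 'I_0 -> 'I_N) : hpoint t = 0 by apply/rowP => -[].
  have cE N : cube_sum F N = F 0.
    rewrite /cube_sum (eq_bigr (fun=> F 0)) => [|t _]; last by rewrite p0.
    by rewrite sumr_const card_ffun !card_ord expn0.
  exists (F 0); split.
  - by move=> e e0; exists 0%N => N _; rewrite cE subrr normc0.
  - rewrite (eq_bigr (fun=> F 0)) => [|t _]; last by rewrite /= /omprod big_ord0 mul1r.
    by rewrite sumr_const card_ffun !card_ord expn0 mul1r.
  - move=> N; rewrite cE expr0; have [_ _ _ h] := hF; have := h 0; rewrite big_ord0; apply.
    by case.
have B0 := admissible_ge0 hF.
pose s N v := cube_sum (fun w => F (rvcons v w)) N.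
(* The guard makes the statement total, so that choice yields a function [Sn] of the first variable;
   its values off the strip are dummies. *)
have exS v : exists S, `|complex.Re v| < eta -> [/\ ccvg (s ^~ v) S,
    \sum_(phi : {ffun 'I_n -> 'I_3})
       vline_integral (c \o phi) (fun z => omprod phi z * F (rvcons v z)) = c0 ^+ n * S &
    forall N, normc (s N v) <= B * weight a (complex.Im v) * M ^+ n].
  have [hv|_] := boolP (`|complex.Re v| < eta); last by exists 0.
  by have [S hS] := IH _ _ (admissible_tail hv hF); exists S.
have [Sn hSn] := choice exS.
have w1 v : weight a v <= 1 by exact: weight_le1.
have sB N v : `|complex.Re v| < eta -> normc (s N v) <= B * M ^+ n * weight a (complex.Im v).
  by move=> /hSn[_ _ h]; rewrite mulrAC.
have BM0 : 0 <= B * M ^+ n by rewrite mulr_ge0// exprn_ge0.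
have sB1 N v : `|complex.Re v| < eta -> normc (s N v) <= B * M ^+ n.
  by move=> /(sB N) h; apply: le_trans h _; rewrite ler_piMr.
(* A pointwise limit of finite sums of holomorphic functions, bounded uniformly in N by the third
   part of the induction hypothesis. *)
have holoS v : `|complex.Re v| < eta -> holo Sn v.
  move=> hv; pose r := eta - `|complex.Re v|; have r0 : 0 < r by rewrite subr_gt0.
  have sub w : normc (w - v) < r -> `|complex.Re w| < eta.
    move=> wr; have := le_lt_trans (le_Re_normc _) wr; rewrite cReD cReN /r.
    move: (complex.Re w) (complex.Re v) => x y h.
    have -> : x = (x - y) + y by ring.
    by apply: le_lt_trans (ler_normD _ _) _; lra.
  have H : holo_disc Sn v r.
    apply: (@holo_limit _ s Sn v r (B * M ^+ n)) => [N w /sub hw|N w /sub hw|w /sub hw].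
    - apply: holo_sum => t.
      by have [h _] := admissible_head (@in_strip_hpoint n N t) hF; exact: h.
    - exact: sB1.
    - by have [] := hSn w hw.
  by apply: H; rewrite subrr normc0.
have evS v : `|complex.Re v| < eta -> Sn (- v) = Sn v.
  move=> hv; have hv' : `|complex.Re (- v)| < eta by rewrite cReN normrN.
  have [h1 _ _] := hSn _ hv; have [h2 _ _] := hSn _ hv'; apply: ccvg_uniq h2 _.
  rewrite (_ : s ^~ (- v) = s ^~ v)//; apply/funext => N; apply: eq_bigr => t _.
  by have [_ h] := admissible_head (@in_strip_hpoint n N t) hF; exact: h.
have bS v : `|complex.Re v| < eta -> normc (Sn v) <= B * M ^+ n * weight a (complex.Im v).
  by move=> hv; have [h _ _] := hSn _ hv; apply: ccvg_le h _ => N; exact: sB.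
have [S cS eS] := onevar holoS evS bS.
(* The inner integrals produce c0^n Sn rather than Sn, so the one-variable formula is applied to
   that function too. *)
have [S' cS' eS'] : exists2 S', ccvg (fun N => \sum_(0 <= t < N) (c0 ^+ n * Sn (0 +i* g t))) S' &
    \sum_k cint setT (fun y => 'i * (om k (c k +i* y) * (c0 ^+ n * Sn (c k +i* y)))) = c0 * S'.
  apply: (@onevar (fun v => c0 ^+ n * Sn v) (normc (c0 ^+ n) * (B * M ^+ n))) => v hv.
  - by apply: holoM; [exact: holo_cst|exact: holoS].
  - by rewrite evS.
  - by rewrite normcM -mulrA ler_wpM2l ?normc_ge0// bS.
have SS : S' = c0 ^+ n * S.
  apply: ccvg_uniq cS' _; rewrite (_ : (fun N => _) = (fun N => c0 ^+ n * \sum_(0 <= t < N) Sn (0 +i* g t))).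
    by apply: ccvgM => //; exact: ccvg_cst.
  by apply/funext => N; rewrite mulr_sumr.
have cubeE N : cube_sum F N = \sum_(0 <= t < N) s N (0 +i* g t).
  rewrite /cube_sum (big_ffun_recl (fun t : 'I_n.+1 -> 'I_N => F (hpoint t))) big_mkord.
  by apply: eq_bigr => x _; apply: eq_bigr => t _; rewrite hpoint_cons.
exists S; split.
(* In the cube sum the inner range grows along with the outer one. Replacing each inner sum by its
   limit costs an error that is dominated by the weights and tends to 0. *)
- have cD : ccvg (fun N => \sum_(0 <= t < N) (s N (0 +i* g t) - Sn (0 +i* g t))) 0.
    apply: (@tannery _ (fun N t => s N (0 +i* g t) - Sn (0 +i* g t))
      (fun t => (B * M ^+ n) * weight a (g t) + (B * M ^+ n) * weight a (g t)) (B * M ^+ n * M + B * M ^+ n * M)).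
    + move=> N t; apply: le_trans (le_normcB _ _) _; apply: lerD.
        exact: (sB N (0 +i* g t) (gst _)).
      exact: (bS (0 +i* g t) (gst _)).
    + by move=> N; rewrite big_split /= -!mulr_sumr; apply: lerD; rewrite ler_wpM2l.
    + move=> t; rewrite -(subrr (Sn (0 +i* g t))); apply: ccvgD; last exact: ccvg_cst.
      by have [] := hSn (0 +i* g t) (gst _).
  rewrite (_ : cube_sum F = (fun N => \sum_(0 <= t < N) (s N (0 +i* g t) - Sn (0 +i* g t)) +
     \sum_(0 <= t < N) Sn (0 +i* g t))).
    by rewrite -[S]add0r; exact: ccvgD.
  by apply/funext => N; rewrite cubeE -big_split /=; apply: eq_bigr => t _; rewrite subrK.
- rewrite (big_ffun_recl (fun phi : 'I_n.+1 -> 'I_3 =>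
     vline_integral (c \o phi) (fun z => omprod phi z * F z))).
  have -> : c0 ^+ n.+1 * S = c0 * S' by rewrite SS exprS mulrA.
  rewrite -eS'.
  apply: eq_bigr => k _.
  (* Integrability of the slices justifies exchanging the outer integral with the finite sum over
     [phi]. *)
  have sl (phi : 'I_n -> 'I_3) := slice_integrable b1 (@omprod_nice _ F B (fcons k phi) hF).
  rewrite /= -[LHS]cint_sum//; last by move=> phi _; exact: sl.
  apply: eq_cint => y _.
  have hv : `|complex.Re (c k +i* y : C)| < eta by exact: ceta.
  have [_ <- _] := hSn _ hv; rewrite !mulr_sumr; apply: eq_bigr => phi _.
  congr ('i * _); rewrite fcons0.
  rewrite -(vlineZ b1 _ (omprod_nice phi (admissible_tail hv hF))).
  have -> : (fun j : 'I_n => (c \o fcons k phi) (lift ord0 j)) = c \o phi.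
    by apply/funext => j /=; rewrite fconsS.
  apply: vline_ext => y'; rewrite mulrA; congr (_ * _).
  rewrite /omprod big_ord_recl fcons0 -/(rvcons _ _) rvcons0; congr (_ * _).
  by apply: eq_bigr => j _; rewrite fconsS rvconsS.
- move=> N; rewrite cubeE exprSr mulrA; apply: le_trans (normc_sum _ _ _) _.
  apply: (@le_trans _ _ (\sum_(0 <= t < N) B * M ^+ n * weight a (g t))).
    by apply: ler_sum => t _; exact: (sB N (0 +i* g t) (gst _)).
  by rewrite -mulr_sumr ler_wpM2l.
Qed.

End several_variables.

(** * Periodicity of the Kronecker symbol *)

Section quadratic_reciprocity.
Local Open Scope nat_scope.
Implicit Types (p q a b k l m n D : nat).

Lemma Fp_nat_eq0 p n : prime p -> ((n%:R : 'F_p) == 0)%R = (p %| n).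
Proof. by move=> pp; rewrite (dvdn_pcharf (pchar_Fp pp)). Qed.

Lemma Fp_p p : prime p -> (p%:R = 0 :> 'F_p)%R.
Proof. by move=> pp; apply/eqP; rewrite Fp_nat_eq0. Qed.

Lemma Fp_nat_mod p m n : prime p -> m = n %[mod p] -> (m%:R = n%:R :> 'F_p)%R.
Proof.
move=> pp mn; rewrite (divn_eq m p) (divn_eq n p) mn !natrD !natrM.
by rewrite Fp_p// !mulr0.
Qed.

Lemma Fp_natP p m n : prime p -> (m%:R = n%:R :> 'F_p)%R -> m = n %[mod p].
Proof.
move=> pp; wlog mn : m n / m <= n.
  by move=> H; case: (leqP m n) => [/H//|/ltnW /H h /esym/h].
move=> E; apply/esym/eqP; rewrite eqn_mod_dvd// -Fp_nat_eq0// natrB// E.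
by rewrite subrr.
Qed.

Lemma odd_prime_half p : odd p -> p = (p.-1./2).*2.+1.
Proof. by move=> op; have := odd_double_half p; rewrite op; case: p op => //= p; lia. Qed.

Lemma fermat_half p (x : 'F_p) : prime p -> odd p -> (x != 0)%R ->
  ((x ^+ 2) ^+ p.-1./2 = 1)%R.
Proof.
move=> pp op x0; apply: (mulfI x0); rewrite mulr1 -exprM -exprS.
rewrite mul2n -odd_prime_half//.
by have := finfield.expf_card x; rewrite card_Fp.
Qed.

Lemma kronecker_primeE a p : p != 2 -> kronecker_prime a p =
  (if (p %| a)%N then 0 else
   if [exists x : 'I_p, (x ^ 2 == a %[mod p])%N] then 1 else -1)%R.
Proof. by rewrite /kronecker_prime => /negbTE ->. Qed.

(** Squares are settled by Fermat. A nonsquare a with a^h = 1, h = (p - 1) / 2, would be one root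
    too many of X^h - 1, which already has the h distinct squares of 1, ..., h. *)
Lemma euler_criterion a p : prime p -> odd p ->
  ((kronecker_prime a p)%:~R = a%:R ^+ p.-1./2 :> 'F_p)%R.
Proof.
move=> pp op; have p2 : p != 2 by apply: contraTneq op => ->.
rewrite kronecker_primeE//; have hE := odd_prime_half op; set h := p.-1./2 in hE *.
have p1 := prime_gt1 pp.
have h0 : 0 < h by rewrite lt0n; apply/eqP => h0; rewrite h0 /= in hE; lia.
case: ifPn => [pa|pa].
  have /eqP -> : (a%:R == 0 :> 'F_p)%R by rewrite Fp_nat_eq0.
  by rewrite expr0n gtn_eqF.
have a0 : (a%:R != 0 :> 'F_p)%R by rewrite Fp_nat_eq0.
case: ifPn => [/existsP[x /eqP xa]|/existsPn nsq].
  rewrite -(Fp_nat_mod pp xa) natrX fermat_half//.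
  by apply: contraNneq a0 => x0; rewrite -(Fp_nat_mod pp xa) natrX x0 expr0n.
have sq1 : ((a%:R ^+ h) ^+ 2 = 1 :> 'F_p)%R.
  by rewrite exprAC fermat_half.
move/eqP: sq1; rewrite sqrf_eq1 => /orP[/eqP a1|/eqP->//]; exfalso.
pose sqs := [seq (k%:R ^+ 2 : 'F_p)%R | k <- iota 1 h].
pose P := ('X^h - 1 : {poly 'F_p})%R.
have sP : size P = h.+1 by rewrite size_XnsubC.
have P0 : (P != 0)%R by rewrite -size_poly_eq0 sP.
have nz k : k \in iota 1 h -> (k%:R != 0 :> 'F_p)%R.
  rewrite mem_iota => /andP[k1 kh]; rewrite Fp_nat_eq0//; apply/negP => /dvdn_leq; lia.
have rts : all (root P) (a%:R%R :: sqs).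
  apply/allP => y; rewrite inE => /orP[/eqP->|/mapP[k kh ->]].
    by rewrite /root /P !hornerE ?hornerXn a1 subrr.
  by rewrite /root /P !hornerE ?hornerXn fermat_half ?nz// subrr.
have un : uniq (a%:R%R :: sqs).
  rewrite cons_uniq; apply/andP; split.
    apply/negP => /mapP[k kh]; rewrite -natrX => /(Fp_natP pp) E.
    have kp : k < p by move: kh; rewrite mem_iota; lia.
    by have /negP := nsq (Ordinal kp); apply; apply/eqP.
  rewrite map_inj_in_uniq ?iota_uniq// => k l kh lh /eqP.
  rewrite eqf_sqr => /orP[/eqP/(Fp_natP pp)|].
    by rewrite !modn_small//; move: kh lh; rewrite !mem_iota; lia.
  rewrite -subr_eq0 opprK -natrD Fp_nat_eq0// => /dvdn_leq.
  by move: kh lh; rewrite !mem_iota; lia.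
have := max_poly_roots P0 rts un.
by rewrite /= size_map size_iota sP ltnn.
Qed.

Definition sign_like (x : int) := ((x == 0) || (x == 1) || (x == -1))%R.

Lemma sign_likeM x y : sign_like x -> sign_like y -> sign_like (x * y)%R.
Proof.
by rewrite /sign_like => /orP[/orP[]|] /eqP-> /orP[/orP[]|] /eqP->.
Qed.

Lemma kronecker_prime_sign a p : sign_like (kronecker_prime a p).
Proof. by rewrite /kronecker_prime; do !case: ifP. Qed.

(** Two values among 0, 1, -1 differ by at most 2, which is less than the odd prime p, so they can
    be compared modulo p. *)
Lemma sign_like_inj p (x y : int) : prime p -> odd p -> sign_like x -> sign_like y ->
  (x%:~R = y%:~R :> 'F_p)%R -> x = y.
Proof.
move=> pp op sx sy /eqP; rewrite -subr_eq0 -intrB => E.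
have p3 : 2 < p by case: p pp op {E} => [|[|[|]]].
have small (z : int) : `|z|%N < 3 -> (z%:~R == 0 :> 'F_p)%R -> z = 0%R.
  case: z => n n3; first by rewrite -pmulrn Fp_nat_eq0//; case: n n3 => // n n3 /dvdn_leq; lia.
  rewrite NegzE mulrNz oppr_eq0 -pmulrn Fp_nat_eq0// => /dvdn_leq; move: n3; lia.
apply/eqP; rewrite -subr_eq0; apply/eqP/small => //.
by move: sx sy; rewrite /sign_like => /orP[/orP[]|] /eqP-> /orP[/orP[]|] /eqP->.
Qed.

Lemma kronecker_prime_modl a b p : prime p -> odd p -> a = b %[mod p] ->
  kronecker_prime a p = kronecker_prime b p.
Proof.
move=> pp op ab; apply: (sign_like_inj pp op); try exact: kronecker_prime_sign.
by rewrite !euler_criterion// (Fp_nat_mod pp ab).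
Qed.

Lemma kronecker_primeMl a b p : prime p -> odd p ->
  kronecker_prime (a * b) p = (kronecker_prime a p * kronecker_prime b p)%R.
Proof.
move=> pp op; apply: (sign_like_inj pp op); rewrite ?sign_likeM ?kronecker_prime_sign//.
by rewrite rmorphM /= !euler_criterion// natrM exprMn.
Qed.

Definition gauss_count a p := \sum_(k <- iota 1 p.-1./2) (p.-1./2 < (a * k) %% p).

(** The absolute value of the least residue of a k in absolute value. *)
Definition folded a p k :=
  if p.-1./2 < (a * k) %% p then p - (a * k) %% p else (a * k) %% p.

Lemma folded_perm a p : prime p -> odd p -> ~~ (p %| a) ->
  perm_eq [seq folded a p k | k <- iota 1 p.-1./2] (iota 1 p.-1./2).
Proof.
move=> pp op pa; have hE := odd_prime_half op; set h := p.-1./2 in hE *.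
have p0 := prime_gt0 pp.
have sub : {subset [seq folded a p k | k <- iota 1 h] <= iota 1 h}.
  move=> _ /mapP[k kh ->]; rewrite /folded -/h.
  have rp : (a * k) %% p < p by rewrite ltn_mod.
  have r0 : 0 < (a * k) %% p.
    rewrite lt0n; apply/negP => /eqP/eqP; rewrite -/(dvdn _ _) Euclid_dvdM// (negbTE pa) /=.
    by move/dvdn_leq; move: kh; rewrite mem_iota; lia.
  by rewrite mem_iota; case: ifP; lia.
have un : uniq [seq folded a p k | k <- iota 1 h].
  rewrite map_inj_in_uniq ?iota_uniq// => k l kh lh; rewrite /folded -/h => E.
  have a0 : (a%:R != 0 :> 'F_p)%R by rewrite Fp_nat_eq0.
  have rk : (a * k) %% p < p by rewrite ltn_mod.
  have rl : (a * l) %% p < p by rewrite ltn_mod.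
  have same : (a * k) %% p = (a * l) %% p -> k = l.
    move=> /(Fp_nat_mod pp); rewrite !natrM => /(mulfI a0)/(Fp_natP pp).
    by rewrite !modn_small//; move: kh lh; rewrite !mem_iota; lia.
  have opp : (a * k) %% p + (a * l) %% p = p -> k = l.
    move=> /eqP E2; exfalso.
    have : p %| a * k + a * l by rewrite /dvdn -modnDm (eqP E2) modnn.
    rewrite -mulnDr Euclid_dvdM// (negbTE pa) /= => /dvdn_leq.
    by move: kh lh; rewrite !mem_iota; lia.
  by move: E; do 2 case: ifP; move=> *; (apply: same; lia) || (apply: opp; lia).
apply: uniq_perm => //; first exact: iota_uniq.
by have [] := uniq_min_size un sub _; rewrite ?size_map.
Qed.

(** Up to sign the residues of a, 2 a, ..., h a are a permutation of 1, ..., h. Comparing products,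
    h! cancels and a^h is the product of the signs, to which Euler's criterion applies. *)
Lemma gauss_lemma a p : prime p -> odd p -> ~~ (p %| a) ->
  kronecker_prime a p = ((-1) ^+ gauss_count a p)%R.
Proof.
move=> pp op pa; apply: (sign_like_inj pp op); first exact: kronecker_prime_sign.
  by rewrite -signr_odd; case: odd.
have hE := odd_prime_half op; set h := p.-1./2 in hE *.
have p0 := prime_gt0 pp.
rewrite euler_criterion// rmorphXn /= rmorphN rmorph1 -/h.
pose W := (\prod_(k <- iota 1 h) k%:R : 'F_p)%R.
have W0 : (W != 0)%R.
  rewrite prodf_seq_neq0; apply/allP => k kh /=; rewrite Fp_nat_eq0//.
  by apply/negP => /dvdn_leq; move: kh; rewrite mem_iota; lia.
apply: (mulIf W0).
have -> : (a%:R ^+ h * W = \prod_(k <- iota 1 h) (a * k)%:R :> 'F_p)%R.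
  rewrite -{1}(size_iota 1 h) /W; elim: (iota 1 h) => [|k s IH] /=.
    by rewrite !big_nil expr0 mulr1.
  by rewrite !big_cons -IH natrM exprS; ring.
transitivity (\prod_(k <- iota 1 h) ((-1) ^+ (h < (a * k) %% p)%N * (folded a p k)%:R) : 'F_p)%R.
  apply: eq_bigr => k _; rewrite /folded -/h.
  have rk : (a * k) %% p < p by rewrite ltn_mod.
  rewrite -(Fp_nat_mod pp (modn_mod _ _)); case: ifP => _; last by rewrite expr0 mul1r.
  rewrite natrB ?(ltnW rk)//.
  by rewrite Fp_p// expr1 sub0r mulN1r opprK.
rewrite big_split /=; congr (_ * _)%R.
  rewrite /gauss_count -/h; elim: (iota 1 h) => [|k s IH]; first by rewrite !big_nil.
  by rewrite !big_cons IH exprD.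
by rewrite /W -[RHS](perm_big _ (folded_perm pp op pa)) big_map.
Qed.

Lemma odd_sum_seq (s : seq nat) (F : nat -> nat) :
  odd (\sum_(k <- s) F k) = odd (\sum_(k <- s) odd (F k)).
Proof.
by elim: s => [|k s IH]; rewrite ?big_nil// !big_cons !oddD IH oddb.
Qed.

(** Modulo 2 and for odd p, folding flips the parity of exactly the counted residues. Summing a k =
    p floor(a k / p) + remainder, and using that the folded residues permute 1, ..., h, gives the
    parity. *)
Lemma gauss_count_parity a p : prime p -> odd p -> ~~ (p %| a) ->
  odd (gauss_count a p) = odd (a.+1 * (\sum_(k <- iota 1 p.-1./2) k) +
     \sum_(k <- iota 1 p.-1./2) (a * k) %/ p).
Proof.
move=> pp op pa; set h := p.-1./2.
have p0 := prime_gt0 pp.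
have E1 : odd (\sum_(k <- iota 1 h) folded a p k) = odd (\sum_(k <- iota 1 h) k).
  by rewrite -[in RHS](perm_big _ (folded_perm pp op pa)) big_map.
have E2 : odd (a * \sum_(k <- iota 1 h) k) = odd (\sum_(k <- iota 1 h) (a * k) %/ p)
   (+) odd (\sum_(k <- iota 1 h) (a * k) %% p).
  rewrite big_distrr /= -oddD -big_split /=.
  rewrite odd_sum_seq [in RHS]odd_sum_seq; congr (odd _); apply: eq_bigr => k _.
  by rewrite {1}(divn_eq (a * k) p) !oddD oddM op andbT.
have E3 : odd (\sum_(k <- iota 1 h) folded a p k) =
  odd (\sum_(k <- iota 1 h) (a * k) %% p) (+) odd (gauss_count a p).
  rewrite /gauss_count -/h -oddD -big_split /=.
  rewrite odd_sum_seq [in RHS]odd_sum_seq; congr (odd _); apply: eq_bigr => k _.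
  rewrite /folded -/h oddD; case: ifP => _; last by rewrite addbF.
  by rewrite oddB ?op ?addbT// ltnW// ltn_mod.
rewrite mulSn !oddD E2 -E1 E3.
by case: (odd (\sum_(k <- iota 1 h) _ %% p)); case: (odd (gauss_count a p));
   case: (odd (\sum_(k <- iota 1 h) _ %/ p)).
Qed.

Lemma iota_rcons N : iota 1 N.+1 = iota 1 N ++ [:: N.+1].
Proof. by rewrite -{1}(addn1 N) iotaD. Qed.

Lemma divn_count m p N : 0 < p -> \sum_(l <- iota 1 N) (p * l <= m) = minn N (m %/ p).
Proof.
move=> p0; elim: N => [|N IH]; first by rewrite big_nil min0n.
rewrite iota_rcons big_cat big_seq1 IH mulnC -leq_divRL//.
by move: (m %/ p) => d; case: leqP => h /=; lia.
Qed.

(** Both sums count lattice points of an h x h' rectangle, on either side of the line p l = q k; no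
    point lies on the line since p and q are distinct primes. *)
Lemma eisenstein_sum p q : prime p -> odd p -> prime q -> odd q -> p != q ->
  \sum_(k <- iota 1 p.-1./2) (q * k) %/ p + \sum_(l <- iota 1 q.-1./2) (p * l) %/ q =
  p.-1./2 * q.-1./2.
Proof.
move=> pp op pq oq npq; have hp := odd_prime_half op; have hq := odd_prime_half oq.
set h := p.-1./2 in hp *; set h' := q.-1./2 in hq *.
have p0 := prime_gt0 pp; have q0 := prime_gt0 pq.
have A : \sum_(k <- iota 1 h) (q * k) %/ p =
    \sum_(k <- iota 1 h) \sum_(l <- iota 1 h') (p * l <= q * k).
  apply: eq_big_seq => k; rewrite mem_iota => /andP[k1 kh].
  rewrite divn_count//; apply/esym/minn_idPr; rewrite -ltnS ltn_divLR//; nia.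
have B : \sum_(l <- iota 1 h') (p * l) %/ q =
    \sum_(k <- iota 1 h) \sum_(l <- iota 1 h') (q * k <= p * l).
  rewrite exchange_big /=; apply: eq_big_seq => l; rewrite mem_iota => /andP[l1 lh].
  rewrite divn_count//; apply/esym/minn_idPr; rewrite -ltnS ltn_divLR//; nia.
rewrite A B -big_split /=.
transitivity (\sum_(k <- iota 1 h) h'); last first.
  by rewrite big_const_seq count_predT size_iota iter_addn_0 mulnC.
apply: eq_big_seq => k; rewrite mem_iota => /andP[k1 kh]; rewrite -big_split /=.
transitivity (\sum_(l <- iota 1 h') 1); last first.
  by rewrite big_const_seq count_predT size_iota iter_addn_0 mul1n.
apply: eq_big_seq => l; rewrite mem_iota => /andP[l1 lh].
have ne : p * l <> q * k.
  move=> E; have : p %| q * k by rewrite -E dvdn_mulr.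
  rewrite Euclid_dvdM// dvdn_prime2// (negbTE npq) /= => /dvdn_leq; lia.
by case: leqP; case: leqP; lia.
Qed.

Lemma quadratic_reciprocity p q : prime p -> odd p -> prime q -> odd q -> p != q ->
  (kronecker_prime q p * kronecker_prime p q = (-1) ^+ (p.-1./2 * q.-1./2))%R.
Proof.
move=> pp op pq oq npq.
have pq' : ~~ (p %| q) by rewrite dvdn_prime2.
have qp' : ~~ (q %| p) by rewrite dvdn_prime2// eq_sym.
rewrite (gauss_lemma pp op pq') (gauss_lemma pq oq qp') -exprD.
rewrite -(eisenstein_sum pp op pq oq npq).
have E : odd (gauss_count q p + gauss_count p q) =
  odd (\sum_(k <- iota 1 p.-1./2) (q * k) %/ p + \sum_(l <- iota 1 q.-1./2) (p * l) %/ q).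
  have P1 := gauss_count_parity pp op pq'; have P2 := gauss_count_parity pq oq qp'.
  rewrite oddD oddM /= oq /= in P1; rewrite oddD oddM /= op /= in P2.
  by rewrite !oddD P1 P2.
by rewrite -[LHS]signr_odd E signr_odd.
Qed.

(** On odd n this is (-1)^((n - 1) / 2), and [s8] below is (-1)^((n^2 - 1) / 8). *)
Definition s4 n : int := (if (n %% 4 == 3)%N then -1 else 1)%R.
Definition s8 n : int := (if (n %% 8)%N \in [:: 1; 7]%N then 1 else -1)%R.

Lemma odd_triangle h : odd (\sum_(k <- iota 1 h) k) = (h %% 4 \in [:: 1; 2]).
Proof.
elim: h => [|h IH]; first by rewrite big_nil.
rewrite iota_rcons big_cat big_seq1 oddD IH /= !inE.
lia.
Qed.

Lemma kronecker_prime_2 p : prime p -> odd p -> kronecker_prime 2 p = s8 p.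
Proof.
move=> pp op; have hE := odd_prime_half op.
have p2 : ~~ (p %| 2).
  by rewrite dvdn_prime2//; apply: contraTneq op => ->.
rewrite gauss_lemma// -signr_odd gauss_count_parity//.
rewrite [X in _ + X]big1_seq ?addn0; last first.
  move=> k /andP[_]; rewrite mem_iota => /andP[_ kh]; apply: divn_small; lia.
rewrite oddM /= odd_triangle /s8; set h := p.-1./2 in hE *.
have -> : (p %% 8 \in [:: 1; 7]) = ~~ (h %% 4 \in [:: 1; 2]) by rewrite hE !inE; lia.
by case: (_ \in _).
Qed.

Lemma s4M a b : odd a -> odd b -> s4 (a * b) = (s4 a * s4 b)%R.
Proof.
move=> oa ob; have Ea : odd (a %% 4) by rewrite odd_mod.
have Eb : odd (b %% 4) by rewrite odd_mod.
rewrite /s4 -modnMm; move: Ea Eb (ltn_pmod a (isT : 0 < 4)) (ltn_pmod b (isT : 0 < 4)).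
by move: (a %% 4) (b %% 4) => [|[|[|[|]]]]// [|[|[|[|]]]].
Qed.

Lemma s8M a b : odd a -> odd b -> s8 (a * b) = (s8 a * s8 b)%R.
Proof.
move=> oa ob; have Ea : odd (a %% 8) by rewrite odd_mod.
have Eb : odd (b %% 8) by rewrite odd_mod.
rewrite /s8 -modnMm; move: Ea Eb (ltn_pmod a (isT : 0 < 8)) (ltn_pmod b (isT : 0 < 8)).
by move: (a %% 8) (b %% 8) => [|[|[|[|[|[|[|[|]]]]]]]]// [|[|[|[|[|[|[|[|]]]]]]]].
Qed.

Lemma kronecker_sign p q : prime p -> odd p -> prime q -> odd q ->
  kronecker_prime q p = ((if (q %% 4 == 3)%N then s4 p else 1) * kronecker_prime p q)%R.
Proof.
move=> pp op pq oq; have [->|npq] := eqVneq p q.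
  by rewrite /kronecker_prime dvdnn mulr0.
have E := quadratic_reciprocity pp op pq oq npq.
have qp' : ~~ (q %| p) by rewrite dvdn_prime2// eq_sym.
have sq : (kronecker_prime p q * kronecker_prime p q = 1)%R.
  by rewrite gauss_lemma// -expr2 sqrr_sign.
have -> : kronecker_prime q p = ((-1) ^+ (p.-1./2 * q.-1./2) * kronecker_prime p q)%R.
  by rewrite -E -mulrA sq mulr1.
congr (_ * _)%R; rewrite -signr_odd oddM /s4.
have par r : odd r -> (r %% 4 == 3) = odd r.-1./2.
  move=> orr; rewrite [in LHS](odd_prime_half orr); set h := r.-1./2.
  by rewrite -{1}(odd_double_half h); case: (odd h); lia.
by rewrite !par//; case: (odd p.-1./2); case: (odd q.-1./2).
Qed.

Lemma prod_prime_decomp (f : nat -> int) n N : n < N ->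
  (\prod_(pe <- prime_decomp n) f pe.1 ^+ pe.2 = \prod_(0 <= p < N) f p ^+ logn p n)%R.
Proof.
move=> nN; rewrite prime_decompE big_map /=.
rewrite (perm_big [seq p <- index_iota 0 N | p \in primes n]); last first.
  apply: uniq_perm; rewrite ?filter_uniq ?iota_uniq ?primes_uniq// => p.
  rewrite mem_filter mem_index_iota; case pn : (p \in primes n) => //=.
  move: pn; rewrite mem_primes => /and3P[_ n0 /(dvdn_leq n0)]; lia.
rewrite big_filter big_mkcond /=; apply: eq_bigr => p _.
case: ifPn => //; rewrite -logn_gt0 lt0n negbK => /eqP ->; by rewrite expr0.
Qed.

Lemma kroneckerE D n : 0 < n ->
  kronecker D n = (\prod_(p <- primes n) kronecker_prime D p ^+ logn p n)%R.
Proof. by move=> n0; rewrite /kronecker gtn_eqF// prime_decompE big_map. Qed.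

Lemma kroneckerM D a b : 0 < a -> 0 < b ->
  kronecker D (a * b) = (kronecker D a * kronecker D b)%R.
Proof.
move=> a0 b0; rewrite /kronecker muln_eq0 (gtn_eqF a0) (gtn_eqF b0) /=.
rewrite !(@prod_prime_decomp _ _ (a * b).+1)// ?ltnS ?leq_pmull ?leq_pmulr//.
by rewrite -big_split /=; apply: eq_bigr => p _; rewrite lognM// exprD.
Qed.

Lemma kronecker_1 D : kronecker D 1 = 1%R.
Proof. by rewrite /kronecker /= big_nil. Qed.

Lemma kronecker_primeK D p : prime p -> kronecker D p = kronecker_prime D p.
Proof.
move=> pp; rewrite /kronecker gtn_eqF ?prime_gt0// prime_decompE primes_prime//.
by rewrite big_map big_seq1 /= logn_prime// eqxx expr1.
Qed.

Lemma prime_factor_ind (P : nat -> Prop) : P 1 ->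
  (forall p n, prime p -> 0 < n -> P n -> P (p * n)) -> forall n, 0 < n -> P n.
Proof.
move=> P1 PM n; have [k] := ubnP n; elim: k n => // k IH n nk n0.
have [n1|n1] := leqP n 1; first by have -> : n = 1 by lia.
have pp := pdiv_prime n1; have pn := pdiv_dvd n.
have m0 : 0 < n %/ pdiv n by rewrite divn_gt0 ?pdiv_gt0// dvdn_leq.
rewrite -(divnK pn) mulnC; apply: PM => //; apply: IH => //.
by apply: leq_trans (ltn_Pdiv (prime_gt1 pp) n0) _.
Qed.

(** A completely multiplicative function is determined by its values at primes; this transfers
    reciprocity from primes to all positive n. *)
Lemma kronecker_char D (psi : nat -> int) : psi 1 = 1%R ->
  (forall a b, 0 < a -> 0 < b -> psi (a * b) = (psi a * psi b)%R) ->
  (forall p, prime p -> psi p = kronecker_prime D p) ->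
  forall n, 0 < n -> kronecker D n = psi n.
Proof.
move=> psi1 psiM psip; apply: prime_factor_ind => [|p n pp n0 IH].
  by rewrite kronecker_1.
by rewrite kroneckerM ?(prime_gt0 pp)// (kronecker_primeK D pp) IH psiM ?(prime_gt0 pp)// (psip p pp).
Qed.

Lemma kronecker_Ml a b D : odd D -> kronecker (a * b) D = (kronecker a D * kronecker b D)%R.
Proof.
move=> oD; have D0 : 0 < D by case: D oD.
rewrite !kroneckerE// -big_split /= big_seq [RHS]big_seq.
apply: eq_bigr => p; rewrite mem_primes => /and3P[pp _ pD].
by rewrite kronecker_primeMl ?exprMn// (dvdn_odd pD).
Qed.

Lemma kronecker_modl a b D : odd D -> a = b %[mod D] -> kronecker a D = kronecker b D.
Proof.
move=> oD ab; have D0 : 0 < D by case: D oD {ab}.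
rewrite !kroneckerE// big_seq [RHS]big_seq.
apply: eq_bigr => p; rewrite mem_primes => /and3P[pp _ pD].
rewrite (@kronecker_prime_modl a b)// ?(dvdn_odd pD)//.
by rewrite -(modn_dvdm a pD) ab modn_dvdm.
Qed.

Lemma kronecker_2 D : 0 < D -> odd D -> kronecker 2 D = s8 D.
Proof.
move: D; apply: prime_factor_ind => [_|p n pp n0 IH]; first by rewrite kronecker_1.
rewrite oddM => /andP[op on].
by rewrite kroneckerM ?(prime_gt0 pp)// kronecker_primeK// kronecker_prime_2// IH// s8M.
Qed.

(** Induction over the prime factors of D. Each factor congruent to 3 modulo 4 brings a sign [s4 p],
    and the number of those factors is odd exactly when D is 3 modulo 4. *)
Lemma jacobi_reciprocity p D : 0 < D -> prime p -> odd p -> odd D ->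
  kronecker_prime D p = ((if (D %% 4 == 3)%N then s4 p else 1) * kronecker p D)%R.
Proof.
move=> D0 pp op; move: D D0; apply: prime_factor_ind => [_|q n pq n0 IH].
  rewrite kronecker_1 mulr1 kronecker_primeE; last by apply: contraTneq op => ->.
  rewrite Euclid_dvd1//; case: ifPn => // /existsPn /(_ (Ordinal (prime_gt1 pp))).
  by rewrite /= exp1n eqxx.
rewrite oddM => /andP[oq on].
rewrite kronecker_primeMl// IH// kroneckerM ?(prime_gt0 pq)// (kronecker_primeK p pq).
rewrite (kronecker_sign pp op pq oq) mulrACA; congr (_ * _)%R.
have Eq : odd (q %% 4) by rewrite odd_mod.
have En : odd (n %% 4) by rewrite odd_mod.
have s2 : (s4 p * s4 p = 1)%R by rewrite /s4; case: ifP.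
rewrite -modnMm; move: Eq En (ltn_pmod q (isT : 0 < 4)) (ltn_pmod n (isT : 0 < 4)).
move: (q %% 4) (n %% 4) => [|[|[|[|]]]]// [|[|[|[|]]]]//= _ _ _ _; by rewrite ?mulr1 ?mul1r.
Qed.

Lemma kronecker_prime_1 p : prime p -> odd p -> kronecker_prime 1 p = 1%R.
Proof.
move=> pp op; rewrite kronecker_primeE; last by apply: contraTneq op => ->.
rewrite Euclid_dvd1//; case: ifPn => // /existsPn /(_ (Ordinal (prime_gt1 pp))).
by rewrite /= exp1n eqxx.
Qed.

Lemma kronecker_1l D : odd D -> kronecker 1 D = 1%R.
Proof.
move=> oD; have D0 : 0 < D by case: D oD.
rewrite kroneckerE// big_seq big1// => p; rewrite mem_primes => /and3P[pp _ pD].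
by rewrite kronecker_prime_1 ?expr1n// (dvdn_odd pD).
Qed.

(** Reciprocity turns the symbol into a function of n modulo fixed integers. An odd fundamental
    discriminant is 1 modulo 4, so that n modulo D decides; an even one is 2^v E with E odd, and the
    characters modulo 8 and 4 enter beside n modulo E. The number 8 D is a common period. *)
Lemma kronecker_periodic D m : fundamental_discriminant D -> 0 < m ->
  kronecker D (m + 8 * D) = kronecker D m.
Proof.
move=> fD m0; have D0 : 0 < D.
  move: fD => /orP[/andP[_ /andP[]//]|/and3P[_ _ /andP[h _]]].
  by case: D h.
have per E : odd E -> E %| D -> kronecker (m + 8 * D) E = kronecker m E.
  move=> oE ED; apply: kronecker_modl => //.
  by have /dvdnP[k ->] := ED; rewrite mulnA addnC modnMDl.
have [oD|eD] := boolP (odd D).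
  have D4 : D %% 4 = 1.
    move: fD => /orP[/andP[/eqP//]|/andP[D4 _]].
    by have := dvdn_odd D4 oD.
  have H n : 0 < n -> kronecker D n = kronecker n D.
    apply: (@kronecker_char D (fun n => kronecker n D)) => [|a b _ _|p pp].
    - exact: kronecker_1l.
    - exact: kronecker_Ml.
    - have [op|ep] := boolP (odd p); first by rewrite jacobi_reciprocity// D4 mul1r.
      have -> : p = 2 by case: (even_prime pp) => // op; rewrite op in ep.
      rewrite kronecker_2// /kronecker_prime dvdn2 oD /=; by [].
  by rewrite !H ?addn_gt0 ?m0// per.
pose v := logn 2 D; pose E := D %/ 2 ^ v.
have DE : D = 2 ^ v * E by rewrite mulnC divnK// pfactor_dvdnn.
have oE : odd E.
  have := pfactor_coprime (isT : prime 2) D0 => -[E' cE' DE'].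
  have -> : E = E' by rewrite /E {1}DE' mulnK// expn_gt0.
  by rewrite -coprime2n.
have E0 : 0 < E by case: (E) oE.
(* The flipped symbol: s8^v comes from the power of 2 in D, s4 from reciprocity with the odd part E,
   and the value 0 at even n from D being even. *)
pose psi n : int := (if odd n then s8 n ^+ v * (if (E %% 4 == 3)%N then s4 n else 1) * kronecker n E else 0)%R.
have K1 := kronecker_1l oE.
have H n : 0 < n -> kronecker D n = psi n.
  apply: (@kronecker_char D psi) => [|a b _ _|p pp].
  - by rewrite /psi /= K1 /s8 /s4 /= expr1n; case: ifP.
  - rewrite /psi oddM; case: (boolP (odd a)) => oa /=; last by rewrite mul0r.
    case: (boolP (odd b)) => ob /=; last by rewrite mulr0.
    by rewrite s8M// s4M// kronecker_Ml// exprMn; case: ifP => _; ring.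
  - rewrite /psi; have [op|ep] := boolP (odd p).
      rewrite [in RHS]DE kronecker_primeMl// (jacobi_reciprocity E0 pp op oE) mulrA; congr (_ * _ * _)%R.
      elim: (v) => [|k IH]; last by rewrite expnS kronecker_primeMl// -IH kronecker_prime_2// exprS.
      have := @jacobi_reciprocity p 1 isT pp op isT; by rewrite /= kronecker_1 mulr1 => ->.
    have -> : p = 2 by case: (even_prime pp) => // op; rewrite op in ep.
    by rewrite /kronecker_prime dvdn2 eD.
rewrite !H ?addn_gt0 ?m0// /psi.
have -> : odd (m + 8 * D) = odd m by rewrite oddD oddM addbF.
have -> : s8 (m + 8 * D) = s8 m by rewrite /s8 addnC mulnC modnMDl.
have -> : s4 (m + 8 * D) = s4 m.
  by rewrite /s4 addnC (_ : 8 * D = (2 * D) * 4) ?modnMDl//; lia.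
by rewrite per// DE dvdn_mull.
Qed.

End quadratic_reciprocity.

(** * The L-functions of fundamental discriminants *)

Section kronecker_L.
Variable R : realType.
Local Notation C := (R[i]^o).

Lemma kronecker_sign_like (D n : nat) : (0 < n)%N -> sign_like (kronecker D n).
Proof.
move=> n0; rewrite kroneckerE//; apply: (big_ind sign_like) => //; first exact: sign_likeM.
move=> p _; elim: (logn p n) => [|k IH]; first by rewrite expr0.
by rewrite exprS; apply: sign_likeM => //; exact: kronecker_prime_sign.
Qed.

Definition kron_coef (d k : nat) : R := (kronecker d k.+1)%:~R.

Variables (d : nat) (L : C -> C).
Hypotheses (fd : fundamental_discriminant d) (LF : is_Lfunction d L).

Lemma kron_coef_le1 k : `|kron_coef d k| <= 1.
Proof.
have := @kronecker_sign_like d k.+1 isT.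
by rewrite /kron_coef /sign_like => /orP[/orP[]|] /eqP->; rewrite ?normr0 ?normr1 ?normrN1.
Qed.

Lemma discriminant_gt0 : (0 < d)%N.
Proof. by move: fd; case: d. Qed.

Lemma kron_coef_periodic k : kron_coef d (k + 8 * d)%N = kron_coef d k.
Proof. by rewrite /kron_coef -addSn kronecker_periodic. Qed.

Lemma Lfunction_series s : 1 < complex.Re s ->
  ccvg (fun N => \sum_(0 <= k < N) (kron_coef d k)%:C * rpw k.+1%:R (- s)) (L s).
Proof.
move=> s1; have [h _] := LF; have /ccvgP := h s s1.
rewrite (_ : series _ = (fun N => \sum_(0 <= k < N) (kron_coef d k)%:C * rpw k.+1%:R (- s)))//.
apply/funext => N; rewrite /series /=; apply: eq_bigr => k _.
by rewrite rpowCE /kron_coef /rpw rmorph_int.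
Qed.

Lemma Lfunction_holo s : s != 1 -> holo L s.
Proof.
move=> s1; have [_ h] := LF; have : holomorphic_at L s by apply: h => _; exact/eqP.
by move=> /nbhs_singleton /holoP.
Qed.

Let q0 : (0 < 8 * d)%N. Proof. by rewrite muln_gt0 discriminant_gt0. Qed.

Lemma Lfunction_growth (rho : R) : 0 < rho < 2 -> exists K : R, forall (T : R) (w : C),
    4 <= T -> normc (w - (2 +i* T)) <= rho -> normc (L w) <= K * T.
Proof.
move=> hr; exact: (periodic_dirichlet_growth q0 kron_coef_periodic kron_coef_le1 hr
  Lfunction_holo Lfunction_series).
Qed.

Lemma Lfunction_lower (T : R) : 4^-1 <= normc (L (2 +i* T)).
Proof.
apply: (dirichlet_lower (T := T) q0 kron_coef_le1); first by rewrite /kron_coef kronecker_1.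
by apply: Lfunction_series => /=; rewrite ltr1n.
Qed.

Lemma Lfunction_conj s : complex.Im s != 0 -> L s^* = (L s)^*.
Proof. exact: dirichlet_conj Lfunction_holo Lfunction_series s. Qed.

End kronecker_L.

(** * The three lines and factors for a fixed discriminant *)

Section line_weights.
Variable R : realType.
Local Notation C := (R[i]^o).
Local Notation mu := (@lebesgue_measure R).
Variables (d : nat) (L psi : C -> C) (g : nat -> R) (dl eta a : R).
Hypotheses (fd : fundamental_discriminant d) (LF : is_Lfunction d L)
  (fe : forall s, 0 < complex.Re s < 1 -> L s = psi s * L (1 - s))
  (rh : GRH L) (Lc : L 2^-1 <> 0) (zo : zero_ordinates L g)
  (dl0 : 0 < dl) (dl2 : dl < 2^-1) (dle : dl < eta) (a1 : 1 < a).

(** The indices 0, 1, 2 stand for membership in K, L, M. *)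
Definition line (k : 'I_3) : R := if k == 0 then dl else - dl.

(* The factor attached to a variable with index in K, L or M, the sign
   (-1)^|M| being distributed over M. *)
Definition line_factor (L' psi' : C -> C) (k : 'I_3) (z : C) : C :=
  if k == 0 then logderiv L' (2^-1 + z)
  else if k == 1 then logderiv L' (2^-1 + - z) else - logderiv psi' (2^-1 + z).

Let om := line_factor L psi.

Lemma zero_ordinates_pzero : [/\ forall t, 0 < g t,
  {homo g : t u / (t <= u)%N >-> t <= u} &
  forall y : R, 0 < y -> exists2 m : nat,
        pzero L (2^-1 +i* y) m & ([set t | g t = y] #= `I_m)%card].
Proof.
have [h1 h2 h3] := zo; split => // y /h3[m [h [hh h0 Lh]] cm]; exists m => //.
exists h; split; [by move: hh => /nbhs_singleton /holoP|exact: h0|].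
by have /nbhsC[e e0 he] := Lh; exists e => // w /andP[_]; exact: he.
Qed.

Let gz := zero_ordinates_pzero.

Let refl_point (y : R) : 2^-1 + - (- dl +i* y) = 2^-1 + (dl +i* - y) :> C.
Proof. by congr (_ + _); apply: eq_ReIm; rewrite ?cReN ?cImN /= ?opprK. Qed.

Let om2 (y : R) : om 2 (- dl +i* y) = - (logderiv L (2^-1 + (- dl +i* y)) +
  logderiv L (2^-1 + (dl +i* - y))).
Proof.
rewrite /om /line_factor /= (logderiv_functional dl0 dl2 (Lfunction_holo LF) rh y fe).
by rewrite refl_point.
Qed.

Let ad : `|dl| = dl. Proof. by rewrite gtr0_norm. Qed.
Let ad' : `|- dl| = dl. Proof. by rewrite normrN. Qed.

Let hcont (b y : R) : `|b| = dl -> ccont (fun y => logderiv L (2^-1 + (b +i* y))) y.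
Proof. exact: (logderiv_vline_ccont dl0 dl2 (Lfunction_holo LF) rh y). Qed.

Let rcont (y : R) : ccont (fun y => logderiv L (2^-1 + (dl +i* - y))) y.
Proof.
have /ccontP h := hcont (- y) ad; apply/ccontP => e /h[r r0 hr]; exists r => // x xy.
by apply: hr; rewrite -opprD normrN.
Qed.

Lemma line_factor_cont k y : ccont (fun y => om k (line k +i* y)) y.
Proof.
case: k => -[|[|[|//]]] kl; rewrite /line /om /=.
- exact: hcont.
- rewrite (_ : (fun y => _) = (fun y => logderiv L (2^-1 + (dl +i* - y)))); first exact: rcont.
  by apply/funext => t; rewrite /line_factor /= refl_point.
- rewrite (_ : (fun y => _) = (fun y => - (logderiv L (2^-1 + (- dl +i* y)) +
    logderiv L (2^-1 + (dl +i* - y))))).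
    by apply: ccontN; apply: ccontD; [exact: hcont|exact: rcont].
  by apply/funext => t; rewrite -om2 /om; congr (line_factor _ _ _ _); apply/val_inj.
Qed.

Lemma line_factor_bound (ep : R) : 0 < ep -> exists2 A : R, 0 < A &
  forall k y, normc (om k (line k +i* y)) <= A * (1 + `|y|) `^ ep.
Proof.
move=> ep0.
have [A A0 HA] := vline_logderiv_bound dl0 dl2 (Lfunction_holo LF) (Lfunction_conj LF)
  (Lfunction_growth fd LF) (Lfunction_lower fd LF) rh ep0.
have vb (b y : R) : `|b| = dl -> normc (logderiv L (2^-1 + (b +i* y))) <= A * (1 + `|y|) `^ ep.
  by move=> bd; rewrite half_add; apply: HA; rewrite addrC addKr.
exists (A + A); first by rewrite addr_gt0.
have p0 y : 0 <= A * (1 + `|y|) `^ ep by rewrite mulr_ge0 ?powR_ge0// ltW.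
case=> -[|[|[|//]]] kl y; rewrite /line /om /=; rewrite mulrDl.
- by rewrite /line_factor /=; apply: le_trans (vb _ y ad) _; rewrite lerDl.
- rewrite /line_factor /= refl_point; apply: le_trans (vb _ _ ad) _.
  by rewrite normrN lerDl.
- rewrite (_ : Ordinal kl = 2); last exact/val_inj.
  rewrite -/om om2 normcN; apply: le_trans (le_normcD _ _) _; apply: lerD; first exact: vb.
  by apply: le_trans (vb _ _ ad) _; rewrite normrN.
Qed.

Lemma line_sum (G : C -> C) (B : R) :
  (forall z, `|complex.Re z| < eta -> holo G z) ->
  (forall z, `|complex.Re z| < eta -> G (- z) = G z) ->
  (forall z, `|complex.Re z| < eta -> normc (G z) <= B * weight a (complex.Im z)) ->
  exists2 S, ccvg (fun N => \sum_(0 <= t < N) G (0 +i* g t)) S &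
  \sum_k cint setT (fun y => 'i * (om k (line k +i* y) * G (line k +i* y))) =
    2 * (2 * pi%:C * 'i) * S.
Proof.
move=> hG Gev GB; have [gpos gmono gzero] := gz.
have [S cS eS] := one_variable dl0 dl2 (Lfunction_holo LF) (Lfunction_conj LF)
  (Lfunction_growth fd LF) (Lfunction_lower fd LF) rh Lc gpos gmono gzero dle a1 hG Gev GB.
exists S => //; rewrite -eS.
pose ep := (a - 1) / 2; have ep0 : 0 < ep by move: a1; rewrite /ep => h; lra.
have [A A0 HA] := line_factor_bound ep0.
have b1 : 1 < a - ep by move: a1; rewrite /ep => h; lra.
have adl (b : R) : `|b| = dl -> `|b| < eta by move=> ->.
have B0 : 0 <= B.
  have h0 : `|complex.Re (0 : C)| < eta by rewrite /= normr0; exact: lt_trans dle.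
  have := le_trans (normc_ge0 _) (GB 0 h0); rewrite /weight /= normr0 addr0 powR1 mulr1.
  by [].
have gc (b y : R) : `|b| = dl -> ccont (fun y => G (b +i* y)) y.
  by move=> bd; apply: ccont_vline; apply: hG; exact: adl.
have int (h : R -> C) : (forall y, ccont h y) ->
    (forall y, normc (h y) <= A * (1 + `|y|) `^ ep) ->
    cintegrable setT (fun y => 'i * (h y * G (- dl +i* y))).
  move=> hc hb.
  have iw : mu.-integrable setT (EFin \o (fun y => A * B * weight (a - ep) y)).
    rewrite (_ : _ \o _ = (fun y => (A * B)%:E * (weight (a - ep) y)%:E)%E)//.
    by apply: integrableZl => //; exact: weight_integrable.
  apply: (cintegrable_dom measurableT _ iw).
    apply: cmeas_ccont => y; apply: ccontM; first exact: ccont_cst.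
    by apply: ccontM; [exact: hc|exact: gc].
  move=> y _; rewrite !normcM normc_i mul1r.
  have -> : weight (a - ep) y = (1 + `|y|) `^ ep * weight a y.
    by rewrite /weight -powRDl ?ltr_wpDr//; congr (_ `^ _); ring.
  have -> : A * B * ((1 + `|y|) `^ ep * weight a y) = A * (1 + `|y|) `^ ep * (B * weight a y) by ring.
  by apply: ler_pM; rewrite ?normc_ge0//; apply: GB; exact: adl.
have i1 := int (fun y => om 1 (- dl +i* y)) (line_factor_cont 1) (HA 1).
have i2 := int (fun y => om 2 (- dl +i* y)) (line_factor_cont 2) (HA 2).
rewrite !big_ord_recl big_ord0 addr0; congr (_ + _).
have -> : lift ord0 (ord0 : 'I_2) = 1 :> 'I_3 by exact/val_inj.
have -> : lift ord0 (lift ord0 (ord0 : 'I_1)) = 2 :> 'I_3 by exact/val_inj.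
rewrite -[LHS](cintD measurableT i1 i2).
(* On the left line the reflected logarithmic derivatives of choices 1 and 2 cancel; what remains is
   minus the integrand of the one-variable formula. *)
have -> : (fun y => 'i * (om 1 (- dl +i* y) * G (- dl +i* y)) +
   'i * (om 2 (- dl +i* y) * G (- dl +i* y))) =
   (fun y => - ('i * (logderiv L (2^-1 + (- dl +i* y)) * G (- dl +i* y)))).
  apply/funext => y; rewrite om2 {1}/om /line_factor /= refl_point.
  by move: (logderiv _ _) (logderiv _ _) (G _) => u v w; ring.
rewrite cintN//.
have -> : (fun y => 'i * (logderiv L (2^-1 + (- dl +i* y)) * G (- dl +i* y))) =
  (fun y => - ('i * (om 1 (- dl +i* y) * G (- dl +i* y)) +
   'i * (om 2 (- dl +i* y) * G (- dl +i* y)))).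
  apply/funext => y; rewrite om2 {1}/om /line_factor /= refl_point.
  by move: (logderiv _ _) (logderiv _ _) (G _) => u v w; ring.
by apply: cintegrableN => //; apply: cintegrableD.
Qed.

(** The domination is recorded with the identity because the iterated integral will be exchanged
    with the sum over discriminants. *)
Lemma line_identity n (F : 'rV[C]_n -> C) (B : R) : admissible eta a F B ->
  [/\ (2 * (2 * pi%:C * 'i)) ^+ n * limn (cube_sum g F) =
    \sum_(phi : {ffun 'I_n -> 'I_3})
       vline_integral (line \o phi) (fun z => omprod om phi z * F z) &
    exists K : R, forall phi : 'I_n -> 'I_3,
      vnice ((a + 1) / 2) (line \o phi) (fun z => omprod om phi z * F z) K].
Proof.
move=> hF; have [gpos gmono gzero] := gz.
pose ep := (a - 1) / 2; have ep0 : 0 < ep by move: a1; rewrite /ep => h; lra.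
have [A A0 HA] := line_factor_bound ep0.
have b1 : 1 < a - ep by move: a1; rewrite /ep => h; lra.
have bE : (a + 1) / 2 = a - ep by rewrite /ep; field.
have eta0 : 0 < eta by exact: lt_trans dle.
have leta k : `|line k| < eta by rewrite /line; case: ifP => _; rewrite ?ad' ?ad.
have [M HM] := zero_sum_bound dl0 dl2 (Lfunction_holo LF)
  (Lfunction_growth fd LF) (Lfunction_lower fd LF) rh gpos gmono gzero a1.
have gsum N : \sum_(0 <= t < N) weight a (g t) <= M.
  apply: le_trans (HM N); rewrite le_eqVlt; apply/orP; left; apply/eqP.
  by apply: eq_bigr => t _; rewrite /weight gtr0_norm.
split; last first.
  exists (A ^+ n * B) => phi; rewrite bE.
  exact: (omprod_nice eta0 (ltW A0) leta line_factor_cont HA phi hF).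
have [S [cS -> _]] := several_variables eta0 a1 b1 (ltW A0) leta line_factor_cont HA
  line_sum gsum hF.
by rewrite (ccvg_lim cS).
Qed.

End line_weights.

(** * The test function in the rotated variables *)

Section rotated_test_function.
Variable R : realType.
Local Notation C := (R[i]^o).

Lemma seq_continuous n (f : 'rV[C]_n -> C) (u : nat -> 'rV[C]_n) x :
  {for x, continuous f} -> (forall j, ccvg (fun m => u m 0 j) (x 0 j)) -> ccvg (f \o u) (f x).
Proof.
move=> fc cu e e0.
have nf : nbhs (f x) [set w : C | normc (w - f x) < e] by apply/nbhsC; exists e.
have /nbhs_ballP[r /= r0 hr] := fc _ nf.
have [r1 rE] : 0 < complex.Re r /\ r = (complex.Re r)%:C.
  by move: r0; rewrite ltcE /= => /andP[/eqP ri r1]; split => //; case: (r) ri => ? ? /= ->.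
have exN (j : 'I_n) : exists N, forall m, (N <= m)%N -> normc (u m 0 j - x 0 j) < complex.Re r.
  exact: cu.
have [N hN] := choice exN.
exists (\max_j N j) => m hm; apply: hr; split => // i j; rewrite (ord1 i).
have := hN j m (leq_trans (leq_bigmax j) hm).
rewrite /ball /= distrC rE => h.
by rewrite -[`|_|]/(`|u m 0 j - x 0 j| : R[i]) absC_normc ltcR.
Qed.

(** Multiplication by 'i carries |Re z| < eta to |Im x| < eta. Holomorphy in one variable is the
    existence of the directional derivative along the corresponding coordinate vector. *)
Lemma admissible_rotation n (f : 'rV[C]_n -> C) (eta : R) :
  (forall x, polystrip eta x -> differentiable f x) ->
  even_in_each (polystrip eta) f -> decays_in (polystrip eta) f ->
  exists a B : R, 1 < a /\ admissible eta a (fun z => f (\row_j ('i * z 0 j))) B.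
Proof.
move=> fd fev [a [B [a1 fB]]]; exists a, B; split => //.
have ps (z : 'rV[C]_n) : in_strip eta z -> polystrip eta (\row_j ('i * z 0 j)).
  by move=> hz j; rewrite mxE cImM /= mul0r mul1r add0r; exact: hz.
split.
- move=> u z us zs cu.
  apply: (@seq_continuous _ f (fun m => \row_j ('i * u m 0 j)) (\row_j ('i * z 0 j))).
    by apply: differentiable_continuous; apply: fd; exact: ps.
  move=> j; rewrite mxE (_ : (fun m => _) = (fun m => 'i * u m 0 j)).
    by apply: ccvgM => //; exact: ccvg_cst.
  by apply/funext => m; rewrite mxE.
- move=> z j zs.
  pose x := \row_k ('i * z 0 k) : 'rV[C]_n; pose e := delta_mx 0 j : 'rV[C]_n.
  have dx : derivable f x e by apply: diff_derivable; apply: fd; exact: ps.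
  have h0 : holo (fun t => f (t *: e + x)) 0.
    apply/holoP; move: dx; rewrite /derivable.
    rewrite (_ : (fun h : C => h^-1 *: _) =
      (fun h : C => h^-1 *: (f ((h *: (1 : C) + 0) *: e + x) - f ((0 : C) *: e + x)))) //.
    have E (h : C) : h *: (1 : C) + 0 = h by rewrite addr0; exact: mulr1.
    by apply/funext => h; rewrite E scale0r add0r.
  have h1 : holo (fun v => 'i * (v - z 0 j)) (z 0 j).
    by apply: holoM; [exact: holo_cst|exact: holo_shift].
  have := @holo_comp _ (fun v => 'i * (v - z 0 j)) (fun t => f (t *: e + x)) (z 0 j) h1.
  rewrite subrr mulr0 => /(_ h0).
  rewrite (_ : _ \o _ = (fun v => f (\row_j0 ('i * upd z j v 0 j0))))//.
  apply/funext => v /=; congr f; apply/rowP => k; rewrite !mxE eqxx /=.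
  case: eqP => [->|_]; first by rewrite mulr1; ring.
  by rewrite mulr0 add0r.
- move=> z j zs; rewrite -[RHS](fev (fun k => k == j)); last exact: ps.
  congr f; apply/rowP => k; rewrite !mxE; case: eqP => [->|_] /=.
    by rewrite expr1; ring.
  by rewrite expr0 mul1r.
- move=> z zs; have := fB _ (ps z zs); rewrite absC_normc lecR => h; apply: le_trans h _.
  rewrite le_eqVlt; apply/orP; left; apply/eqP; congr (_ * _); apply: eq_bigr => j _.
  by rewrite mxE cReM /= mul0r mul1r sub0r /weight normrN.
Qed.

(** The zeros sit at z = i g, where i z = - g; evenness in all variables together removes the
    signs. *)
Lemma cube_sum_rotation n (f : 'rV[C]_n -> C) (eta : R) (g : nat -> R) : 0 < eta ->
  even_in_each (polystrip eta) f ->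
  cube_sum g (fun z => f (\row_j ('i * z 0 j))) =
  (fun T : nat => \sum_(t : {ffun 'I_n -> 'I_T}) f (\row_j (g (t j))%:C)).
Proof.
move=> eta0 fev; apply/funext => T; apply: eq_bigr => t _.
rewrite -[RHS](fev (fun=> true)); last by move=> j; rewrite mxE /= normr0.
congr f; apply/rowP => j; rewrite !mxE.
by apply: eq_ReIm; rewrite ?cReM ?cImM expr1 ?cReM ?cImM /=; ring.
Qed.

End rotated_test_function.

(** * Triples of sets as colourings, and the sum over discriminants *)

Lemma partition3_reindex (V : zmodType) n
    (E : {set 'I_n} * {set 'I_n} * {set 'I_n} -> V) :
  \sum_(P | partition3 P) E P = \sum_(phi : {ffun 'I_n -> 'I_3})
    E ([set j | phi j == 0], [set j | phi j == 1], [set j | phi j == 2])%SET.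
Proof.
pose to (phi : {ffun 'I_n -> 'I_3}) :=
  ([set j | phi j == 0], [set j | phi j == 1], [set j | phi j == 2])%SET.
pose from (P : {set 'I_n} * {set 'I_n} * {set 'I_n}) : {ffun 'I_n -> 'I_3} :=
  [ffun j => if j \in P.1.1 then 0 else if j \in P.1.2 then 1 else 2].
have case3 (x : 'I_3) : [\/ x = 0, x = 1 | x = 2].
  case: x => -[|[|[|//]]] h; [constructor 1|constructor 2|constructor 3]; exact/val_inj.
rewrite (reindex_onto to from) /=; last first.
  move=> [[K L] M] /and4P[KL KM LM /eqP KLM]; rewrite /to /from /=.
  have dK j : j \in K -> (j \notin L) && (j \notin M).
    by move=> jK; rewrite (disjointFr KL jK) (disjointFr KM jK).
  have dL j : j \in L -> j \notin M by move=> jL; rewrite (disjointFr LM jL).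
  have cov j : [|| j \in K, j \in L | j \in M].
    have : j \in (K :|: L :|: M)%SET by rewrite KLM inE.
    by rewrite !inE -orbA.
  congr (_, _, _); apply/setP => j; rewrite inE ffunE /=.
  - by case: ifP => // _; case: ifP.
  - by case: ifPn => [/dK/andP[/negbTE -> _]//|jK]; case: ifP.
  - case: ifPn => [/dK/andP[_ /negbTE ->]//|jK]; case: ifPn => [/dL/negbTE->//|jL].
    by move: (cov j); rewrite (negbTE jK) (negbTE jL) /= => ->.
apply: eq_bigl => phi.
suff H : partition3 (to phi) && (from (to phi) == phi) by exact: H.
apply/andP; split.
  apply/and4P; split.
  - by rewrite finset.disjoints_subset; apply/fintype.subsetP => j; rewrite !inE => /eqP ->.
  - by rewrite finset.disjoints_subset; apply/fintype.subsetP => j; rewrite !inE => /eqP ->.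
  - by rewrite finset.disjoints_subset; apply/fintype.subsetP => j; rewrite !inE => /eqP ->.
  - by apply/eqP/setP => j; rewrite !inE; case: (case3 (phi j)) => ->.
apply/eqP/ffunP => j; rewrite /from /to ffunE /= !inE.
by case: (case3 (phi j)) => ->.
Qed.

Lemma omprod_partition (R : realType) n (L psi : R[i]^o -> R[i]^o) (phi : 'I_n -> 'I_3)
    (z : 'rV[R[i]^o]_n) :
  let K := [set j | phi j == 0]%SET in let Ls := [set j | phi j == 1]%SET in
  let M := [set j | phi j == 2]%SET in
  (-1) ^+ #|M| *
  ((\prod_(alpha <- [seq z 0 k | k <- enum K] ++ [seq - z 0 l | l <- enum Ls])
      logderiv L (2^-1 + alpha)) *
   (\prod_(beta <- [seq z 0 m | m <- enum M]) logderiv psi (2^-1 + beta))) =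
  omprod (line_factor L psi) phi z.
Proof.
have case3 (x : 'I_3) : [\/ x = 0, x = 1 | x = 2].
  case: x => -[|[|[|//]]] h; [constructor 1|constructor 2|constructor 3]; exact/val_inj.
move=> K Ls M; rewrite big_cat !big_map /= !big_enum /= -prodr_const /omprod.
rewrite [X in X * _]big_mkcond [\prod_(i in K) _]big_mkcond [\prod_(i in Ls) _]big_mkcond.
rewrite [\prod_(i in M) logderiv _ _]big_mkcond -!big_split /=; apply: eq_bigr => j _.
by rewrite !inE /line_factor; case: (case3 (phi j)) => -> /=; rewrite ?mul1r ?mulr1 ?mulN1r.
Qed.

Theorem theorem6p4 (R : realType) (n : nat) (X : R)
    (LD : nat -> R[i]^o -> R[i]^o) (gamma : nat -> nat -> R)
    (eta delta : R) (f : 'rV[R[i]^o]_n -> R[i]^o)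
    (hL : forall d : nat, fundamental_discriminant d -> d%:R <= X ->
       is_Lfunction d (LD d))
    (hFE : forall d : nat, fundamental_discriminant d -> d%:R <= X ->
       functional_equation d (LD d))
    (hGRH : forall d : nat, fundamental_discriminant d -> d%:R <= X ->
       GRH (LD d))
    (hcentral : forall d : nat, fundamental_discriminant d -> d%:R <= X ->
       LD d 2^-1 <> 0)
    (hgamma : forall d : nat, fundamental_discriminant d -> d%:R <= X ->
       zero_ordinates (LD d) (gamma d))
    (hdelta : 0 < delta) (hdelta_half : delta < 2^-1) (hdelta_eta : delta < eta)
    (hf_hol : forall x : 'rV[R[i]^o]_n, polystrip eta x -> differentiable f x)
    (hf_even : even_in_each (polystrip eta) f)
    (hf_decay : decays_in (polystrip eta) f) :
  2 ^+ n * (2 * pi%:C * 'i) ^+ n * S_DL X gamma f =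
  \sum_(P : {set 'I_n} * {set 'I_n} * {set 'I_n} | partition3 P)
    let: (K, L, M) := P in
    vline_integral (fun j => if j \in K then delta else - delta)
      (fun z : 'rV[R[i]^o]_n =>
         (-1) ^+ #|M| *
         J_DL X LD
           ([seq z 0 k | k <- enum K] ++ [seq - z 0 l | l <- enum L])
           [seq z 0 m | m <- enum M] *
         f (\row_j ('i * z 0 j))).
Proof.
have eta0 : 0 < eta by exact: lt_trans hdelta_eta.
have [a [B [a1 hF]]] := admissible_rotation hf_hol hf_even hf_decay.
set F := (fun z : 'rV[R[i]^o]_n => f (\row_j ('i * z 0 j))) in hF.
(* Membership in the summation range yields d >= 1 and, through the truncation of X, d <= X, as the
   hypotheses on [LD] demand. *)
pose D (d : nat) := (d \in index_iota 1 (Num.truncn X).+1) && fundamental_discriminant d.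
have hD d : D d -> fundamental_discriminant d /\ d%:R <= X.
  rewrite /D mem_index_iota ltnS => /andP[/andP[d1 dX] fd]; split => //.
  have X0 : 0 <= X by rewrite (le_trans ler01)// -truncn_gt0 (leq_trans d1).
  by rewrite -truncn_ge_nat.
pose om d := line_factor (LD d) (psiDL d).
have per d : D d -> (2 * (2 * pi%:C * 'i)) ^+ n * limn (cube_sum (gamma d) F) =
    \sum_(phi : {ffun 'I_n -> 'I_3})
       vline_integral (line delta \o phi) (fun z => omprod (om d) phi z * F z) /\
    exists K : R, forall phi : 'I_n -> 'I_3,
      vnice ((a + 1) / 2) (line delta \o phi) (fun z => omprod (om d) phi z * F z) K.
  move=> /hD[fd dX]; have [h1 h2] := line_identity fd (hL d fd dX) (hFE d fd dX) (hGRH d fd dX)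
    (hcentral d fd dX) (hgamma d fd dX) hdelta hdelta_half hdelta_eta a1 hF.
  by split.
have exK d : exists K : R, D d -> forall phi : 'I_n -> 'I_3,
      vnice ((a + 1) / 2) (line delta \o phi) (fun z => omprod (om d) phi z * F z) K.
  have [/per[_ [K hK]]|_] := boolP (D d); last by exists 0.
  by exists K.
have [K hK] := choice exK.
have b1 : 1 < (a + 1) / 2 by lra.
rewrite partition3_reindex -exprMn_comm; last exact: mulrC.
rewrite /S_DL /discr_sum big_seq_cond mulr_sumr -/(D _).
rewrite (eq_bigr (fun d => \sum_(phi : {ffun 'I_n -> 'I_3})
   vline_integral (line delta \o phi) (fun z => omprod (om d) phi z * F z))); last first.
  by move=> d Dd; have [<- _] := per d Dd; rewrite /F (cube_sum_rotation _ eta0 hf_even).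
rewrite exchange_big /=; apply: eq_bigr => phi _.
(* Each integrand being dominated, the finite sum over discriminants moves inside the iterated
   integral, where it becomes [J_DL]. *)
rewrite -(vline_sum b1 _ (fun d Dd => hK d Dd phi)).
have -> : (fun j => if j \in [set j0 | phi j0 == 0]%SET then delta else - delta) = line delta \o phi.
  by apply/funext => j; rewrite inE.
apply: vline_ext => y; rewrite /J_DL /discr_sum [in RHS]big_seq_cond mulr_sumr mulr_suml.
by apply: eq_bigr => d _; congr (_ * _); rewrite -omprod_partition.
Qed.
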